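(* Let $Q$ be a finite quiver without loops, $\mathfrak a$ an admissible automorphism of $Q$ of order $n$, $\Gamma$ the associated valued graph, and $k$ an algebraically closed field whose characteristic does not divide $n$. Then: (1) The set $\{f(\underline{\dim}\,X) : X \text{ an ii-indecomposable representation of } (Q,\mathfrak a) \text{ over } k\}$ is exactly the set $\Delta(\Gamma)_+$ of positive roots of the symmetrisable Kac–Moody algebra $\mathfrak g(\Gamma)$. (2) If $\alpha\in(\mathbb Z\mathcal I)^{\langle\mathfrak a\rangle}$ is such that $f(\alpha)$ is a positive real root of $\Gamma$, then there is, up to isomorphism, exactly one ii-indecomposable of dimension vector $\alpha$, and its number of indecomposable direct summands (as a representation of $Q$) equals $\tfrac12(f(\alpha),f(\alpha))_\Gamma$ (equivalently, the size of the $\mathfrak a$-orbit of isomorphism classes of indecomposables it corresponds to).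
   Context: Let $Q$ be a finite quiver without loops, with vertex set $\mathcal I$. Its symmetric generalised Cartan matrix (GCM) $A=(a_{ij})$ has $a_{ii}=2$ and $a_{ij}=-\#\{\text{edges between } i \text{ and } j\}$ for $i\ne j$. An admissible automorphism $\mathfrak a$ of $Q$ is a quiver automorphism (a permutation of the vertices and of the arrows compatible with heads and tails) such that no arrow joins two vertices lying in the same $\langle\mathfrak a\rangle$-orbit. Let $\mathbf I$ be the set of vertex orbits, $d_{\mathbf i}$ the number of vertices in the orbit $\mathbf i$, and $B=(b_{\mathbf i\mathbf j})$ the symmetric matrix with $b_{\mathbf i\mathbf i}=2d_{\mathbf i}$ and $b_{\mathbf i\mathbf j}=-\#\{\text{edges between the orbits }\mathbf i\text{ and }\mathbf j\}$ for $\mathbf i\neq\mathbf j$. Put $D=\mathrm{diag}(d_{\mathbf i})$; then $C=D^{-1}B$ is a symmetrisable GCM and $\Gamma$ denotes its valued graph (vertex set $\mathbf I$). On $\mathbb Z\mathbf I$ let $(\cdot,\cdot)_\Gamma$ be the symmetric bilinear form with $(e_{\mathbf i},e_{\mathbf j})_\Gamma=b_{\mathbf i\mathbf j}$, let $r_{\mathbf i}(x)=x-\frac{1}{d_{\mathbf i}}(x,e_{\mathbf i})_\Gamma e_{\mathbf i}$, and let $W(\Gamma)=\langle r_{\mathbf i}\rangle$. The real roots of $\Gamma$ are the elements $w(e_{\mathbf i})$, $w\in W(\Gamma)$; the fundamental set is $F_\Gamma=\{x\in\mathbb Z_{\ge 0}\mathbf I\setminus\{0\} : (x,e_{\mathbf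 i})_\Gamma\le 0\ \forall\mathbf i,\ \mathrm{supp}(x)\text{ connected in }\Gamma\}$; the imaginary roots are $\pm w(x)$, $w\in W(\Gamma)$, $x\in F_\Gamma$. The set $\Delta(\Gamma)$ of all these is the root system of $\mathfrak g(\Gamma)$, and $\Delta(\Gamma)_+$ its positive elements. $\mathfrak a$ acts on $\mathbb Z\mathcal I$ by permuting the basis $e_i$, and $f:(\mathbb Z\mathcal I)^{\langle\mathfrak a\rangle}\to\mathbb Z\mathbf I$ is the bijection $f(x)_{\mathbf i}=x_i$ for any $i\in\mathbf i$. For a representation $X$ of $Q$ over $k$, ${}^{\mathfrak a}X$ is the representation with $({}^{\mathfrak a}X)_i=X_{\mathfrak a^{-1}(i)}$ and $({}^{\mathfrak a}X)_\rho=X_{\mathfrak a^{-1}(\rho)}$. $X$ is an ii-representation (isomorphically invariant) if ${}^{\mathfrak a}X\cong X$, and an ii-indecomposable if it is a nonzero ii-representation not isomorphic to a direct sum of two nonzero ii-representations. $\underline{\dim}\,X=\sum_i(\dim X_i)e_i$. *)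

(* Defs.v *)
From HB Require Import structures.
From mathcomp Require Import all_boot all_order all_algebra all_fingroup.
Set Implicit Arguments. Unset Strict Implicit. Unset Printing Implicit Defensive.
Import GRing.Theory Num.Theory.
Local Open Scope ring_scope.

Section Quiver.
Variables (V A : finType) (src tgt : A -> V).

Definition no_loops : Prop := forall a : A, src a != tgt a.

Record quiver_aut := QuiverAut {
  qa_v : {perm V};
  qa_a : {perm A};
  qa_src : forall a, src (qa_a a) = qa_v (src a);
  qa_tgt : forall a, tgt (qa_a a) = qa_v (tgt a) }.

Definition admissible (g : quiver_aut) : Prop :=
  forall a : A, tgt a \notin porbit (qa_v g) (src a).

Definition aut_order (g : quiver_aut) : nat := lcmn #[qa_v g]%g #[qa_a g]%g.

Lemma qa_srcV (g : quiver_aut) a :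
  src ((qa_a g)^-1%g a) = (qa_v g)^-1%g (src a).
Proof.
by apply: (canRL (permK (qa_v g))); rewrite -qa_src permKV.
Qed.

Lemma qa_tgtV (g : quiver_aut) a :
  tgt ((qa_a g)^-1%g a) = (qa_v g)^-1%g (tgt a).
Proof.
by apply: (canRL (permK (qa_v g))); rewrite -qa_tgt permKV.
Qed.

Section Reps.
Variable k : fieldType.

(** A (finite-dimensional) representation: X_i = k^(rdim i) (row vectors),
    X_rho : X_(src rho) -> X_(tgt rho) acting on the right (v |-> v *m M). *)
Record rep := Rep {
  rdim : V -> nat;
  rmap : forall a : A, 'M[k]_(rdim (src a), rdim (tgt a)) }.

Definition dimvec (X : rep) : {ffun V -> int} := [ffun i => (rdim X i)%:Z].

Definition nonzero_rep (X : rep) : Prop := exists i, (0 < rdim X i)%N.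

Definition rep_iso (X Y : rep) : Prop :=
  exists (phi : forall i, 'M[k]_(rdim X i, rdim Y i))
         (psi : forall i, 'M[k]_(rdim Y i, rdim X i)),
    (forall i, phi i *m psi i = 1%:M /\ psi i *m phi i = 1%:M) /\
    (forall a, rmap X a *m phi (tgt a) = phi (src a) *m rmap Y a).

Definition rep_dsum (X Y : rep) : rep :=
  @Rep (fun i => (rdim X i + rdim Y i)%N)
       (fun a => block_mx (rmap X a) 0 0 (rmap Y a)).

Definition rep0 : rep := @Rep (fun _ => 0%N) (fun _ => 0).

Definition rep_bigsum (Ys : seq rep) : rep := foldr rep_dsum rep0 Ys.

Definition twist (g : quiver_aut) (X : rep) : rep :=
  @Rep (fun i => rdim X ((qa_v g)^-1%g i))
       (fun a => castmx (congr1 (rdim X) (qa_srcV g a),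
                         congr1 (rdim X) (qa_tgtV g a))
                        (rmap X ((qa_a g)^-1%g a))).

Definition indecomposable (X : rep) : Prop :=
  nonzero_rep X /\
  ~ (exists Y Z : rep, nonzero_rep Y /\ nonzero_rep Z /\ rep_iso X (rep_dsum Y Z)).

Definition ii_rep (g : quiver_aut) (X : rep) : Prop := rep_iso (twist g X) X.

Definition ii_indec (g : quiver_aut) (X : rep) : Prop :=
  ii_rep g X /\ nonzero_rep X /\
  ~ (exists Y Z : rep, ii_rep g Y /\ ii_rep g Z /\ nonzero_rep Y /\
                       nonzero_rep Z /\ rep_iso X (rep_dsum Y Z)).

Fixpoint all_indec (Ys : seq rep) : Prop :=
  if Ys is Y :: Ys' then indecomposable Y /\ all_indec Ys' else True.

Definition indec_decomposition (X : rep) (Ys : seq rep) : Prop :=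
  all_indec Ys /\ rep_iso X (rep_bigsum Ys).

End Reps.

Section Roots.
Variable g : quiver_aut.

Definition orb : finType := {o : {set V} | o \in porbits (qa_v g)}.

Definition dorb (o : orb) : nat := #|val o|.

Definition nedges (o1 o2 : orb) : nat :=
  #|[set a : A | ((src a \in val o1) && (tgt a \in val o2))
              || ((src a \in val o2) && (tgt a \in val o1))]|.

Definition bmat (o1 o2 : orb) : int :=
  if o1 == o2 then (2 * dorb o1)%:Z else - (nedges o1 o2)%:Z.

Definition formG (x y : {ffun orb -> int}) : int :=
  \sum_(i : orb) \sum_(j : orb) x i * bmat i j * y j.

Definition ebase (i : orb) : {ffun orb -> int} :=
  [ffun j => if i == j then 1 else 0].

(** r_i(x) = x - (1/d_i)(x,e_i) e_i; the division is exact (d_i | (x,e_i)). *)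
Definition refl (i : orb) (x : {ffun orb -> int}) : {ffun orb -> int} :=
  [ffun j => x j - ((formG x (ebase i)) %/ (dorb i)%:Z)%Z * ebase i j].

(** action of the Weyl group element r_(i1) ... r_(ik) (W is generated by the
    involutions r_i, so every element is such a word) *)
Definition weyl_word (s : seq orb) (x : {ffun orb -> int}) : {ffun orb -> int} :=
  foldr refl x s.

Definition real_root (beta : {ffun orb -> int}) : Prop :=
  exists (s : seq orb) (i : orb), beta = weyl_word s (ebase i).

Definition gadj (i j : orb) : bool := (i != j) && (bmat i j != 0).

Definition supp (x : {ffun orb -> int}) : {set orb} := [set i | x i != 0].

Definition connected_in (S : {set orb}) : Prop :=
  forall i j, i \in S -> j \in S ->
    connect [rel u v | [&& u \in S, v \in S & gadj u v]] i j.

Definition nonneg_vec (x : {ffun orb -> int}) : Prop := forall i, 0 <= x i.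

Definition fundamental (x : {ffun orb -> int}) : Prop :=
  nonneg_vec x /\ x != 0 /\ (forall i, formG x (ebase i) <= 0) /\
  connected_in (supp x).

Definition imag_root (beta : {ffun orb -> int}) : Prop :=
  exists (s : seq orb) (x : {ffun orb -> int}),
    fundamental x /\ (beta = weyl_word s x \/ beta = - weyl_word s x).

Definition is_root (beta : {ffun orb -> int}) : Prop :=
  real_root beta \/ imag_root beta.

Definition pos_root (beta : {ffun orb -> int}) : Prop :=
  is_root beta /\ nonneg_vec beta /\ beta != 0.

(** the bijection f : (Z V)^<a> -> Z I *)
Definition fmap (x : {ffun V -> int}) : {ffun orb -> int} :=
  [ffun o : orb => (odflt 0 (omap x [pick i in (val o : {set V})]) : int)].

Definition aut_invariant (x : {ffun V -> int}) : Prop :=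
  forall i, x (qa_v g i) = x i.

End Roots.
End Quiver.

Arguments formG {V A src tgt} g x y.
Arguments real_root {V A src tgt} g beta.
Arguments imag_root {V A src tgt} g beta.
Arguments is_root {V A src tgt} g beta.
Arguments pos_root {V A src tgt} g beta.
Arguments nonneg_vec {V A src tgt} g x.
Arguments fundamental {V A src tgt} g x.

(* Main.v *)
(** By Krull-Schmidt, an ii-indecomposable is the sum of one orbit, under
    twisting, of isomorphism classes of indecomposables of [Q].

    Kac's theorem for [Q] enters through two facts.  First, existence and
    uniqueness of an indecomposable of dimension [d] do not depend on the
    orientation: over the closure of [F_p] the indecomposables fixed by a power
    of Frobenius are counted by a recursion involving only the numbers of
    isomorphism classes over finite fields, and those are orientation independent
    by Burnside's formula and trace duality; quantifier elimination carries the
    statement to every algebraically closed field.  Hence, second, reflection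
    functors at sinks act at every vertex.  Applying them to all the vertices of an
    orbit (an independent set) realises the generators of the Weyl group of
    [Gamma]; decreasing the height brings the dimension of a summand either to
    a simple root, which gives a real root and uniqueness, or into the
    fundamental set.

    Conversely, let [x] be in the fundamental set.  The skew group algebra of [Q]
    is Morita equivalent to the path algebra of a dual quiver, with vertices the
    pairs (orbit, character of the stabiliser), and its indecomposables
    restrict to ii-indecomposables of [Q] by Clifford theory, [n] being
    invertible.  A lift of [x] to the dual quiver minimising the Tits form has
    [(b, c) < 0] for all decompositions [b + c], by averaging over the
    characters; then a generic representation of this dimension is a brick,
    except if [x] is a multiple [m * delta] of an isotropic vector.  In that case
    one adds [m] character translates of a lift of [delta] so that the Tits
    form stays at most [1]: the sum is a real root of a tame component, or
    a multiple of its null root, for which a chain of self-extensions of a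
    generic brick is indecomposable. *)

(* About a dimension vector of [Q] the proof carries only [Ex] (an indecomposable exists) and [Un]
   (it is unique up to isomorphism). Unlike the number of indecomposables, usually infinite, these
   are first-order sentences for a fixed vector and can be tested over closures of prime fields. A
   vertex is in general neither a sink nor a source, so the arrows at it are turned before
   reflecting. The obstacle behind the dual quiver is invariance. A generic representation of [Q] of
   invariant dimension may be indecomposable, but it need not be isomorphic to its twist, and the
   sum over its orbit is then too large. On the dual quiver no invariance has to be imposed; the
   price is that a root of [Gamma] has many lifts, of which a suitable one must be chosen.
   Reflecting at a whole fibre of the dual quiver covers a simple reflection of [Gamma], so only the
   fundamental set needs lifts by hand. Real roots stay on [Q], where reflections at orbits commute
   with the twist and uniqueness makes the orbit length computable. *)
Require Import Defs.
From HB Require Import structures.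
From mathcomp Require Import all_boot all_order all_algebra all_fingroup all_field.
From mathcomp Require Import boolp ring lra zify.
Set Implicit Arguments. Unset Strict Implicit. Unset Printing Implicit Defensive.
Import Order.TTheory GRing.Theory Num.Theory.

(** * Counting orbits in a multiset *)

Section OrbitCount.
Variables (U : eqType) (P : U -> Prop) (rho : U -> U) (Y : U).
Hypothesis rhoP : forall Z, P Z -> P (rho Z).
Hypothesis rho_inj : forall Z Z', P Z -> P Z' -> rho Z = rho Z' -> Z = Z'.
Hypothesis PY : P Y.
Hypothesis perY : exists l, (0 < l) && (iter l rho Y == Y).

Let l := ex_minn perY.
Let l_gt0 : 0 < l.
Proof. by rewrite /l; case: ex_minnP => m /andP[]. Qed.
Let lY : iter l rho Y = Y.
Proof. by rewrite /l; case: ex_minnP => m /andP[_ /eqP]. Qed.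

Let iter_mod s : iter s rho Y = iter (s %% l) rho Y.
Proof.
rewrite {1}(divn_eq s l) addnC iterD; congr (iter _ _ _).
by elim: (s %/ l) => [|j IH] //; rewrite mulSn addnC iterD lY.
Qed.

Let iter_per s : (iter s rho Y == Y) = (l %| s).
Proof.
rewrite /dvdn iter_mod; case: (posnP (s %% l)) => [->|s0]; first by rewrite /= eqxx.
apply/negP=> h; have : l <= s %% l.
  by rewrite {1}/l; case: ex_minnP => m _; apply; rewrite s0.
by rewrite leqNgt ltn_mod l_gt0.
Qed.

Let P_iter s : P (iter s rho Y).
Proof. by elim: s => //= s; apply: rhoP. Qed.

Let iter_inj a b : a < l -> b < l -> iter a rho Y = iter b rho Y -> a = b.
Proof.
wlog le : a b / a <= b => [wl|] al bl e.
  by case/orP: (leq_total a b) => h; [apply: wl | apply/esym; apply: wl].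
have : iter (b - a) rho Y = Y.
  rewrite -(subnK le) in e; move: (b - a) e => c {le al bl}.
  elim: a => [|a IH]; first by rewrite addn0.
  by rewrite addnS !iterS => /rho_inj h; apply: IH; apply: h.
move/eqP; rewrite iter_per /dvdn modn_small; last by apply: leq_ltn_trans bl; rewrite leq_subr.
by rewrite subn_eq0 => h; apply/eqP; rewrite eqn_leq le.
Qed.

Let count_traject j t : count_mem (iter t rho Y) (traject rho Y (j * l)) = j.
Proof.
have one : count_mem (iter t rho Y) (traject rho Y l) = 1.
  rewrite count_uniq_mem.
    rewrite iter_mod; apply/eqP; rewrite eqb1; apply/trajectP.
    by exists (t %% l); rewrite // ltn_mod.
  rewrite -[traject _ _ _](mkseq_nth Y) /mkseq size_traject map_inj_in_uniq ?iota_uniq //.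
  move=> a b; rewrite !mem_iota !add0n /= => al bl.
  by rewrite !nth_traject //; apply: iter_inj.
elim: j => [|j IH]; first by rewrite mul0n.
by rewrite mulSn trajectD count_cat one lY IH.
Qed.

Variables (D : seq U) (M : nat).
Hypothesis DM : size D <= M.
Hypothesis PD : forall Z, Z \in D -> P Z.
Hypothesis fixD : perm_eq (map rho D) D.

Let count_iter t : count_mem (iter t rho Y) D = count_mem Y D.
Proof.
elim: t => //= t IH; rewrite -IH; move/seq.permP: fixD => <-.
rewrite count_map; apply: eq_in_count => Z ZD /=.
by apply/eqP/eqP=> [/rho_inj h|->] //; apply: h; [apply: PD | apply: P_iter].
Qed.

(** A segment of length [s.+1] closes up exactly when [s.+1 = j * l] with [l] the period, and then
    it contains every member of the orbit [j] times; since [D] contains all of them equally often,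
    it fits into [D] iff [j] is at most the multiplicity of [Y]. In this form of the multiplicity
    the period no longer occurs, so the sums over [Y] and over [s] can be exchanged in
    [cls_recursion]. *)
Lemma orbit_count : count_mem Y D =
  \sum_(s < M) ((iter s.+1 rho Y == Y) &&
     all (fun Z => count_mem Z (traject rho Y s.+1) <= count_mem Z D)
         (traject rho Y s.+1)).
Proof.
set m := count_mem Y D.
(* The [l] distinct members of the orbit occur [m] times each, so all the lengths [j * l] with
   [j <= m] are at most [M]. *)
have mlM : m * l <= M.
  apply: leq_trans DM; have ut : uniq (traject rho Y l).
    rewrite -[traject _ _ _](mkseq_nth Y) /mkseq size_traject map_inj_in_uniq ?iota_uniq //.
    move=> a b; rewrite !mem_iota !add0n /= => al bl.
    by rewrite !nth_traject //; apply: iter_inj.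
  have -> : m * l = \sum_(Z <- traject rho Y l) count_mem Z D.
    rewrite -{1}(size_traject rho Y l) -sum1_size big_distrr /=.
    rewrite big_seq [RHS]big_seq; apply: eq_bigr => Z /trajectP[t _ ->].
    by rewrite muln1 count_iter.
  elim: (traject rho Y l) ut D => [|Z r IH] /= ut D'; first by rewrite big_nil.
  case/andP: ut => Zr ur; rewrite big_cons -(count_predC (pred1 Z) D') leq_add2l.
  rewrite -size_filter; apply: leq_trans (IH ur _); rewrite big_seq [leqRHS]big_seq.
  apply: leq_sum => W Wr; rewrite count_filter; apply: sub_count => x /= /eqP->.
  by rewrite eqxx /=; apply: contraNneq Zr => <-.
have key n : 0 < n -> (iter n rho Y == Y) &&
     all (fun Z => count_mem Z (traject rho Y n) <= count_mem Z D) (traject rho Y n) =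
     (l %| n) && (n %/ l <= m).
  move=> n0; rewrite iter_per; case: (boolP (l %| n)) => //= /dvdnP[j jE].
  rewrite jE mulnK //; apply/allP/idP=> [h|jm Z /trajectP[t _ ->]].
    have j0 : 0 < j * l by rewrite -jE.
    rewrite -(count_traject j 0); apply: h.
    by case: (j * l) j0 => //= *; rewrite mem_head.
  by rewrite count_traject count_iter.
under eq_bigr do rewrite key //.
rewrite -(big_mkord xpredT (fun s => ((l %| s.+1) && (s.+1 %/ l <= m)) : nat)).
have -> : \sum_(0 <= s < M) ((l %| s.+1) && (s.+1 %/ l <= m)) =
  \sum_(1 <= s < M.+1) (if (l %| s) && (s %/ l <= m) then 1 else 0).
  by rewrite big_add1 /=; apply: eq_bigr => s _; case: ifP.
rewrite -big_mkcond sum1_count -size_filter.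
rewrite -[LHS](size_iota 1 m) -[LHS](size_map (fun j => j * l)); apply: perm_size.
apply: uniq_perm; last move=> s.
- rewrite map_inj_uniq ?iota_uniq // => a b /eqP; rewrite eqn_pmul2r //; exact: eqP.
- by rewrite filter_uniq // iota_uniq.
rewrite mem_filter mem_index_iota; apply/mapP/andP.
  move=> [j]; rewrite mem_iota add1n ltnS => /andP[j0 jm] ->.
  rewrite dvdn_mull // mulnK //; split; first by rewrite jm.
  rewrite muln_gt0 j0 l_gt0 ltnS; apply: leq_trans mlM; by rewrite leq_pmul2r.
move=> [/andP[/dvdnP[j ->]]]; rewrite mulnK // muln_gt0 => jm /andP[/andP[j0 _] _].
by exists j; rewrite // mem_iota j0 add1n ltnS.
Qed.

End OrbitCount.

Local Open Scope ring_scope.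

(** * Modules and the Krull-Schmidt theorem *)

(* A module over the free algebra on [T], one square matrix per generator.
   Representations of a quiver are the modules with [T = V + A] for which the
   generators in [V] are complementary idempotents ([qmod] below); this
   avoids matrices with dependent sizes. *)
Record tmod (k : fieldType) (T : Type) :=
  TMod { tsz : nat; tact :> T -> 'M[k]_tsz }.

Section Modules.
Variables (k : fieldType) (T : Type).
Local Notation tmod := (tmod k T).
Implicit Types X Y Z W : tmod.

Definition thom X Y (f : 'M[k]_(tsz X, tsz Y)) : Prop :=
  forall t, X t *m f = f *m Y t.
Definition tiso X Y : Prop :=
  exists f g, [/\ thom f, f *m g = 1%:M & (g : 'M_(tsz Y, tsz X)) *m f = 1%:M].
Definition tsum X Y : tmod := TMod (fun t => block_mx (X t) 0 0 (Y t)).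
Definition tzero : tmod := TMod (fun _ : T => 0 : 'M[k]_0).
Definition tsummand X Y : Prop :=
  exists f g, [/\ @thom X Y f, @thom Y X g & f *m g = 1%:M].
(** Idempotents instead of decompositions: this form quantifies over one matrix of known size, hence
    becomes first-order, and it is easily carried along functors. [tindecP] gives the usual form. *)
Definition tindec X : Prop := (0 < tsz X)%N /\
  forall e, @thom X X e -> e *m e = e -> e = 0 \/ e = 1%:M.

Lemma thom1 X : @thom X X 1%:M.
Proof. by move=> t; rewrite mul1mx mulmx1. Qed.

Lemma thomM X Y Z f g : @thom X Y f -> @thom Y Z g -> @thom X Z (f *m g).
Proof. by move=> hf hg t; rewrite mulmxA hf -!mulmxA hg. Qed.

Lemma thom0 X Y : @thom X Y 0.
Proof. by move=> t; rewrite mulmx0 mul0mx. Qed.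

Lemma thomD X Y f g : @thom X Y f -> @thom X Y g -> @thom X Y (f + g).
Proof. by move=> hf hg t; rewrite mulmxDr mulmxDl hf hg. Qed.

Lemma thomN X Y f : @thom X Y f -> @thom X Y (- f).
Proof. by move=> hf t; rewrite mulmxN mulNmx hf. Qed.

Lemma thomB X Y f g : @thom X Y f -> @thom X Y g -> @thom X Y (f - g).
Proof. by move=> hf hg; apply: thomD => //; apply: thomN. Qed.

Lemma thomZ X Y a f : @thom X Y f -> @thom X Y (a *: f).
Proof. by move=> hf t; rewrite -scalemxAr -scalemxAl hf. Qed.

Lemma thom_sum X Y (I : finType) (P : pred I) (F : I -> 'M_(tsz X, tsz Y)) :
  (forall i, P i -> thom (F i)) -> @thom X Y (\sum_(i | P i) F i).
Proof.
move=> h; apply: (big_ind (@thom X Y)) => //; first exact: thom0.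
exact: thomD.
Qed.

Lemma thomX X f n : @thom X X f -> @thom X X (f ^+ n).
Proof.
move=> hf; elim: n => [|n IH]; first by rewrite expr0; apply: thom1.
by rewrite exprS; apply: thomM.
Qed.

Lemma thomV X Y f g : @thom X Y f -> f *m g = 1%:M -> g *m f = 1%:M ->
  @thom Y X g.
Proof.
move=> hf fg gf t.
by rewrite -[Y t *m g]mul1mx -gf -!mulmxA (mulmxA f) -hf -!mulmxA fg mulmx1.
Qed.

Lemma tiso_refl X : tiso X X.
Proof. by exists 1%:M, 1%:M; split; rewrite ?mulmx1 //; apply: thom1. Qed.

Lemma tiso_sym X Y : tiso X Y -> tiso Y X.
Proof. by move=> [f [g [hf fg gf]]]; exists g, f; split=> //; apply: thomV gf. Qed.

Lemma tiso_trans Y X Z : tiso X Y -> tiso Y Z -> tiso X Z.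
Proof.
move=> [f [g [hf fg gf]]] [f' [g' [hf' fg' gf']]].
exists (f *m f'), (g' *m g); split; first exact: thomM hf'.
  by rewrite -mulmxA (mulmxA f') fg' mul1mx.
by rewrite -mulmxA (mulmxA g) gf mul1mx.
Qed.

Lemma tiso_sz X Y : tiso X Y -> tsz X = tsz Y.
Proof.
move=> [f [g [_ fg gf]]]; apply/eqP; rewrite eqn_leq.
by rewrite (mulmx1_min fg) (mulmx1_min gf).
Qed.

Lemma tiso_summand X Y : tiso X Y -> tsummand X Y.
Proof. by move=> [f [g [hf fg gf]]]; exists f, g; split=> //; apply: thomV gf. Qed.

Lemma tsummand_trans Y X Z : tsummand X Y -> tsummand Y Z -> tsummand X Z.
Proof.
move=> [f [g [hf hg fg]]] [f' [g' [hf' hg' fg']]].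
exists (f *m f'), (g' *m g); split; [exact: thomM hf' | exact: thomM hg|].
by rewrite -mulmxA (mulmxA f') fg' mul1mx.
Qed.

Lemma tsummand_sz X Y : tsummand X Y -> (tsz X <= tsz Y)%N.
Proof. by move=> [f [g [_ _ fg]]]; apply: mulmx1_min fg. Qed.

Lemma tsummand_iso X Y : tsummand X Y -> tsz X = tsz Y -> tiso X Y.
Proof.
move=> [f [g [hf hg fg]]] e; exists f, g; split=> //.
case: X Y f g e hf hg fg => [n x] [m y] /= f g e; move: y f g.
by case: m / e => y f g _ _; apply: mulmx1C.
Qed.

Lemma thom_block X Y X' Y' a b c d :
  @thom X X' a -> @thom X Y' b -> @thom Y X' c -> @thom Y Y' d ->
  @thom (tsum X Y) (tsum X' Y') (block_mx a b c d).
Proof.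
move=> ha hb hc hd t; rewrite /= !mulmx_block !mulmx0 !mul0mx.
by rewrite !addr0 !add0r ha hb hc hd.
Qed.

Lemma thom_blockP X Y X' Y' a b c d :
  @thom (tsum X Y) (tsum X' Y') (block_mx a b c d) ->
  [/\ @thom X X' a, @thom X Y' b, @thom Y X' c & @thom Y Y' d].
Proof.
move=> h; split=> t; move: (h t);
  rewrite /= !mulmx_block !mulmx0 !mul0mx !addr0 !add0r;
  by case/eq_block_mx.
Qed.

Lemma tsum_iso X X' Y Y' : tiso X X' -> tiso Y Y' -> tiso (tsum X Y) (tsum X' Y').
Proof.
move=> [f [g [hf fg gf]]] [f' [g' [hf' fg' gf']]].
exists (block_mx f 0 0 f'), (block_mx g 0 0 g'); split.
- by apply: thom_block => //; apply: thom0.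
- by rewrite mulmx_block !mulmx0 !mul0mx !addr0 !add0r fg fg' -scalar_mx_block.
- by rewrite mulmx_block !mulmx0 !mul0mx !addr0 !add0r gf gf' -scalar_mx_block.
Qed.

Lemma tsumC X Y : tiso (tsum X Y) (tsum Y X).
Proof.
exists (block_mx 0 1%:M 1%:M 0), (block_mx 0 1%:M 1%:M 0); split.
- by apply: thom_block; [exact: thom0|exact: thom1|exact: thom1|exact: thom0].
- by rewrite mulmx_block !mulmx0 !mul0mx !addr0 !add0r !mulmx1 -scalar_mx_block.
- by rewrite mulmx_block !mulmx0 !mul0mx !addr0 !add0r !mulmx1 -scalar_mx_block.
Qed.

Lemma tsummandl X Y : tsummand X (tsum X Y).
Proof.
exists (row_mx 1%:M 0), (col_mx 1%:M 0); split=> [t|t|].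
- by rewrite /= mul_row_block mul_mx_row !(mulmx0, mul0mx, mulmx1, mul1mx, addr0).
- by rewrite /= mul_block_col mul_col_mx !(mulmx0, mul0mx, mulmx1, mul1mx, addr0).
- by rewrite mul_row_col mulmx1 mulmx0 addr0.
Qed.

Lemma tsum_split X Y Z (f : 'M_(tsz Y, tsz X)) (g : 'M_(tsz X, tsz Y))
    (f' : 'M_(tsz Z, tsz X)) (g' : 'M_(tsz X, tsz Z)) :
  thom g -> thom g' -> f *m g = 1%:M -> f' *m g' = 1%:M ->
  f *m g' = 0 -> f' *m g = 0 -> g *m f + g' *m f' = 1%:M -> tiso X (tsum Y Z).
Proof.
move=> hg hg' fg fg' z z' s; exists (row_mx g g'), (col_mx f f'); split=> [t||].
- by rewrite /= mul_row_block mul_mx_row !mulmx0 addr0 add0r hg hg'.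
- by rewrite mul_row_col.
- by rewrite mul_col_row fg fg' z z' -scalar_mx_block.
Qed.

Lemma rank_factor n (g : 'M[k]_n) :
  exists (r : nat) (P : 'M[k]_(r, n)) (C : 'M[k]_(n, r)) R L,
    [/\ C *m P = g, P *m R = 1%:M, L *m C = 1%:M & r = \rank g].
Proof.
have /row_freeP[R PR] : row_free (row_base g) by exact: row_base_free.
have /row_fullP[L LC] : row_full (col_base g) by exact: col_base_full.
exists (\rank g), (row_base g), (col_base g), R, L; split=> //.
exact: mulmx_base.
Qed.

Lemma idem_split n (e : 'M[k]_n) : e *m e = e ->
  exists (r : nat) (P : 'M[k]_(r, n)) (C : 'M[k]_(n, r)),
    [/\ P *m C = 1%:M, C *m P = e & r = \rank e].
Proof.
have [r [P [C [R [L [CP PR LC rE]]]]]] := rank_factor e.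
move=> ee; exists r, P, C; split=> //.
have h : L *m (C *m P *m (C *m P)) *m R = L *m (C *m P) *m R by rewrite CP ee.
by move: h; rewrite -!mulmxA PR !mulmx1 !(mulmxA L) LC !mul1mx.
Qed.

Lemma tsplit_idem X e : @thom X X e -> e *m e = e ->
  exists Y Z, [/\ tiso X (tsum Y Z), tsz Y = \rank e & tsz Z = \rank (1%:M - e)].
Proof.
move=> he ee.
have ee' : (1%:M - e) *m (1%:M - e) = 1%:M - e.
  by rewrite mulmxBr mulmx1 mulmxBl mul1mx ee subrr subr0.
have he' : @thom X X (1%:M - e) by apply: thomB => //; apply: thom1.
have [r [P [C [PC CP rE]]]] := idem_split ee.
have [r' [P' [C' [PC' CP' rE']]]] := idem_split ee'.
pose Y := TMod (fun t => P *m X t *m C); pose Z := TMod (fun t => P' *m X t *m C').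
exists Y, Z; split=> //; apply: (@tsum_split X Y Z P C P' C') => //=.
- move=> t /=; rewrite !mulmxA CP -he -!mulmxA; congr (_ *m _).
  by rewrite -{1}CP -mulmxA PC mulmx1.
- move=> t /=; rewrite !mulmxA CP' -he' -!mulmxA; congr (_ *m _).
  by rewrite -{1}CP' -mulmxA PC' mulmx1.
- have h : e *m (1%:M - e) = 0 by rewrite mulmxBr mulmx1 ee subrr.
  rewrite -[P]mul1mx -PC -[C']mulmx1 -PC' -!mulmxA (mulmxA C') CP' !mulmxA.
  by rewrite -(mulmxA P) CP -(mulmxA P) h mulmx0 mul0mx.
- have h : (1%:M - e) *m e = 0 by rewrite mulmxBl mul1mx ee subrr.
  rewrite -[P']mul1mx -PC' -[C]mulmx1 -PC -!mulmxA (mulmxA C) CP !mulmxA.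
  by rewrite -(mulmxA P') CP' -(mulmxA P') h mulmx0 mul0mx.
- by rewrite CP CP' addrC subrK.
Qed.

Lemma tsummand_compl X Y : tsummand X Y -> exists Z, tiso Y (tsum X Z).
Proof.
move=> [f [g [hf hg fg]]]; pose e := g *m f.
have ee : e *m e = e by rewrite /e -mulmxA (mulmxA f) fg mul1mx.
have he : @thom Y Y e by apply: thomM hf.
have ee' : (1%:M - e) *m (1%:M - e) = 1%:M - e.
  by rewrite mulmxBr mulmx1 mulmxBl mul1mx ee subrr subr0.
have he' : @thom Y Y (1%:M - e) by apply: thomB => //; apply: thom1.
have [r' [P' [C' [PC' CP' rE']]]] := idem_split ee'.
pose Z := TMod (fun t => P' *m Y t *m C').
exists Z; apply: (@tsum_split Y X Z f g P' C') => //=.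
- move=> t /=; rewrite !mulmxA CP' -he' -!mulmxA; congr (_ *m _).
  by rewrite -{1}CP' -mulmxA PC' mulmx1.
- have h : f *m (1%:M - e) = 0 by rewrite mulmxBr mulmx1 /e mulmxA fg mul1mx subrr.
  by rewrite -[C']mulmx1 -PC' (mulmxA C') CP' mulmxA h mul0mx.
- have h : (1%:M - e) *m g = 0.
    by rewrite mulmxBl mul1mx /e -mulmxA fg mulmx1 subrr.
  by rewrite -[P']mul1mx -PC' -(mulmxA P') CP' -(mulmxA P') h mulmx0.
- by rewrite CP' addrC subrK.
Qed.

Lemma tindecP X : tindec X <-> (0 < tsz X)%N /\
  ~ (exists Y Z, [/\ (0 < tsz Y)%N, (0 < tsz Z)%N & tiso X (tsum Y Z)]).
Proof.
split=> [[X0 Xi]|[X0 Xi]]; split=> //.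
  move=> [Y [Z [Y0 Z0 [f [g [hf fg gf]]]]]].
  pose p : 'M[k]_(tsz Y + tsz Z) := block_mx 1%:M 0 0 0.
  have hp : @thom (tsum Y Z) (tsum Y Z) p.
    by apply: thom_block; [exact: thom1|exact: thom0|exact: thom0|exact: thom0].
  have hg := thomV hf fg gf.
  have pp : p *m p = p by rewrite /p mulmx_block !mulmx0 !mul0mx !addr0 !mulmx1.
  have hE : (f *m p *m g) *m (f *m p *m g) = f *m p *m g.
    by rewrite !mulmxA -(mulmxA _ g f) gf mulmx1 -(mulmxA _ p p) pp.
  have pE : p = g *m (f *m p *m g) *m f.
    by rewrite !mulmxA gf mul1mx -mulmxA gf mulmx1.
  case: (Xi _ (thomM (thomM hf hp) hg) hE) => h; move: pE; rewrite h.
    rewrite mulmx0 mul0mx /p -(block_mx0 _ _ _ _ _) => /eq_block_mx[e _ _ _].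
    by move: Y0; rewrite -(mxrank1 k (tsz Y)) e mxrank0.
  rewrite mulmx1 gf /p scalar_mx_block => /eq_block_mx[_ _ _ e].
  by move: Z0; rewrite -(mxrank1 k (tsz Z)) -e mxrank0.
move=> e he ee; have [Y [Z [iXYZ sY sZ]]] := tsplit_idem he ee.
case: (posnP (\rank e)) => [/eqP|re]; first by rewrite mxrank_eq0 => /eqP; left.
case: (posnP (\rank (1%:M - e))) => [/eqP|re'].
  by rewrite mxrank_eq0 subr_eq0 => /eqP; right.
by case: Xi; exists Y, Z; rewrite sY sZ.
Qed.

Lemma tindec_iso X Y : tiso X Y -> tindec X -> tindec Y.
Proof.
move=> iXY /tindecP[X0 Xi]; apply/tindecP; rewrite -(tiso_sz iXY); split=> //.
move=> [A [B [A0 B0 iY]]]; apply: Xi; exists A, B; split=> //.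
exact: tiso_trans iY.
Qed.

(* Fitting's lemma: the idempotent is the projection on the stable image. *)
Lemma tindec_fitting X f : tindec X -> @thom X X f ->
  f \in unitmx \/ exists n, f ^+ n = 0.
Proof.
move=> [X0 Xi] hf.
have mono i j : (\rank (f ^+ (i + j)) <= \rank (f ^+ i))%N.
  by rewrite addnC exprD; apply: mxrankM_maxr.
have [i ri] : exists i, (0 < i)%N /\ \rank (f ^+ i) = \rank (f ^+ (i + i)).
  have exr : exists r, `[< exists i, (0 < i)%N /\ \rank (f ^+ i) = r >].
    by exists (\rank (f ^+ 1)); apply/asboolP; exists 1%N.
  case: (ex_minnP exr) => r /asboolP[i [i0 ir]] rmin; exists i; split=> //.
  apply/eqP; rewrite eqn_leq mono andbT ir; apply: rmin; apply/asboolP.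
  by exists (i + i)%N; split=> //; rewrite addn_gt0 i0.
case: ri => i0 ri; pose g := f ^+ i.
have hg : @thom X X g by apply: thomX.
have [r [P [C [R [L [CP PR LC rE]]]]]] := rank_factor g.
(* [P *m C] is the restriction of [g] to its image; it is invertible because [g] and its square have
   the same rank, and [e] below projects onto the image of [g] along its kernel. *)
have uPC : P *m C \in unitmx.
  rewrite -row_full_unit -col_leq_rank {1}rE {1}/g ri exprD -[_ * _]/(g *m g).
  rewrite -CP -mulmxA (mulmxA P).
  by apply: leq_trans (mxrankM_maxr _ _) _; apply: mxrankM_maxl.
pose e := C *m invmx (P *m C) *m P.
have ee : e *m e = e.
  rewrite /e !mulmxA -(mulmxA _ P C) -(mulmxA C (invmx _) (P *m C)).
  by rewrite mulVmx // mulmx1.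
have he : @thom X X e.
  move=> t; have hXt := hg t; rewrite -CP in hXt.
  have h1 : P *m X t = (L *m X t *m C) *m P.
    by rewrite -!mulmxA hXt !mulmxA LC mul1mx.
  have h2 : X t *m C = C *m (P *m X t *m R).
    by rewrite !mulmxA -hXt -!mulmxA PR mulmx1.
  have h3 : P *m C *m (P *m X t *m R) = (L *m X t *m C) *m (P *m C).
    by rewrite -mulmxA -h2 mulmxA h1 !mulmxA.
  have h4 : (P *m X t *m R) *m invmx (P *m C) = invmx (P *m C) *m (L *m X t *m C).
    by rewrite -[X in X *m _ = _](mulKmx uPC) h3 -(mulmxA (invmx (P *m C))) mulmxK.
  have -> : e *m X t = C *m (invmx (P *m C) *m (L *m X t *m C)) *m P.
    by rewrite /e -mulmxA h1 !mulmxA.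
  by rewrite -h4 /e !mulmxA h2 !mulmxA.
case: (Xi e he ee) => h.
  right; exists i; rewrite -/g -CP.
  have : C = 0.
    have := congr1 (fun M => M *m C) h.
    by rewrite /e -mulmxA -mulmxA mulVmx // mulmx1 mul0mx.
  by move->; rewrite mul0mx.
left; have : \rank g = tsz X.
  apply/eqP; rewrite eqn_leq rank_leq_row /= -{1}(mxrank1 k (tsz X)) -h.
  by apply: leq_trans (mxrankM_maxr _ _) _; rewrite -rE rank_leq_row.
move=> rg; rewrite -row_free_unit /row_free eqn_leq rank_leq_row /= -{1}rg.
by rewrite /g -(prednK i0) exprSr; apply: mxrankM_maxr.
Qed.

Lemma nilp_unit n (f : 'M[k]_n) m : f ^+ m = 0 -> 1%:M - f \in unitmx.
Proof.
move=> fm; have /mulmx1_unit[] // :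
  (1%:M - f) *m (\sum_(i < m) f ^+ i) = 1%:M.
have := subrX1 f m; rewrite fm sub0r => /(congr1 -%R).
by rewrite opprK -mulNr opprB.
Qed.

Lemma unitmx_iso n m (f : 'M[k]_(n, m)) (g : 'M[k]_(m, n)) :
  n = m -> f *m g \in unitmx -> exists h, f *m h = 1%:M /\ h *m f = 1%:M.
Proof.
move=> e; move: g f; case: m / e => g f.
rewrite unitmx_mul => /andP[uf _]; exists (invmx f).
by rewrite mulmxV // mulVmx.
Qed.

(** After division by [f + g] the two endomorphisms add up to 1; by Fitting's lemma the first is
    invertible or nilpotent, and 1 minus a nilpotent is invertible. Endomorphism rings of
    indecomposables are thus local, which is the source of every cancellation below. *)
Lemma tindec_local X f g : tindec X -> @thom X X f -> @thom X X g ->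
  f + g \in unitmx -> f \in unitmx \/ g \in unitmx.
Proof.
move=> iX hf hg u; pose h := f + g; have hh : @thom X X h by apply: thomD.
have hV : @thom X X (invmx h) by apply: (thomV hh); rewrite ?mulmxV ?mulVmx.
case: (tindec_fitting iX (thomM hV hf)) => [|[n nil]].
  by rewrite unitmx_mul => /andP[_]; left.
right; have := nilp_unit nil.
have -> : 1%:M - invmx h *m f = invmx h *m g.
  rewrite -[1%:M](mulVmx u) -mulmxBr; congr (_ *m _).
  by rewrite addrC addKr.
by rewrite unitmx_mul => /andP[].
Qed.

Lemma tindec_local_sum X (I : finType) (P : pred I) (F : I -> 'M_(tsz X)) :
  tindec X -> (forall i, P i -> @thom X X (F i)) ->
  \sum_(i | P i) F i \in unitmx -> exists2 i, P i & F i \in unitmx.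
Proof.
move=> iX hF u.
suff : \sum_(i | P i) F i \notin unitmx \/ exists2 i, P i & F i \in unitmx.
  by case=> //; rewrite u.
suff : @thom X X (\sum_(i | P i) F i) /\
  (\sum_(i | P i) F i \notin unitmx \/ exists2 i, P i & F i \in unitmx) by case.
elim/big_rec: _ => [|i x Pi [hx IH]].
  split; first exact: thom0.
  left; rewrite -row_full_unit /row_full mxrank0 eq_sym -lt0n.
  by case: iX.
split; first by apply: thomD => //; apply: hF.
case: IH => [nu|]; last by right.
case: (boolP (F i + x \in unitmx)) => [ux|]; last by left.
by case: (tindec_local iX (hF _ Pi) hx ux) => [uF|ux']; [right; exists i | rewrite ux' in nu].
Qed.

(** The identity of [X] is the sum of the composites through [Y] and through [Z]; locality makes one
    of them invertible. *)
Lemma tindec_summand_sum X Y Z : tindec X -> tsummand X (tsum Y Z) ->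
  tsummand X Y \/ tsummand X Z.
Proof.
move=> iX [f [g [hf hg]]].
have := hf; have := hg; rewrite -[f]hsubmxK -[g]vsubmxK /=.
set f1 := lsubmx f; set f2 := rsubmx f; set g1 := usubmx g; set g2 := dsubmx g.
move=> hg' hf'; rewrite mul_row_col => s.
have hg1 : @thom Y X g1 /\ @thom Z X g2.
  split=> t; move: (hg' t); rewrite /= mul_block_col !mul0mx addr0 add0r mul_col_mx.
    by case/eq_col_mx.
  by case/eq_col_mx.
have hf1 : @thom X Y f1 /\ @thom X Z f2.
  split=> t; move: (hf' t); rewrite /= mul_row_block !mulmx0 addr0 add0r mul_mx_row.
    by case/eq_row_mx.
  by case/eq_row_mx.
case: hg1 hf1 => hg1 hg2 [hf1 hf2].
have : f1 *m g1 + f2 *m g2 \in unitmx by rewrite s unitmx1.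
case/(tindec_local iX (thomM hf1 hg1) (thomM hf2 hg2)) => u; [left|right].
  exists f1, (g1 *m invmx (f1 *m g1)); split=> //.
    apply: thomM => //; apply: (thomV (thomM hf1 hg1));
    by rewrite ?mulmxV ?mulVmx.
  by rewrite mulmxA mulmxV.
exists f2, (g2 *m invmx (f2 *m g2)); split=> //.
  apply: thomM => //; apply: (thomV (thomM hf2 hg2));
  by rewrite ?mulmxV ?mulVmx.
by rewrite mulmxA mulmxV.
Qed.

Lemma tindec_summand_indec X Y : tindec X -> tindec Y -> tsummand X Y -> tiso X Y.
Proof.
move=> iX /tindecP[Y0 iY] sXY; have [Z iZ] := tsummand_compl sXY.
case: (posnP (tsz Z)) => [Z0|Z0].
  apply: (tsummand_iso sXY); rewrite (tiso_sz iZ) /= Z0 addn0 //.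
by case: iY; exists X, Z; split=> //; case: iX.
Qed.

(* After composing with an automorphism of X + B, the corner X -> X is invertible
   and a Schur complement gives the isomorphism. *)
Lemma tsum_cancel_indec X A B : tindec X -> tiso (tsum X A) (tsum X B) -> tiso A B.
Proof.
move=> iX [F [G [hF FG GF]]].
wlog : F G hF FG GF / ulsubmx F \in unitmx => [wl|].
  pose f11 := ulsubmx F; pose f12 := ursubmx F.
  pose g11 := ulsubmx G; pose g21 := dlsubmx G.
  have hG := thomV hF FG GF.
  have [h11 h12 _ _] : [/\ @thom X X f11, @thom X B f12,
     @thom A X (dlsubmx F) & @thom A B (drsubmx F)].
    by apply: thom_blockP; rewrite submxK.
  have [k11 _ k21 _] : [/\ @thom X X g11, @thom X A (ursubmx G),
     @thom B X g21 & @thom B A (drsubmx G)].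
    by apply: thom_blockP; rewrite submxK.
  case: (boolP (f11 \in unitmx)) => [|nu]; first exact: wl FG GF.
  have e1 : f11 *m g11 + f12 *m g21 = 1%:M.
    move: FG; rewrite -[F]submxK -[G]submxK mulmx_block scalar_mx_block.
    by case/eq_block_mx.
  (* The shear replaces the corner [f11] by [f11 + f12 *m g21 = 1 + f11 *m (1 - g11)], which must be
     a unit: otherwise locality would make the non-unit [f11] invertible. *)
  pose th := block_mx 1%:M 0 g21 1%:M : 'M_(tsz X + tsz B).
  pose th' := block_mx 1%:M 0 (- g21) 1%:M : 'M_(tsz X + tsz B).
  have tt : th *m th' = 1%:M.
    rewrite mulmx_block !mulmx0 !mul0mx !mul1mx !mulmx1 !addr0 add0r subrr.
    by rewrite -scalar_mx_block.
  have tt' : th' *m th = 1%:M.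
    rewrite mulmx_block !mulmx0 !mul0mx !mul1mx !mulmx1 !addr0 add0r addNr.
    by rewrite -scalar_mx_block.
  have hth : @thom (tsum X B) (tsum X B) th.
    by apply: thom_block => //; [exact: thom1|exact: thom0|exact: thom1].
  apply: (wl (F *m th) (th' *m G)).
  - exact: thomM hth.
  - by rewrite -mulmxA (mulmxA th) tt mul1mx.
  - by rewrite -mulmxA (mulmxA G) GF mul1mx.
  have -> : ulsubmx (F *m th) = f11 + f12 *m g21.
    by rewrite -[F]submxK mulmx_block block_mxKul mulmx1.
  have -> : f12 *m g21 = 1%:M - f11 *m g11 by rewrite -e1 addrC addKr.
  have -> : f11 + (1%:M - f11 *m g11) = 1%:M + f11 *m (1%:M - g11).
    by rewrite mulmxBr mulmx1 addrCA addrA.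
  have h' : @thom X X (f11 *m (1%:M - g11)).
    by apply: thomM => //; apply: thomB => //; apply: thom1.
  case: (boolP (1%:M + f11 *m (1%:M - g11) \in unitmx)) => // nu'.
  have : 1%:M \in @unitmx k (tsz X) by exact: unitmx1.
  rewrite -[1%:M](addrK (f11 *m (1%:M - g11))).
  case/(tindec_local iX _ (thomN h')) => [|u|u].
  - by apply: thomD => //; apply: thom1.
  - by rewrite u in nu'.
  - have : f11 *m (1%:M - g11) \in unitmx.
      by move: u; rewrite -mulmxN unitmx_mul -[X in X = true -> _]andbC;
         move=> /andP[u2 u1]; rewrite (negbTE nu) in u1.
    by rewrite unitmx_mul (negbTE nu).
move=> u.
pose f11 := ulsubmx F; pose f12 := ursubmx F; pose f21 := dlsubmx F.
pose f22 := drsubmx F.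
have FE : F = block_mx f11 f12 f21 f22 by rewrite submxK.
have [h11 h12 h21 h22] : [/\ @thom X X f11, @thom X B f12,
   @thom A X f21 & @thom A B f22].
  by apply: thom_blockP; rewrite -FE.
have hV : @thom X X (invmx f11) by apply: (thomV h11); rewrite ?mulmxV ?mulVmx.
pose c := f22 - f21 *m invmx f11 *m f12.
have hc : @thom A B c.
  by apply: thomB => //; apply: thomM h12; apply: thomM hV.
pose G22 := drsubmx G; pose G12 := ursubmx G.
have GE : G = block_mx (ulsubmx G) G12 (dlsubmx G) G22 by rewrite submxK.
exists c, G22; split=> //.
  move: FG; rewrite FE GE mulmx_block scalar_mx_block => /eq_block_mx[_ e2 _ e4].
  rewrite /c mulmxBl -e4 -!mulmxA.
  have -> : f12 *m G22 = - (f11 *m G12) by apply/eqP; rewrite -addr_eq0 addrC e2.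
  by rewrite !mulmxN mulKmx // opprK addrC.
move: GF; rewrite FE GE mulmx_block scalar_mx_block => /eq_block_mx[_ _ e3 e4].
rewrite /c mulmxBr -e4 !mulmxA.
have -> : G22 *m f21 = - (dlsubmx G *m f11) by apply/eqP; rewrite -addr_eq0 addrC e3.
by rewrite !mulNmx mulmxK // opprK addrC.
Qed.

Lemma tsum0r X : tiso (tsum X tzero) X.
Proof.
apply: tiso_sym; apply: tsummand_iso; first exact: tsummandl.
by rewrite /= addn0.
Qed.

Lemma tsum0l X : tiso (tsum tzero X) X.
Proof. exact: tiso_trans (tsumC _ _) (tsum0r X). Qed.

Lemma tsumA X Y Z : tiso (tsum X (tsum Y Z)) (tsum (tsum X Y) Z).
Proof.
apply: (@tsum_split (tsum X (tsum Y Z)) (tsum X Y) Z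
  (block_mx 1%:M 0 0 (row_mx 1%:M 0)) (block_mx 1%:M 0 0 (col_mx 1%:M 0))
  (row_mx 0 (row_mx 0 1%:M)) (col_mx 0 (col_mx 0 1%:M))).
- move=> t; rewrite /= !mulmx_block mul_block_col mul_col_mx.
  by rewrite !(mulmx0, mul0mx, addr0, add0r, mulmx1, mul1mx) mul_col_mx mul1mx mul0mx col_mx0.
- move=> t; rewrite /= !mul_block_col !mul_col_mx.
  by rewrite !(mulmx0, mul0mx, addr0, add0r, mulmx1, mul1mx).
- rewrite mulmx_block mul_row_col.
  by rewrite !(mulmx0, mul0mx, addr0, add0r, mulmx1, mul1mx) -scalar_mx_block.
- by rewrite !mul_row_col !(mulmx0, mul0mx, addr0, add0r, mulmx1, mul1mx).
- rewrite mul_block_col mul_row_col.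
  by rewrite !(mulmx0, mul0mx, addr0, add0r, mulmx1, mul1mx) col_mx0.
- rewrite mul_row_block mul_row_col.
  by rewrite !(mulmx0, mul0mx, addr0, add0r, mulmx1, mul1mx) row_mx0.
- rewrite mulmx_block mul_col_row !mul_col_row.
  rewrite !(mulmx0, mul0mx, addr0, add0r, mulmx1, mul1mx) add_block_mx !addr0.
  rewrite add_block_mx !(addr0, add0r) -scalar_mx_block -scalar_mx_block //.
Qed.

Definition tbig (s : seq tmod) : tmod := foldr tsum tzero s.

Lemma tbig_cat s1 s2 : tiso (tbig (s1 ++ s2)) (tsum (tbig s1) (tbig s2)).
Proof.
elim: s1 => [|X s1 IH] /=; first by apply: tiso_sym; apply: tsum0l.
apply: (tiso_trans _ (tsumA _ _ _)); apply: tsum_iso IH; exact: tiso_refl.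
Qed.

(** [{classic tmod}] carries classical equality and choice, so that [can] picks one module in each
    isomorphism class and multisets of classes become sequences compared by [perm_eq]. *)
Definition ctmod := {classic tmod}.

Definition can X : ctmod := choose (fun Y : ctmod => `[< tiso X Y >]) (X : ctmod).

Lemma can_iso X : tiso X (can X).
Proof.
apply/asboolP; apply: (@chooseP _ (fun Y : ctmod => `[< tiso X Y >])).
by apply/asboolP; apply: tiso_refl.
Qed.

Lemma canP X Y : can X = can Y <-> tiso X Y.
Proof.
split=> [e|iXY].
  by apply: tiso_trans (can_iso X) _; rewrite e; apply: tiso_sym; apply: can_iso.
rewrite /can; have PP : (fun Z : ctmod => `[< tiso X Z >]) =1
                        (fun Z : ctmod => `[< tiso Y Z >]).
  move=> Z; apply/asboolP/asboolP; first by apply: tiso_trans; apply: tiso_sym.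
  exact: tiso_trans.
rewrite (eq_choose PP); apply: choose_id; apply/asboolP; last exact: tiso_refl.
exact: tiso_sym.
Qed.

Lemma canK X : can (can X) = can X.
Proof. by apply/canP; apply: tiso_sym; apply: can_iso. Qed.

Definition cindec (Y : tmod) : Prop := tindec Y /\ can Y = Y.

Definition all_cindec (s : seq ctmod) : Prop := forall Y : ctmod, Y \in s -> cindec Y.

Lemma ks_exists X : exists s : seq ctmod,
  all_cindec s /\ tiso X (tbig s).
Proof.
elim: (tsz X).+1 {-2}X (ltnSn (tsz X)) => // n IH {}X; rewrite ltnS => Xn.
case: (posnP (tsz X)) => [X0|X0].
  exists [::]; split=> //=.
  by case: X X0 {Xn} => n0 x /= n00; move: x; rewrite n00 => x;
    exists 0, 0; split=> [t||]; apply/matrixP=> -[].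
case: (EM (tindec X)) => [iX|niX].
  exists [:: can X]; split=> [Y|].
    rewrite inE => /eqP->; split; last exact: canK.
    exact: tindec_iso (can_iso X) iX.
  by apply: (tiso_trans (can_iso X)); apply: tiso_sym; apply: tsum0r.
have [Y [Z [Y0 Z0 iX]]] : exists Y Z, [/\ (0 < tsz Y)%N, (0 < tsz Z)%N & tiso X (tsum Y Z)].
  by apply: contrapT => h; apply: niX; apply/tindecP.
have sX := tiso_sz iX; rewrite /= in sX.
have [|s [hs iY]] := IH Y.
  by apply: leq_trans Xn; rewrite sX -addn1 leq_add2l.
have [|s' [hs' iZ]] := IH Z.
  by apply: leq_trans Xn; rewrite sX -add1n leq_add2r.
exists (s ++ s'); split.
  by move=> W; rewrite mem_cat => /orP[/hs|/hs'].
apply: (tiso_trans iX); apply: tiso_trans (tiso_sym (tbig_cat _ _)).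
exact: tsum_iso.
Qed.

Lemma tbig_perm (s s' : seq ctmod) : perm_eq s s' -> tiso (tbig s) (tbig s').
Proof.
elim: s s' => [|X s IH] s'; first by rewrite perm_sym => /perm_nilP->; apply: tiso_refl.
move=> pX; have Xs' : X \in s' by rewrite -(perm_mem pX) mem_head.
case/splitPr: Xs' pX => s1 s2.
rewrite perm_sym perm_catC /= perm_cons perm_catC perm_sym => /IH i12 /=.
apply: (tiso_trans (tsum_iso (tiso_refl X) (tiso_trans i12 (tbig_cat _ _)))).
apply: tiso_sym; apply: (tiso_trans (tbig_cat _ _)) => /=.
apply: (tiso_trans (tsumA _ _ _)); apply: tiso_sym.
apply: (tiso_trans (tsumA _ _ _)); apply: tsum_iso (tiso_refl _).
exact: tsumC.
Qed.

Lemma tindec_summand_tbig X (s : seq ctmod) : tindec X -> tsummand X (tbig s) ->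
  exists2 Y, Y \in s & tsummand X Y.
Proof.
move=> iX; elim: s => [|Y s IH] /=.
  by move/tsummand_sz; rewrite /= leqn0 => /eqP; case: iX => + _ => /[swap] ->.
case/(tindec_summand_sum iX) => [h|/IH[Z Zs h]]; first by exists Y; rewrite ?mem_head.
by exists Z; rewrite // in_cons Zs orbT.
Qed.

(** Exchange: the head of [s] is a summand of the other sum, hence of one of its members, which is
    then equal to it; both are cancelled. *)
Lemma ks_unique (s s' : seq ctmod) :
  all_cindec s -> all_cindec s' ->
  tiso (tbig s) (tbig s') -> perm_eq s s'.
Proof.
elim: s s' => [|X s IH] s' hs hs' iss.
  case: s' hs' iss => // Y s' hs' /tiso_sz /= e.
  have [[Y0 _] _] := hs' _ (mem_head _ _).
  by move: Y0; case: (tsz Y) e.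
have [iX cX] := hs _ (mem_head _ _).
have [Y Ys' sXY] : exists2 Y, Y \in s' & tsummand X Y.
  apply: tindec_summand_tbig => //.
  exact: tsummand_trans (tsummandl _ _) (tiso_summand iss).
have [iY cY] := hs' _ Ys'.
have YX : Y = X by rewrite -cY -cX; apply/canP; apply: tiso_sym; apply: tindec_summand_indec.
rewrite YX in Ys'; have pX := perm_to_rem Ys'.
rewrite perm_sym; apply: (perm_trans pX); rewrite perm_cons perm_sym; apply: IH.
- by move=> Z Zs; apply: hs; rewrite in_cons Zs orbT.
- by move=> Z /mem_rem; apply: hs'.
apply: (@tsum_cancel_indec X) => //; apply: (tiso_trans iss).
exact: (tbig_perm pX).
Qed.

Definition dec X : seq ctmod := sval (cid (ks_exists X)).

Lemma dec_indec X : all_cindec (dec X).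
Proof. by move=> Y; rewrite /dec; case: cid => s [hs _] /=; apply: hs. Qed.

Lemma dec_iso X : tiso X (tbig (dec X)).
Proof. by rewrite /dec; case: cid => s []. Qed.

Lemma dec_isoP X Y : perm_eq (dec X) (dec Y) <-> tiso X Y.
Proof.
split=> [p|iXY].
  by apply: (tiso_trans (dec_iso X)); apply: tiso_trans (tbig_perm p) _;
     apply: tiso_sym; apply: dec_iso.
apply: ks_unique; try exact: dec_indec.
apply: (tiso_trans (tiso_sym (dec_iso X))); apply: (tiso_trans iXY); exact: dec_iso.
Qed.

Lemma dec_unique X (s : seq ctmod) : all_cindec s ->
  tiso X (tbig s) -> perm_eq (dec X) s.
Proof.
move=> hs iX; apply: ks_unique => //; first exact: dec_indec.
exact: tiso_trans (tiso_sym (dec_iso X)) iX.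
Qed.

Lemma dec_sum X Y : perm_eq (dec (tsum X Y)) (dec X ++ dec Y).
Proof.
apply: dec_unique => [Z|]; first by rewrite mem_cat => /orP[] /dec_indec.
apply: tiso_trans (tiso_sym (tbig_cat _ _)).
by apply: tsum_iso; apply: dec_iso.
Qed.

Lemma dec_tindec X : tindec X -> perm_eq (dec X) [:: can X].
Proof.
move=> iX; apply: dec_unique => [Y|].
  rewrite inE => /eqP->; split; last exact: canK.
  exact: tindec_iso (can_iso X) iX.
by apply: (tiso_trans (can_iso X)); apply: tiso_sym; apply: tsum0r.
Qed.

Fixpoint all_tindec (s : seq tmod) : Prop :=
  if s is X :: s' then tindec X /\ all_tindec s' else True.

Lemma dec_tbig (s : seq tmod) : all_tindec s -> perm_eq (dec (tbig s)) (map can s).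
Proof.
move=> hs; apply: dec_unique.
  elim: s hs => //= X s IH [iX /IH{}IH] Y; rewrite inE => /orP[/eqP->|]; last exact: IH.
  split; last exact: canK.
  exact: tindec_iso (can_iso X) iX.
elim: s {hs} => [|X s IH] /=; first exact: tiso_refl.
by apply: tsum_iso => //; apply: can_iso.
Qed.

Lemma tsum_cancel X A B : tiso (tsum X A) (tsum X B) -> tiso A B.
Proof.
move=> /dec_isoP h; apply/dec_isoP; rewrite -(perm_cat2l (dec X)).
by rewrite -(permPl (dec_sum _ _)) -(permPr (dec_sum _ _)).
Qed.

Lemma tsummandP X Y : tsummand X Y <->
  forall Z : ctmod, (count_mem Z (dec X) <= count_mem Z (dec Y))%N.
Proof.
split=> [/tsummand_compl[Z iY] W|h].
  move/dec_isoP/seq.permP: iY => ->; move/seq.permP: (dec_sum X Z) => ->.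
  by rewrite count_cat leq_addr.
have [s ps] : exists s, perm_eq (dec Y) (dec X ++ s).
  elim: (dec X) (dec Y) h => [|Z s IH] s' h; first by exists s'.
  have Zs' : Z \in s'.
    by rewrite -has_pred1 has_count; apply: leq_trans (h Z); rewrite /= eqxx.
  have [|r pr] := IH (rem Z s').
    move=> W; have := h W; move/seq.permP: (perm_to_rem Zs') => -> /=.
    by rewrite leq_add2l.
  exists r; apply: (perm_trans (perm_to_rem Zs')).
  by rewrite /= perm_cons.
apply: (tsummand_trans (tiso_summand (dec_iso X))).
apply: (tsummand_trans (tsummandl _ (tbig s))); apply: tiso_summand.
apply: (tiso_trans (tiso_sym (tbig_cat _ _))).
apply: (tiso_trans (tbig_perm _) (tiso_sym (dec_iso Y))).
by rewrite perm_sym.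
Qed.

End Modules.

(** * Representations as modules *)

Section SplittingSystems.
Variables (k : fieldType) (V : finType).

(** For row vectors, [P v] and [C v] are inclusion and projection of a decomposition of [k^N] into
    spaces of dimensions [d v]. This is the dictionary between families of matrices of dependent
    sizes and single square matrices. *)
Definition splitsys N (d : V -> nat)
    (P : forall v, 'M[k]_(d v, N)) (C : forall v, 'M[k]_(N, d v)) : Prop :=
  [/\ forall v, P v *m C v = 1%:M, forall v w, v != w -> P v *m C w = 0 &
      \sum_v C v *m P v = 1%:M].

Definition stdsz (d : V -> nat) : nat := #|{: {v : V & 'I_(d v)}}|.

Definition stdP (d : V -> nat) v : 'M[k]_(d v, stdsz d) :=
  \matrix_(i, b) (enum_val b == Tagged (fun v => 'I_(d v)) i)%:R.

Lemma stdsys d : @splitsys (stdsz d) d (@stdP d) (fun v => (@stdP d v)^T).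
Proof.
have dot v w i j : (stdP d v *m (stdP d w)^T) i j =
    (Tagged (fun v => 'I_(d v)) i == Tagged (fun v => 'I_(d v)) j)%:R.
  rewrite !mxE (bigD1 (enum_rank (Tagged (fun v => 'I_(d v)) i))) //= !mxE.
  rewrite enum_rankK eqxx mul1r big1 ?addr0 // => b bi; rewrite !mxE.
  case: eqP => [e|]; last by rewrite mul0r.
  by rewrite -e enum_valK eqxx in bi.
split=> [v|v w vw|].
- apply/matrixP=> i j; rewrite dot mxE; congr (_%:R); congr nat_of_bool.
  by rewrite -tag_eqE /tag_eq /= eqxx tagged_asE.
- apply/matrixP=> i j; rewrite dot mxE -tag_eqE /tag_eq /= (negbTE vw) //.
- apply/matrixP=> b c; rewrite summxE mxE.
  have -> : (b == c) = (enum_val b == enum_val c) by rewrite (inj_eq enum_val_inj).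
  case: (enum_val b) (enum_val c) (enum_valK b) (enum_valK c) => v i x bE cE.
  rewrite (bigD1 v) //= big1 ?addr0 => [|w wv].
    rewrite mxE (bigD1 i) //= !mxE big1 ?addr0 => [|j ji].
      by rewrite -bE -cE !enum_rankK eqxx mul1r eq_sym.
    rewrite !mxE -bE enum_rankK -tag_eqE /tag_eq /= eqxx tagged_asE eq_sym.
    by rewrite (negbTE ji) mul0r.
  rewrite mxE big1 // => j _; rewrite !mxE -bE enum_rankK -tag_eqE /tag_eq /=.
  by rewrite eq_sym (negbTE wv) mul0r.
Qed.

Lemma splitsys_sz N d P C : @splitsys N d P C -> N = (\sum_v d v)%N.
Proof.
have h M (D : V -> nat) Q R : @splitsys M D Q R -> (\sum_v D v <= M)%N ->
  (M <= \sum_v D v)%N.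
  move=> [QR _ s] _; rewrite -{1}(mxrank1 k M) -s.
  elim/big_ind2: _ => [|x x' y y' hx hy|v _]; first by rewrite mxrank0.
    by apply: leq_trans (mxrank_add _ _) _; apply: leq_add.
  by apply: leq_trans (mxrankM_maxl _ _) _; apply: rank_leq_col.
move=> sPC; have [PC PC0 s] := sPC.
have sz : stdsz d = (\sum_v d v)%N.
  rewrite /stdsz card_tagged sumnE big_map big_enum.
  by apply: eq_bigr => v _; rewrite card_ord.
have [JJ JJ0 sJ] := stdsys d.
pose f : 'M[k]_(N, stdsz d) := \sum_v C v *m stdP d v.
pose g : 'M[k]_(stdsz d, N) := \sum_v (stdP d v)^T *m P v.
have fg : f *m g = 1%:M.
  rewrite /f /g mulmx_suml -s; apply: eq_bigr => v _; rewrite mulmx_sumr.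
  rewrite (bigD1 v) //= !mulmxA -(mulmxA (C v)) JJ mulmx1 big1 ?addr0 // => w wv.
  by rewrite !mulmxA -(mulmxA (C v)) JJ0 1?eq_sym // mulmx0 mul0mx.
have gf : g *m f = 1%:M.
  rewrite /f /g mulmx_suml -sJ; apply: eq_bigr => v _; rewrite mulmx_sumr.
  rewrite (bigD1 v) //= !mulmxA -(mulmxA (_^T)) PC mulmx1 big1 ?addr0 // => w wv.
  by rewrite !mulmxA -(mulmxA (_^T)) PC0 1?eq_sym // mulmx0 mul0mx.
by rewrite -sz; apply/eqP; rewrite eqn_leq (mulmx1_min fg) (mulmx1_min gf).
Qed.

Lemma sum_splitsys N N' d1 d2 (P : forall v, 'M[k]_(d1 v, N)) C m
    (L : forall v, 'M[k]_(m, d1 v)) (F : forall v, 'M[k]_(d1 v, d2 v))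
    (R : forall v, 'M[k]_(d2 v, N')) :
  @splitsys N d1 P C ->
  (\sum_v L v *m P v) *m (\sum_v C v *m F v *m R v) = \sum_v L v *m F v *m R v.
Proof.
move=> [PC PC0 _]; rewrite mulmx_suml; apply: eq_bigr => v _.
rewrite mulmx_sumr (bigD1 v) //= !mulmxA -(mulmxA (L v)) PC mulmx1.
rewrite big1 ?addr0 // => w wv.
by rewrite !mulmxA -(mulmxA (L v)) PC0 1?eq_sym // mulmx0 !mul0mx.
Qed.

Lemma mul_sumCP N d P C m (F : forall v, 'M[k]_(d v, m)) v : @splitsys N d P C ->
  P v *m (\sum_w C w *m F w) = F v.
Proof.
move=> [PC PC0 _]; rewrite mulmx_sumr (bigD1 v) //= mulmxA PC mul1mx.
rewrite big1 ?addr0 // => w wv.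
by rewrite mulmxA PC0 1?eq_sym // mul0mx.
Qed.

Lemma mul_sumPC N d P C m (F : forall v, 'M[k]_(m, d v)) v : @splitsys N d P C ->
  (\sum_w F w *m P w) *m C v = F v.
Proof.
move=> [PC PC0 _]; rewrite mulmx_suml (bigD1 v) //= -mulmxA PC mulmx1.
rewrite big1 ?addr0 // => w wv.
by rewrite -mulmxA PC0 // mulmx0.
Qed.

End SplittingSystems.

Section QuiverModules.
Variables (V A : finType) (src tgt : A -> V) (k : fieldType).
Local Notation tmod := (tmod k (V + A)%type).
Implicit Types X Y Z : tmod.

Definition qmod X : Prop :=
  [/\ forall v w, X (inl v) *m X (inl w) = (if v == w then X (inl v) else 0),
      \sum_v X (inl v) = 1%:M &
      forall a, X (inl (src a)) *m X (inr a) *m X (inl (tgt a)) = X (inr a)].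

Definition qdim X (v : V) : nat := \rank (X (inl v)).

Lemma qdim_iso X Y : tiso X Y -> qdim X =1 qdim Y.
Proof.
move=> [f [g [hf fg gf]]] v; rewrite /qdim.
have rE (Z W : tmod) (h : 'M_(tsz Z, tsz W)) (l : 'M_(tsz W, tsz Z)) :
    thom h -> h *m l = 1%:M -> (\rank (Z (inl v)) <= \rank (W (inl v)))%N.
  move=> hh hl; rewrite -[Z _]mulmx1 -hl mulmxA hh.
  by apply: leq_trans (mxrankM_maxl _ _) _; apply: mxrankM_maxr.
by apply/eqP; rewrite eqn_leq (rE _ _ _ _ hf fg) (rE _ _ _ _ (thomV hf fg gf) gf).
Qed.

Lemma qdim_sum X Y v : qdim (tsum X Y) v = (qdim X v + qdim Y v)%N.
Proof. exact: rank_diag_block_mx. Qed.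

Lemma qmod_iso X Y : tiso X Y -> qmod X -> qmod Y.
Proof.
move=> [f [g [hf fg gf]]] [h1 h2 h3].
have YE t : Y t = g *m X t *m f by rewrite -mulmxA hf mulmxA gf mul1mx.
have M (M N : 'M_(tsz X)) : g *m M *m f *m (g *m N *m f) = g *m (M *m N) *m f.
  by rewrite !mulmxA -(mulmxA _ f g) fg mulmx1.
split=> [v w||a].
- by rewrite !YE M h1; case: eqP => // _; rewrite mulmx0 mul0mx.
- under eq_bigr do rewrite YE.
  by rewrite -mulmx_suml -mulmx_sumr h2 mulmx1.
- by rewrite !YE !M h3.
Qed.

Lemma qmod_sum X Y : qmod (tsum X Y) <-> qmod X /\ qmod Y.
Proof.
split.
  move=> [h1 h2 h3]; split; split=> [v w||a].
  - move: (h1 v w); rewrite /= mulmx_block !(mulmx0, mul0mx, addr0, add0r).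
    by case: eqP => _; rewrite -?(block_mx0 _ _ _ _ _) => /eq_block_mx[].
  - apply/matrixP=> i j; move/matrixP: h2 => /(_ (lshift _ i) (lshift _ j)).
    rewrite !summxE scalar_mx_block block_mxEul => <-.
    by apply: eq_bigr => v _; rewrite block_mxEul.
  - move: (h3 a); rewrite /= !mulmx_block !(mulmx0, mul0mx, addr0, add0r).
    by case/eq_block_mx.
  - move: (h1 v w); rewrite /= mulmx_block !(mulmx0, mul0mx, addr0, add0r).
    by case: eqP => _; rewrite -?(block_mx0 _ _ _ _ _) => /eq_block_mx[].
  - apply/matrixP=> i j; move/matrixP: h2 => /(_ (rshift _ i) (rshift _ j)).
    rewrite !summxE scalar_mx_block block_mxEdr => <-.
    by apply: eq_bigr => v _; rewrite block_mxEdr.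
  - move: (h3 a); rewrite /= !mulmx_block !(mulmx0, mul0mx, addr0, add0r).
    by case/eq_block_mx.
move=> [[h1 h2 h3] [k1 k2 k3]]; split=> [v w||a] /=.
- rewrite mulmx_block !(mulmx0, mul0mx, addr0, add0r) h1 k1; case: eqP => // _.
  by rewrite block_mx0.
- rewrite scalar_mx_block -h2 -k2.
  elim/big_ind3: _ => [|x y z x' y' z' -> ->|//]; first by rewrite block_mx0.
  by rewrite add_block_mx !addr0.
- by rewrite !mulmx_block !(mulmx0, mul0mx, addr0, add0r) h3 k3.
Qed.

Lemma qmod_summand X Y : tsummand X Y -> qmod Y -> qmod X.
Proof. by case/tsummand_compl=> Z /qmod_iso h /h /qmod_sum[]. Qed.

(** A relation rather than a function: a module carries many splitting systems, and the transport
    lemmas work with any of them. Partners exist in both directions by [linked_ex] and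
    [qmod_linked]. *)
Definition linked (R : rep src tgt k) X : Prop :=
  exists P C, [/\ @splitsys k V (tsz X) (rdim R) P C,
    forall v, X (inl v) = C v *m P v &
    forall a, X (inr a) = C (src a) *m rmap R a *m P (tgt a)].

Lemma linked_dim R X : linked R X -> qdim X =1 rdim R.
Proof.
move=> [P [C [[PC PC0 s] XV XA]]] v; rewrite /qdim XV.
apply/eqP; rewrite eqn_leq.
rewrite (leq_trans (mxrankM_maxl _ _) (rank_leq_col _)) /=.
rewrite -{1}(mxrank1 k (rdim R v)) -[1%:M]mulmx1 -{1}(PC v) -(PC v) -!mulmxA.
rewrite (mulmxA (C v)).
by apply: leq_trans (mxrankM_maxr _ _) _; apply: mxrankM_maxl.
Qed.

Lemma linked_sz R X : linked R X -> tsz X = (\sum_v rdim R v)%N.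
Proof. by move=> [P [C [/splitsys_sz]]]. Qed.

Lemma linked_qmod R X : linked R X -> qmod X.
Proof.
move=> [P [C [[PC PC0 s] XV XA]]]; split=> [v w||a].
- rewrite !XV !mulmxA -(mulmxA (C v)); case: eqP => [<-|/eqP vw].
    by rewrite PC mulmx1.
  by rewrite PC0 // mulmx0 mul0mx.
- by rewrite -s; apply: eq_bigr => v _; rewrite XV.
- rewrite !XV XA !mulmxA -(mulmxA (C _) (P _) (C _)) PC mulmx1.
  by rewrite -!mulmxA; do !congr (_ *m _); rewrite mulmxA PC mul1mx.
Qed.

Lemma linked_ex R : exists X, linked R X.
Proof.
have sys := @stdsys k V (rdim R).
exists (TMod (fun t => match t with
  | inl v => (stdP k (rdim R) v)^T *m stdP k (rdim R) v
  | inr a => (stdP k (rdim R) (src a))^T *m rmap R a *m stdP k (rdim R) (tgt a) end)).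
by exists (@stdP k V (rdim R)), (fun v => (@stdP k V (rdim R) v)^T).
Qed.

Lemma qmod_splitsys X : qmod X -> exists P C,
  @splitsys k V (tsz X) (qdim X) P C /\ forall v, X (inl v) = C v *m P v.
Proof.
move=> [h1 h2 h3].
have h v : exists PC : 'M[k]_(qdim X v, tsz X) * 'M[k]_(tsz X, qdim X v),
    PC.1 *m PC.2 = 1%:M /\ X (inl v) = PC.2 *m PC.1.
  have [] := @idem_split k _ (X (inl v)); first by rewrite h1 eqxx.
  move=> r [P [C [PC CP rE]]]; rewrite -[qdim X v]rE.
  by exists (P, C).
pose PC v := sval (cid (h v)); have hPC v : (PC v).1 *m (PC v).2 = 1%:M /\ X (inl v) = (PC v).2 *m (PC v).1 := svalP (cid (h v)).
exists (fun v => (PC v).1), (fun v => (PC v).2); split; last by move=> v; case: (hPC v).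
split=> [v|v w vw|]; first by case: (hPC v).
  have [e1 e2] := hPC v; have [e3 e4] := hPC w.
  have -> : (PC v).1 = (PC v).1 *m X (inl v) by rewrite e2 mulmxA e1 mul1mx.
  have -> : (PC w).2 = X (inl w) *m (PC w).2 by rewrite e4 -mulmxA e3 mulmx1.
  by rewrite -mulmxA (mulmxA (X (inl v))) h1 (negbTE vw) mul0mx mulmx0.
by rewrite -h2; apply: eq_bigr => v _; case: (hPC v).
Qed.

Lemma qmod_linked X : qmod X -> exists R, linked R X /\ rdim R = qdim X.
Proof.
move=> qX; have [P [C [sys XE]]] := qmod_splitsys qX.
exists (@Rep V A src tgt k (qdim X) (fun a => P (src a) *m X (inr a) *m C (tgt a))).
split=> //; exists P, C; split=> //= a.
have [_ _ h3] := qX; rewrite -{1}h3 !XE !mulmxA.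
by rewrite -!mulmxA.
Qed.

Lemma linked_iso R R' X X' : linked R X -> linked R' X' ->
  (rep_iso R R' <-> tiso X X').
Proof.
move=> [P [C [sys XV XA]]] [P' [C' [sys' XV' XA']]]; split.
  move=> [phi [psi [h1 h2]]].
  exists (\sum_v C v *m phi v *m P' v), (\sum_v C' v *m psi v *m P v); split.
  - move=> [v|a].
      rewrite XV XV' -[LHS]mulmxA.
      have -> : P v *m (\sum_v C v *m phi v *m P' v) = phi v *m P' v.
        by under eq_bigr do rewrite -mulmxA; rewrite (mul_sumCP _ _ sys).
      have -> : (\sum_v C v *m phi v *m P' v) *m (C' v *m P' v) = C v *m phi v *m P' v.
        by rewrite mulmxA (mul_sumPC _ _ sys').
      by rewrite mulmxA.
    rewrite XA XA' -[LHS]mulmxA.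
    have -> : P (tgt a) *m (\sum_v C v *m phi v *m P' v) = phi (tgt a) *m P' (tgt a).
      by under eq_bigr do rewrite -mulmxA; rewrite (mul_sumCP _ _ sys).
    rewrite -[C' _ *m _ *m _]mulmxA [RHS]mulmxA (mul_sumPC _ _ sys').
    by rewrite !mulmxA -(mulmxA (C _)) h2 !mulmxA.
  - rewrite (sum_splitsys _ _ _ sys'); have [_ _ <-] := sys.
    by apply: eq_bigr => v _; rewrite -(mulmxA (C v)) (h1 v).1 mulmx1.
  - rewrite (sum_splitsys _ _ _ sys); have [_ _ <-] := sys'.
    by apply: eq_bigr => v _; rewrite -(mulmxA (C' v)) (h1 v).2 mulmx1.
move=> [f [g [hf fg gf]]]; have hg := thomV hf fg gf.
have [PC PC0 s] := sys; have [PC' PC0' s'] := sys'.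
have Pf v : P v *m f = P v *m f *m (C' v *m P' v).
  rewrite -XV' -mulmxA -hf XV !mulmxA.
  by rewrite PC mul1mx.
have Pg v : P' v *m g = P' v *m g *m (C v *m P v).
  rewrite -XV -mulmxA -hg XV' !mulmxA.
  by rewrite PC' mul1mx.
exists (fun v => P v *m f *m C' v), (fun v => P' v *m g *m C v); split.
  move=> v; split.
    by rewrite !mulmxA -(mulmxA _ (C' v)) -Pf -(mulmxA _ f) fg mulmx1 PC.
  by rewrite !mulmxA -(mulmxA _ (C v)) -Pg -(mulmxA _ g) gf mulmx1 PC'.
move=> a; have := hf (inr a); rewrite XA XA'.
move/(congr1 (fun M => P (src a) *m M *m C' (tgt a))).
rewrite /= !mulmxA PC mul1mx => ->.
rewrite -[P _ *m f *m _ *m _ *m _ *m _]mulmxA PC' mulmx1 //.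
Qed.

Lemma linked_sum R R' X X' : linked R X -> linked R' X' ->
  linked (rep_dsum R R') (tsum X X').
Proof.
move=> [P [C [[PC PC0 s] XV XA]]] [P' [C' [[PC' PC0' s'] XV' XA']]].
exists (fun v => block_mx (P v) 0 0 (P' v)), (fun v => block_mx (C v) 0 0 (C' v)).
split; [split=> [v|v w vw|]|move=> v|move=> a] => /=.
- by rewrite mulmx_block !(mulmx0, mul0mx, addr0, add0r) PC PC' -scalar_mx_block.
- by rewrite mulmx_block !(mulmx0, mul0mx, addr0, add0r) PC0 // PC0' // block_mx0.
- under eq_bigr do rewrite mulmx_block !(mulmx0, mul0mx, addr0, add0r).
  rewrite scalar_mx_block -s -s'.
  elim/big_ind3: _ => [|x y z x' y' z' -> ->|//]; first by rewrite block_mx0.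
  by rewrite add_block_mx !addr0.
- by rewrite mulmx_block !(mulmx0, mul0mx, addr0, add0r) XV XV'.
- by rewrite !mulmx_block !(mulmx0, mul0mx, addr0, add0r) XA XA'.
Qed.

Lemma linked_nonzero R X : linked R X -> (nonzero_rep R <-> (0 < tsz X)%N).
Proof.
move=> /linked_sz ->; rewrite lt0n sum_nat_eq0 negb_forall; split.
  by move=> [i ri]; apply/existsP; exists i; rewrite implyTb -lt0n.
by move/existsP=> [i]; rewrite implyTb -lt0n; exists i.
Qed.

Lemma linked_indec R X : linked R X -> (indecomposable R <-> tindec X).
Proof.
move=> lRX; split.
  move=> [nz ni]; apply/tindecP; split; first by apply/(linked_nonzero lRX).
  move=> [Y [Z [Y0 Z0 iX]]]; apply: ni.
  have /qmod_sum[qY qZ] := qmod_iso iX (linked_qmod lRX).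
  have [S [lS _]] := qmod_linked qY; have [S' [lS' _]] := qmod_linked qZ.
  exists S, S'; split; first exact/(linked_nonzero lS).
  split; first exact/(linked_nonzero lS').
  exact/(linked_iso lRX (linked_sum lS lS')).
move=> /tindecP[X0 Xi]; split; first by apply/(linked_nonzero lRX).
move=> [S [S' [nS [nS' iR]]]]; apply: Xi.
have [Y lY] := linked_ex S; have [Z lZ] := linked_ex S'.
exists Y, Z; split; [exact/(linked_nonzero lY)|exact/(linked_nonzero lZ)|].
exact/(linked_iso lRX (linked_sum lY lZ)).
Qed.

(** All modules of dimension vector [d] up to isomorphism, on one fixed space and with freely chosen
    matrices [x a], which the idempotents cut down to the right block. Counting points, writing
    first-order sentences and choosing generic representations all use this parametrisation. *)
Definition nf (d : V -> nat) (x : A -> 'M[k]_(stdsz d)) : tmod :=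
  let E v := (stdP k d v)^T *m stdP k d v in
  TMod (fun t => match t with
    | inl v => E v | inr a => E (src a) *m x a *m E (tgt a) end).

Lemma nf_linked d x : exists2 R, linked R (@nf d x) & rdim R = d.
Proof.
exists (@Rep V A src tgt k d (fun a => stdP k d (src a) *m x a *m (stdP k d (tgt a))^T)) => //.
exists (@stdP k V d), (fun v => (@stdP k V d v)^T); split=> //=.
  exact: stdsys.
by move=> a; rewrite !mulmxA.
Qed.

Lemma nf_qmod d x : qmod (@nf d x).
Proof. by have [R /linked_qmod] := nf_linked x. Qed.

Lemma qdim_nf d x : qdim (@nf d x) = d.
Proof. by have [R /linked_dim e dR] := nf_linked x; apply: funext=> v; rewrite e dR. Qed.

Lemma qmod_nf X : qmod X -> exists x, tiso X (@nf (qdim X) x).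
Proof.
move=> qX; have [R [lR dR]] := qmod_linked qX.
have [] := @stdsys k V (qdim X); set J := @stdP k V (qdim X) => JJ JJ0 sJ.
have [P [C [sys XE]]] := qmod_splitsys qX; have [PC PC0 s] := sys.
exists (fun a => (J (src a))^T *m (P (src a) *m X (inr a) *m C (tgt a)) *m J (tgt a)).
set Y := nf _.
pose RR := @Rep V A src tgt k (qdim X) (fun a => P (src a) *m X (inr a) *m C (tgt a)).
have lX : linked RR X.
  exists P, C; split=> //= a; have [_ _ h3] := qX.
  by rewrite -{1}h3 !XE !mulmxA.
have lY : linked RR Y.
  exists J, (fun v => (J v)^T); split=> //= a.
  rewrite -/J !mulmxA -(mulmxA _ (J _) (J _)^T) JJ mulmx1 -(mulmxA _^T) JJ mulmx1.
  by [].
apply/(linked_iso lX lY).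
exists (fun v => 1%:M), (fun v => 1%:M); split=> [v|a]; first by rewrite mulmx1.
by rewrite mulmx1 mul1mx.
Qed.

Lemma qmod_sz X : qmod X -> tsz X = (\sum_v qdim X v)%N.
Proof. by case/qmod_linked=> R [/linked_sz -> ->]. Qed.

End QuiverModules.

(** * Counting over finite fields *)

Section TraceDuality.
Variables (L : finFieldType) (N : nat).

Lemma eq_card_ker n (A B : 'M[L]_n) : \rank A = \rank B ->
  #|[set u : 'rV[L]_n | u *m A == 0]| = #|[set u : 'rV[L]_n | u *m B == 0]|.
Proof.
move=> rAB; have kE (M : 'M[L]_n) (u : 'rV[L]_n) :
    (u *m M == 0) = (u *m col_ebase M *m pid_mx (\rank M) == 0 :> 'rV_n).
  apply/eqP/eqP=> h; last by rewrite -[M]mulmx_ebase !mulmxA h mul0mx.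
  by rewrite -[_ *m pid_mx _](mulmxK (row_ebase_unit M)) -!mulmxA (mulmxA (col_ebase M))
             (mulmxA _ (row_ebase M)) mulmx_ebase (mulmxA u) h mul0mx.
pose f (u : 'rV[L]_n) := u *m col_ebase A *m invmx (col_ebase B).
have f_inj : injective f.
  by apply: can_inj (fun u => u *m col_ebase B *m invmx (col_ebase A)) _ => u;
     rewrite /f mulmxKV ?col_ebase_unit // mulmxK ?col_ebase_unit.
rewrite -(card_imset _ f_inj); apply: eq_card => u; rewrite inE.
apply/imsetP/eqP=> [[w]|h].
  rewrite inE kE => /eqP h ->; apply/eqP; rewrite kE /f.
  by rewrite mulmxKV ?col_ebase_unit // -rAB h.
exists (u *m col_ebase B *m invmx (col_ebase A)).
  rewrite inE kE mulmxKV ?col_ebase_unit //; move/eqP: h; rewrite kE rAB //.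
by rewrite /f mulmxKV ?col_ebase_unit // mulmxK ?col_ebase_unit.
Qed.

Lemma mxvec_dot (A B : 'M[L]_N) : mxvec A *m (mxvec B)^T = (\tr (A *m B^T))%:M.
Proof.
apply/matrixP=> i j; rewrite !ord1 !mxE mulr1n.
rewrite (reindex _ (curry_mxvec_bij N N)) /= /mxtrace.
rewrite (eq_bigr (fun i => \sum_j A i j * B i j)) => [|i0 _]; last first.
  by rewrite mxE; apply: eq_bigr => j0 _; rewrite !mxE.
by rewrite pair_big /=; apply: eq_bigr => -[a b] _; rewrite !mxE !mxvecE.
Qed.

(** In the coordinates of [mxvec] the Gram matrix of the trace form is the matrix [S] of
    transposition, so adjointness makes [lin_mx g] conjugate to the transpose of [lin_mx f]. *)
Lemma rank_adjoint (f g : {linear 'M[L]_N -> 'M[L]_N}) :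
  (forall z y, \tr (z *m f y) = \tr (g z *m y)) ->
  \rank (lin_mx f) = \rank (lin_mx g).
Proof.
move=> h; pose S := lin_mx (@trmx L N N).
have SS : S *m S = 1%:M.
  apply/row_matrixP=> i; rewrite !rowE -[delta_mx 0 i]vec_mxK mulmxA mulmx1.
  by rewrite !mul_vec_lin /= trmxK.
have uS : S \in unitmx by case/mulmx1_unit: SS.
have key : S^T *m (lin_mx f)^T = lin_mx g *m S^T.
  apply/eqP; rewrite -subr_eq0; apply/eqP; apply/matrixP=> i j.
  have e : delta_mx 0 i *m (S^T *m (lin_mx f)^T - lin_mx g *m S^T) *m (delta_mx 0 j)^T = 0 :> 'M_1.
    rewrite mulmxBr mulmxBl.
    have -> : delta_mx 0 i = mxvec (vec_mx (delta_mx 0 i)) :> 'rV[L]_(N * N) by rewrite vec_mxK.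
    have -> : delta_mx 0 j = mxvec (vec_mx (delta_mx 0 j)) :> 'rV[L]_(N * N) by rewrite vec_mxK.
    move: (vec_mx _) (vec_mx _) => z y.
    rewrite (mulmxA _ (lin_mx g)) -!trmx_mul -!(mulmxA _ _ (mxvec z)^T) -!trmx_mul.
    by rewrite (mulmxA (mxvec z)) !mul_vec_lin !mxvec_dot /= !trmxK h subrr.
  move/matrixP: e => /(_ 0 0); rewrite trmx_delta -rowE -colE !mxE => ->.
  by [].
have -> : \rank (lin_mx f) = \rank (S^T *m (lin_mx f)^T).
  by rewrite -trmx_mul mxrank_tr mxrankMfree // row_free_unit.
by rewrite key mxrankMfree // row_free_unit unitmx_tr.
Qed.

(* The subspaces are kernels of two operators that are adjoint for the trace form. *)
Lemma card_commutant_sym (g E F : 'M[L]_N) :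
  E *m E = E -> F *m F = F -> g *m E = E *m g -> g *m F = F *m g ->
  #|[set y : 'M[L]_N | (E *m y *m F == y) && (y *m g == g *m y)]| =
  #|[set y : 'M[L]_N | (F *m y *m E == y) && (y *m g == g *m y)]|.
Proof.
move=> EE FF gE gF.
(* On the corner [E y F] the operator [f] is the commutator with [g], off the corner it is the
   identity; hence its kernel is the first set. [h] does the same for the second set with the
   opposite sign, which makes the two adjoint. *)
pose f : {linear 'M[L]_N -> 'M[L]_N} :=
  (mulmx E \o (mulmxr F \o (mulmx g \- mulmxr g))) \+ (idfun \- (mulmx E \o mulmxr F)).
pose h : {linear 'M[L]_N -> 'M[L]_N} :=
  (mulmx F \o (mulmxr E \o (mulmxr g \- mulmx g))) \+ (idfun \- (mulmx F \o mulmxr E)).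
have kE (P Q : 'M[L]_N) s (y : 'M[L]_N) : P *m P = P -> Q *m Q = Q ->
    g *m P = P *m g -> g *m Q = Q *m g ->
    (P *m ((-1) ^+ s *: (g *m y - y *m g) *m Q) + (y - P *m (y *m Q)) == 0) =
    (P *m y *m Q == y) && (y *m g == g *m y).
  move=> PP QQ gP gQ; apply/eqP/andP=> [e|[/eqP e1 /eqP e2]]; last first.
    by rewrite e2 subrr scaler0 mul0mx mulmx0 add0r mulmxA e1 subrr.
  have := congr1 (fun M => P *m M *m Q) e; rewrite mulmxDr mulmxDl mulmx0 mul0mx.
  rewrite mulmxBr mulmxBl !mulmxA PP -!(mulmxA _ Q Q) QQ subrr addr0.
  rewrite -scalemxAr -scalemxAl => /eqP; rewrite scaler_eq0 signr_eq0 /= => /eqP e'.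
  have e1 : P *m y *m Q = y.
    move: e; rewrite -scalemxAl -scalemxAr (mulmxA P (g *m y - y *m g)) e' scaler0 add0r mulmxA => /eqP.
    by rewrite subr_eq0 => /eqP.
  split; first by rewrite e1.
  rewrite eq_sym -subr_eq0; apply/eqP; rewrite -[RHS]e'.
  rewrite mulmxBr mulmxBl; congr (_ - _).
    by rewrite -{1}e1 !mulmxA gP.
  by rewrite -{1}e1 -!mulmxA gQ.
have r : \rank (lin_mx f) = \rank (lin_mx h).
  have hf y : f y = E *m ((g *m y - y *m g) *m F) + (y - E *m (y *m F)) by [].
  have hh y : h y = F *m ((y *m g - g *m y) *m E) + (y - F *m (y *m E)) by [].
  apply: rank_adjoint => z y; rewrite hf hh mulmxDr [X in _ = \tr X]mulmxDl.
  rewrite !mxtraceD; congr (_ + _).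
    rewrite !(mulmxBr, mulmxBl) !(raddfB (@mxtrace L N)) /=; congr (_ - _).
      rewrite !mulmxA mxtrace_mulC !mulmxA -(mulmxA _ g E) gE !mulmxA //.
    by rewrite !mulmxA -(mulmxA _ g F) gF mulmxA [LHS]mxtrace_mulC !mulmxA [LHS]mxtrace_mulC !mulmxA.
  by rewrite !(mulmxBr, mulmxBl) !(raddfB (@mxtrace L N)) /= !mulmxA [\tr (_ *m F)]mxtrace_mulC !mulmxA.
have ck (u : {linear 'M[L]_N -> 'M[L]_N}) :
    #|[set v : 'rV[L]_(N * N) | v *m lin_mx u == 0]| = #|[set y : 'M[L]_N | u y == 0]|.
  rewrite -(card_imset _ (can_inj (@mxvecK L N N))); apply: eq_card => v.
  rewrite inE -{1}[v]vec_mxK mul_vec_lin mxvec_eq0; apply/idP/imsetP => [e|[y]].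
    by exists (vec_mx v); rewrite ?inE ?vec_mxK.
  by rewrite inE => uy ->; rewrite mxvecK.
have := eq_card_ker r; rewrite !ck => e.
rewrite (_ : [set _ | _] = [set y | f y == 0]).
  rewrite e; apply: eq_card => y; rewrite !inE /=.
  rewrite -(kE _ _ 1 _ FF EE gF gE) expr1 scaleN1r opprB //.
apply/setP=> y; rewrite !inE -(kE _ _ 0 _ EE FF gE gF) expr0 scale1r //.
Qed.

End TraceDuality.

Section Counting.
Variables (V A : finType) (L : finFieldType) (d : V -> nat).
Local Notation N := (stdsz d).
Local Notation E v := ((stdP L d v)^T *m stdP L d v : 'M[L]_N).
Local Notation pt := {ffun A -> 'M[L]_N}.

Lemma stdE_idem v : E v *m E v = E v.
Proof.
have [JJ _ _] := stdsys L d.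
by rewrite mulmxA -(mulmxA _^T) JJ mulmx1.
Qed.

Definition repset (src tgt : A -> V) : {set pt} :=
  [set x : pt | [forall a, E (src a) *m x a *m E (tgt a) == x a]].

(** The product of the groups [GL (d v)], inside one matrix algebra. *)
Definition levi : {set 'M[L]_N} :=
  [set g : 'M[L]_N | (g \in unitmx) && [forall v, g *m E v == E v *m g]].

Definition lact (g : 'M[L]_N) (x : pt) : pt := [ffun a => invmx g *m x a *m g].

Lemma levi1 : 1%:M \in levi.
Proof. by rewrite inE unitmx1; apply/forallP=> v; rewrite mul1mx mulmx1. Qed.

Lemma leviM g h : g \in levi -> h \in levi -> g *m h \in levi.
Proof.
rewrite !inE => /andP[ug /forallP gE] /andP[uh /forallP hE].
rewrite unitmx_mul ug uh; apply/forallP=> v.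
by rewrite -mulmxA (eqP (hE v)) mulmxA (eqP (gE v)) mulmxA.
Qed.

Lemma levi_inv g : g \in levi -> invmx g \in levi.
Proof.
rewrite !inE => /andP[ug /forallP gE]; rewrite unitmx_inv ug; apply/forallP=> v.
by rewrite -[X in X == _]mulmx1 -(mulmxV ug) mulmxA -(mulmxA (invmx g))
   -(eqP (gE v)) mulKmx.
Qed.

Lemma lact1 x : lact 1%:M x = x.
Proof. by apply/ffunP=> a; rewrite ffunE invmx1 mul1mx mulmx1. Qed.

Lemma lactM g h x : g \in unitmx -> h \in unitmx ->
  lact (g *m h) x = lact h (lact g x).
Proof.
move=> ug uh; apply/ffunP=> a; rewrite !ffunE !mulmxA; do 3!congr (_ *m _).
rewrite -[LHS]mulmx1 -(mulmxV ug) -[X in _ *m (X *m _)]mulmx1 -(mulmxV uh).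
by rewrite !mulmxA -(mulmxA _ g h) mulVmx ?mul1mx // unitmx_mul ug.
Qed.

Lemma lact_repset src tgt g x : g \in levi -> x \in repset src tgt ->
  lact g x \in repset src tgt.
Proof.
move=> gl; have := levi_inv gl.
move: gl; rewrite !inE => /andP[ug /forallP gE] /andP[_ /forallP iE] /forallP hx.
apply/forallP=> a; rewrite ffunE; apply/eqP.
rewrite !mulmxA -(eqP (iE _)) -!mulmxA (eqP (gE _)) -{2}(eqP (hx a)).
by rewrite !mulmxA.
Qed.

Definition lrel (x y : pt) : bool := [exists g in levi, y == lact g x].

Definition nclass (src tgt : A -> V) : nat :=
  #|equivalence_partition lrel (repset src tgt)|.

Lemma lrel_equiv (D : {set pt}) : {in D & &, equivalence_rel lrel}.
Proof.
have rfl x : lrel x x by apply/existsP; exists 1%:M; rewrite levi1 lact1 eqxx.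
have sym x y : lrel x y -> lrel y x.
  case/existsP=> g /andP[gl /eqP->]; apply/existsP; exists (invmx g).
  rewrite levi_inv //=; move: gl; rewrite inE => /andP[ug _].
  by rewrite -lactM ?unitmx_inv // mulmxV // lact1.
have trans x y z : lrel x y -> lrel y z -> lrel x z.
  case/existsP=> g /andP[gl /eqP->] /existsP[h /andP[hl /eqP->]].
  apply/existsP; exists (g *m h); rewrite leviM //=.
  by move: gl hl; rewrite !inE => /andP[ug _] /andP[uh _]; rewrite lactM.
move=> x y z _ _ _; split=> // xy; apply/idP/idP; last exact: trans.
by apply: trans; apply: sym.
Qed.

(** Burnside's formula by double counting of pairs of a group element and a point it fixes: within a
    class, translates of the stabilisers fill up the whole group. The proof is direct because the
    group is a mere set of matrices. *)
Lemma nclass_burnside src tgt :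
  (nclass src tgt * #|levi| =
   \sum_(g in levi) #|[set x in repset src tgt | lact g x == x]|)%N.
Proof.
have lu g : g \in levi -> g \in unitmx by rewrite inE => /andP[].
pose P := equivalence_partition lrel (repset src tgt).
have partP : partition P (repset src tgt).
  by apply: equivalence_partitionP; apply: lrel_equiv.
transitivity (\sum_(x in repset src tgt) #|[set g in levi | lact g x == x]|); last first.
  under [RHS]eq_bigr do rewrite -sum1_card.
  under [LHS]eq_bigr do rewrite -sum1_card.
  rewrite (exchange_big_dep (mem levi)) /=; last by move=> x g _; rewrite inE => /andP[].
  apply: eq_bigr => g gl; apply: eq_bigl => x; rewrite !inE.
  by rewrite inE in gl; rewrite gl.
rewrite (set_partition_big _ partP) /= /nclass -/P -sum_nat_const.
apply: eq_bigr => B BP.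
have /imsetP[x0 x0R BE] := BP.
have xB y : (y \in B) = (y \in repset src tgt) && lrel x0 y by rewrite BE inE.
rewrite -sum1_card.
rewrite (partition_big (fun g => lact g x0) (mem B)) /=; last first.
  move=> g gl; rewrite xB lact_repset //; apply/existsP; exists g.
  by rewrite gl eqxx.
apply: eq_bigr => y; rewrite xB => /andP[yR /existsP[h /andP[hl /eqP yE]]].
rewrite sum1dep_card.
symmetry; rewrite -(card_in_imset (f := fun g => h *m g)
  (D := mem [set g in levi | lact g y == y])) /=; last first.
  by move=> g g' _ _ /(congr1 (mulmx (invmx h))); rewrite !mulKmx ?lu.
symmetry; apply: eq_card => g; rewrite !inE; apply/andP/imsetP.
  move=> [gl gy]; exists (invmx h *m g); last by rewrite mulKVmx ?lu.
  have gl' : g \in levi by rewrite inE.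
  have := leviM (levi_inv hl) gl'; rewrite !inE => -> /=.
  have e : lact (invmx h) y = x0.
    by rewrite yE -lactM ?unitmx_inv ?lu // mulmxV ?lu // lact1.
  by rewrite lactM ?unitmx_inv ?lu // e.
move=> [g']; rewrite inE => /andP[gl gy] ->; split.
  by have := leviM hl gl; rewrite inE.
by rewrite lactM ?lu // -yE.
Qed.

Lemma card_fix src tgt g : g \in levi ->
  #|[set x in repset src tgt | lact g x == x]| =
  (\prod_a #|[set y : 'M[L]_N |
      (E (src a) *m y *m E (tgt a) == y) && (y *m g == g *m y)]|)%N.
Proof.
move=> gl; have ug : g \in unitmx by move: gl; rewrite inE => /andP[].
pose F a := [set y : 'M[L]_N |
      (E (src a) *m y *m E (tgt a) == y) && (y *m g == g *m y)].
have -> : (\prod_a #|F a|)%N = #|family F|.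
  by rewrite card_family foldrE big_map big_enum.
apply: eq_card => x; rewrite !inE; apply/andP/familyP.
  move=> [/forallP h /eqP /ffunP e] a; rewrite inE h /=.
  by have := e a; rewrite ffunE => e'; rewrite -{2}e' -mulmxA mulKVmx.
move=> h; split; first by apply/forallP=> a; have := h a; rewrite inE => /andP[].
apply/eqP/ffunP=> a; rewrite ffunE.
have := h a; rewrite inE => /andP[_ /eqP e].
by rewrite -mulmxA e mulKmx.
Qed.

(** The fixed points of [g] split into one factor per arrow, the intertwiners between the parts of
    [g] at its two ends; turning the arrow exchanges the ends, and trace duality shows that the
    number of intertwiners stays the same. *)
Lemma nclass_orient (src tgt src' tgt' : A -> V) :
  (forall a, (src' a, tgt' a) = (src a, tgt a) \/ (src' a, tgt' a) = (tgt a, src a)) ->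
  nclass src tgt = nclass src' tgt'.
Proof.
move=> h; have l0 : (0 < #|levi|)%N by apply/card_gt0P; exists 1%:M; apply: levi1.
apply/eqP; rewrite -(eqn_pmul2r l0) !nclass_burnside; apply/eqP.
apply: eq_bigr => g gl; rewrite !card_fix //; apply: eq_bigr => a _.
have gE v : g *m E v = E v *m g.
  by move: gl; rewrite inE => /andP[_ /forallP/(_ v)/eqP].
case: (h a) => -[-> ->] //.
by apply: card_commutant_sym; rewrite ?stdE_idem ?gE.
Qed.

End Counting.

(** * Base change and Galois descent *)

Section BaseChange.
Variables (T : Type) (L K : fieldType) (io : {rmorphism L -> K}).
Implicit Types X Y Z : tmod L T.

Definition tmap X : tmod K T := TMod (fun t => map_mx io (X t)).

Lemma thom_tmap X Y f : thom f -> @thom K T (tmap X) (tmap Y) (map_mx io f).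
Proof. by move=> h t; rewrite /= -!map_mxM h. Qed.

Lemma tmap_iso X Y : tiso X Y -> tiso (tmap X) (tmap Y).
Proof.
move=> [f [g [hf fg gf]]]; exists (map_mx io f), (map_mx io g); split.
- exact: thom_tmap.
- by rewrite -map_mxM fg map_mx1.
- by rewrite -map_mxM gf map_mx1.
Qed.

Lemma tmap_sum X Y : tiso (tmap (tsum X Y)) (tsum (tmap X) (tmap Y)).
Proof.
exists 1%:M, 1%:M; split; rewrite ?mulmx1 // => t.
by rewrite /= mulmx1 mul1mx map_block_mx !raddf0.
Qed.

Lemma tmap_tbig (s : seq (tmod L T)) : tiso (tmap (tbig s)) (tbig (map tmap s)).
Proof.
elim: s => [|X s IH] /=.
  by exists 1%:M, 1%:M; split; rewrite ?mulmx1 // => t; apply/matrixP=> -[].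
exact: tiso_trans (tmap_sum _ _) (tsum_iso (tiso_refl _) IH).
Qed.

Lemma tmap_summand X Y : tsummand X Y -> tsummand (tmap X) (tmap Y).
Proof.
case/tsummand_compl=> Z iY; apply: tsummand_trans (tsummandl _ (tmap Z)) _.
apply: tiso_summand; apply: tiso_sym.
exact: tiso_trans (tmap_iso iY) (tmap_sum _ _).
Qed.

Lemma tindec_tmap X : tindec (tmap X) -> tindec X.
Proof.
move=> /tindecP[X0 Xi]; apply/tindecP; split=> // -[Y [Z [Y0 Z0 i]]].
apply: Xi; exists (tmap Y), (tmap Z); split=> //.
exact: tiso_trans (tmap_iso i) (tmap_sum _ _).
Qed.

End BaseChange.

(** * Descent of homomorphisms and isomorphisms along a field extension *)

Section Descent.
Variables (T : finType) (L K : fieldType) (io : {rmorphism L -> K}).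
Implicit Types X Y Z : tmod L T.

(** Homomorphisms are the kernel of a linear system with coefficients in [L], and forming a kernel
    commutes with field extension. *)
Lemma thom_span X Y (f : 'M[K]_(tsz X, tsz Y)) : @thom K T (tmap io X) (tmap io Y) f ->
  exists n (c : 'I_n -> K) (F : 'I_n -> 'M[L]_(tsz X, tsz Y)),
    (forall i, @thom L T X Y (F i)) /\ f = \sum_i c i *: map_mx io (F i).
Proof.
move=> hf.
pose A t : 'M[L]_(tsz X * tsz Y) := lin_mx (mulmx (X t)) - lin_mx (mulmxr (Y t)).
pose B := \mxrow_(j < #|T|) A (enum_val j).
have AE t (g : 'M[L]_(tsz X, tsz Y)) : mxvec g *m A t = mxvec (X t *m g - g *m Y t).
  by rewrite mulmxBr !mul_vec_lin /= linearB.
have fB : mxvec f *m map_mx io B = 0.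
  have -> : map_mx io B = \mxrow_(j < #|T|) map_mx io (A (enum_val j)).
    by apply/matrixP=> i j; rewrite !mxE.
  rewrite mul_mxrow -(mxrow0 (q_ := fun=> (tsz X * tsz Y)%N)); apply: eq_mxrow => j.
  set t := enum_val j; rewrite /A map_mxB mulmxBr.
  have -> : map_mx io (lin_mx (mulmx (X t))) =
            lin_mx (mulmx (map_mx io (X t))) :> 'M[K]_(tsz X * tsz Y).
    by apply: map_lin_mx => M /=; rewrite map_mxM.
  have -> : map_mx io (lin_mx (mulmxr (Y t))) =
            lin_mx (mulmxr (map_mx io (Y t))) :> 'M[K]_(tsz X * tsz Y).
    by apply: map_lin_mx => M /=; rewrite map_mxM.
  by rewrite !mul_vec_lin /= -linearB /= hf subrr linear0.
have /submxP[D fD] : (mxvec f <= map_mx io (kermx B))%MS.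
  by rewrite map_kermx sub_kermx fB.
exists (tsz X * tsz Y)%N, (fun i => D 0 i), (fun i => vec_mx (row i (kermx B))).
split=> [i t|].
  apply/eqP; rewrite -subr_eq0 -mxvec_eq0 -AE vec_mxK.
  have : row i (kermx B) *m B = 0 by rewrite -row_mul mulmx_ker row0.
  rewrite /B mul_mxrow -(mxrow0 (q_ := fun=> (tsz X * tsz Y)%N)).
  by move/eq_mxrowP=> /(_ (enum_rank t)); rewrite enum_rankK => ->.
rewrite -[f]mxvecK fD mulmx_sum_row linear_sum /=; apply: eq_bigr => i _.
by rewrite linearZ /= map_vec_mx map_row.
Qed.

(** The identity of [X] is a [K]-combination of composites [F i *m G j] defined over [L]. Membership
    in a span does not depend on the field, so it is also an [L]-combination, and locality makes one
    composite invertible over [L]. *)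
Lemma tindec_summand_descent X Y : tindec X ->
  tsummand (tmap io X) (tmap io Y) -> tsummand X Y.
Proof.
move=> iX [f [g [hf hg fg]]].
have [n [c [F [hF fE]]]] := thom_span hf.
have [m [c' [G [hG gE]]]] := thom_span hg.
pose H (ij : 'I_n * 'I_m) := F ij.1 *m G ij.2.
have s1 : 1%:M = \sum_ij (c ij.1 * c' ij.2) *: map_mx io (H ij) :> 'M[K]_(tsz X).
  rewrite -fg fE gE mulmx_suml.
  rewrite (eq_bigr (fun i => \sum_j (c i * c' j) *: map_mx io (H (i, j)))).
    by rewrite pair_big /=; apply: eq_bigr => -[].
  move=> i _; rewrite mulmx_sumr; apply: eq_bigr => j _.
  by rewrite -scalemxAl -scalemxAr scalerA map_mxM.
pose B : 'M[L]_(#|{: 'I_n * 'I_m}|, tsz X * tsz X) :=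
  \matrix_(i, j) (mxvec (H (enum_val i))) 0 j.
have rB i : row i B = mxvec (H (enum_val i)).
  by apply/rowP=> j; rewrite !mxE.
have : (mxvec (1%:M : 'M[L]_(tsz X)) <= B)%MS.
  rewrite -(map_submx io) map_mxvec map_mx1 s1.
  apply/submxP; exists (\row_i (c (enum_val i).1 * c' (enum_val i).2)).
  rewrite mulmx_sum_row linear_sum /= (reindex (fun j : 'I_#|{: 'I_n * 'I_m}| => enum_val j)) /=.
    apply: eq_bigr => i _.
    by rewrite -map_row rB mxE linearZ /= -map_mxvec.
  by exists enum_rank => x _; rewrite ?enum_rankK ?enum_valK.
case/submxP=> e eE.
have s2 : \sum_i e 0 i *: H (enum_val i) = 1%:M.
  apply: (can_inj mxvecK); rewrite eE mulmx_sum_row linear_sum /=.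
  by apply: eq_bigr => i _; rewrite linearZ /= rB.
have hH i : @thom L T X X (e 0 i *: H (enum_val i)).
  by apply: thomZ; apply: thomM.
have [|i _] := tindec_local_sum (P := xpredT) iX (fun i _ => hH i).
  by rewrite s2 unitmx1.
rewrite /H scalemxAl => u; have hF' := thomZ (e 0 i) (hF (enum_val i).1).
set F' := _ *: F _ in u hF'; set G' := G _ in u.
exists F', (G' *m invmx (F' *m G')); split=> //; last by rewrite mulmxA mulmxV.
apply: thomM; first exact: hG.
by apply: (thomV (f := F' *m G')); [apply: thomM hF' (hG _)|rewrite mulmxV|rewrite mulVmx].
Qed.

(** The theorem of Noether and Deuring: an indecomposable summand of [X] is one of [Y] already over
    [L] by the previous lemma, and it is cancelled over [K] by Krull-Schmidt. *)
Lemma tiso_descent X Y : tiso (tmap io X) (tmap io Y) -> tiso X Y.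
Proof.
elim: (tsz X).+1 {-2}X (ltnSn (tsz X)) Y => // n IH {}X; rewrite ltnS => Xn Y iXY.
case: (posnP (tsz X)) => [X0|X0].
  have Y0 : tsz Y = 0%N by rewrite -X0; exact/esym/(tiso_sz iXY).
  case: X Y X0 Y0 {Xn iXY} => [nX x] [nY y] /= e e'; move: x y; rewrite e e' => x y.
  by exists 0, 0; split=> [t||]; apply/matrixP=> -[].
have [[|Z s] [hs iX]] := ks_exists X.
  by move: X0; rewrite (tiso_sz iX).
have [iZ _] := hs _ (mem_head _ _).
have sZX : tsummand Z X by apply: tsummand_trans (tsummandl _ _) (tiso_summand (tiso_sym iX)).
have sZY : tsummand Z Y.
  apply: tindec_summand_descent => //.
  exact: tsummand_trans (tmap_summand io sZX) (tiso_summand iXY).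
have [X' iX'] := tsummand_compl sZX; have [Y' iY'] := tsummand_compl sZY.
apply: (tiso_trans iX'); apply: tiso_trans (tiso_sym iY').
apply: tsum_iso (tiso_refl _) _; apply: IH.
  apply: leq_trans Xn; rewrite (tiso_sz iX') /= -add1n leq_add2r.
  by case: iZ.
apply: (@tsum_cancel _ _ (tmap io Z)).
apply: (tiso_trans (tiso_sym (tmap_sum io _ _))).
apply: (tiso_trans (tmap_iso io (tiso_sym iX'))); apply: (tiso_trans iXY).
exact: tiso_trans (tmap_iso io iY') (tmap_sum io _ _).
Qed.

End Descent.

(** * Frobenius, its finite fixed fields, and the theorem of Speiser *)

Section Frobenius.
Variables (K : countClosedFieldType) (p : nat).
Hypothesis pK : p \in [pchar K].
Hypothesis Kalg : forall x : K, exists2 s, (0 < s)%N & x ^+ (p ^ s) = x.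

Lemma p_gt0 : (0 < p)%N.
Proof. by have /andP[/prime_gt0] := pK. Qed.

Lemma p_gt1 : (1 < p)%N.
Proof. by have /andP[/prime_gt1] := pK. Qed.

(* The vacuous let makes [frob], hence its canonical structure, depend on [pK]. *)
Definition frob (s : nat) (x : K) : K := let _ := pK in x ^+ (p ^ s).

Lemma frob_pnat s : [pchar K].-nat (p ^ s)%N.
Proof. by rewrite pnatX (pnatE _ (pcharf_prime pK)) pK. Qed.

Fact frob_additive s : {morph frob s : x y / x - y}.
Proof.
move=> x y; rewrite /frob exprDn_pchar ?frob_pnat //; congr (_ + _).
have h : frob s (- y) + frob s y = 0.
  rewrite /frob -exprDn_pchar ?frob_pnat // addNr expr0n /=.
  by rewrite -(prednK p_gt0) expn_eq0.
by apply/eqP; rewrite -addr_eq0; apply/eqP.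
Qed.

Fact frob_multiplicative s : monoid_morphism (frob s).
Proof. by split=> [|x y]; rewrite /frob ?expr1n // exprMn. Qed.

HB.instance Definition _ s := GRing.isZmodMorphism.Build K K (frob s) (@frob_additive s).
HB.instance Definition _ s := GRing.isMonoidMorphism.Build K K (frob s) (@frob_multiplicative s).

Lemma frobD s t x : frob (s + t) x = frob s (frob t x).
Proof. by rewrite /frob -exprM -expnD addnC. Qed.

Lemma frob0 x : frob 0 x = x. Proof. by []. Qed.

Lemma frob_fix_mul s t x : frob s x = x -> frob (s * t) x = x.
Proof.
move=> h; elim: t => [|t IH]; first by rewrite muln0 frob0.
by rewrite mulnS frobD IH.
Qed.

Lemma frob_fin (I : finType) (F : I -> K) :
  exists2 s, (0 < s)%N & forall i, frob s (F i) = F i.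
Proof.
have h i : exists s, (0 < s)%N /\ frob s (F i) = F i.
  by have [s s0 e] := Kalg (F i); exists s.
pose s i := sval (cid (h i)).
have hs i : (0 < s i)%N /\ frob (s i) (F i) = F i := svalP (cid (h i)).
exists (\prod_i s i)%N; first by rewrite prodn_gt0 // => i; case: (hs i).
by move=> i; rewrite (bigD1 i) //= frob_fix_mul //; case: (hs i).
Qed.

Section FixedField.
Variable s : nat.
(** The shift to [s.+1] keeps the power of Frobenius positive, so that the fixed field is finite,
    with [p ^ s.+1] elements. *)
Definition frobfix : {pred K} := fun x => frob s.+1 x == x.

Fact frobfix_closed : GRing.divring_closed frobfix.
Proof.
rewrite /frobfix; split=> [|x y|x y] /=; rewrite ?inE -?topredE /= /in_mem /=.
- by rewrite rmorph1.
- by move=> /eqP xs /eqP ys; rewrite rmorphB /= xs ys.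
- by move=> /eqP xs /eqP ys; rewrite fmorph_div /= xs ys.
Qed.
HB.instance Definition _ := GRing.isDivringClosed.Build K frobfix frobfix_closed.

Record fixF := FixF { fixval :> K; fixvalP : fixval \in frobfix }.
HB.instance Definition _ := [isSub for fixval].
HB.instance Definition _ := [Countable of fixF by <:].
HB.instance Definition _ := [SubChoice_isSubIntegralDomain of fixF by <:].
HB.instance Definition _ := [SubIntegralDomain_isSubField of fixF by <:].

Lemma fixroots_ex : exists r : seq K,
  uniq r /\ 'X^(p ^ s.+1) - 'X = \prod_(z <- r) ('X - z%:P).
Proof.
have q1 : (1 < p ^ s.+1)%N by rewrite (ltn_exp2l 0) // p_gt1.
have [r rE] := closed_field_poly_normal ('X^(p ^ s.+1) - 'X : {poly K}).
have lc : lead_coef ('X^(p ^ s.+1) - 'X : {poly K}) = 1.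
  by rewrite lead_coefDl ?lead_coefXn // size_polyN size_polyX size_polyXn.
rewrite lc scale1r in rE; exists r; split=> //.
rewrite -separable_prod_XsubC -rE separable_poly.unlock derivB derivXn derivX.
have e : (p ^ s.+1)%:R = 0 :> K.
  by apply/eqP; rewrite -(dvdn_pcharf pK) dvdn_exp.
rewrite -mulr_natl -polyC_natr e mul0r sub0r.
rewrite [X in coprimep _ X](_ : _ = (-1) *: (1 : {poly K})); last by rewrite scaleN1r.
by rewrite coprimepZr ?coprimep1 // oppr_eq0 oner_eq0.
Qed.

Definition fixroots : seq K := sval (cid fixroots_ex).

Lemma fixroots_uniq : uniq fixroots.
Proof. by rewrite /fixroots; case: cid => r []. Qed.

Lemma fixroots_prod : 'X^(p ^ s.+1) - 'X = \prod_(z <- fixroots) ('X - z%:P).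
Proof. by rewrite /fixroots; case: cid => r []. Qed.

Lemma mem_fixroots x : (x \in fixroots) = (x \in frobfix).
Proof.
by rewrite -root_prod_XsubC -fixroots_prod rootE !hornerE subr_eq0.
Qed.

Lemma size_fixroots : size fixroots = (p ^ s.+1)%N.
Proof.
apply: succn_inj; rewrite -(size_prod_XsubC fixroots id) -fixroots_prod.
have q1 : (1 < p ^ s.+1)%N by rewrite (ltn_exp2l 0) // p_gt1.
by rewrite size_polyDl size_polyXn // size_polyN size_polyX.
Qed.

Definition fixenum : seq fixF := pmap insub fixroots.

Fact fixenumP : Finite.axiom fixenum.
Proof.
apply: Finite.uniq_enumP; first by rewrite pmap_sub_uniq // fixroots_uniq.
by move=> x; rewrite mem_pmap_sub mem_fixroots fixvalP.
Qed.
HB.instance Definition _ := isFinite.Build fixF fixenumP.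

Lemma fix_map m n (M : 'M[K]_(m, n)) : map_mx (frob s.+1) M = M ->
  exists M0 : 'M[fixF]_(m, n), map_mx (\val : fixF -> K) M0 = M.
Proof.
move=> /matrixP h.
have hM i j : M i j \in frobfix by have := h i j; rewrite mxE => e; apply/eqP.
by exists (\matrix_(i, j) FixF (hM i j)); apply/matrixP=> i j; rewrite !mxE.
Qed.

Lemma map_fix m n (M0 : 'M[fixF]_(m, n)) :
  map_mx (frob s.+1) (map_mx (\val : fixF -> K) M0) = map_mx \val M0.
Proof.
apply/matrixP=> i j; rewrite !mxE; apply/eqP.
exact: (fixvalP (M0 i j)).
Qed.

End FixedField.

Section Speiser.
Variables (s : nat) (T : finType).
Local Notation tau := (frob s.+1).

Lemma map_frobM N m n (M : 'M[K]_(m, n)) :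
  map_mx (frob (N * s.+1)) M = iter N (map_mx tau) M.
Proof.
elim: N => [|N IH]; first by apply/matrixP=> i j; rewrite mxE mul0n frob0.
rewrite iterS -IH; apply/matrixP=> i j; rewrite !mxE mulSn.
exact: frobD.
Qed.

(** The values at the powers of Frobenius of the cocycle determined by [g], that is, twisted
    products of conjugates of [g]. *)
Fixpoint frobnorm n (g : 'M[K]_n) (j : nat) : 'M[K]_n :=
  if j is j'.+1 then map_mx tau (frobnorm g j') *m g else 1%:M.

Lemma frobnormD n (g : 'M[K]_n) i j :
  frobnorm g (i + j) = iter j (map_mx tau) (frobnorm g i) *m frobnorm g j.
Proof.
elim: j => [|j IH]; first by rewrite addn0 mulmx1.
by rewrite addnS /= IH map_mxM -mulmxA.
Qed.

Lemma frobnorm_fix n (g : 'M[K]_n) r : iter r (map_mx tau) g = g ->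
  forall i, iter r (map_mx tau) (frobnorm g i) = frobnorm g i.
Proof.
move=> h; have iM (a b : 'M[K]_n) : iter r (map_mx tau) (a *m b) =
   iter r (map_mx tau) a *m iter r (map_mx tau) b.
  by elim: (r) => //= m ->; rewrite map_mxM.
elim=> [|i IH] /=; first by elim: (r) => //= m ->; rewrite map_mx1.
by rewrite iM h -iterSr iterS IH.
Qed.

(** The entries lie in a finite field, so two powers coincide. *)
Lemma unit_finite_order n (g : 'M[K]_n) : g \in unitmx ->
  exists2 o, (0 < o)%N & g ^+ o = 1.
Proof.
move=> ug; have [s' s'0 hs] := frob_fin (fun ij : 'I_n * 'I_n => g ij.1 ij.2).
have [g0 g0E] : exists g0 : 'M[fixF s'.-1]_n, map_mx (\val : fixF _ -> K) g0 = g.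
  apply: fix_map; rewrite prednK //; apply/matrixP=> i j; rewrite mxE.
  exact: (hs (i, j)).
pose f (i : 'I_(#|{: 'M[fixF s'.-1]_n}|).+1) := g0 ^+ i.
have [i [j [ij fij]]] : exists i j, i != j /\ f i = f j.
  apply: contrapT => h; have f_inj : injective f.
    by move=> i j e; apply/eqP; apply: contra_notT h => ij; exists i, j.
  by have := leq_card f f_inj; rewrite card_ord ltnn.
wlog lij : i j ij fij / (i < j)%N.
  move=> wl; move: (ij); rewrite neq_ltn => /orP[|l]; first exact: wl.
  by apply: (wl j i); rewrite // eq_sym.
exists (j - i)%N; first by rewrite subn_gt0.
have e : g ^+ j = g ^+ i.
  have mX m : map_mx (\val : fixF _ -> K) (g0 ^+ m) = g ^+ m.
    by elim: m => [|m IH]; rewrite ?map_mx1 // !exprS map_mxM g0E IH.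
  by rewrite -!mX -[g0 ^+ j]/(f j) -fij.
have ui : g ^+ i \in unitmx.
  by elim: (nat_of_ord i) => [|m IH]; rewrite ?unitmx1 // exprS unitmx_mul ug.
apply: (can_inj (mulKmx ui)); rewrite -[_ *m _]/(_ * _) -exprD subnKC ?(ltnW lij) // e.
by rewrite -[RHS]/(_ * _) mulr1.
Qed.

(** Hilbert's theorem 90 for [GL_n]: [h] is assembled from rows of the averages [v x], all of which
    satisfy the required equation; the point is that enough of these rows are independent. *)
Lemma speiser_basis n (g : 'M[K]_n) : g \in unitmx ->
  exists2 h, h \in unitmx & map_mx tau h *m g = h.
Proof.
move=> ug.
have [r0 r00 fg] : exists2 r0, (0 < r0)%N & iter r0 (map_mx tau) g = g.
  have [r0 r00 hr] := frob_fin (fun ij : 'I_n * 'I_n => g ij.1 ij.2).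
  exists r0 => //; rewrite -map_frobM; apply/matrixP=> i j; rewrite mxE.
  by rewrite frob_fix_mul //; exact: (hr (i, j)).
have un : frobnorm g r0 \in unitmx.
  elim: (r0) => [|m IH] /=; first exact: unitmx1.
  by rewrite unitmx_mul ug map_unitmx IH.
have [o o0 ho] := unit_finite_order un.
(* After [r] steps the cocycle is trivial: the norm over [r0] steps is fixed by that power of
   Frobenius and has finite order [o], and its [o]-th power is the norm over [r0 * o] steps. *)
pose r := (r0 * o)%N.
have nr : frobnorm g r = 1%:M.
  have e m : frobnorm g (r0 * m) = frobnorm g r0 ^+ m.
    elim: m => [|m IH]; first by rewrite muln0 expr0.
    rewrite mulnSr frobnormD exprSr IH; congr (_ *m _).
    by rewrite -IH frobnorm_fix.
  by rewrite /r e.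
have r0' : (0 < r)%N by rewrite muln_gt0 r00.
pose c := nth 0 (fixroots (r * s.+1).-1).
have rs1 : (r * s.+1).-1.+1 = (r * s.+1)%N by rewrite prednK // muln_gt0 r0'.
pose Q := (p ^ (r * s.+1))%N.
have szQ : size (fixroots (r * s.+1).-1) = Q by rewrite size_fixroots rs1.
pose v (x : K) := \sum_(i < r) (iter i tau x) *: frobnorm g i.
have vfix x : frob (r * s.+1) x = x -> map_mx tau (v x) *m g = v x.
  move=> hx; rewrite /v map_mx_sum mulmx_suml.
  have it i y : iter i tau y = frob (i * s.+1) y.
    by elim: i => [|i IH] //=; rewrite IH mulSn frobD.
  have -> : \sum_(i < r) map_mx tau (iter i tau x *: frobnorm g i) *m g =
            \sum_(i < r) iter i.+1 tau x *: frobnorm g i.+1.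
    by apply: eq_bigr => i _; rewrite map_mxZ -scalemxAl.
  rewrite -(big_mkord xpredT (fun i => iter i.+1 tau x *: frobnorm g i.+1)).
  rewrite -(big_mkord xpredT (fun i => iter i tau x *: frobnorm g i)).
  pose F i : 'M[K]_n := iter i tau x *: frobnorm g i.
  have -> : \sum_(0 <= i < r) iter i.+1 tau x *: frobnorm g i.+1 = \sum_(1 <= i < r.+1) F i.
    by rewrite big_add1.
  rewrite -/(F _) -(prednK r0') big_nat_recr //= [RHS]big_ltn //= addrC; congr (_ + _).
  by rewrite prednK // /F nr it hx.
pose ev (i : 'I_#|{: 'I_Q * 'I_n}|) : 'I_Q * 'I_n := enum_val i.
pose S : 'M[K]_(#|{: 'I_Q * 'I_n}|, n) :=
  \matrix_(i, l) (v (c (ev i).1) : 'M_n) (ev i).2 l.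
have cfix a : (a < Q)%N -> frob (r * s.+1) (c a) = c a.
  move=> aQ; have : c a \in frobfix (r * s.+1).-1 by rewrite -mem_fixroots mem_nth ?szQ.
  by move/eqP; rewrite rs1.
have fullS : row_full S.
  have uz : cokermx S = 0.
    have Su : S *m cokermx S = 0 by exact: mulmx_coker.
    set u := cokermx S in Su *.
    have vu a : (a < Q)%N -> v (c a) *m u = 0.
      move=> aQ; apply/matrixP=> j l; move/matrixP: Su.
      move=> /(_ (enum_rank (Ordinal aQ, j)) l) e; rewrite !mxE in e *.
      by apply: etrans e; apply: eq_bigr => m _; rewrite !mxE /ev enum_rankK.
    apply/matrixP=> j l; rewrite [RHS]mxE.
    (* A column killed by all the rows makes this polynomial of degree below [Q] vanish at all [Q]
       elements of a fixed field. Its coefficient at [X], the term [i = 0], is the entry of [u]. *)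
    pose P : {poly K} := \sum_(i < r) (frobnorm g i *m u) j l *: 'X^(p ^ (i * s.+1)).
    have szP : (size P <= Q)%N.
      apply: leq_trans (size_sum _ _ _) _; apply/bigmax_leqP=> i _.
      apply: leq_trans (size_scale_leq _ _) _; rewrite size_polyXn.
      by rewrite ltn_exp2l ?p_gt1 // ltn_pmul2r.
    have P0 : P = 0.
      apply/eqP; apply: contraT => nP.
      have : all (root P) (fixroots (r * s.+1).-1).
        apply/(all_nthP 0) => a; rewrite szQ => aQ; rewrite -/(c a).
        have := vu a aQ => /matrixP/(_ j l); rewrite [RHS]mxE => e.
        rewrite rootE -e /v mulmx_suml summxE horner_sum; apply/eqP.
        apply: eq_bigr => i _; rewrite -scalemxAl !mxE hornerZ hornerXn mulrC; congr (_ * _).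
        by elim: (nat_of_ord i) => //= m IH; rewrite -IH -[LHS]/(frob (m.+1 * s.+1) (c a)) mulSn frobD.
      move/(max_poly_roots nP)/(_ (fixroots_uniq _)); rewrite szQ.
      by rewrite ltnNge szP.
    have := congr1 (fun P : {poly K} => P`_1) P0; rewrite coef0 /P coef_sum => <-.
    rewrite (bigD1 (Ordinal r0')) //= big1 => [|i ni].
      by rewrite addr0 mul0n expn0 coefZ coefXn eqxx mulr1 mul1mx.
    rewrite coefZ coefXn (_ : (1 == p ^ _)%N = (p ^ 0 == p ^ (i * s.+1))%N) // eqn_exp2l ?p_gt1 // eq_sym.
    rewrite muln_eq0 orbF.
    by case: eqP => [i0|_]; [case/eqP: ni; apply: val_inj | rewrite mulr0].
  by rewrite -col_leq_rank -subn_eq0 -mxrank_coker uz mxrank0.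
exists (rowsub (fullrankfun fullS) S); first exact: fullrowsub_unit.
apply/row_matrixP=> i; rewrite row_mul -map_row row_rowsub.
have -> : row (fullrankfun fullS i) S =
   row (ev (fullrankfun fullS i)).2 (v (c (ev (fullrankfun fullS i)).1)).
  by apply/rowP=> l; rewrite !mxE.
by rewrite map_row -row_mul vfix // cfix.
Qed.

(** In the basis given by [h] the structure matrices are fixed by Frobenius, so their entries lie in
    the fixed field. *)
Lemma speiser (X : tmod K T) : tiso (tmap tau X) X ->
  exists X0 : tmod (fixF s) T, tiso X (tmap (\val : fixF s -> K) X0).
Proof.
move=> [g [g' [hg gg' g'g]]].
have [h uh hE] : exists2 h, h \in unitmx & map_mx tau h *m g = h.
  by apply: speiser_basis; case/mulmx1_unit: gg'.
have fixX t : map_mx tau (h *m X t *m invmx h) = h *m X t *m invmx h.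
  rewrite !map_mxM map_invmx; set m := map_mx tau h.
  have um : m \in unitmx by rewrite map_unitmx.
  apply: (can_inj (mulmxK um)); rewrite mulmxKV //.
  have mE : m = h *m g' by rewrite -hE -mulmxA gg' mulmx1.
  have e : m *m map_mx tau (X t) *m g = h *m X t by rewrite -mulmxA hg mulmxA hE.
  have -> : m *m map_mx tau (X t) = h *m X t *m g'.
    by rewrite -e -[RHS]mulmxA gg' mulmx1.
  by rewrite [in RHS]mE -!mulmxA (mulmxA (invmx h)) mulVmx // mul1mx.
have h' t : exists M0 : 'M[fixF s]_(tsz X), map_mx (\val : fixF s -> K) M0 = h *m X t *m invmx h.
  exact: fix_map.
pose x0 t := sval (cid (h' t)).
exists (TMod x0); exists (invmx h), h; split; rewrite ?mulVmx ?mulmxV //.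
by move=> t /=; rewrite (svalP (cid (h' t))) !mulmxA mulVmx // mul1mx.
Qed.

End Speiser.
End Frobenius.

Lemma size_undup_classes (S : finType) (U : eqType) (D : {set S}) (f : S -> U) (R : rel S) :
  {in D & &, equivalence_rel R} -> {in D &, forall x y, (f x == f y) = R x y} ->
  size (undup [seq f x | x <- enum D]) = #|equivalence_partition R D|.
Proof.
move=> eR fR; set P := equivalence_partition R D.
have pP : partition P D by apply: equivalence_partitionP.
pose X := transversal P D; have tX := transversalP pP.
have XD : X \subset D by exact: (transversal_sub tX).
rewrite -(card_transversal tX) cardE -(size_map f); apply: perm_size; apply: uniq_perm.
- exact: undup_uniq.
- rewrite map_inj_in_uniq ?enum_uniq // => x y; rewrite !mem_enum => xX yX fxy.
  have xD := subsetP XD _ xX; have yD := subsetP XD _ yX.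
  apply: (pblock_inj tX) => //; apply/eqP.
  rewrite eq_pblock ?(partition_trivIset pP) // ?(cover_partition pP) //.
  by rewrite pblock_equivalence_partition // -fR // fxy eqxx.
move=> u; rewrite mem_undup; apply/mapP/mapP=> -[x]; rewrite mem_enum => xD ->; last first.
  by exists x; rewrite // mem_enum (subsetP XD).
exists (transversal_repr x X (pblock P x)).
  by rewrite mem_enum; apply: (repr_mem_transversal tX); rewrite pblock_mem // (cover_partition pP).
have BP : pblock P x \in P by rewrite pblock_mem // (cover_partition pP).
have xB := repr_mem_pblock tX x BP.
apply/eqP; rewrite fR //; last first.
  by apply: (subsetP XD); apply: (repr_mem_transversal tX).
by rewrite -(pblock_equivalence_partition eR) //; apply: (subsetP XD); apply: (repr_mem_transversal tX).
Qed.

(** * Indecomposables over the closure of a finite field *)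

Section TmodEq.
Variables (k : fieldType) (T : Type).
Lemma tiso_eq n (x y : T -> 'M[k]_n) : x =1 y -> tiso (TMod x) (TMod y).
Proof. by move=> /funext ->; apply: tiso_refl. Qed.
End TmodEq.

Section QmodMap.
Variables (V A : finType) (src tgt : A -> V) (L K : fieldType) (io : {rmorphism L -> K}).

Lemma qmod_tmap X : qmod src tgt X <-> qmod src tgt (tmap io X).
Proof.
split=> -[h1 h2 h3]; split=> [v w||a] /=.
- by rewrite -map_mxM h1; case: eqP => // _; rewrite raddf0.
- by rewrite -(map_mx1 io) -h2 map_mx_sum.
- by rewrite -!map_mxM h3.
- apply: (map_mx_inj (f := io)); rewrite map_mxM [LHS]h1.
  by case: eqP => // _; rewrite raddf0.
- by apply: (map_mx_inj (f := io)); rewrite map_mx1 -h2 map_mx_sum.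
- by apply: (map_mx_inj (f := io)); rewrite !map_mxM [LHS]h3.
Qed.

Lemma qdim_tmap (X : tmod L (V + A)%type) : qdim (tmap io X) = qdim X.
Proof. by apply: funext => v; rewrite /qdim /= mxrank_map. Qed.

End QmodMap.

Section NfIso.
Variables (V A : finType) (L : finFieldType) (d : V -> nat) (src tgt : A -> V).

Lemma nf_repset (x : {ffun A -> 'M[L]_(stdsz d)}) : x \in repset L d src tgt ->
  forall a, nf src tgt x (inr a) = x a.
Proof. by rewrite inE => /forallP h a; apply/eqP; exact: h. Qed.

Lemma lrel_nf (x y : {ffun A -> 'M[L]_(stdsz d)}) :
  x \in repset L d src tgt -> y \in repset L d src tgt ->
  lrel x y <-> tiso (nf src tgt x) (nf src tgt y).
Proof.
move=> xR yR; split.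
  case/existsP=> g /andP[]; rewrite inE => /andP[ug /forallP gE] /eqP yE.
  exists g, (invmx g); split; rewrite ?mulmxV ?mulVmx //.
  move=> [v|a]; first by rewrite /= (eqP (gE v)).
  by rewrite !nf_repset // yE ffunE !mulmxA mulmxV // mul1mx.
move=> [f [g [hf fg gf]]]; apply/existsP; exists f.
have uf : f \in unitmx by case/mulmx1_unit: fg.
rewrite inE uf /=; apply/andP; split.
  by apply/forallP=> v; rewrite -(hf (inl v)).
apply/eqP/ffunP=> a; rewrite ffunE; have := hf (inr a); rewrite !nf_repset //.
by move=> e; rewrite -mulmxA e mulKmx.
Qed.

Lemma nf_repset_ex (x : A -> 'M[L]_(stdsz d)) : exists2 y : {ffun A -> 'M[L]_(stdsz d)},
  y \in repset L d src tgt & tiso (nf src tgt x) (nf src tgt y).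
Proof.
have h (E F y : 'M[L]_(stdsz d)) : E *m E = E -> F *m F = F ->
    E *m (E *m y *m F) *m F = E *m y *m F.
  by move=> hE hF; rewrite -!mulmxA hF !mulmxA hE.
exists [ffun a => nf src tgt x (inr a)].
  by rewrite inE; apply/forallP=> a; rewrite ffunE /= h ?stdE_idem.
by apply: tiso_eq => -[v|a] //; rewrite ffunE /= h ?stdE_idem.
Qed.

End NfIso.

Section QmodDec.
Variables (V A : finType) (src tgt : A -> V) (k : fieldType).
Local Notation tmod := (tmod k (V + A)).
Local Notation ctmod := (ctmod k (V + A)).
Local Notation qmod := (qmod src tgt).

Lemma qdim_tbig (s : seq tmod) v : qdim (tbig s) v = (\sum_(X <- s) qdim X v)%N.
Proof.
elim: s => [|X s IH]; first by rewrite big_nil /qdim thinmx0 mxrank0.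
by rewrite big_cons -IH; apply: qdim_sum.
Qed.

Lemma dec_qmod X (Y : ctmod) : qmod X -> Y \in dec X -> cindec Y /\ qmod Y.
Proof.
move=> qX YX; have cY := dec_indec YX; split=> //.
apply: qmod_summand qX; apply/tsummandP=> Z.
have /seq.permP -> := dec_tindec cY.1; rewrite cY.2 /= addn0.
by case: eqP => // <-; rewrite -has_count has_pred1.
Qed.

Lemma qdim_dec X v : qdim X v = (\sum_(Y <- dec X) qdim (Y : tmod) v)%N.
Proof. by rewrite (qdim_iso (dec_iso X)) qdim_tbig. Qed.

End QmodDec.

Section Classes.
Variables (K : countClosedFieldType) (p : nat).
Hypothesis pK : p \in [pchar K].
Hypothesis Kalg : forall x : K, exists2 s, (0 < s)%N & x ^+ (p ^ s) = x.
Variables (V A : finType).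
Local Notation T := (V + A)%type.
Local Notation tmod := (tmod K T).
Local Notation ctmod := (ctmod K T).
Local Notation frob := (frob pK).
Local Notation fixF := (fixF pK).
Local Notation emb s := (\val : fixF s -> K).

Lemma tmap_frobD e f (X : tmod) : tiso (tmap (frob (e + f)) X) (tmap (frob e) (tmap (frob f) X)).
Proof.
apply: tiso_eq => t; apply/matrixP=> i j; rewrite !mxE; exact: frobD.
Qed.

Lemma frob_stable (X : tmod) e : (0 < e)%N ->
  exists2 r, (0 < r)%N & tiso (tmap (frob (e * r)) X) X.
Proof.
move=> e0; have [r r0 hr] := frob_fin pK Kalg (fun tij : T * ('I_(tsz X) * 'I_(tsz X)) =>
   X tij.1 tij.2.1 tij.2.2).
exists r => //; apply: (tiso_trans _ (tiso_refl X)); case: X hr => n x hr.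
apply: tiso_eq => t; apply/matrixP=> i j; rewrite mxE mulnC.
by apply: frob_fix_mul; exact: (hr (t, (i, j))).
Qed.

Lemma frob_stable_mul (X : tmod) e r : tiso (tmap (frob e) X) X -> tiso (tmap (frob (e * r)) X) X.
Proof.
move=> h; elim: r => [|r IH].
  rewrite muln0; case: X {h} => n x; apply: tiso_eq => t.
  by apply/matrixP=> i j; rewrite mxE; apply: frob0.
rewrite mulnS; apply: (tiso_trans (tmap_frobD _ _ _)).
by apply: (tiso_trans _ h); apply: tmap_iso.
Qed.

(** A further power of Frobenius brings the twist back to [X] up to isomorphism and would carry a
    splitting of the twist to one of [X]. *)
Lemma tindec_frob e (X : tmod) : tindec X -> tindec (tmap (frob e) X).
Proof.
case: e => [|e] iX.
  apply: tindec_iso iX; case: X => n x; apply: tiso_eq => t.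
  by apply/matrixP=> i j; rewrite mxE; apply/esym/frob0.
have [[|r] // _ ir] := @frob_stable X e.+1 isT.
rewrite mulnSr in ir.
have := tindec_iso (tiso_trans (tiso_sym ir) (tmap_frobD _ _ _)) iX.
exact: tindec_tmap.
Qed.

Variables (src tgt : A -> V).
Local Notation qmod := (qmod src tgt).
Local Notation nf := (nf src tgt).

(** The index [e.-1] compensates the shift in [fixF]: for positive [e] these are the classes of
    dimension [d] defined over the field with [p ^ e] elements. *)
Definition cls (e : nat) (d : V -> nat) : seq ctmod :=
  undup [seq can (tmap (emb e.-1) (nf x)) | x : {ffun A -> 'M[fixF e.-1]_(stdsz d)} <-
     enum (repset (fixF e.-1) d src tgt)].

Lemma cls_uniq e d : uniq (cls e d).
Proof. exact: undup_uniq. Qed.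

(** By Speiser's theorem a module isomorphic to its Frobenius twist is defined over the fixed field.
    In this description sums and summands can be handled without leaving [K]. *)
Lemma mem_cls e d (Y : ctmod) : (0 < e)%N ->
  Y \in cls e d <-> [/\ can Y = Y, qmod Y, qdim Y = d & tiso (tmap (frob e) Y) Y].
Proof.
move=> e0; rewrite /cls mem_undup; split.
  case/mapP=> x _ ->; set X := tmap _ _; have iX := can_iso X.
  have qX : qmod X by apply/(qmod_tmap src tgt (emb e.-1)); apply: nf_qmod.
  split; first exact: canK.
  - exact: qmod_iso iX qX.
  - by apply: funext => v; rewrite -(qdim_iso iX) qdim_tmap qdim_nf.
  - apply: (tiso_trans (tmap_iso _ (tiso_sym iX))); apply: tiso_trans iX.
    apply: tiso_eq => t; rewrite -{1}(prednK e0); exact: map_fix.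
move=> [cY qY dY fY].
have [X0 iX0] : exists X0, tiso Y (tmap (emb e.-1) X0).
  by apply: (speiser Kalg); rewrite prednK.
have qX0 : qmod X0 by apply/(qmod_tmap src tgt (emb e.-1)); apply: qmod_iso iX0 qY.
have dX0 : qdim X0 = d.
  rewrite -(qdim_tmap (emb e.-1)) -dY; apply: funext => v; apply/esym; exact: qdim_iso.
have [x ix] := qmod_nf qX0; move: x ix; rewrite dX0 => x ix.
have [y yR iy] := nf_repset_ex src tgt x.
apply/mapP; exists y; rewrite ?mem_enum // -cY; apply/canP.
apply: (tiso_trans iX0); apply: tmap_iso; exact: tiso_trans iy.
Qed.

(** By descent, modules defined over the finite field that are isomorphic over [K] are isomorphic
    over that field, hence conjugate under [levi]. *)
Lemma size_cls e d : size (cls e d) = nclass (fixF e.-1) d src tgt.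
Proof.
apply: size_undup_classes; first exact: lrel_equiv.
move=> x y xR yR; apply/eqP/idP.
  by move/canP/tiso_descent=> h; apply/(lrel_nf xR yR).
by move/(lrel_nf xR yR)=> h; apply/canP; apply: tmap_iso.
Qed.

(** Indecomposability is meant over [K]: these are the absolutely indecomposable classes over the
    finite field. *)
Definition icls e d : seq ctmod := [seq Y <- cls e d | `[< tindec Y >]].

Lemma mem_icls e d (Y : ctmod) : (0 < e)%N ->
  Y \in icls e d <->
  [/\ cindec Y, qmod Y, qdim Y = d & tiso (tmap (frob e) Y) Y].
Proof.
move=> e0; rewrite mem_filter; split.
  by case/andP=> /asboolP iY /(mem_cls _ _ e0)[].
move=> [[iY cY] qY dY fY]; apply/andP; split; first exact/asboolP.
exact/(mem_cls _ _ e0).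
Qed.



Section Recursion.
Variable e : nat.
Hypothesis e_gt0 : (0 < e)%N.

Definition rho (Y : ctmod) : ctmod := can (tmap (frob e) Y).

Lemma iter_rho s (Y : ctmod) : can Y = Y -> iter s rho Y = can (tmap (frob (e * s)) Y).
Proof.
move=> cY; elim: s => [|s IH] /=.
  rewrite muln0 -{1}cY; apply/canP; apply: tiso_sym; case: (Y : tmod) => n x.
  by apply: tiso_eq => t; apply/matrixP=> i j; rewrite mxE; apply: frob0.
rewrite IH /rho; apply/canP; rewrite mulnS.
apply: tiso_trans (tiso_sym (tmap_frobD _ _ _)).
by apply: tmap_iso; apply: tiso_sym; apply: can_iso.
Qed.

Lemma rho_cindec (Y : ctmod) : cindec Y -> cindec (rho Y).
Proof.
move=> [iY cY]; split; last exact: canK.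
exact: tindec_iso (can_iso _) (tindec_frob e iY).
Qed.

Lemma rho_inj (Y Y' : ctmod) : cindec Y -> cindec Y' -> rho Y = rho Y' -> Y = Y'.
Proof.
by move=> [_ cY] [_ cY'] /canP/tiso_descent h; rewrite -cY -cY'; apply/canP.
Qed.

Lemma iter_rho_cindec (Y : ctmod) s : cindec Y -> cindec (iter s rho Y).
Proof. by move=> h; elim: s => //= s; apply: rho_cindec. Qed.

Lemma dec_frob X : perm_eq (dec (tmap (frob e) X)) (map rho (dec X)).
Proof.
apply: dec_unique => [Y /mapP[Z Zd ->]|].
  by apply: rho_cindec; apply: dec_indec Zd.
apply: (tiso_trans (tmap_iso _ (dec_iso X))).
apply: (tiso_trans (tmap_tbig _ _)).
elim: (dec X) => [|Z s IH] /=; first exact: tiso_refl.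
by apply: tsum_iso => //; apply: can_iso.
Qed.

Lemma frob_fixP X : tiso (tmap (frob e) X) X <-> perm_eq (map rho (dec X)) (dec X).
Proof.
split=> [/dec_isoP h|h].
  by rewrite perm_sym in h; rewrite perm_sym; apply: (perm_trans h); apply: dec_frob.
by apply/dec_isoP; apply: perm_trans h; apply: dec_frob.
Qed.

Definition orbsum (Y : ctmod) s : tmod := tbig (traject rho Y s).

Lemma dec_orbsum (Y : ctmod) s : cindec Y -> perm_eq (dec (orbsum Y s)) (traject rho Y s).
Proof.
move=> cY; apply: dec_unique; last exact: tiso_refl.
by move=> Z /trajectP[t _ ->]; apply: iter_rho_cindec.
Qed.

Lemma orbsum_fix (Y : ctmod) s : cindec Y -> iter s rho Y = Y ->
  tiso (tmap (frob e) (orbsum Y s)) (orbsum Y s).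
Proof.
move=> cY per; apply/frob_fixP; set D := dec _.
have pD : perm_eq D (traject rho Y s) by apply: dec_orbsum.
apply: (perm_trans (perm_map _ pD)); rewrite perm_sym; apply: (perm_trans pD).
case: s per {pD D} => // s per.
have mt n Z : map rho (traject rho Z n) = traject rho (rho Z) n.
  by elim: n Z => //= n IH Z; rewrite IH.
by rewrite mt [X in perm_eq _ X]trajectSr -iterSr per perm_sym perm_rcons.
Qed.

Lemma qdim_rho (Y : ctmod) : qdim (rho Y) = qdim Y.
Proof.
by apply: funext => v; rewrite -(qdim_iso (can_iso _)) qdim_tmap.
Qed.

Lemma qdim_orbsum (Y : ctmod) s v : qdim (orbsum Y s) v = (s * qdim Y v)%N.
Proof.
rewrite /orbsum; elim: s Y => [|s IH] Y /=.
  by rewrite /qdim thinmx0 mxrank0.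
by rewrite (qdim_sum (Y : tmod)) IH qdim_rho mulSn.
Qed.

Lemma qmod_orbsum (Y : ctmod) s : qmod Y -> qmod (orbsum Y s).
Proof.
rewrite /orbsum; elim: s Y => [|s IH] Y qY /=.
  by split=> *; rewrite ?thinmx0 //; apply: thinmx0.
apply/qmod_sum; split => //; apply: IH.
by apply: (qmod_iso (can_iso _)); exact: (qmod_tmap src tgt (frob e) Y).1.
Qed.

Definition orbsub (Y : ctmod) s (X : ctmod) : bool :=
  all (fun Z => count_mem Z (traject rho Y s.+1) <= count_mem Z (dec X))%N (traject rho Y s.+1).

Lemma orbsubP (Y : ctmod) s (X : ctmod) : cindec Y ->
  orbsub Y s X <-> tsummand (orbsum Y s.+1) X.
Proof.
move=> cY; have pD := seq.permP (dec_orbsum s.+1 cY).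
split=> [/allP h|/tsummandP h].
  apply/tsummandP=> Z; rewrite pD; case: (boolP (Z \in traject rho Y s.+1)) => Zt.
    exact: h.
  by rewrite (count_memPn Zt).
by apply/allP=> Z _; rewrite -pD; apply: h.
Qed.

Lemma cls_frob d (X : ctmod) : X \in cls e d -> perm_eq (map rho (dec X)) (dec X).
Proof. by case/(mem_cls _ _ e_gt0) => _ _ _ /frob_fixP. Qed.

(** Splitting off [W] is a bijection from the classes containing it to the classes of complementary
    dimension: Krull-Schmidt cancels [W] from isomorphisms and from the Frobenius invariance of the
    whole. *)
Lemma count_orbsub d (Y : ctmod) s : cindec Y -> qmod Y -> iter s.+1 rho Y = Y ->
  count (orbsub Y s) (cls e d) =
  if [forall v, (s.+1 * qdim Y v <= d v)%N]
  then size (cls e (fun v => d v - s.+1 * qdim Y v)%N) else 0%N.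
Proof.
move=> cY qY per; set W := orbsum Y s.+1.
have dW v : qdim W v = (s.+1 * qdim Y v)%N by apply: qdim_orbsum.
have qW : qmod W by apply: qmod_orbsum.
have fW : tiso (tmap (frob e) W) W by apply: orbsum_fix.
case: ifPn => [/forallP h|]; last first.
  rewrite negb_forall => /existsP[v nv]; apply/eqP; rewrite -leqn0 leqNgt -has_count.
  apply/negP=> /seq.hasP[X /(mem_cls _ _ e_gt0) [_ _ dX _]] /(orbsubP _ _ cY)/tsummand_compl[Z iX].
  move: nv; rewrite -dX (qdim_iso iX) qdim_sum dW; by rewrite leq_addr.
rewrite -size_filter -[RHS](size_map (fun Z : ctmod => can (tsum W Z))).
apply: perm_size; apply: uniq_perm.
- exact/filter_uniq/cls_uniq.
- rewrite map_inj_in_uniq ?cls_uniq // => Z Z' /(mem_cls _ _ e_gt0)[cZ _ _ _].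
  move=> /(mem_cls _ _ e_gt0)[cZ' _ _ _] /canP /tsum_cancel /canP.
  by rewrite cZ cZ'.
move=> X; rewrite mem_filter; apply/andP/mapP; last first.
  case=> Z /(mem_cls _ _ e_gt0)[cZ qZ dZ fZ] ->; have iX := can_iso (tsum W Z).
  split; first by apply/(orbsubP _ _ cY); apply: tsummand_trans (tiso_summand iX); apply: tsummandl.
  apply/(mem_cls _ _ e_gt0); split; first exact: canK.
  - by apply: (qmod_iso iX); apply/qmod_sum.
  - by apply: funext => v; rewrite -(qdim_iso iX) qdim_sum dW dZ subnKC.
  - apply: (tiso_trans _ iX); apply: (tiso_trans (tmap_iso _ (tiso_sym iX))).
    by apply: (tiso_trans (tmap_sum _ _ _)); apply: tsum_iso.
case=> /(orbsubP _ _ cY)/tsummand_compl[Z iX] /(mem_cls _ _ e_gt0)[cX qX dX fX].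
have iZ := can_iso Z; exists (can Z); last first.
  by rewrite -cX; apply/canP; apply: (tiso_trans iX); apply: tsum_iso => //; apply: tiso_refl.
apply/(mem_cls _ _ e_gt0); split; first exact: canK.
- apply: (qmod_iso iZ); have /qmod_sum[] // : qmod (tsum W Z) by apply: qmod_iso iX qX.
- by apply: funext => v; rewrite -(qdim_iso iZ) -dX (qdim_iso iX) qdim_sum dW addKn.
- apply: (tiso_trans _ iZ); apply: (tiso_trans (tmap_iso _ (tiso_sym iZ))).
  apply: (@tsum_cancel _ _ W); apply: (tiso_trans _ iX); apply: tiso_trans fX.
  apply: tiso_trans (tmap_iso _ (tiso_sym iX)).
  apply: tiso_trans (tiso_sym (tmap_sum _ _ _)); apply: tsum_iso; last exact: tiso_refl.
  exact: tiso_sym.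
Qed.





Lemma size_dec (X : tmod) : (size (dec X) <= tsz X)%N.
Proof.
rewrite (tiso_sz (dec_iso X)); elim: (dec X) (@dec_indec _ _ X) => // Y s IH h.
apply: (@leq_add 1); first by have [[]] := h Y (mem_head _ _).
by apply: IH => Z Zs; apply: h; rewrite inE Zs orbT.
Qed.

Lemma sum_count_undup (U : eqType) (D J : seq U) (w : U -> nat) : uniq J ->
  {subset D <= J} -> (\sum_(Y <- D) w Y = \sum_(Y <- J) count_mem Y D * w Y)%N.
Proof.
move=> uJ sD; rewrite [RHS](eq_bigr (fun Y => \sum_(Z <- D | Z == Y) w Z)%N); last first.
  move=> Y _; rewrite -sum1_count big_distrl /=; apply: eq_bigr => Z /eqP ->.
  by rewrite mul1n.
rewrite (exchange_big_dep xpredT) //= big_seq [RHS]big_seq; apply: eq_bigr => Z ZD.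
by rewrite (big_rem Z) ?sD //= eqxx big1_seq ?addn0 // => i /andP[/eqP <-]; rewrite mem_rem_uniqF.
Qed.

(** Both sides add up the [i]-th dimensions of all the classes. Each class is expanded into
    indecomposable summands, [orbit_count] replaces multiplicities by closed segments of Frobenius
    orbits, and [count_orbsub] counts the classes containing a given segment. A segment of length
    [s.+1] starts at an indecomposable fixed by the power [e * s.+1] of Frobenius, whence the factor
    [icls]. *)
Theorem cls_recursion d i :
  (d i * size (cls e d) =
   \sum_(s < \sum_v d v) \sum_(b : {ffun V -> 'I_(\sum_v d v).+1} |
        [forall v, (s.+1 * b v <= d v)%N])
      b i * (size (icls (e * s.+1) (fun v => b v)) * size (cls e (fun v => d v - s.+1 * b v))))%N.
Proof.
set M := (\sum_v d v)%N.
(* A finite list containing all summands that occur, so that the sum over indecomposables is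
   finite. *)
pose J := undup (flatten [seq dec X | X : ctmod <- cls e d]).
have JP (Y : ctmod) : Y \in J -> exists2 X : ctmod, X \in cls e d & Y \in dec X.
  by rewrite mem_undup => /flattenP[_ /mapP[X XD ->] YX]; exists X.
have JI (Y : ctmod) : Y \in J -> cindec Y /\ qmod Y.
  by case/JP=> X /(mem_cls _ _ e_gt0)[_ qX _ _]; apply: dec_qmod.
transitivity (\sum_(X <- cls e d) qdim (X : tmod) i)%N.
  rewrite big_seq (eq_bigr (fun=> d i)); last first.
    by move=> X /(mem_cls _ _ e_gt0)[_ _ -> _].
  by rewrite -big_seq big_const_seq count_predT iter_addn_0 mulnC.
transitivity (\sum_(X <- cls e d) \sum_(Y <- J) \sum_(s < M)
    ((iter s.+1 rho Y == Y) && orbsub Y s X) * qdim (Y : tmod) i)%N.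
  rewrite big_seq [RHS]big_seq; apply: eq_bigr => X XD.
  rewrite qdim_dec (@sum_count_undup _ (dec X) J) ?undup_uniq //; last first.
    by move=> Y YX; rewrite mem_undup; apply/flattenP; exists (dec X) => //; apply: map_f.
  rewrite -/J big_seq [RHS]big_seq; apply: eq_bigr => Y YJ.
  rewrite -big_distrl /=; congr (_ * _)%N.
  have [cY qY] := JI _ YJ.
  have [_ qX dX _] := (mem_cls _ _ e_gt0).1 XD.
  apply: (orbit_count (P := fun Z : ctmod => cindec Z)) => //.
  - exact: rho_cindec.
  - exact: rho_inj.
  - have [r r0 hr] := frob_stable Y e_gt0; exists r; rewrite r0 /=; apply/eqP.
    by rewrite iter_rho ?cY.2 // -[RHS]cY.2; apply/canP.
  - by apply: (leq_trans (size_dec _)); rewrite (qmod_sz qX) dX.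
  - exact: dec_indec.
  - exact: cls_frob XD.
rewrite (eq_bigr _ (fun X _ => exchange_big _ _ _ _ _ _)) /= exchange_big /=.
apply: eq_bigr => s _; rewrite exchange_big /=.
transitivity (\sum_(Y <- J | iter s.+1 rho Y == Y) qdim (Y : tmod) i * count (orbsub Y s) (cls e d))%N.
  rewrite [RHS]big_mkcond; apply: eq_bigr => Y _.
  rewrite -iterS; case: ifP => h /=; last by rewrite big1.
  by rewrite -sum1_count big_distrr [RHS]big_mkcond; apply: eq_bigr => X _ /=; case: ifP => _; rewrite ?mul1n ?muln1.
transitivity (\sum_(Y <- J | iter s.+1 rho Y == Y)
   \sum_(b : {ffun V -> 'I_M.+1} | [forall v, (s.+1 * b v <= d v)%N] && [forall v, qdim (Y : tmod) v == b v :> nat])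
     b i * size (cls e (fun v => d v - s.+1 * b v)))%N.
  rewrite big_seq_cond [RHS]big_seq_cond; apply: eq_bigr => Y /andP[YJ /eqP per].
  have [cY qY] := JI _ YJ; rewrite (count_orbsub _ cY qY per).
  case: ifPn => h; last first.
    rewrite muln0 big1 // => b /andP[/forallP h1 /forallP h2]; case/negP: h.
    by apply/forallP=> v; rewrite (eqP (h2 v)) h1.
  have M1 v : (qdim (Y : tmod) v < M.+1)%N.
    rewrite ltnS; apply: (@leq_trans (d v)).
      by apply: leq_trans (forallP h v); rewrite mulSn leq_addr.
    by rewrite /M (bigD1 v) //= leq_addr.
  pose b : {ffun V -> 'I_M.+1} := [ffun v => Ordinal (M1 v)].
  rewrite (big_pred1 b) => [|c].
    rewrite ffunE /=; congr (_ * size (cls _ _))%N; apply: funext => v; by rewrite ffunE.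
  apply/andP/eqP => [[_ /forallP hc]|->].
    by apply/ffunP=> v; apply/val_inj; rewrite ffunE /= (eqP (hc v)).
  by split; apply/forallP=> v; rewrite ffunE //=; apply: (forallP h).
rewrite (exchange_big_dep (fun b : {ffun V -> 'I_M.+1} => [forall v, (s.+1 * b v <= d v)%N])) /=; last first.
  by move=> Y b _ /andP[].
apply: eq_bigr => b hb; set N := size (cls e (fun v => d v - s.+1 * b v)%N).
(* If no class of the complementary dimension exists, both sides are 0; otherwise every member of
   [icls] does occur as a summand, hence in [J]. *)
case: (posnP N) => [->|N0].
  by rewrite [RHS]mulnA [RHS]muln0; apply: big1_seq => *; rewrite muln0.
rewrite hb /= mulnCA; transitivity ((b i * N) * size (icls (e * s.+1) (fun v => b v)))%N; last by rewrite mulnC.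
have es0 : (0 < e * s.+1)%N by rewrite muln_gt0 e_gt0.
rewrite big_const_seq iter_addn_0 mulnC [RHS]mulnC; congr (_ * _)%N.
rewrite -size_filter; apply: perm_size; apply: uniq_perm.
- exact/filter_uniq/undup_uniq.
- exact/filter_uniq/cls_uniq.
move=> Y; rewrite mem_filter; apply/idP/idP.
  case/andP=> /andP[/eqP per /forallP hY] /JI[cY qY]; apply/(mem_icls _ _ es0); split=> //.
    by apply: funext => v; rewrite (eqP (hY v)).
  apply/canP; rewrite [RHS]cY.2 -[RHS]per -iterS iter_rho //; exact: cY.2.
case/(mem_icls _ _ es0) => cY qY dY fY.
have per : iter s.+1 rho Y = Y.
  by rewrite iter_rho ?cY.2 // -[RHS]cY.2; apply/canP.
rewrite -iterS per eqxx dY /=; apply/andP; split; first exact/forallP.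
have : (0 < count (orbsub Y s) (cls e d))%N by rewrite count_orbsub // dY hb.
rewrite -has_count => /seq.hasP[X XD /allP/(_ Y)] /=; rewrite !inE eqxx => /(_ isT) h.
rewrite mem_undup; apply/flattenP; exists (dec X); first exact: map_f.
by rewrite -has_pred1 has_count; apply: leq_trans h.
Qed.

End Recursion.

Lemma cls_gt0 e d : (0 < size (cls e d))%N.
Proof.
have h : can (tmap (emb e.-1) (nf (d := d) ([ffun=> 0] : {ffun A -> 'M[fixF e.-1]_(stdsz d)}))) \in cls e d.
  rewrite mem_undup; apply: map_f; rewrite mem_enum inE; apply/forallP=> a.
  by rewrite ffunE mulmx0 mul0mx.
by case: (cls e d) h.
Qed.

End Classes.

(** * The recursion determines the number of indecomposables *)

Section RecursionUnique.
Variable V : finType.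
Implicit Types (d : V -> nat) (N I : nat -> (V -> nat) -> nat).

(* [N] counts isomorphism classes and [I] indecomposable ones fixed by the [e]-th
   power of Frobenius: count the pairs of a class and a Frobenius orbit of
   length [s.+1] of summands of dimension [b], weighted by the [i]-th dimension. *)
Definition root_recursion N I : Prop := forall e d i, (0 < e)%N -> (d i * N e d =
   \sum_(s < \sum_v d v) \sum_(b : {ffun V -> 'I_(\sum_v d v).+1} |
        [forall v, (s.+1 * b v <= d v)%N])
      b i * (I (e * s.+1) (fun v => b v) * N e (fun v => d v - s.+1 * b v)))%N.

(** The term [s = 0], [b = d] contains [I e d] with a positive factor; in the other nonzero terms
    the dimension vector given to [I] has smaller total, though [e] may grow, so the induction is on
    the total for all [e] at once. *)
Lemma root_recursion_unique N I I' : root_recursion N I -> root_recursion N I' ->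
  (forall e d, 0 < N e d)%N ->
  forall e d i, (0 < e)%N -> (0 < d i)%N -> I e d = I' e d.
Proof.
move=> recI recI' N0 e d; have [m] := ubnP (\sum_v d v).
elim: m e d => // m IH e d hm i e0 di.
have := recI e d i e0.
rewrite (recI' e d i e0); set M := (\sum_v d v)%N.
have M0 : (0 < M)%N by rewrite /M (bigD1 i) //= addn_gt0 di.
have M1 v : (d v < M.+1)%N by rewrite ltnS /M (bigD1 v) //= leq_addr.
pose b0 : {ffun V -> 'I_M.+1} := [ffun v => Ordinal (M1 v)].
have b0E : (fun v => b0 v : nat) = d by apply: funext => v; rewrite ffunE.
rewrite (bigD1 (Ordinal M0)) //= [in RHS](bigD1 (Ordinal M0)) //=.
have hb0 : [forall v, (1 * b0 v <= d v)%N] by apply/forallP=> v; rewrite mul1n ffunE.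
rewrite (bigD1 b0) //= [in RHS](bigD1 b0) //= muln1 b0E.
have IHt s (b : {ffun V -> 'I_M.+1}) : [forall v, (s.+1 * b v <= d v)%N] ->
   (s, b) != (0%N, b0) ->
   (b i * ((I' (e * s.+1) (fun v => b v)) * (N e (fun v => d v - s.+1 * b v)))
   = b i * ((I (e * s.+1) (fun v => b v)) * (N e (fun v => d v - s.+1 * b v))))%N.
  (* Terms with [b i = 0] vanish because of the weight, so the vertex [i] can be passed on to the
     induction hypothesis for [b]. *)
  move=> /forallP hb ne; case: (posnP (b i)) => [->|bi]; first by rewrite !mul0n.
  congr (_ * (_ * _))%N; apply/esym; apply: (IH _ _ _ i) => //.
    move: hm; rewrite ltnS; apply: leq_trans.
    have le v : (b v <= d v)%N by apply: leq_trans (hb v); rewrite mulSn leq_addr.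
    rewrite ltn_neqAle leq_sum // andbT; apply: contra ne => /eqP eM.
    have {}eM v : b v = d v :> nat.
      apply/eqP; rewrite eqn_leq le /=; rewrite leqNgt; apply/negP=> lt.
      have := leqnn (\sum_v d v)%N; rewrite -{2}eM leqNgt => /negP; apply.
      rewrite (bigD1 v) //= [ltnRHS](bigD1 v) //= -addSn leq_add //.
      by apply: leq_sum.
    have s0 : s = 0%N.
      have := hb i; rewrite -eM -[leqRHS]mul1n leq_pmul2r //.
      by case: (s).
    rewrite s0; apply/eqP; congr pair; apply/ffunP=> v; apply: val_inj.
    by rewrite /= eM ffunE.
  by rewrite muln_gt0 e0.
rewrite (eq_bigr (fun b : {ffun V -> 'I_M.+1} => b i * ((I e (fun v => b v)) *
    (N e (fun v => d v - 1 * b v))))%N); last first.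
  move=> b /andP[hb nb]; have := IHt 0%N b hb; rewrite muln1; apply.
  by rewrite xpair_eqE negb_and nb orbT.
rewrite (eq_bigr (fun s : 'I_M => \sum_(b : {ffun V -> 'I_M.+1} | [forall v, (s.+1 * b v <= d v)%N])
   b i * ((I (e * s.+1) (fun v => b v)) *
    (N e (fun v => d v - s.+1 * b v))))%N); last first.
  move=> s ns; apply: eq_bigr => b hb; rewrite IHt // xpair_eqE negb_and.
  by apply/orP; left.
move/eqP; rewrite !eqn_add2r ffunE /= eqn_pmul2l //.
by rewrite eqn_pmul2r ?N0 // => /eqP.
Qed.

End RecursionUnique.

Lemma uniq_size1 (U : eqType) (l : seq U) : uniq l -> {in l &, forall x y, x = y} ->
  (size l <= 1)%N.
Proof.
case: l => [|x [|y l]] //= /andP[+ _] h.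
by rewrite (h x y) ?inE ?eqxx ?orbT.
Qed.

(** * Orientation independence over the closure of a prime field *)

Section Orientation.
Variables (K : countClosedFieldType) (p : nat).
Hypothesis pK : p \in [pchar K].
Hypothesis Kalg : forall x : K, exists2 s, (0 < s)%N & x ^+ (p ^ s) = x.
Variables (V A : finType).
Local Notation T := (V + A)%type.

Section TwoOrientations.
Variables (src tgt src' tgt' : A -> V).
Hypothesis orient : forall a, (src' a, tgt' a) = (src a, tgt a) \/
                              (src' a, tgt' a) = (tgt a, src a).

Lemma size_icls_orient e d i : (0 < e)%N -> (0 < d i)%N ->
  size (icls pK src tgt e d) = size (icls pK src' tgt' e d).
Proof.
move=> e0 di; have e1 : root_recursion (fun e d => size (cls pK src tgt e d)) (fun e d => size (icls pK src tgt e d)).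
  by move=> e' d' i' e0'; apply: cls_recursion.
have e2 : root_recursion (fun e d => size (cls pK src' tgt' e d)) (fun e d => size (icls pK src' tgt' e d)).
  by move=> e' d' i' e0'; apply: cls_recursion.
have e3 : (fun e d => size (cls pK src tgt e d)) = (fun e d => size (cls pK src' tgt' e d)).
  apply: funext => e'; apply: funext => d'.
  apply: etrans (size_cls pK src tgt e' d') _.
  apply: etrans _ (esym (size_cls pK src' tgt' e' d')).
  exact: (nclass_orient _ _ orient).
rewrite -e3 in e2; apply: (root_recursion_unique e1 e2 _ e0 di) => e' d'; exact: cls_gt0.
Qed.
End TwoOrientations.

Definition Ex (k : fieldType) (s t : A -> V) d :=
  exists X : tmod k T, [/\ qmod s t X, tindec X & qdim X = d].
Definition Un (k : fieldType) (s t : A -> V) d := forall X Y : tmod k T,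
  qmod s t X -> tindec X -> qdim X = d ->
  qmod s t Y -> tindec Y -> qdim Y = d -> tiso X Y.

Lemma can_icls src tgt d (X : tmod K T) e : (0 < e)%N -> qmod src tgt X -> tindec X -> qdim X = d ->
  tiso (tmap (frob pK e) X) X -> (can X : ctmod K T) \in icls pK src tgt e d.
Proof.
move=> e0 qX iX dX fX; have cX := can_iso X; apply/mem_icls => //; split.
- by split; [apply: tindec_iso iX | apply: canK].
- exact: qmod_iso qX.
- by rewrite -dX; apply: funext => v; rewrite (qdim_iso cX).
- by apply: (tiso_trans (tmap_iso _ (tiso_sym cX))); apply: (tiso_trans fX).
Qed.

Lemma tindec_qdim_gt0 (k : fieldType) src tgt (X : tmod k T) : qmod src tgt X -> tindec X ->
  exists i, (0 < qdim X i)%N.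
Proof.
move=> qX [X0 _]; apply/existsP; apply: contraTT X0; rewrite negb_exists => /forallP h.
by rewrite (qmod_sz qX) big1 // => v _; apply/eqP; rewrite -leqn0 leqNgt.
Qed.

Lemma Ex_orient_p src tgt src' tgt' d : (forall a, (src' a, tgt' a) = (src a, tgt a) \/
     (src' a, tgt' a) = (tgt a, src a)) -> Ex K src tgt d -> Ex K src' tgt' d.
Proof.
move=> orient [X [qX iX dX]]; have [r r0 fX] := frob_stable pK Kalg X (isT : (0 < 1)%N).
rewrite mul1n in fX; have [i di] := tindec_qdim_gt0 qX iX.
rewrite dX in di; have := can_icls r0 qX iX dX fX; have e := size_icls_orient orient r0 di.
case: (icls pK src' tgt' r d) e (@mem_icls _ _ pK Kalg _ _ src' tgt' r d ^~ r0) => [|Y s] e h.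
  by move: (size0nil e) => ->.
by have [[iY _] qY dY _] := (h Y).1 (mem_head _ _); exists Y.
Qed.

(** Some power of Frobenius fixes both modules, so one [icls] counts them; its size is that for the
    other orientation, hence at most 1. *)
Lemma Un_orient_p src tgt src' tgt' d : (forall a, (src' a, tgt' a) = (src a, tgt a) \/
     (src' a, tgt' a) = (tgt a, src a)) -> Un K src tgt d -> Un K src' tgt' d.
Proof.
move=> orient un X Y qX iX dX qY iY dY.
have [r r0 fX] := frob_stable pK Kalg X (isT : (0 < 1)%N); rewrite mul1n in fX.
have [r' r0' fY] := frob_stable pK Kalg Y r0.
have rr0 : (0 < r * r')%N by rewrite muln_gt0 r0.
have {}fX : tiso (tmap (frob pK (r * r')) X) X.
  exact: frob_stable_mul.
have [i di] := tindec_qdim_gt0 qX iX; rewrite dX in di.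
have Xi := can_icls rr0 qX iX dX fX; have Yi := can_icls rr0 qY iY dY fY.
have e := size_icls_orient orient rr0 di.
have {e} : (size (icls pK src' tgt' (r * r') d) <= 1)%N.
  rewrite -e; apply: uniq_size1; first exact/filter_uniq/undup_uniq.
  move=> Z Z' /(@mem_icls _ _ pK Kalg _ _ src tgt _ d Z rr0)[[iZ cZ] qZ dZ _].
  move=> /(@mem_icls _ _ pK Kalg _ _ src tgt _ d Z' rr0)[[iZ' cZ'] qZ' dZ' _].
  by rewrite -cZ -cZ'; apply/canP; apply: un.
case: (icls _ _ _ _ _) Xi Yi => [|Z [|//]] //; rewrite !inE => /eqP eX /eqP eY _.
by apply/canP; rewrite eX eY.
Qed.

End Orientation.

(** The iterated [p]-th powers of [x] are roots of one nonzero polynomial over [F_p], so two of them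
    coincide, and Frobenius is injective. *)
Lemma Fp_closure_ex p : prime p -> exists K : countClosedFieldType,
  p \in [pchar K] /\ forall x : K, exists2 s, (0 < s)%N & x ^+ (p ^ s) = x.
Proof.
move=> p_pr; have [K [io ioI]] := countable_algebraic_closure 'F_p; exists K.
have pK : p \in [pchar K] by rewrite (fmorph_pchar io) pchar_Fp.
split=> // x; have [q q_mon qx] := ioI x.
pose fr i : K := x ^+ (p ^ i).
have frS i : fr i.+1 = pFrobenius_aut pK (fr i) by rewrite pFrobenius_autE /fr expnSr exprM.
have rt i : root (map_poly io q) (fr i).
  elim: i => [|i IH]; first by rewrite /fr expn0 expr1.
  rewrite frS; set F := pFrobenius_aut pK.
  have : (map_poly F (map_poly io q)).[F (fr i)] = 0 by rewrite horner_map (rootP IH) rmorph0.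
  rewrite -map_poly_comp (eq_map_poly (g := io)) => [h|c /=]; first exact/rootP.
  rewrite pFrobenius_autE -rmorphXn /=; congr (io _).
  have := @expf_card _ c; by rewrite card_Fp.
have q0 : map_poly io q != 0 by rewrite map_poly_eq0 monic_neq0.
have inj : ~ {in gtn (size (map_poly io q)) &, injective fr}.
  move=> inj; pose s := [seq fr i | i <- iota 0 (size (map_poly io q))].
  have us : uniq s.
    rewrite map_inj_in_uniq ?iota_uniq // => i j; rewrite !mem_iota => hi hj; apply: inj.
    - by move: hi; rewrite add0n.
    - by move: hj; rewrite add0n.
  have al : all (root (map_poly io q)) s by apply/allP=> _ /mapP[i _ ->].
  by have := max_poly_roots q0 al us; rewrite size_map size_iota ltnn.
have [i [j [ij e]]] : exists i j, (i < j)%N /\ fr i = fr j.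
  apply: contrapT => h; apply: inj => i j _ _ e.
  by have [lt|lt|//] := ltngtP i j; case: h; [exists i, j | exists j, i].
exists (j - i)%N; first by rewrite subn_gt0.
elim: i j ij e => [|i IH] j ij e.
  by rewrite subn0 -/(fr _) -e /fr expr1.
case: j ij e => // j ij e; rewrite subSS; apply: IH => //.
have h : pFrobenius_aut pK (fr i) = pFrobenius_aut pK (fr j) by rewrite -!frS.
exact: fmorph_inj h.
Qed.

(** * Quantifier elimination for algebraically closed fields *)

(* The coefficients are integers, so that the same formula makes sense over
   every field. *)
Inductive tm := TV of nat | TZ of int | TA of tm & tm | TM of tm & tm.
Inductive qf := QE0 of tm | QA of qf & qf | QN of qf.

Section Eval.
Variable k : pzRingType.
Fixpoint tev (t : tm) (e : seq k) : k := match t with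
  | TV n => nth 0 e n | TZ z => z%:~R
  | TA a b => tev a e + tev b e | TM a b => tev a e * tev b e end.
Fixpoint qev (g : qf) (e : seq k) : bool := match g with
  | QE0 t => tev t e == 0 | QA a b => qev a e && qev b e | QN a => ~~ qev a e end.
End Eval.

(** The coefficients are terms, so that one list serves all fields and assignments; its length only
    bounds the degree, which varies with the assignment. *)
Definition up (k : nzRingType) (p : seq tm) (e : seq k) : {poly k} := Poly [seq tev c e | c <- p].

Lemma coef_up (k : nzRingType) p (e : seq k) i : (up p e)`_i = tev (nth (TZ 0) p i) e.
Proof.
rewrite coef_Poly; case: (ltnP i (size p)) => h; first by rewrite (nth_map (TZ 0)).
by rewrite !nth_default ?size_map.
Qed.

Lemma size_up (k : nzRingType) p (e : seq k) : (size (up p e) <= size p)%N.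
Proof. by apply: leq_trans (size_Poly _) _; rewrite size_map. Qed.

Lemma up_nil (k : nzRingType) (e : seq k) : up [::] e = 0.
Proof. by []. Qed.

Lemma lead_up (k : nzRingType) p t (e : seq k) : tev t e != 0 ->
  lead_coef (up (rcons p t) e) = tev t e /\ size (up (rcons p t) e) = (size p).+1.
Proof.
move=> h; have sz : size (up (rcons p t) e) = (size p).+1.
  apply/eqP; rewrite eqn_leq -{1}(size_rcons p t) size_up /= ltnNge; apply/negP => le.
  have : (up (rcons p t) e)`_(size p) = 0 by apply/leq_sizeP: le.
  by rewrite coef_up nth_rcons ltnn eqxx => /eqP; rewrite (negPf h).
by rewrite lead_coefE sz coef_up nth_rcons ltnn eqxx.
Qed.

Lemma up_rcons0 (k : nzRingType) p t (e : seq k) : tev t e = 0 -> up (rcons p t) e = up p e.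
Proof.
move=> h; apply/polyP=> i; rewrite !coef_up nth_rcons; case: ltngtP => // hi.
  by rewrite nth_default // ltnW.
by rewrite h hi nth_default.
Qed.

Definition tsumn (F : nat -> tm) n : tm := foldr TA (TZ 0) (mkseq F n).

Lemma tev_tsumn (k : pzRingType) F n (e : seq k) : tev (tsumn F n) e = \sum_(i < n) tev (F i) e.
Proof.
rewrite /tsumn -(big_mkord xpredT (fun i => tev (F i) e)) /mkseq /index_iota subn0.
by elim: (iota 0 n) => [|i s IH] /=; rewrite ?big_nil ?big_cons ?IH.
Qed.

Lemma up_mul_ex p q : exists r, forall (k : closedFieldType) (e : seq k), up r e = up p e * up q e.
Proof.
exists (mkseq (fun i => tsumn (fun j => TM (nth (TZ 0) p j) (nth (TZ 0) q (i - j))) i.+1) (size p + size q)).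
move=> k e; apply/polyP=> i; rewrite coef_up coefM.
case: (ltnP i (size p + size q)) => h.
  by rewrite nth_mkseq // tev_tsumn; apply: eq_bigr => j _ /=; rewrite !coef_up.
rewrite nth_default ?size_mkseq //= big1 // => j _; rewrite !coef_up.
case: (ltnP j (size p)) => hj; last by rewrite [nth _ p _]nth_default // mul0r.
rewrite [nth _ q _]nth_default ?mulr0 // leq_subRL ?(leq_ord j) //.
by apply: leq_trans h; rewrite leq_add2r ltnW.
Qed.

Lemma up_exp_ex p n : exists r, forall (k : closedFieldType) (e : seq k), up r e = up p e ^+ n.
Proof.
elim: n => [|n [r hr]].
  exists [:: TZ 1] => k e; rewrite expr0; apply/polyP=> -[|i]; rewrite coef_up coef1 //=.
  by rewrite nth_default.
by have [r' hr'] := up_mul_ex p r; exists r' => k e; rewrite hr' hr exprS.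
Qed.

(** One step of pseudo-division. The length of [r] is what makes elimination terminate: it is below
    that of [rcons p' t'] whether or not coefficients vanish at the assignment. *)
Lemma up_step_ex p t p' t' : (size p <= size p')%N -> exists2 r, size r = size p' &
  forall (k : closedFieldType) (e : seq k),
  up r e = tev t e *: up (rcons p' t') e - tev t' e *: ('X^(size p' - size p) * up (rcons p t) e).
Proof.
move=> le; set d := (size p' - size p)%N.
exists (mkseq (fun i => TA (TM t (nth (TZ 0) p' i)) (TM (TM (TZ (-1)) t')
          (if (i < d)%N then TZ 0 else nth (TZ 0) (rcons p t) (i - d)))) (size p')).
  by rewrite size_mkseq.
move=> k e; apply/polyP=> i; rewrite coef_up coefB !coefZ coefXnM !coef_up.
case: (ltngtP i (size p')) => hi.
- rewrite nth_mkseq //= [nth _ (rcons p' _) _]nth_rcons hi; case: ifP => //= _.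
    by rewrite !mulr0 oppr0.
  by rewrite mulrN1z mulN1r mulNr.
- rewrite nth_default; last by rewrite size_mkseq ltnW.
  have -> : (i < d)%N = false by apply/negbTE; rewrite -leqNgt (leq_trans (leq_subr _ _)) // ltnW.
  rewrite !nth_default /= ?mulr0 ?oppr0 ?addr0 // ?size_rcons //.
  by rewrite ltn_subRL subnK.
- rewrite nth_default ?size_mkseq ?hi //= nth_rcons ltnn eqxx.
  have -> : (size p' < d)%N = false by apply/negbTE; rewrite -leqNgt leq_subr.
  by rewrite subKn // nth_rcons ltnn eqxx mulrC subrr.
Qed.

Lemma up_rem_ex p t q : exists2 r, (size r <= size p)%N &
  forall (k : closedFieldType) (e : seq k), tev t e != 0 ->
  exists (c : k) h, c != 0 /\ c *: up q e = h * up (rcons p t) e + up r e.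
Proof.
have [n] := ubnP (size q); elim: n q => // n IH q hn.
case: (leqP (size q) (size p)) => h.
  by exists q => // k e _; exists 1, 0; rewrite oner_neq0 scale1r mul0r add0r.
case/lastP: q hn h => [|q u]; first by rewrite ltn0.
rewrite !size_rcons !ltnS => hn h.
have [r sr hr] := up_step_ex t u h; have [|r' sr' hr'] := IH r; first by rewrite sr.
exists r' => // k e t0; have [c [g [c0 hc]]] := hr' k e t0.
exists (c * tev t e), (g + (c * tev u e) *: 'X^(size q - size p)).
rewrite mulf_neq0 //; split=> //.
have -> : up r' e = c *: up r e - g * up (rcons p t) e by rewrite hc addrC addKr.
rewrite hr -!mul_polyC !rmorphM /=; ring.
Qed.

Definition pdef := forall k : closedFieldType, seq k -> Prop.
(** One formula for all algebraically closed fields at once; this uniformity permits the transfer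
    between characteristics. *)
Definition Def (P : pdef) := exists g, forall k e, P k e <-> qev g e.
Definition Pol (F : forall k : closedFieldType, seq k -> k) := exists t, forall k e, F k e = tev t e.

Lemma Def_ext (P Q : pdef) : (forall k e, P k e <-> Q k e) -> Def Q -> Def P.
Proof. by move=> PQ [g hg]; exists g => k e; rewrite PQ. Qed.

Lemma Def_eq0 F : Pol F -> Def (fun k e => F k e = 0).
Proof. by move=> [t ht]; exists (QE0 t) => k e /=; rewrite ht; split=> /eqP. Qed.

Lemma Def_not P : Def P -> Def (fun k e => ~ P k e).
Proof. by move=> [g hg]; exists (QN g) => k e /=; rewrite hg; split=> /negP. Qed.

Lemma Def_and P Q : Def P -> Def Q -> Def (fun k e => P k e /\ Q k e).
Proof.
move=> [g hg] [h hh]; exists (QA g h) => k e /=; rewrite hg hh; split; first by case=> -> ->.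
by case/andP.
Qed.

Lemma Def_or P Q : Def P -> Def Q -> Def (fun k e => P k e \/ Q k e).
Proof.
move=> dP dQ; apply: (Def_ext _ (Def_not (Def_and (Def_not dP) (Def_not dQ)))) => k e.
split=> [[] h [] //|h]; case: (EM (P k e)) => hP; [by left|right].
by apply: contrapT => hQ; apply: h.
Qed.

Lemma Def_imp P Q : Def P -> Def Q -> Def (fun k e => P k e -> Q k e).
Proof.
move=> dP dQ; apply: (Def_ext _ (Def_or (Def_not dP) dQ)) => k e.
split=> [h|[h /h|]] //; case: (EM (P k e)) => hP; [by right; apply: h|by left].
Qed.

Lemma Def_const (p : Prop) : Def (fun _ _ => p).
Proof.
case: (EM p) => h; [exists (QE0 (TZ 0)) | exists (QN (QE0 (TZ 0)))] => k e /=; rewrite eqxx //.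
Qed.

Lemma Def_if C P1 P2 P : Def C -> Def P1 -> Def P2 -> (forall k e, C k e -> (P k e <-> P1 k e)) ->
  (forall k e, ~ C k e -> (P k e <-> P2 k e)) -> Def P.
Proof.
move=> dC d1 d2 h1 h2.
apply: (Def_ext _ (Def_or (Def_and dC d1) (Def_and (Def_not dC) d2))) => k e.
case: (EM (C k e)) => hC; first by rewrite h1 //; split=> [|[[]|[]]] //; left.
by rewrite h2 //; split=> [|[[]|[]]] //; right.
Qed.

Lemma Def_seq (U : Type) (s : seq U) (P : U -> pdef) : (forall u, Def (P u)) ->
  Def (fun k e => foldr (fun u R => P u k e \/ R) False s).
Proof.
move=> dP; elim: s => [|u s IH] /=; first exact: Def_const.
exact: Def_or.
Qed.

Definition sol (k : closedFieldType) (ps : seq (seq tm)) q (e : seq k) : Prop :=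
  exists x, all (fun p => (up p e).[x] == 0) ps && ((up q e).[x] != 0).

Lemma nonzero_nonroot (k : closedFieldType) (q : {poly k}) : q != 0 -> exists x, q.[x] != 0.
Proof.
move=> q0; by have /closed_nonrootP[x] := q0; exists x.
Qed.

Lemma Def_up_neq0 q : Def (fun k e => up q e != 0).
Proof.
apply: (Def_ext (Q := fun k e => ~ (up q e == 0))) => [k e|]; first by split=> /negP.
apply: Def_not; elim/last_ind: q => [|q t IH].
  by apply: (Def_ext _ (Def_const True)) => k e; rewrite up_nil eqxx.
apply: (Def_if (C := fun k e => tev t e = 0) _ IH (Def_const False)).
- by apply: Def_eq0; exists t.
- by move=> k e h; rewrite up_rcons0.
- move=> k e /eqP h; have [lc _] := lead_up q h; split=> // /eqP h'.
  by move: lc h; rewrite h' lead_coef0 => <-; rewrite eqxx.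
Qed.

Lemma Def_sol0 q : Def (fun k e => sol [::] q e).
Proof.
apply: (Def_ext _ (Def_up_neq0 q)) => k e; split=> [[x /= h]|h].
  by apply: contraNneq h => ->; rewrite horner0.
exact: nonzero_nonroot.
Qed.

Lemma dvdp_exp_roots (k : closedFieldType) (p q : {poly k}) : p != 0 ->
  (forall x, root p x -> root q x) -> p %| q ^+ (size p).-1.
Proof.
move=> p0 h; have [r pr] := closed_field_poly_normal p.
have sr : size p = (size r).+1 by rewrite pr size_scale ?lead_coef_eq0 // size_prod_XsubC.
rewrite sr /= {1}pr dvdpZl ?lead_coef_eq0 //.
have {}h : all (root q) r.
  apply/allP=> z zr; apply: h; rewrite pr rootZ ?lead_coef_eq0 //.
  by rewrite root_prod_XsubC.
elim: r h {pr sr} => [|z r IH] /=; first by rewrite big_nil dvd1p.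
by case/andP=> hz /IH hr; rewrite big_cons exprS dvdp_mul // dvdp_XsubCl.
Qed.

(** Over an algebraically closed field all roots of a polynomial of degree [n] are roots of [q] iff
    the polynomial divides [q ^+ n]; with a nonzero leading coefficient this is read off from the
    pseudo-remainder. *)
Lemma Def_sol1 p t q : Def (fun k e => tev t e != 0 /\ sol [:: rcons p t] q e).
Proof.
have [r hr] := up_exp_ex q (size p); have [r' sr' hr'] := up_rem_ex p t r.
apply: (Def_ext (Q := fun k e => tev t e != 0 /\ up r' e != 0)); last first.
  apply: Def_and (Def_up_neq0 r'); apply: (Def_ext (Q := fun k e => ~ tev t e = 0)).
    by move=> k e; split=> /eqP.
  by apply: Def_not; apply: Def_eq0; exists t.
move=> k e; split=> -[t0 h]; split=> //; have [c [g [c0 hc]]] := hr' k e t0; have [lc sz] := lead_up p t0.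
  case: h => x /=; rewrite andbT => /andP[/eqP px qx]; apply: contraNneq qx => r0.
  move: hc; rewrite r0 addr0 hr => /(congr1 (horner^~ x)).
  rewrite hornerZ hornerM px mulr0 horner_exp => /eqP.
  by rewrite mulf_eq0 (negPf c0) expf_eq0 => /andP[].
apply: contrapT => ns; case/negP: h.
have p0 : up (rcons p t) e != 0 by rewrite -size_poly_gt0 sz.
have : up (rcons p t) e %| up r e.
  rewrite hr -[size p]/((size p).+1.-1) -sz; apply: dvdp_exp_roots => // x /rootP px.
  apply: contrapT => /negP qx; apply: ns; exists x; by rewrite /= px eqxx.
rewrite -(dvdpZr _ _ c0) hc dvdpE => h.
have : up (rcons p t) e %| up r' e.
  by rewrite -(dvdp_addr _ (dvdp_mull g (dvdpp _))) dvdpE.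
case: eqP => // /eqP r0 /(dvdp_leq r0); rewrite sz ltnNge.
by rewrite (leq_trans (size_up _ _)).
Qed.

Lemma sol_step p t p' t' r ps q : (size p <= size p')%N ->
  (forall (k : closedFieldType) (e : seq k), up r e = tev t e *: up (rcons p' t') e
     - tev t' e *: ('X^(size p' - size p) * up (rcons p t) e)) ->
  forall (k : closedFieldType) (e : seq k), tev t e != 0 ->
  sol (rcons p t :: rcons p' t' :: ps) q e <-> sol (rcons p t :: r :: ps) q e.
Proof.
move=> le hr k e t0; split=> -[x /= /andP[/and3P[h1 h2 h3] h4]]; exists x; rewrite /= h1 h3 h4 !andbT.
  by rewrite hr hornerD hornerN !hornerZ hornerM (eqP h1) (eqP h2) !mulr0 subr0 eqxx.
move: h2; rewrite hr hornerD hornerN !hornerZ hornerM (eqP h1) !mulr0 subr0 mulf_eq0.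
by rewrite (negPf t0).
Qed.

Lemma sol_swap (k : closedFieldType) p p' ps q (e : seq k) : sol (p :: p' :: ps) q e <-> sol (p' :: p :: ps) q e.
Proof. by split=> -[x h]; exists x; move: h => /=; rewrite andbCA. Qed.

(** Euclid's algorithm on the equations: either the leading coefficient of the shorter of two
    equations vanishes and is dropped, or the other equation is reduced by it. The total length
    decreases in both cases, until one equation remains. *)
Lemma Def_sol ps q : Def (fun k e => sol ps q e).
Proof.
have [n] := ubnP (\sum_(p <- ps) (size p).+1); elim: n ps => // n IH [|p [|p' ps]].
- by move=> _; apply: Def_sol0.
- case/lastP: p => [|p t] hn.
    apply: (Def_ext _ (Def_sol0 q)) => k e; split=> -[x /=]; rewrite ?up_nil ?horner0 ?eqxx => h.
      by exists x.
    by exists x; rewrite /= up_nil horner0 eqxx.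
  have dp : Def (fun k e => sol [:: p] q e).
    by apply: IH; move: hn; rewrite !big_cons size_rcons.
  apply: (Def_if (C := fun k e => tev t e = 0) _ dp (Def_sol1 p t q)).
  + by apply: Def_eq0; exists t.
  + by move=> k e h; rewrite /sol /= up_rcons0.
  + by move=> k e /eqP h; split=> [|[]].
wlog le : p p' / (size p <= size p')%N => [hw|].
  case/orP: (leq_total (size p) (size p')) => le; first exact: hw.
  move=> hn; apply: (Def_ext (fun k e => sol_swap p p' ps q e)); apply: hw => //.
  by move: hn; rewrite !big_cons addnCA.
case/lastP: p le => [|p t] le hn.
  have dp : Def (fun k e => sol (p' :: ps) q e).
    by apply: IH; move: hn; rewrite !big_cons add1n.
  apply: (Def_ext _ dp) => k e; split=> -[x h]; exists x; move: h; rewrite /= up_nil horner0 eqxx //.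
case/lastP: p' le hn => [|p' t']; rewrite !size_rcons // ltnS => le hn.
have [r sr hr] := up_step_ex t t' le.
have d1 : Def (fun k e => sol (p :: rcons p' t' :: ps) q e).
  by apply: IH; move: hn; rewrite !big_cons size_rcons.
have d2 : Def (fun k e => sol (rcons p t :: r :: ps) q e).
  by apply: IH; move: hn; rewrite !big_cons !size_rcons sr addnCA addSn addnCA.
apply: (Def_if (C := fun k e => tev t e = 0) _ d1 d2).
- by apply: Def_eq0; exists t.
- by move=> k e h; rewrite /sol /= up_rcons0.
- by move=> k e /eqP h; apply: sol_step.
Qed.

Lemma tm_up_ex t : exists p, forall (k : closedFieldType) (e : seq k) x, tev t (x :: e) = (up p e).[x].
Proof.
elim: t => [[|n]|z|a [p hp] b [q hq]|a [p hp] b [q hq]].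
- by exists [:: TZ 0; TZ 1] => k e x; rewrite horner_Poly /= mul0r add0r mul1r addr0.
- by exists [:: TV n] => k e x; rewrite horner_Poly /= mul0r add0r.
- by exists [:: TZ z] => k e x; rewrite horner_Poly /= mul0r add0r.
- exists (mkseq (fun i => TA (nth (TZ 0) p i) (nth (TZ 0) q i)) (maxn (size p) (size q))) => k e x.
  rewrite /= hp hq -hornerD; congr (_.[x]); apply/polyP=> i; rewrite coefD !coef_up.
  case: (ltnP i (maxn (size p) (size q))) => h; first by rewrite nth_mkseq.
  by move: h; rewrite geq_max => /andP[h1 h2]; rewrite !nth_default ?size_mkseq ?geq_max ?h1 //= addr0.
- by have [r hr] := up_mul_ex p q; exists r => k e x; rewrite hr hornerM /= hp hq.
Qed.

Definition ors U (P : U -> Prop) (s : seq U) : Prop := foldr (fun u R => P u \/ R) False s.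

Lemma ors_cat U (P : U -> Prop) s s' : ors P (s ++ s') <-> ors P s \/ ors P s'.
Proof.
elim: s => [|u s IH] /=; first by split=> [|[]] //; right.
by rewrite IH; split; [case=> [|[]]; tauto | case=> [[]|]; tauto].
Qed.

(** One clause of a disjunctive normal form; a single inequation suffices, since a product merges
    several. *)
Definition cl (k : closedFieldType) (c : seq (seq tm) * seq tm) (e : seq k) x :=
  all (fun p => (up p e).[x] == 0) c.1 && ((up c.2 e).[x] != 0).

(** A formula and its negation are treated together, so that the induction passes through [QN]. *)
Lemma dnf_ex g : (exists s, forall (k : closedFieldType) (e : seq k) x, qev g (x :: e) <-> ors (fun c => cl c e x) s) /\
  (exists s, forall (k : closedFieldType) (e : seq k) x, ~~ qev g (x :: e) <-> ors (fun c => cl c e x) s).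
Proof.
elim: g => [t|a [[s1 h1] [s1' h1']] b [[s2 h2] [s2' h2']]|a [h h']] /=; last first.
  by split=> //; case: h => s h; exists s => k e x; rewrite negbK.
- split.
    have mul c d : exists c', forall (k : closedFieldType) (e : seq k) x, cl c' e x = cl c e x && cl d e x.
      case: c d => [c1 c2] [d1 d2]; have [r hr] := up_mul_ex c2 d2; exists (c1 ++ d1, r) => k e x.
      by rewrite /cl /= all_cat hr hornerM mulf_eq0 negb_or; case: all; case: all; rewrite /= ?andbF.
    have [s hs] : exists s, forall (k : closedFieldType) (e : seq k) x,
        ors (fun c => cl c e x) s <-> ors (fun c => cl c e x) s1 /\ ors (fun c => cl c e x) s2.
      elim: s1 {h1 h1'} => [|c s1 [s hs]]; first by exists [::] => k e x; split=> [|[]].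
      have [s' hs'] : exists s, forall (k : closedFieldType) (e : seq k) x,
          ors (fun c => cl c e x) s <-> cl c e x /\ ors (fun c => cl c e x) s2.
        elim: s2 {h2 h2' hs} => [|d s2 [s' hs']]; first by exists [::] => k e x; split=> [|[]].
        have [c' hc'] := mul c d; exists (c' :: s') => k e x; rewrite /= hc' hs'.
        by split=> [[/andP[]|]|[? []]]; [tauto|tauto|left; apply/andP|right].
      by exists (s' ++ s) => k e x; rewrite ors_cat hs hs' /=; tauto.
    exists s => k e x; rewrite hs -h1 -h2; split=> [/andP|[]] //; by move=> -> ->.
  exists (s1' ++ s2') => k e x; rewrite ors_cat -h1' -h2' negb_and; split=> /orP //.
have [p hp] := tm_up_ex t; split.
  exists [:: ([:: p], [:: TZ 1])] => k e x; rewrite hp /= /cl /= andbT.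
  rewrite [(up [:: _] e).[x]]horner_Poly /= mul0r add0r oner_eq0 andbT; split=> [|[]] //; by left.
exists [:: ([::], p)] => k e x; rewrite hp /= /cl /=; split=> [|[]] //; by left.
Qed.

Lemma Def_ex P : Def P -> Def (fun k e => exists x, P k (x :: e)).
Proof.
move=> [g hg]; have [[s hs] _] := dnf_ex g.
apply: (Def_ext (Q := fun k e => ors (fun c => sol c.1 c.2 e) s)); last first.
  by apply: Def_seq => -[ps q]; apply: Def_sol.
move=> k e; have -> : ors (fun c => sol c.1 c.2 e) s <-> exists x, ors (fun c => cl c e x) s.
  elim: s {hs} => [|c s IH] /=; first by split=> // -[].
  rewrite IH; split=> [[[x h]|[x h]]|[x [h|h]]].
  - by exists x; left.
  - by exists x; right.
  - by left; exists x.
  - by right; exists x.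
by split=> -[x h]; exists x; [rewrite -hs -hg|rewrite hg hs].
Qed.

Lemma Def_exs n P : Def P -> Def (fun k e => exists2 v, size v = n & P k (v ++ e)).
Proof.
elim: n P => [|n IH] P dP.
  apply: (Def_ext _ dP) => k e; split=> [[v /size0nil ->]|] //; by exists [::].
apply: (Def_ext _ (Def_ex (IH _ dP))) => k e; split=> [[v]|[x [v sv h]]].
  case/lastP: v => // v x; rewrite size_rcons => -[sv]; rewrite cat_rcons => h.
  by exists x, v.
by exists (rcons v x); rewrite ?size_rcons ?sv // cat_rcons.
Qed.

(** Variables indexed by a finite type are listed in the order of [enum]. For a sum type the left
    summand comes first, so quantifying over a family prefixes a block of variables ([CDef_ex]). *)
Definition cenv (S : finType) k (x : S -> k) : seq k := [seq x s | s <- enum S].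
Definition cdef (S : finType) := forall k : closedFieldType, (S -> k) -> Prop.
Definition CDef S (P : cdef S) := exists2 Q, Def Q & forall (k : closedFieldType) (x : S -> k), P k x <-> Q k (cenv x).
Definition CPol (S : finType) (F : forall k : closedFieldType, (S -> k) -> k) :=
  exists2 G, Pol G & forall (k : closedFieldType) (x : S -> k), F k x = G k (cenv x).

Section Closure.
Variable S : finType.
Implicit Types P Q : cdef S.

Lemma CDef_ext P Q : (forall k x, P k x <-> Q k x) -> CDef Q -> CDef P.
Proof. by move=> PQ [R dR hR]; exists R => // k x; rewrite PQ hR. Qed.

Lemma CDef_const (p : Prop) : CDef (fun k (_ : S -> k) => p).
Proof. by exists (fun _ _ => p) => //; apply: Def_const. Qed.

Lemma CDef_and P Q : CDef P -> CDef Q -> CDef (fun k x => P k x /\ Q k x).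
Proof. by move=> [p dp hp] [q dq hq]; eexists; first exact: (Def_and dp dq); move=> k x; rewrite hp hq. Qed.

Lemma CDef_and3 P Q R : CDef P -> CDef Q -> CDef R -> CDef (fun k x => [/\ P k x, Q k x & R k x]).
Proof.
move=> dP dQ dR; apply: (CDef_ext _ (CDef_and (CDef_and dP dQ) dR)) => k x.
by split=> [[]|[[]]].
Qed.

Lemma CDef_or P Q : CDef P -> CDef Q -> CDef (fun k x => P k x \/ Q k x).
Proof. by move=> [p dp hp] [q dq hq]; eexists; first exact: (Def_or dp dq); move=> k x; rewrite hp hq. Qed.

Lemma CDef_imp P Q : CDef P -> CDef Q -> CDef (fun k x => P k x -> Q k x).
Proof. by move=> [p dp hp] [q dq hq]; eexists; first exact: (Def_imp dp dq); move=> k x; rewrite hp hq. Qed.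

Lemma CDef_not P : CDef P -> CDef (fun k x => ~ P k x).
Proof. by move=> [p dp hp]; eexists; first exact: (Def_not dp); move=> k x; rewrite hp. Qed.

Lemma CDef_all (I : finType) (P : I -> cdef S) : (forall i, CDef (P i)) ->
  CDef (fun k x => forall i, P i k x).
Proof.
move=> dP; apply: (CDef_ext (Q := fun k x => foldr (fun i R => P i k x /\ R) True (enum I))).
  move=> k x; have -> : foldr (fun i R => P i k x /\ R) True (enum I) <-> forall i, i \in enum I -> P i k x.
    elim: (enum I) => [|i s IH] /=; first by split.
    rewrite IH; split=> [[h1 h2] j|h].
      by rewrite inE => /predU1P[->|/h2].
    by split=> [|j js]; apply: h; rewrite inE ?eqxx ?js ?orbT.
  by split=> [h i _|h i]; [apply: h|apply: h; rewrite mem_enum].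
elim: (enum I) => [|i s IH] /=; first exact: CDef_const.
exact: CDef_and.
Qed.

Lemma CDef_eq F G : @CPol S F -> CPol G -> CDef (fun k x => F k x = G k x).
Proof.
move=> [f [t ht] hf] [g [u hu] hg].
exists (fun k e => tev (TA t (TM (TZ (-1)) u)) e = 0).
  by apply: Def_eq0; eexists.
move=> k x; rewrite /= hf hg ht hu mulrN1z mulN1r; split=> [->|/eqP]; first by rewrite subrr.
by rewrite subr_eq0 => /eqP.
Qed.

Lemma CPol_var s : CPol (fun k (x : S -> k) => x s).
Proof.
exists (fun k e => nth 0 e (enum_rank s)); first by exists (TV (enum_rank s)).
by move=> k x; rewrite (nth_map s) ?nth_enum_rank // -cardE.
Qed.

Lemma CPol_nat n : CPol (fun k (x : S -> k) => n%:R).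
Proof. by exists (fun k e => n%:R) => //; exists (TZ n). Qed.

Lemma CPol_mul F G : @CPol S F -> CPol G -> CPol (fun k x => F k x * G k x).
Proof.
move=> [f [t ht] hf] [g [u hu] hg]; exists (fun k e => f k e * g k e).
  by exists (TM t u) => k e /=; rewrite ht hu.
by move=> k x; rewrite hf hg.
Qed.

Lemma CPol_sum (I : finType) (F : I -> forall k : closedFieldType, (S -> k) -> k) :
  (forall i, CPol (F i)) -> CPol (fun k x => \sum_i F i k x).
Proof.
move=> h; have h' i : exists t, forall (k : closedFieldType) (x : S -> k), F i k x = tev t (cenv x).
  by have [g [t ht] hg] := h i; exists t => k x; rewrite hg ht.
pose t i := sval (cid (h' i)).
exists (fun k e => \sum_i tev (t i) e).
  exists (foldr TA (TZ 0) [seq t i | i <- enum I]) => k e; rewrite -[LHS]big_enum.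
  by elim: (enum I) => [|i s IH] /=; rewrite ?big_nil ?big_cons ?IH.
by move=> k x; apply: eq_bigr => i _; rewrite (svalP (cid (h' i))).
Qed.

Definition MPol m n (F : forall k : closedFieldType, (S -> k) -> 'M[k]_(m, n)) :=
  forall i j, CPol (fun k x => F k x i j).

Lemma CPol_ext F G : (forall k x, F k x = G k x) -> @CPol S G -> CPol F.
Proof. by move=> FG [g pg hg]; exists g => // k x; rewrite FG hg. Qed.

Lemma MPol_mul m n l F G : @MPol m n F -> @MPol n l G -> MPol (fun k x => F k x *m G k x).
Proof.
move=> hF hG i j; apply: (CPol_ext (fun k x => mxE _ _ _ _)); apply: CPol_sum => h.
exact: CPol_mul.
Qed.

Lemma MPol_const m n (M : forall k : closedFieldType, 'M[k]_(m, n)) :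
  (forall i j, exists c : nat, forall k, M k i j = c%:R) -> MPol (fun k _ => M k).
Proof.
move=> h i j; have [c hc] := h i j; apply: (CPol_ext (G := fun k _ => c%:R)) => //.
exact: CPol_nat.
Qed.

Lemma CDef_mx_eq m n F G : @MPol m n F -> MPol G -> CDef (fun k x => F k x = G k x).
Proof.
move=> hF hG; apply: (CDef_ext (Q := fun k x => forall i j, F k x i j = G k x i j)).
  by move=> k x; split=> [->|h] //; apply/matrixP.
apply: CDef_all => i; apply: CDef_all => j; exact: CDef_eq.
Qed.

Lemma CDef_ex (S' : finType) (P : forall k : closedFieldType, (S -> k) -> (S' -> k) -> Prop) :
  CDef (S := (S' + S)%type) (fun k z => P k (fun s => z (inr s)) (fun s => z (inl s))) ->
  CDef (fun k x => exists y, P k x y).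
Proof.
move=> [Q dQ hQ]; eexists; first exact: (Def_exs #|S'| dQ).
move=> k x /=.
have ce (y : S' -> k) : cenv (fun z => match z with inl s => y s | inr s => x s end : k) = cenv y ++ cenv x.
  by rewrite /cenv !enumT [in LHS]unlock map_cat -!map_comp.
split=> [[y h]|[v sv h]].
  exists (cenv y); first by rewrite size_map -cardE.
  rewrite -ce -hQ; exact: h.
exists (fun s => nth 0 v (enum_rank s)).
move: h; have -> : v = cenv (fun s : S' => nth 0 v (enum_rank s)).
  apply: (@eq_from_nth _ 0); first by rewrite size_map -cardE.
  move=> i; rewrite sv => hi.
  have [s si] : exists s : S', enum_rank s = i :> nat by exists (enum_val (Ordinal hi)); rewrite enum_valK.
  by rewrite -si (nth_map s) ?nth_enum_rank // -cardE.
rewrite -ce -hQ.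
set w := fun s : S' => _; have -> // : (fun s => nth 0 (cenv w) (enum_rank s)) = w.
by apply: funext => s; rewrite /cenv (nth_map s) ?nth_enum_rank // -cardE.
Qed.

End Closure.

Section Quantifiers.
Variable S : finType.

Lemma CDef_forall (S' : finType) (P : forall k : closedFieldType, (S -> k) -> (S' -> k) -> Prop) :
  CDef (S := (S' + S)%type) (fun k z => P k (fun s => z (inr s)) (fun s => z (inl s))) ->
  CDef (fun k x => forall y, P k x y).
Proof.
move=> h; apply: (CDef_ext (Q := fun k x => ~ exists y, ~ P k x y)).
  move=> k x; split=> [h1 [y]|h1 y]; first by apply; apply: h1.
  by apply: contrapT => h2; apply: h1; exists y.
apply: (CDef_not (P := fun k x => exists y, ~ P k x y)).
apply: (CDef_ex (P := fun k x y => ~ P k x y)); exact: (CDef_not h).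
Qed.

Lemma CDef_forall_mx m n (P : forall k : closedFieldType, (S -> k) -> 'M[k]_(m, n) -> Prop) :
  CDef (S := ('I_m * 'I_n + S)%type)
    (fun k z => P k (fun s => z (inr s)) (\matrix_(i, j) z (inl (i, j)))) ->
  CDef (fun k x => forall M, P k x M).
Proof.
move=> h; apply: (CDef_ext (Q := fun k x => forall y : 'I_m * 'I_n -> k, P k x (\matrix_(i, j) y (i, j)))).
  move=> k x; split=> h1 // M; have := h1 (fun ij => M ij.1 ij.2).
  by congr (P _ _ _); apply/matrixP=> i j; rewrite mxE.
exact: (CDef_forall (P := fun k x (y : 'I_m * 'I_n -> k) => P k x (\matrix_(i, j) y (i, j)))).
Qed.

Lemma CDef_ex_mx m n (P : forall k : closedFieldType, (S -> k) -> 'M[k]_(m, n) -> Prop) :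
  CDef (S := ('I_m * 'I_n + S)%type)
    (fun k z => P k (fun s => z (inr s)) (\matrix_(i, j) z (inl (i, j)))) ->
  CDef (fun k x => exists M, P k x M).
Proof.
move=> h; apply: (CDef_ext (Q := fun k x => ~ forall M, ~ P k x M)).
  move=> k x; split=> [[M h1] h2|h1]; first exact: (h2 M).
  by apply: contrapT => h2; apply: h1 => M h3; apply: h2; exists M.
apply: (CDef_not (P := fun k x => forall M, ~ P k x M)).
by apply: (CDef_forall_mx (P := fun k x M => ~ P k x M)); apply: (CDef_not h).
Qed.

Lemma MPol_var m n (c : 'I_m -> 'I_n -> S) : MPol (fun k x => \matrix_(i, j) x (c i j)).
Proof.
move=> i j; apply: (CPol_ext (G := fun k x => x (c i j))) => [k x|]; first by rewrite mxE.
exact: CPol_var.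
Qed.

End Quantifiers.

Fixpoint tz (t : tm) : int := match t with
  | TV n => 0 | TZ z => z | TA a b => tz a + tz b | TM a b => tz a * tz b end.

Lemma tev_tz t (k : pzRingType) : tev t ([::] : seq k) = (tz t)%:~R.
Proof.
elim: t => [n|z|a IHa b IHb|a IHa b IHb] //=; first by rewrite nth_nil.
  by rewrite IHa IHb rmorphD.
by rewrite IHa IHb rmorphM.
Qed.

Fixpoint qtz (g : qf) : seq int := match g with
  | QE0 t => [:: tz t] | QA a b => qtz a ++ qtz b | QN a => qtz a end.

Lemma qev_eq g (k k' : pzRingType) : (forall z, z \in qtz g -> (z%:~R == 0 :> k) = (z%:~R == 0 :> k')) ->
  qev g ([::] : seq k) = qev g ([::] : seq k').
Proof.
elim: g => [t|a IHa b IHb|a IHa] /= h; first by rewrite !tev_tz h ?inE.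
  rewrite IHa ?IHb // => z hz; apply: h; rewrite mem_cat hz ?orbT //.
by rewrite IHa.
Qed.

Lemma intr_eq0_pchar (k : nzRingType) p (z : int) : p \in [pchar k] -> (z%:~R == 0 :> k) = (p %| `|z|)%N.
Proof.
move=> pk; rewrite (dvdn_pcharf pk); case: z => n //=.
by rewrite NegzE mulrNz oppr_eq0.
Qed.

(** The value of a closed formula depends only on which of finitely many integers vanish in the
    field. In characteristic [p] the same ones vanish in the given field of that characteristic; in
    characteristic 0 one compares with a prime larger than all of them. *)
Theorem CDef_transfer (P : forall k : closedFieldType, Prop) :
  CDef (S := void) (fun k _ => P k) ->
  (forall p, prime p -> exists2 K : closedFieldType, p \in [pchar K] & P K) ->
  forall k, P k.
Proof.
move=> [Q [g hg] hQ] hp k.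
have e0 (K : closedFieldType) : cenv (fun s : void => match s return K with end) = [::].
  by apply: size0nil; rewrite size_map -cardE card_void.
have PE (K : closedFieldType) : P K <-> qev g ([::] : seq K).
  by rewrite -hg -(e0 K) -(hQ K (fun s : void => match s with end)).
apply/PE; case: (EM (exists p, p \in [pchar k])) => [[p pk]|np].
  have pp : prime p by case/andP: pk.
  have [K pK PK] := hp p pp; move/PE: PK; rewrite (qev_eq (k' := k)) // => z _.
  by rewrite (intr_eq0_pchar z pK) (intr_eq0_pchar z pk).
pose m := (\max_(z <- qtz g) `|z|)%N; have [p pm pp] := prime_above m.
have [K pK PK] := hp p pp; move/PE: PK; rewrite (qev_eq (k' := k)) // => z zg.
rewrite (intr_eq0_pchar z pK).
have zm : (`|z| <= m)%N by rewrite /m; apply: leq_bigmax_seq.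
have ch0 : [pchar k] =i pred0.
  by move=> q; apply/negbTE; apply/negP=> h; apply: np; exists q.
have -> : (z%:~R == 0 :> k) = (z == 0).
  case: z {zg zm} => n; rewrite ?NegzE ?mulrNz ?oppr_eq0.
    by rewrite [LHS]((pcharf0P k).1 ch0 n).
  by rewrite [LHS]((pcharf0P k).1 ch0 n.+1).
case: (eqVneq z 0) => [->|z0]; first by rewrite dvdn0.
by apply/negbTE; rewrite gtnNdvd // ?absz_gt0 // (leq_ltn_trans zm).
Qed.

(** * Existence and uniqueness of indecomposables as first-order sentences *)

Section Sentences.
Variables (V A : finType) (src tgt : A -> V) (d : V -> nat).
Local Notation N := (stdsz d).
Local Notation Om := (A * ('I_N * 'I_N))%type.

Definition vnf (S : finType) (c : Om -> S) (k : closedFieldType) (x : S -> k) : tmod k (V + A) :=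
  nf src tgt (fun a => \matrix_(i < N, j < N) x (c (a, (i, j)))).

Lemma MPol_vnf (S : finType) (c : Om -> S) t : MPol (fun k x => vnf c x t).
Proof.
have hE v : MPol (fun k (_ : S -> k) => (stdP k d v)^T *m stdP k d v).
  apply: MPol_mul; apply: MPol_const => i j.
    by eexists => k; rewrite !mxE.
  by eexists => k; rewrite !mxE.
case: t => [v|a]; first exact: hE.
by apply: MPol_mul (hE _); apply: MPol_mul; [apply: hE|apply: MPol_var].
Qed.

Lemma MPol_const_nat (S : finType) m n (c : nat) : m = n ->
  MPol (fun k (_ : S -> k) => c%:R%:M : 'M[k]_n).
Proof.
move=> _; apply: MPol_const => i j; exists (c * (i == j))%N => k; rewrite !mxE natrM mulr_natr.
by case: eqP.
Qed.

Lemma CDef_tindec (S : finType) (c : Om -> S) : CDef (fun k x => tindec (vnf c x)).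
Proof.
apply: (CDef_and (P := fun k (_ : S -> k) => (0 < N)%N) (Q := fun k x => forall e : 'M[k]_N,
  @thom k _ (vnf c x) (vnf c x) e -> e *m e = e -> e = 0 \/ e = 1%:M)); first exact: CDef_const.
apply: (CDef_forall_mx (P := fun k x (e : 'M[k]_N) =>
  @thom k _ (vnf c x) (vnf c x) e -> e *m e = e -> e = 0 \/ e = 1%:M)).
have hv := MPol_var (fun i j : 'I_N => inl (i, j) : 'I_N * 'I_N + S)%type.
have hx t : MPol (fun k (z : ('I_N * 'I_N + S)%type -> k) => vnf c (fun s => z (inr s)) t).
  exact: (MPol_vnf (fun o => inr (c o))).
have hc (n : nat) := @MPol_const_nat ('I_N * 'I_N + S)%type N N n erefl.
apply: CDef_imp; last apply: CDef_imp; last apply: CDef_or.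
- by apply: CDef_all => t; apply: CDef_mx_eq; apply: MPol_mul.
- by apply: CDef_mx_eq => //; apply: MPol_mul.
- apply: (CDef_ext (Q := fun k x => \matrix_(i, j) x (inl (i, j)) = 0%:R%:M)); last exact: CDef_mx_eq (hc 0%N).
  by move=> k x; rewrite raddf0.
- exact: CDef_mx_eq (hc 1%N).
Qed.

Lemma CDef_tiso (S : finType) (c c' : Om -> S) : CDef (fun k x => tiso (vnf c x) (vnf c' x)).
Proof.
pose S1 := ('I_N * 'I_N + S)%type; pose S2 := ('I_N * 'I_N + S1)%type.
apply: (CDef_ex_mx (P := fun k x (f : 'M[k]_N) => exists g : 'M[k]_N,
  [/\ @thom k _ (vnf c x) (vnf c' x) f, f *m g = 1%:M & g *m f = 1%:M])).
apply: (CDef_ex_mx (S := S1) (P := fun k x (g : 'M[k]_N) =>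
  let f := \matrix_(i, j) x (inl (i, j)) in
  [/\ @thom k _ (vnf c (fun s => x (inr s))) (vnf c' (fun s => x (inr s))) f,
     f *m g = 1%:M & g *m f = 1%:M])).
have hg := MPol_var (fun i j : 'I_N => inl (i, j) : S2).
have hf := MPol_var (fun i j : 'I_N => inr (inl (i, j)) : S2).
have hx b t : MPol (fun k (z : S2 -> k) => vnf b (fun s => z (inr (inr s))) t).
  exact: (MPol_vnf (fun o => inr (inr (b o)))).
have hc := @MPol_const_nat S2 N N 1 erefl.
apply: CDef_and3.
- by apply: CDef_all => t; apply: CDef_mx_eq; apply: MPol_mul.
- by apply: CDef_mx_eq => //; apply: MPol_mul.
- by apply: CDef_mx_eq => //; apply: MPol_mul.
Qed.

Lemma nf_vnf (k : closedFieldType) (y : A -> 'M[k]_N) :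
  exists x : Om -> k, nf src tgt y = vnf id x.
Proof.
exists (fun o => y o.1 o.2.1 o.2.2); congr (nf _ _ _); apply: funext => a.
by apply/matrixP=> i j; rewrite mxE.
Qed.

Lemma Ex_vnf (k : closedFieldType) : Ex k src tgt d <-> exists x : Om -> k, tindec (vnf id x).
Proof.
split=> [[X [qX iX dX]]|[x ix]]; last by exists (vnf id x); rewrite qdim_nf; split=> //; apply: nf_qmod.
have [y iy] := qmod_nf qX; move: y iy; rewrite dX => y iy.
have [x e] := nf_vnf y; exists x; rewrite -e; exact: tindec_iso iX.
Qed.

Lemma Un_vnf (k : closedFieldType) : Un k src tgt d <->
  forall x y : Om -> k, tindec (vnf id x) -> tindec (vnf id y) -> tiso (vnf id x) (vnf id y).
Proof.
split=> [un x y ix iy|h X Y qX iX dX qY iY dY].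
  by apply: un; rewrite ?qdim_nf //; apply: nf_qmod.
have [y iy] := qmod_nf qX; move: y iy; rewrite dX => y iy; have [x e] := nf_vnf y.
have [y' iy'] := qmod_nf qY; move: y' iy'; rewrite dY => y' iy'; have [x' e'] := nf_vnf y'.
rewrite e in iy; rewrite e' in iy'.
apply: (tiso_trans iy); apply: (tiso_trans _ (tiso_sym iy')); apply: h.
  exact: tindec_iso iX.
exact: tindec_iso iY.
Qed.

Lemma CDef_Ex (S : finType) : CDef (S := S) (fun k _ => Ex k src tgt d).
Proof.
apply: (CDef_ext (fun k _ => Ex_vnf k)).
apply: (CDef_ex (P := fun k (_ : S -> k) (x : Om -> k) => tindec (vnf id x))).
exact: (CDef_tindec (fun o => inl o : Om + S)%type).
Qed.

Lemma CDef_Un (S : finType) : CDef (S := S) (fun k _ => Un k src tgt d).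
Proof.
apply: (CDef_ext (fun k _ => Un_vnf k)).
apply: (CDef_forall (P := fun k (_ : S -> k) (x : Om -> k) => forall y : Om -> k,
   tindec (vnf id x) -> tindec (vnf id y) -> tiso (vnf id x) (vnf id y))).
apply: (CDef_forall (S := (Om + S)%type) (P := fun k (z : (Om + S)%type -> k) (y : Om -> k) =>
   tindec (vnf id (fun s => z (inl s))) -> tindec (vnf id y) -> tiso (vnf id (fun s => z (inl s))) (vnf id y))).
pose c1 o : (Om + (Om + S))%type := inr (inl o); pose c2 o : (Om + (Om + S))%type := inl o.
apply: CDef_imp; first exact: (CDef_tindec c1).
apply: CDef_imp; first exact: (CDef_tindec c2).
exact: (CDef_tiso c1 c2).
Qed.

End Sentences.

Section OrientationTheorem.
Variables (k : closedFieldType) (V A : finType) (src tgt src' tgt' : A -> V).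
Hypothesis orient : forall a, (src' a, tgt' a) = (src a, tgt a) \/
                              (src' a, tgt' a) = (tgt a, src a).

(** The transferred sentence is the whole implication, so one closed field for each prime is
    enough. *)
Theorem Ex_orient d : Ex k src tgt d -> Ex k src' tgt' d.
Proof.
move: k; apply: CDef_transfer; first by apply: CDef_imp; apply: CDef_Ex.
move=> p /Fp_closure_ex[K [pK Kalg]]; exists (K : closedFieldType) => //.
exact: (Ex_orient_p pK Kalg).
Qed.

Theorem Un_orient d : Un k src tgt d -> Un k src' tgt' d.
Proof.
move: k; apply: CDef_transfer; first by apply: CDef_imp; apply: CDef_Un.
move=> p /Fp_closure_ex[K [pK Kalg]]; exists (K : closedFieldType) => //.
exact: (Un_orient_p pK Kalg).
Qed.

End OrientationTheorem.

Lemma mxl (R : pzRingType) m n p q (a : 'M[R]_(m, n)) (b : 'M_(n, p)) c (z : 'M_(p, q)) :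
  a *m b = c -> a *m (b *m z) = c *m z.
Proof. by move=> <-; rewrite mulmxA. Qed.

(** * Reflections *)

Section IdemRank.
Variable k : fieldType.

Lemma rank_split n r (e : 'M[k]_n) (P : 'M_(r, n)) C : P *m C = 1%:M -> C *m P = e -> \rank e = r.
Proof.
move=> PC CP; apply/eqP; rewrite eqn_leq; apply/andP; split.
  by rewrite -CP (leq_trans (mxrankM_maxl _ _)) // rank_leq_col.
have e1 : 1%:M = P *m e *m C by rewrite -CP mulmxA PC mul1mx PC.
by rewrite -{1}(mxrank1 k r) e1 (leq_trans (mxrankM_maxl _ _)) // mxrankM_maxr.
Qed.

Lemma splitsP n r (e : 'M[k]_n) (P : 'M_(r, n)) C : P *m C = 1%:M -> C *m P = e -> P *m e = P.
Proof. by move=> PC <-; rewrite mulmxA PC mul1mx. Qed.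

Lemma splitsC n r (e : 'M[k]_n) (P : 'M_(r, n)) C : P *m C = 1%:M -> C *m P = e -> e *m C = C.
Proof. by move=> PC <-; rewrite -mulmxA PC mulmx1. Qed.

Lemma rank_idemD n (e f : 'M[k]_n) : e *m e = e -> f *m f = f -> e *m f = 0 -> f *m e = 0 ->
  \rank (e + f)%R = (\rank e + \rank f)%N.
Proof.
move=> ee ff ef fe; have [r [P [C [PC CP re]]]] := idem_split ee.
have [s [Q [D [QD DQ rf]]]] := idem_split ff.
have PD : P *m D = 0.
  by rewrite -(splitsP PC CP) -(splitsC QD DQ) -mulmxA (mxl _ ef) mul0mx mulmx0.
have QC : Q *m C = 0.
  by rewrite -(splitsP QD DQ) -(splitsC PC CP) -mulmxA (mxl _ fe) mul0mx mulmx0.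
rewrite -re -rf; apply: (@rank_split n _ _ (col_mx P Q) (row_mx C D)).
  by rewrite mul_col_row PC PD QC QD scalar_mx_block.
by rewrite mul_row_col CP DQ.
Qed.

Lemma rank_idem_sum n (I : finType) (Q : pred I) (F : I -> 'M[k]_n) :
  (forall i j, F i *m F j = if i == j then F i else 0) ->
  \rank (\sum_(i | Q i) F i)%R = (\sum_(i | Q i) \rank (F i))%N.
Proof.
move=> hF; rewrite -[X in mxrank X]big_filter -[RHS]big_filter; have := filter_uniq Q (index_enum_uniq I).
elim: [seq i <- _ | _] => [|i s IH] /=; first by rewrite !big_nil mxrank0.
case/andP=> nis us; rewrite !big_cons -IH //.
have h1 : F i *m (\sum_(j <- s) F j) = 0.
  rewrite mulmx_sumr big1_seq // => j /andP[_ js]; rewrite hF; case: eqP => // e.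
  by rewrite e js in nis.
have h2 : (\sum_(j <- s) F j) *m F i = 0.
  rewrite mulmx_suml big1_seq // => j /andP[_ js]; rewrite hF; case: eqP => // e.
  by rewrite -e js in nis.
apply: rank_idemD => //; first by rewrite hF eqxx.
rewrite mulmx_suml big_seq [RHS]big_seq; apply: eq_bigr => j js.
rewrite mulmx_sumr (bigD1_seq j) //= hF eqxx big1 ?addr0 // => l nl; rewrite hF eq_sym.
by rewrite (negPf nl).
Qed.

Lemma rank_sandwich n m (E : 'M[k]_n) (P : 'M_(m, n)) (C : 'M_(n, m)) :
  C *m P *m E *m (C *m P) = E -> \rank (P *m E *m C) = \rank E.
Proof.
move=> h; apply/eqP; rewrite eqn_leq; apply/andP; split.
  by rewrite (leq_trans (mxrankM_maxl _ _)) // mxrankM_maxr.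
rewrite -{1}h; have -> : C *m P *m E *m (C *m P) = C *m (P *m E *m C) *m P by rewrite !mulmxA.
by rewrite (leq_trans (mxrankM_maxl _ _)) // mxrankM_maxr.
Qed.

End IdemRank.

Section Reflection.
Variables (V A : finType) (src tgt : A -> V) (v : V) (k : fieldType).
Hypothesis noloop : forall a, src a != tgt a.
Hypothesis sink : forall a, src a != v.
Local Notation tmod := (tmod k (V + A)%type).
Implicit Types X Y Z : tmod.

Section Data.
Variable X : tmod.
Local Notation N := (tsz X).
Local Notation M := (stdsz (fun _ : A => N)).
Local Notation into := (fun a => tgt a == v).
Definition rin (a : A) : 'M[k]_(N, M) := stdP k (fun _ : A => N) a.
Definition rout (a : A) : 'M[k]_(M, N) := (stdP k (fun _ : A => N) a)^T.
(** [M] is the size of a sum of copies of the whole space, one per arrow. [reps] projects onto the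
    sum of the spaces at the sources of the arrows into [v], and [rphi] is the sum map from there to
    the space at [v]. *)
Definition rphi : 'M[k]_(M, N) := \sum_(a | into a) rout a *m X (inr a).
Definition reps : 'M[k]_M := \sum_(a | into a) rout a *m X (inl (src a)) *m rin a.

Lemma rinout a b : rin a *m rout b = (a == b)%:R%:M.
Proof.
have [h1 h2 _] := stdsys k (fun _ : A => N).
case: eqP => [->|/eqP ne]; first exact: h1.
by rewrite raddf0; apply: h2.
Qed.

Lemma rinphi a : tgt a = v -> rin a *m rphi = X (inr a).
Proof.
move=> ta; rewrite /rphi mulmx_sumr (bigD1 a) ?ta ?eqxx //= mulmxA rinout eqxx mul1mx.
rewrite big1 ?addr0 // => b /andP[_ nb]; rewrite mulmxA rinout eq_sym (negPf nb).
by rewrite raddf0 mul0mx.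
Qed.

(** A section [rsg] of the sum map, splittings [rPk], [rCk] of its kernel and [rP], [rC] of the part
    of [X] away from [v]. With these choices packed in a record the reflected module is given by
    explicit matrices. *)
Record rdata := RData {
  rN : nat; rr : nat;
  rP : 'M[k]_(rN, N); rC : 'M[k]_(N, rN); rPk : 'M[k]_(rr, M); rCk : 'M[k]_(M, rr); rsg : 'M[k]_(N, M);
  rPC : rP *m rC = 1%:M; rCP : rC *m rP = 1%:M - X (inl v);
  rPCk : rPk *m rCk = 1%:M; rCPk : rCk *m rPk = reps - rphi *m rsg;
  rsgphi : rsg *m rphi = X (inl v); rEsg : X (inl v) *m rsg = rsg; rsgeps : rsg *m reps = rsg }.

Hypothesis qX : qmod src tgt X.
Let E := X (inl v).
Let EE w u : X (inl w) *m X (inl u) = if w == u then X (inl w) else 0.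
Proof. by case: qX => h _ _; apply: h. Qed.
Let XE a : X (inr a) *m X (inl (tgt a)) = X (inr a).
Proof. by case: qX => h1 _ h3; rewrite -{1}h3 -mulmxA EE eqxx h3. Qed.
Let EX a : X (inl (src a)) *m X (inr a) = X (inr a).
Proof. by case: qX => h1 _ h3; rewrite -{1}h3 !mulmxA EE eqxx h3. Qed.

Lemma rphiE : rphi *m X (inl v) = rphi.
Proof.
by rewrite mulmx_suml; apply: eq_bigr => a /eqP ta; rewrite -mulmxA -{1}ta XE.
Qed.

Lemma repsphi : reps *m rphi = rphi.
Proof.
rewrite mulmx_suml; apply: eq_bigr => a /eqP ta; rewrite -mulmxA rinphi // -mulmxA.
by rewrite EX.
Qed.

Lemma rblock (a b : A) (F G : 'M[k]_N) : rout a *m F *m rin a *m (rout b *m G *m rin b) =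
  if a == b then rout a *m (F *m G) *m rin a else 0.
Proof.
have -> : rout a *m F *m rin a *m (rout b *m G *m rin b) =
   rout a *m F *m (rin a *m rout b) *m G *m rin b by rewrite !mulmxA.
rewrite rinout; case: eqP => [<-|_]; last by rewrite raddf0 mulmx0 !mul0mx.
by rewrite mulmx1 !mulmxA.
Qed.

Lemma reps_idem : reps *m reps = reps.
Proof.
rewrite {1}/reps mulmx_suml; apply: eq_bigr => a ia; rewrite mulmx_sumr (bigD1 a) //=.
rewrite rblock eqxx EE eqxx big1 ?addr0 // => b /andP[_ nb].
by rewrite rblock eq_sym (negPf nb).
Qed.

Lemma rank_reps : \rank reps = (\sum_(a | into a) qdim X (src a))%N.
Proof.
rewrite /reps rank_idem_sum => [|a b]; last by rewrite rblock; case: eqP => // ->; rewrite EE eqxx.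
apply: eq_bigr => a _; apply/eqP; rewrite eqn_leq; apply/andP; split.
  by rewrite (leq_trans (mxrankM_maxl _ _)) // mxrankM_maxr.
rewrite /qdim; have -> : \rank (X (inl (src a))) = \rank (rin a *m (rout a *m X (inl (src a)) *m rin a) *m rout a).
  have -> : rin a *m (rout a *m X (inl (src a)) *m rin a) *m rout a =
    (rin a *m rout a) *m X (inl (src a)) *m (rin a *m rout a) by rewrite !mulmxA.
  by rewrite rinout eqxx mul1mx mulmx1.
by rewrite (leq_trans (mxrankM_maxl _ _)) // mxrankM_maxr.
Qed.

(** The map [e] projects the space at [v] along the image of the sum map and kills the other spaces;
    as [v] is a sink it is an endomorphism. By indecomposability either [e = 0] and the sum map is
    onto, or [e = 1] and [X] is the simple module at [v]. *)
Lemma rdata_ex : tindec X -> qdim X <> (fun w => (w == v) : nat) -> inhabited rdata.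
Proof.
move=> iX nd; have [s0 pp] : exists s0, rphi *m s0 *m rphi = rphi.
  by exists (pinvmx rphi); rewrite mulmxKpV.
pose e := E - E *m s0 *m rphi.
have e0 : e = 0 \/ e = 1%:M.
  apply: iX.2; last first.
    have Ee : E *m e = e by rewrite /e mulmxBr !mulmxA EE eqxx.
    by rewrite {1}/e mulmxBl Ee -!mulmxA /e mulmxBr rphiE !mulmxA rphiE pp subrr !mulmx0 subr0.
  have Ee : E *m e = e by rewrite /e mulmxBr !mulmxA EE eqxx.
  have eE : e *m E = e by rewrite /e mulmxBl -!mulmxA rphiE EE eqxx.
  move=> [w|a].
    case: (eqVneq w v) => [->|nw]; first by rewrite Ee eE.
    by rewrite -Ee (mxl _ (EE _ _)) (negPf nw) mul0mx Ee -eE -mulmxA EE eq_sym (negPf nw) mulmx0.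
  rewrite -[X in _ = X *m _]eE -[X in _ = _ *m X]EX -(mulmxA e) (mxl _ (EE _ _)) eq_sym (negPf (sink a)).
  rewrite mul0mx mulmx0; case: (eqVneq (tgt a) v) => [ta|nt].
    by rewrite -(rinphi ta) -mulmxA /e mulmxBr rphiE !mulmxA rphiE pp subrr mulmx0.
  by rewrite -Ee -[X (inr a)]XE -mulmxA (mxl _ (EE _ _)) (negPf nt) mul0mx mulmx0.
case: e0 => e0; last first.
  case: nd; have E1 : E = 1%:M.
    have : E *m e = e by rewrite /e mulmxBr !mulmxA EE eqxx.
    by rewrite e0 mulmx1.
  have Ew w : w != v -> X (inl w) = 0.
    by move=> nw; rewrite -[X (inl w)]mulmx1 -E1 EE (negPf nw).
  have Xa a : X (inr a) = 0 by rewrite -EX Ew // mul0mx.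
  have N1 : N = 1%N.
    have [N0 id] := iX; apply/eqP; rewrite eqn_leq N0 andbT leqNgt; apply/negP=> N1.
    have h (i : 'I_N) : thom (X := X) (Y := X) (delta_mx i i).
      move=> [w|a]; last by rewrite Xa mul0mx mulmx0.
      by case: (eqVneq w v) => [->|/Ew ->]; rewrite ?mul0mx ?mulmx0 // -/E E1 mul1mx mulmx1.
    have [] := id _ (h (Ordinal N0)) (mul_delta_mx _ _ _).
      move/matrixP/(_ (Ordinal N0) (Ordinal N0))/eqP; by rewrite !mxE !eqxx oner_eq0.
    move/matrixP/(_ (Ordinal N1) (Ordinal N1))/eqP; by rewrite !mxE !eqxx /= eq_sym oner_eq0.
  apply: funext => w; rewrite /qdim; case: eqP => [->|/eqP/Ew ->]; last by rewrite mxrank0.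
  by rewrite -/E E1 mxrank1 N1.
pose sg := E *m s0 *m reps.
have sgphi : sg *m rphi = E.
  by rewrite /sg -mulmxA repsphi; apply/esym/eqP; rewrite -subr_eq0 -/e e0.
have Esg : E *m sg = sg by rewrite /sg !mulmxA EE eqxx.
have sgeps : sg *m reps = sg by rewrite /sg -mulmxA reps_idem.
have i1 : (1%:M - E) *m (1%:M - E) = 1%:M - E.
  by rewrite mulmxBl mul1mx mulmxBr mulmx1 EE eqxx subrr subr0.
pose ka := reps - rphi *m sg.
have i2 : ka *m ka = ka.
  rewrite /ka mulmxBr !mulmxBl reps_idem -(mulmxA rphi sg reps) sgeps (mulmxA reps) repsphi.
  rewrite -(mulmxA rphi sg (rphi *m sg)) (mulmxA sg) sgphi Esg.
  by rewrite subrr subr0.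
have [n1 [P [C [PC CP _]]]] := idem_split i1.
have [r [Pk [Ck [PCk CPk _]]]] := idem_split i2.
exact: (inhabits (RData PC CP PCk CPk sgphi Esg sgeps)).
Qed.

Variable D : rdata.
Local Notation P := (rP D).
Local Notation C := (rC D).
Local Notation Pk := (rPk D).
Local Notation Ck := (rCk D).

Definition rsrc a := if tgt a == v then v else src a.
Definition rtgt a := if tgt a == v then src a else tgt a.

(** The reflection functor of Bernstein, Gelfand and Ponomarev on objects: at [v] sits the kernel of
    the sum map, and its components in the old sources are the new arrows. *)
Definition rmod : tmod := TMod (fun t => match t with
  | inl w => if w == v then block_mx 0 0 0 1%:M else block_mx (P *m X (inl w) *m C) 0 0 (0 : 'M_(rr D))
  | inr a => if tgt a == v then block_mx 0 0 (Pk *m rout a *m X (inl (src a)) *m C) 0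
             else block_mx (P *m X (inr a) *m C) 0 0 0 end).

Lemma rEC : E *m C = 0.
Proof. by rewrite -(splitsC (rPC D) (rCP D)) mulmxA mulmxBr mulmx1 EE eqxx subrr mul0mx. Qed.

Lemma rPE : P *m E = 0.
Proof. by rewrite -(splitsP (rPC D) (rCP D)) -mulmxA mulmxBl mul1mx EE eqxx subrr mulmx0. Qed.

Lemma rPkphi : Pk *m rphi = 0.
Proof.
rewrite -[Pk]mul1mx -(rPCk D) -!mulmxA (mxl _ (rCPk D)) mulmxBl repsphi -mulmxA rsgphi rphiE.
by rewrite subrr mulmx0.
Qed.

Lemma rPkeps : Pk *m reps = Pk.
Proof.
rewrite -[Pk]mul1mx -(rPCk D) -!mulmxA (mxl _ (rCPk D)) (rCPk D) mulmxBl reps_idem.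
by rewrite -mulmxA rsgeps.
Qed.

Lemma rCPE w : w != v -> C *m P *m X (inl w) = X (inl w) /\ X (inl w) *m (C *m P) = X (inl w).
Proof.
move=> nw; rewrite rCP mulmxBl mulmxBr mul1mx mulmx1 !EE (negPf nw) eq_sym (negPf nw).
by rewrite !subr0.
Qed.

Lemma rmod_qdim w : w != v -> qdim rmod w = qdim X w.
Proof.
move=> nw; rewrite /qdim /= (negPf nw) rank_diag_block_mx mxrank0 addn0.
by have [h1 h2] := rCPE nw; apply: rank_sandwich; rewrite -mulmxA h2.
Qed.

Lemma rmod_qdimv : (qdim rmod v + qdim X v = \sum_(a | into a) qdim X (src a))%N.
Proof.
rewrite {1}/qdim /= eqxx rank_diag_block_mx mxrank0 add0n mxrank1 -rank_reps.
have e : reps = Ck *m Pk + rphi *m rsg D by rewrite rCPk subrK.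
have i1 : Ck *m Pk *m (Ck *m Pk) = Ck *m Pk.
  by rewrite mulmxA -(mulmxA Ck) rPCk mulmx1.
have i2 : rphi *m rsg D *m (rphi *m rsg D) = rphi *m rsg D.
  by rewrite mulmxA -(mulmxA rphi) rsgphi rphiE.
have o1 : Ck *m Pk *m (rphi *m rsg D) = 0 by rewrite -mulmxA (mulmxA Pk) rPkphi mul0mx mulmx0.
have o2 : rphi *m rsg D *m (Ck *m Pk) = 0.
  by rewrite rCPk mulmxBr i2 -mulmxA rsgeps subrr.
rewrite e (rank_idemD i1 i2 o1 o2) (rank_split (rPCk D) erefl); congr (_ + _)%N.
apply/eqP; rewrite eqn_leq; apply/andP; split.
  have -> : qdim X v = \rank (rsg D *m (rphi *m rsg D) *m rphi).
    by rewrite -!mulmxA rsgphi rphiE rsgphi.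
  by rewrite (leq_trans (mxrankM_maxl _ _)) // mxrankM_maxr.
rewrite -rphiE -mulmxA.
by rewrite (leq_trans (mxrankM_maxr _ _)) // mxrankM_maxl.
Qed.

Lemma rmod_qmod : qmod rsrc rtgt rmod.
Proof.
split=> [w u||a] /=.
- have [ew|nw] := eqVneq w v; have [eu|nu] := eqVneq u v; rewrite mulmx_block ?ew ?eu.
  + by rewrite eqxx !mulmx0 !mul0mx mulmx1 !addr0 add0r.
  + by rewrite eq_sym (negPf nu) !mulmx0 !mul0mx !addr0 block_mx0.
  + by rewrite (negPf nw) !mulmx0 !mul0mx !addr0 block_mx0.
  + rewrite !mulmx0 !mul0mx !addr0.
    have -> : P *m X (inl w) *m C *m (P *m X (inl u) *m C) = P *m (X (inl w) *m (C *m P)) *m X (inl u) *m C.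
      by rewrite !mulmxA.
    rewrite (rCPE nw).2 -(mulmxA P) EE; case: eqP => // _.
    by rewrite mulmx0 mul0mx block_mx0.
- rewrite (bigD1 v) //= eqxx (eq_bigr (fun w => block_mx (P *m X (inl w) *m C) 0 0 (0 : 'M_(rr D)))); last first.
    by move=> w /negPf ->.
  have -> : \sum_(w | w != v) block_mx (P *m X (inl w) *m C) 0 0 (0 : 'M_(rr D)) =
            block_mx (P *m (\sum_(w | w != v) X (inl w)) *m C) 0 0 0.
    rewrite mulmx_sumr mulmx_suml.
    elim/big_rec2: _ => [|w y1 y2 _ ->]; first by rewrite block_mx0.
    by rewrite add_block_mx !addr0.
  have -> : \sum_(w | w != v) X (inl w) = 1%:M - E.
    by have [_ h _] := qX; rewrite -h [in RHS](bigD1 v) //= [X in _ = X - _]addrC addrK.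
  rewrite -(rCP D) mulmxA rPC mul1mx rPC add_block_mx !addr0 add0r.
  by rewrite -scalar_mx_block.
- rewrite /rsrc /rtgt; case: (eqVneq (tgt a) v) => [ta|nt].
    rewrite eqxx (negPf (sink a)) !mulmx_block !mulmx0 !mul0mx !addr0 !add0r mul1mx !mul0mx; congr block_mx.
    have -> : Pk *m rout a *m X (inl (src a)) *m C *m (P *m X (inl (src a)) *m C) =
      Pk *m rout a *m (X (inl (src a)) *m (C *m P)) *m X (inl (src a)) *m C by rewrite !mulmxA.
    by rewrite (rCPE (sink a)).2 -(mulmxA (Pk *m _)) EE eqxx.
  rewrite (negPf (sink a)) (negPf nt) !mulmx_block !mulmx0 !mul0mx !addr0 !mul0mx; congr block_mx.
  have -> : P *m X (inl (src a)) *m C *m (P *m X (inr a) *m C) *m (P *m X (inl (tgt a)) *m C) =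
     P *m (X (inl (src a)) *m (C *m P)) *m X (inr a) *m ((C *m P) *m X (inl (tgt a))) *m C.
    by rewrite !mulmxA.
  rewrite (rCPE (sink a)).2 (rCPE nt).1 -(mulmxA P) EX.
  by rewrite -(mulmxA P) XE.
Qed.

End Data.

Section Functor.
Variables (X Y : tmod) (qX : qmod src tgt X) (qY : qmod src tgt Y).
Variables (DX : rdata X) (DY : rdata Y).

(** Morphisms are only carried back from the reflected modules. [rpart] is the part of [g] away from
    [v]. At [v] the map is forced: [rpsi] goes from the sum of the sources to the space of [Y] at
    [v] and kills the kernel of the sum map of [X] ([rPkpsi]), so it factors, and [rsg] computes the
    factor. *)
Definition rpsi (f : 'M[k]_(tsz X, tsz Y)) : 'M[k]_(_, tsz Y) :=
  \sum_(a | tgt a == v) rout X a *m f *m Y (inr a).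
Definition rpart (g : 'M[k]_(tsz (rmod DX), tsz (rmod DY))) : 'M[k]_(tsz X, tsz Y) :=
  locked (rC DX *m ulsubmx g *m rP DY).
Lemma rpartE g : rpart g = rC DX *m ulsubmx g *m rP DY.
Proof. by rewrite /rpart -lock. Qed.
Definition rG g := rpart g + rsg DX *m rpsi (rpart g).

Variable g : 'M[k]_(tsz (rmod DX), tsz (rmod DY)).
Hypothesis hg : thom g.
Let g11 := ulsubmx g.
Let g22 := drsubmx g.
Local Notation g1 := (rpart g).

Let EEX w u : X (inl w) *m X (inl u) = if w == u then X (inl w) else 0.
Proof. by case: qX => h _ _; apply: h. Qed.
Let EEY w u : Y (inl w) *m Y (inl u) = if w == u then Y (inl w) else 0.
Proof. by case: qY => h _ _; apply: h. Qed.
Let XE a : X (inr a) *m X (inl (tgt a)) = X (inr a).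
Proof. by case: qX => h1 _ h3; rewrite -{1}h3 -mulmxA EEX eqxx h3. Qed.
Let EX a : X (inl (src a)) *m X (inr a) = X (inr a).
Proof. by case: qX => h1 _ h3; rewrite -{1}h3 !mulmxA EEX eqxx h3. Qed.
Let YE a : Y (inr a) *m Y (inl (tgt a)) = Y (inr a).
Proof. by case: qY => h1 _ h3; rewrite -{1}h3 -mulmxA EEY eqxx h3. Qed.
Let EY a : Y (inl (src a)) *m Y (inr a) = Y (inr a).
Proof. by case: qY => h1 _ h3; rewrite -{1}h3 !mulmxA EEY eqxx h3. Qed.

Lemma rhom_diag : g = block_mx g11 0 0 g22.
Proof.
have := hg (inl v); rewrite /= eqxx -[in LHS](submxK g) -[in RHS](submxK g) !mulmx_block.
rewrite !mul0mx !mulmx0 !mul1mx !mulmx1 !addr0 !add0r => /eq_block_mx[_ h1 h2 _].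
by rewrite -{1}(submxK g) h2 -h1.
Qed.

Let hgd t : rmod DX t *m block_mx g11 0 0 g22 = block_mx g11 0 0 g22 *m rmod DY t.
Proof. by rewrite -rhom_diag. Qed.

Lemma rhom_vert w : w != v -> X (inl w) *m g1 = g1 *m Y (inl w).
Proof.
move=> nw; have := hgd (inl w); rewrite /= (negPf nw) !mulmx_block.
rewrite !mul0mx !mulmx0 !addr0 => /eq_block_mx[h _ _ _].
have [h1 _] := rCPE qX DX nw; have [_ h2] := rCPE qY DY nw.
have := congr1 (fun z => rC DX *m z *m rP DY) h; rewrite rpartE -/g11 => {}h.
transitivity (rC DX *m (rP DX *m X (inl w) *m rC DX *m g11) *m rP DY).
  by rewrite !mulmxA h1.
by rewrite h -[in RHS]h2 !mulmxA.
Qed.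

Lemma rhom_arrow a : tgt a != v -> X (inr a) *m g1 = g1 *m Y (inr a).
Proof.
move=> nt; have := hgd (inr a); rewrite /= (negPf nt) !mulmx_block.
rewrite !mul0mx !mulmx0 !addr0 => /eq_block_mx[h _ _ _].
have [h1 _] := rCPE qX DX (sink a); have [_ h2] := rCPE qY DY nt.
have := congr1 (fun z => rC DX *m z *m rP DY) h; rewrite rpartE -/g11 => {}h.
transitivity (rC DX *m (rP DX *m X (inr a) *m rC DX *m g11) *m rP DY).
  by rewrite -{1}EX -{1}h1 -[in RHS]EX !mulmxA.
by rewrite h -[Y (inr a)]YE -[in RHS]h2 !mulmxA.
Qed.

Lemma rhom_into a : tgt a = v ->
  rPk DX *m rout X a *m X (inl (src a)) *m g1 = g22 *m (rPk DY *m rout Y a *m Y (inl (src a))).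
Proof.
move=> ta; have := hgd (inr a); rewrite /= ta eqxx !mulmx_block.
rewrite !mul0mx !mulmx0 !addr0 !add0r => /eq_block_mx[_ _ h _].
have [_ h2] := rCPE qY DY (sink a).
transitivity (rPk DX *m rout X a *m X (inl (src a)) *m rC DX *m g11 *m rP DY).
  by rewrite rpartE !mulmxA.
by rewrite h -[in RHS]h2 !mulmxA.
Qed.

Lemma rhom_0l : X (inl v) *m g1 = 0.
Proof. by rewrite rpartE !mulmxA rEC // !mul0mx. Qed.
Lemma rhom_0r : g1 *m Y (inl v) = 0.
Proof. by rewrite rpartE -!mulmxA rPE // !mulmx0. Qed.

Lemma rPkpsi : rPk DX *m rpsi g1 = 0.
Proof.
rewrite mulmx_sumr (eq_bigr (fun a => g22 *m (rPk DY *m (rout Y a *m Y (inr a))))).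
  by rewrite -mulmx_sumr -mulmx_sumr -/(rphi Y) rPkphi // mulmx0.
move=> a /eqP ta; have := congr1 (mulmx^~ (Y (inr a))) (rhom_into ta).
rewrite -!mulmxA EY => <-; do 2 congr (_ *m _).
by rewrite -{1}EY !mulmxA rhom_vert.
Qed.

Lemma rphipsi : rphi X *m (rsg DX *m rpsi g1) = rpsi g1.
Proof.
have : rCk DX *m rPk DX *m rpsi g1 = 0 by rewrite -mulmxA rPkpsi mulmx0.
rewrite rCPk mulmxBl -mulmxA => /eqP; rewrite subr_eq0 => /eqP <-.
rewrite mulmx_suml; apply: eq_bigr => a /eqP ta.
rewrite mulmx_sumr (bigD1 a) ?ta //= big1 ?addr0 => [|b /andP[_ nb]].
  have -> : rout X a *m X (inl (src a)) *m rin X a *m (rout X a *m g1 *m Y (inr a)) =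
    rout X a *m X (inl (src a)) *m (rin X a *m rout X a) *m g1 *m Y (inr a) by rewrite !mulmxA.
  by rewrite rinout eqxx mulmx1 -(mulmxA (rout X a)) rhom_vert // -mulmxA -(mulmxA g1) EY mulmxA.
have -> : rout X a *m X (inl (src a)) *m rin X a *m (rout X b *m g1 *m Y (inr b)) =
    rout X a *m X (inl (src a)) *m (rin X a *m rout X b) *m g1 *m Y (inr b) by rewrite !mulmxA.
by rewrite rinout eq_sym (negPf nb) raddf0 mulmx0 !mul0mx.
Qed.

Lemma rinpsi a : tgt a = v -> X (inr a) *m (rsg DX *m rpsi g1) = g1 *m Y (inr a).
Proof.
move=> ta; rewrite -(rinphi X ta) -mulmxA rphipsi mulmx_sumr (bigD1 a) ?ta //= big1 ?addr0.
  by rewrite !mulmxA rinout eqxx mul1mx.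
by move=> b /andP[_ nb]; rewrite !mulmxA rinout eq_sym (negPf nb) raddf0 !mul0mx.
Qed.

Lemma rpsiE w : rpsi g1 *m Y (inl w) = if w == v then rpsi g1 else 0.
Proof.
rewrite mulmx_suml; case: eqP => [->|nw].
  by apply: eq_bigr => a /eqP ta; rewrite -mulmxA -{1}ta YE.
rewrite big1 // => a /eqP ta; rewrite -(YE a) -!mulmxA EEY ta.
by case: eqP => [e|_]; [case: nw|rewrite !mulmx0].
Qed.

Lemma rEsg0 w : w != v -> X (inl w) *m rsg DX = 0.
Proof. by move=> nw; rewrite -(rEsg DX) mulmxA EEX (negPf nw) mul0mx. Qed.

Lemma rG_thom : @thom k _ X Y (rG g).
Proof.
have psi0 a : rpsi g1 *m Y (inr a) = 0.
  by rewrite -EY mulmxA rpsiE (negPf (sink a)) mul0mx.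
move=> [w|a]; rewrite /rG mulmxDl mulmxDr; last first.
  rewrite -[X in _ = _ + X]mulmxA psi0 mulmx0 addr0.
  have [ta|nt] := eqVneq (tgt a) v.
    by rewrite -{1}(XE a) -mulmxA ta rhom_0l mulmx0 add0r rinpsi.
  by rewrite rhom_arrow // -(XE a) -mulmxA (mulmxA (X (inl _))) rEsg0 // mul0mx mulmx0 addr0.
rewrite -[X in _ = _ + X]mulmxA rpsiE (mulmxA _ (rsg DX)).
have [->|nw] := eqVneq w v; first by rewrite rhom_0l rhom_0r !add0r rEsg.
by rewrite mulmx0 rEsg0 // mul0mx !addr0 rhom_vert.
Qed.

(** The kernel of the sum map embeds into the spaces at the sources, so a homomorphism is determined
    away from [v]. *)
Lemma rG_faithful : ulsubmx g = 0 -> g = 0.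
Proof.
move=> h; have g10 : g1 = 0 by rewrite rpartE h mulmx0 mul0mx.
suff h22 : g22 = 0 by rewrite rhom_diag h22 /g11 h block_mx0.
rewrite -[g22]mulmx1 -(rPCk DY) mulmxA -(rPkeps qY DY).
have -> : g22 *m (rPk DY *m reps Y) = 0; last by rewrite mul0mx.
rewrite mulmxA mulmx_sumr big1 // => a /eqP ta.
have := rhom_into ta; rewrite g10 mulmx0 => e.
have -> : g22 *m rPk DY *m (rout Y a *m Y (inl (src a)) *m rin Y a) =
   g22 *m (rPk DY *m rout Y a *m Y (inl (src a))) *m rin Y a by rewrite !mulmxA.
by rewrite -e mul0mx.
Qed.

End Functor.

Lemma rG_ul X Y (DX : rdata X) (DY : rdata Y) g : qmod src tgt Y ->
  rP DX *m rG (DX := DX) (DY := DY) g *m rC DY = ulsubmx g.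
Proof.
move=> qY; rewrite /rG mulmxDr mulmxDl rpartE.
have -> : rP DX *m (rC DX *m ulsubmx g *m rP DY) *m rC DY =
   (rP DX *m rC DX) *m ulsubmx g *m (rP DY *m rC DY) by rewrite !mulmxA.
rewrite !rPC mul1mx mulmx1 -!mulmxA.
set f := _ *m (_ *m rP DY); have -> : rpsi f *m rC DY = 0; last by rewrite !mulmx0 addr0.
rewrite mulmx_suml big1 // => a /eqP ta; case: qY => h1 h2 h3.
have -> : Y (inr a) = Y (inr a) *m Y (inl v).
  by rewrite -{1}h3 -ta -[in RHS]h3 -[in RHS]mulmxA h1 eqxx.
by rewrite -!mulmxA rEC // !mulmx0.
Qed.

Lemma rG1 X (D : rdata X) : qmod src tgt X -> rG (DX := D) (DY := D) 1%:M = 1%:M.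
Proof.
move=> qX; have [h1 h2 h3] := qX.
have e : rpart (DX := D) (DY := D) 1%:M = 1%:M - X (inl v).
  by rewrite rpartE /= [1%:M]scalar_mx_block block_mxKul mulmx1 rCP.
rewrite /rG e (_ : rpsi _ = rphi X) ?rsgphi ?subrK //.
apply: eq_bigr => a _; rewrite mulmxBr mulmx1 mulmxBl -{2}(h3 a) -!mulmxA (mulmxA (X (inl v))) h1.
by rewrite eq_sym (negPf (sink a)) mul0mx mulmx0 subr0.
Qed.

Lemma rGM X Y Z (DX : rdata X) (DY : rdata Y) (DZ : rdata Z)
   (g : 'M[k]_(tsz (rmod DX), tsz (rmod DY))) (h : 'M[k]_(tsz (rmod DY), tsz (rmod DZ))) :
  qmod src tgt X -> qmod src tgt Y -> qmod src tgt Z -> thom g -> thom h ->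
  rG (g *m h) = rG (DX := DX) (DY := DY) g *m rG (DX := DY) (DY := DZ) h.
Proof.
move=> qX qY qZ hg hh; have [h1 h2 h3] := qY.
have eU : ulsubmx (g *m h) = ulsubmx g *m ulsubmx h.
  by rewrite {1}(rhom_diag hg) {1}(rhom_diag hh) mulmx_block block_mxKul mulmx0 addr0.
have e : rpart (DX := DX) (DY := DZ) (g *m h) = rpart (DX := DX) (DY := DY) g *m rpart (DX := DY) (DY := DZ) h.
  rewrite !rpartE eU.
  have -> : rC DX *m ulsubmx g *m rP DY *m (rC DY *m ulsubmx h *m rP DZ) =
     rC DX *m ulsubmx g *m (rP DY *m rC DY) *m ulsubmx h *m rP DZ by rewrite !mulmxA.
  by rewrite rPC mulmx1 !mulmxA.
rewrite /rG e; have := rinpsi qY qZ hh; have := rhom_0r (DX := DX) qY g; have := rhom_0l (DY := DZ) qY h.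
move: (rpart g) (rpart h) => g1 h1' h0l h0r hin.
have YE a : Y (inr a) = Y (inr a) *m Y (inl (tgt a)).
  by rewrite -{1}(h3 a) -[in RHS](h3 a) -[in RHS]mulmxA h1 eqxx.
rewrite mulmxDl !mulmxDr -!addrA; congr (_ + _).
have -> : g1 *m (rsg DY *m rpsi h1') = 0 by rewrite -(rEsg DY) !mulmxA h0r !mul0mx.
have -> : rsg DX *m rpsi g1 *m h1' = 0.
  rewrite -mulmxA mulmx_suml big1 ?mulmx0 // => a /eqP ta.
  by rewrite YE ta -!mulmxA h0l !mulmx0.
rewrite !add0r -[RHS]mulmxA; congr (_ *m _); rewrite mulmx_suml; apply: eq_bigr => a /eqP ta.
by rewrite -!mulmxA hin.
Qed.

(** [rG] turns an idempotent of the reflected module into one of [X], which is trivial; faithfulness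
    takes this back. *)
Lemma rmod_indec X (D : rdata X) : qmod src tgt X -> tindec X -> tindec (rmod D).
Proof.
move=> qX iX; split.
  (* Were the reflected module zero, [X] would live at [v] alone, and its sum map would be 0 and
     have no section. *)
  rewrite lt0n; apply/eqP => /eqP; rewrite addn_eq0 => /andP[/eqP n0 _].
  have CP := rCP D; move: (rP D) (rC D) CP; rewrite n0 => P C CP.
  have E1 : X (inl v) = 1%:M.
    by apply/esym/eqP; rewrite -subr_eq0 -CP (flatmx0 P) mulmx0.
  have X0 a : X (inr a) = 0.
    have [h1 _ h3] := qX; rewrite -h3 -[X (inl (src a))]mulmx1 -E1 h1 (negPf (sink a)).
    by rewrite !mul0mx.
  have : rsg D *m rphi X = 0 by rewrite /rphi big1 ?mulmx0 // => a _; rewrite X0 mulmx0.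
  rewrite rsgphi E1 => /eqP; rewrite -mxrank_eq0 mxrank1 => /eqP h.
  by have := iX.1; rewrite [tsz X]h.
move=> g hg gg; have := iX.2 _ (rG_thom qX qX hg); rewrite -rGM // gg => /(_ erefl).
case=> e; [left|right].
  by apply: (rG_faithful qX hg); rewrite -(rG_ul g qX) e mulmx0 mul0mx.
apply/eqP; rewrite -subr_eq0; apply/eqP; apply: (rG_faithful qX).
  by apply: thomB => //; apply: thom1.
have -> : ulsubmx (g - 1%:M) = ulsubmx g - ulsubmx (1%:M : 'M_(rN D + rr D)) by apply/matrixP=> i j; rewrite !mxE.
rewrite -{1}(rG_ul g qX) e mulmx1 rPC [1%:M in X in _ - X]scalar_mx_block block_mxKul subrr //.
Qed.

Lemma rmod_iso X Y (DX : rdata X) (DY : rdata Y) : qmod src tgt X -> qmod src tgt Y ->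
  tiso (rmod DX) (rmod DY) -> tiso X Y.
Proof.
move=> qX qY [g [h [hg gh hg1]]]; have hh := thomV hg gh hg1.
exists (rG g), (rG h); split; first exact: rG_thom.
  by rewrite -rGM // gh rG1.
by rewrite -rGM // hg1 rG1.
Qed.

End Reflection.

Lemma scalar_iso (k : fieldType) T (X Y : tmod k T) (c : T -> k) : tsz X = tsz Y ->
  (forall t, X t = (c t)%:M) -> (forall t, Y t = (c t)%:M) -> tiso X Y.
Proof.
case: X Y => [n x] [m y] /= e; subst m => hx hy.
have -> : x = y by apply: funext => t; rewrite hx hy.
exact: tiso_refl.
Qed.

(** * Reflection of dimension vectors at an arbitrary vertex *)

Section ReflectionTheorem.
Variables (k : closedFieldType) (V A : finType) (src tgt : A -> V).
Hypothesis noloop : forall a, src a != tgt a.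
Implicit Type d : V -> nat.

Definition nbr (v : V) d : nat := (\sum_(a | tgt a == v) d (src a) + \sum_(a | src a == v) d (tgt a))%N.
Definition nrefl (v : V) d : V -> nat := fun w => if w == v then (nbr v d - d v)%N else d w.

Variable v : V.
(** The arrows starting at [v] are reversed, which makes [v] a sink; the orientation theorem leads
    there and, after the reflection, back. *)
Let s1 a := if src a == v then tgt a else src a.
Let t1 a := if src a == v then src a else tgt a.

Let or1 : forall a, (s1 a, t1 a) = (src a, tgt a) \/ (s1 a, t1 a) = (tgt a, src a).
Proof. by move=> a; rewrite /s1 /t1; case: ifP; [right|left]. Qed.

Let or1' : forall a, (src a, tgt a) = (s1 a, t1 a) \/ (src a, tgt a) = (t1 a, s1 a).
Proof. by move=> a; rewrite /s1 /t1; case: ifP; [right|left]. Qed.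

Let sink1 a : s1 a != v.
Proof. by rewrite /s1; case: ifP => [/eqP <-|->] //; rewrite eq_sym noloop. Qed.

Let or2 : forall a, (src a, tgt a) = (rsrc s1 t1 v a, rtgt s1 t1 v a) \/
                    (src a, tgt a) = (rtgt s1 t1 v a, rsrc s1 t1 v a).
Proof.
move=> a; rewrite /rsrc /rtgt; case: ifP => [/eqP e|_]; last exact: or1'.
by case: (or1' a); rewrite -e; [right|left].
Qed.

Let or2' : forall a, (rsrc s1 t1 v a, rtgt s1 t1 v a) = (src a, tgt a) \/
                    (rsrc s1 t1 v a, rtgt s1 t1 v a) = (tgt a, src a).
Proof.
move=> a; rewrite /rsrc /rtgt; case: ifP => [/eqP e|_]; last exact: or1.
by case: (or1 a); rewrite -e => -[-> ->]; [right|left].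
Qed.

Lemma nbr_sink d : (\sum_(a | t1 a == v) d (s1 a))%N = nbr v d.
Proof.
rewrite /nbr [RHS]addnC (bigID (fun a => src a == v)) /=; congr (_ + _)%N.
  by apply: eq_big => a; rewrite /t1 /s1; case: ifP; rewrite ?andbT ?andbF // => ->.
apply: eq_big => a; rewrite /t1 /s1; case: ifP => //=; rewrite ?andbF ?andbT //.
by move/eqP=> <-; rewrite eq_sym (negPf (noloop a)).
Qed.

Lemma reflect_mod d (X : tmod k (V + A)) : qmod s1 t1 X -> tindec X -> qdim X = d -> d <> (fun w => (w == v) : nat) ->
  exists D : rdata s1 t1 v X, [/\ qmod (rsrc s1 t1 v) (rtgt s1 t1 v) (rmod D), tindec (rmod D),
    (d v <= nbr v d)%N & qdim (rmod D) = nrefl v d].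
Proof.
move=> qX iX dX nd; have [|D] := rdata_ex sink1 qX iX; first by rewrite dX.
have e := rmod_qdimv qX D; rewrite dX nbr_sink in e.
exists D; split; first exact: (rmod_qmod sink1 qX).
- exact: (rmod_indec sink1 D qX iX).
- by rewrite -e leq_addl.
apply: funext => w; rewrite /nrefl; case: eqP => [->|/eqP nw]; first by rewrite -e addnK.
by rewrite (rmod_qdim qX D nw) dX.
Qed.

Theorem Ex_refl d : Ex k src tgt d -> d <> (fun w => (w == v) : nat) ->
  (d v <= nbr v d)%N /\ Ex k src tgt (nrefl v d).
Proof.
move=> /(Ex_orient or1)[X [qX iX dX]] nd.
have [D [qD iD le dD]] := reflect_mod qX iX dX nd; split=> //.
apply: (Ex_orient or2); by exists (rmod D).
Qed.

Theorem Un_refl d : Un k src tgt (nrefl v d) -> d <> (fun w => (w == v) : nat) -> Un k src tgt d.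
Proof.
move=> /(Un_orient or2') un nd; apply: (Un_orient or1') => X Y qX iX dX qY iY dY.
have [D [qD iD _ dD]] := reflect_mod qX iX dX nd.
have [D' [qD' iD' _ dD']] := reflect_mod qY iY dY nd.
exact: (rmod_iso sink1 qX qY (un _ _ qD iD dD qD' iD' dD')).
Qed.

Lemma Ex_simple : Ex k src tgt (fun w => (w == v) : nat).
Proof.
pose X : tmod k (V + A) := TMod (fun t => match t with
   | inl w => ((w == v) : nat)%:R%:M | inr a => 0 end : 'M[k]_1).
exists X; split.
- split=> [w u||a] /=.
  + rewrite -scalar_mxM -natrM; case: (eqVneq w u) => [->|ne]; first by case: eqP.
    by case: eqP => [ew|_]; [rewrite -ew eq_sym (negPf ne)|]; rewrite ?muln0 ?mul0n raddf0.
  + rewrite (bigD1 v) //= eqxx big1 ?addr0 // => w /negPf ->; by rewrite raddf0.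
  + by rewrite mulmx0 mul0mx.
- split=> // e _ ee; have [c ce] : exists c, e = c%:M by exists (e 0 0); apply: mx11_scalar.
  move: ee; rewrite ce -scalar_mxM => /matrixP/(_ 0 0)/eqP; rewrite !mxE eqxx !mulr1n.
  rewrite -subr_eq0 -[X in _ - X]mulr1 -mulrBr mulf_eq0 subr_eq0 => /orP[]/eqP ->; [left|right] => //.
  by rewrite raddf0.
- apply: funext => w; rewrite /qdim /=; case: eqP => _; first by rewrite mxrank1.
  by rewrite raddf0 mxrank0.
Qed.

Lemma Un_simple : Un k src tgt (fun w => (w == v) : nat).
Proof.
move=> X Y qX iX dX qY iY dY.
have st (Z : tmod k (V + A)) : qmod src tgt Z -> qdim Z = (fun w => (w == v) : nat) ->
   tsz Z = 1%N /\ forall t, Z t = (t == inl v)%:R%:M.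
  move=> qZ dZ; have [h1 h2 h3] := qZ.
  have Zw w : w != v -> Z (inl w) = 0.
    by move=> nw; apply/eqP; rewrite -mxrank_eq0 -/(qdim Z w) dZ (negPf nw).
  have Zv : Z (inl v) = 1%:M by rewrite -h2 (bigD1 v) //= big1 ?addr0.
  split; first by rewrite (qmod_sz qZ) dZ (bigD1 v) //= eqxx big1 ?addn0 // => w /negPf ->.
  move=> [w|a].
    rewrite -[inl w == _]/(w == v); case: eqP => [->|/eqP/Zw ->] //; by rewrite raddf0.
  rewrite /= raddf0 -h3; have [e|/Zw ->] := eqVneq (src a) v; last by rewrite !mul0mx.
  by rewrite (Zw (tgt a)) ?mulmx0 // -e eq_sym noloop.
have [X1 hX] := st X qX dX; have [Y1 hY] := st Y qY dY.
apply: (@scalar_iso _ _ _ _ (fun t => (t == inl v)%:R)) => //; by rewrite X1 Y1.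
Qed.

End ReflectionTheorem.

(** * Inverse roots of invertible matrices *)

Section Roots.
Variables (k : closedFieldType) (n : nat).
Hypothesis n0 : n%:R != 0 :> k.

Lemma closed_n_gt0 : (0 < n)%N.
Proof. by case: n n0 => //; rewrite eqxx. Qed.

Lemma closed_nth_root (z : k) : exists w, w ^+ n = z.
Proof.
have n_gt0 := closed_n_gt0.
have [w hw] := @solve_monicpoly k n (fun i => if i == 0%N then z else 0) n_gt0.
exists w; rewrite hw (bigD1 (Ordinal n_gt0)) //= expr0 mulr1 big1 ?addr0 // => i ni.
by rewrite ifN ?mul0r.
Qed.

Lemma closed_prim_root_ex : exists z : k, n.-primitive_root z.
Proof.
have n_gt0 := closed_n_gt0; pose q : {poly k} := 'X^n - 1.
have [rs hrs] := closed_field_poly_normal q.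
have mq : q \is monic by apply: monicXnsubC.
rewrite (monicP mq) scale1r in hrs.
have srs : size rs = n.
  have := congr1 (fun p : {poly k} => size p) hrs; rewrite size_prod_XsubC /q size_XnsubC // => -[].
  by [].
have urs : uniq rs.
  rewrite -separable_prod_XsubC -hrs separable_poly.unlock /q derivB derivXn derivC subr0.
  apply/Bezout_coprimepP; exists (- 1, n%:R^-1 *: 'X); rewrite /= mulN1r.
  have -> : - ('X^n - 1) + n%:R^-1 *: 'X * ('X^(n.-1) *+ n) = 1 :> {poly k}.
    rewrite mulrnAr -scalerAl -exprS prednK // -scaler_nat scalerA mulfV // scale1r opprB addrC.
    by rewrite addrC subrK.
  by rewrite eqpxx.
have al : all n.-unity_root rs.
  apply/allP=> z zr; rewrite /root_of_unity.
  by rewrite -[_ - 1]/q hrs root_prod_XsubC.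
have /hasP[z _ hz] := cyclic.has_prim_root n_gt0 al urs (eq_leq (esym srs)).
by exists z.
Qed.

Lemma expDn_rem (w y : {poly k}) m : exists g, (w + y) ^+ m = w ^+ m + w ^+ m.-1 * y *+ m + y ^+ 2 * g.
Proof.
elim: m => [|[|m] [g IH]]; first by exists 0; rewrite !expr0 mulr0 addr0 mulr0n addr0.
  by exists 0; rewrite !expr1 expr0; ring.
exists (w * g + m.+1%:R * w ^+ m + y * g); rewrite exprS IH /= -mulr_natr -[in RHS]mulr_natr !exprS.
rewrite -[m.+2]addn1 natrD; ring.
Qed.

Lemma expDn_chi (w chi h : {poly k}) c : w ^+ n * 'X - 1 = h * chi -> exists g,
  (w + c *: chi) ^+ n * 'X - 1 = (h + (w ^+ n.-1 * c%:P *+ n + c%:P ^+ 2 * chi * g) * 'X) * chi.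
Proof.
move=> hw; have [g hg] := expDn_rem w (c *: chi) n; exists g; rewrite hg [RHS]mulrDl -hw.
rewrite -!mul_polyC -[_ *+ n in LHS]mulr_natr -[_ *+ n in RHS]mulr_natr.
move: (w ^+ n) (w ^+ n.-1) (c%:P) (n%:R : {poly k}) => a b d m; ring.
Qed.

(** The roots are added one at a time, and [w] is corrected by a multiple of the product [chi] so
    far: a Newton step for a repeated root, where the invertibility of [n] enters the derivative,
    and interpolation for a new one. *)
Lemma inv_root_poly (r : seq k) : 0 \notin r ->
  exists w : {poly k}, \prod_(z <- r) ('X - z%:P) %| w ^+ n * 'X - 1.
Proof.
elim: r => [|z r IH]; first by exists 0; rewrite big_nil dvd1p.
rewrite inE negb_or eq_sym => /andP[z0 /IH[w /dvdpP[h hw]]].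
set chi := \prod_(z <- r) ('X - z%:P) in h hw *; rewrite big_cons -/chi.
have n_gt0 := closed_n_gt0.
have [cz|cz] := eqVneq chi.[z] 0.
  have wz : w.[z] ^+ n * z = 1.
    have := congr1 (horner^~ z) hw; rewrite !hornerE cz mulr0 => /eqP.
    by rewrite subr_eq0 => /eqP.
  have w0 : w.[z] != 0.
    apply/eqP=> e; move/eqP: wz; rewrite e expr0n eqn0Ngt n_gt0 /= mul0r eq_sym oner_eq0 //.
  (* The coefficient cancelling the linear term of the expansion in [expDn_chi] at the repeated
     root. *)
  pose c := - h.[z] / (n%:R * w.[z] ^+ n.-1 * z).
  have [g hg] := expDn_chi c hw.
  exists (w + c *: chi); rewrite hg dvdp_mul2r; last by rewrite prodf_seq_neq0; apply/allP=> y _; rewrite polyXsubC_eq0.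
  have d0 : n%:R * w.[z] ^+ n.-1 * z != 0 by rewrite !mulf_neq0 ?expf_neq0.
  have cE : c * (n%:R * w.[z] ^+ n.-1 * z) = - h.[z] by rewrite divfK.
  rewrite dvdp_XsubCl; apply/rootP.
  rewrite hornerD hornerMX hornerD hornerMn !hornerM cz mulr0 mul0r addr0 horner_exp hornerC.
  rewrite -mulr_natr; move: cE; clearbody c.
  have -> : w.[z] ^+ n.-1 * c * n%:R * z = c * (n%:R * w.[z] ^+ n.-1 * z).
    by move: (w.[z] ^+ n.-1) (n%:R : k) => b m; ring.
  by move=> ->; rewrite subrr.
(* At a new root the value of [w] is moved to an [n]-th root of [z^-1]. *)
have [y hy] := closed_nth_root z^-1.
exists (w + ((y - w.[z]) / chi.[z]) *: chi); set c := _ / _.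
have [g hg] := expDn_chi c hw.
have [q hq] : exists q, (w + c *: chi) ^+ n * 'X - 1 = q * chi.
  by eexists; exact: hg.
rewrite hq dvdp_mul2r; last by rewrite prodf_seq_neq0; apply/allP=> y' _; rewrite polyXsubC_eq0.
rewrite dvdp_XsubCl; apply/rootP; have := congr1 (horner^~ z) hq; rewrite !hornerE.
rewrite /c divfK // [w.[z] + _]addrC subrK hy mulVf // subrr => /eqP; rewrite eq_sym mulf_eq0 (negPf cz) orbF.
by move/eqP.
Qed.

(** By Cayley-Hamilton the polynomial of the previous lemma, taken for the roots of the
    characteristic polynomial, is evaluated at [u]; a polynomial in [u] commutes with whatever
    commutes with [u]. *)
Lemma unitmx_inv_root N (u : 'M[k]_N) : u \in unitmx ->
  exists2 w, w ^+ n *m u = 1%:M & forall y : 'M[k]_N, y *m u = u *m y -> y *m w = w *m y.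
Proof.
case: N u => [|N] u uu; first by exists 0 => *; apply/matrixP=> -[].
have [rs hrs] := closed_field_poly_normal (char_poly u).
rewrite (monicP (char_poly_monic u)) scale1r in hrs.
have r0 : 0 \notin rs.
  apply/negP; rewrite -root_prod_XsubC -hrs rootE horner_coef0 char_poly_det mulf_eq0.
  by rewrite signr_eq0 /= => /eqP h; move: uu; rewrite unitmxE h unitr0.
have [w /dvdpP[h]] := inv_root_poly r0; rewrite -hrs => hw.
exists (horner_mx u w) => [|y cy].
  have := congr1 (horner_mx u) hw; rewrite rmorphM /= Cayley_Hamilton mulr0 rmorphB rmorphM rmorphXn /=.
  by rewrite horner_mx_X rmorph1 => /eqP; rewrite subr_eq0 => /eqP.
by apply/esym; apply: comm_horner_mx; apply/esym.
Qed.

End Roots.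

(** * Clifford theory *)

Section Clifford.
Variables (k : closedFieldType) (T : Type) (s : T -> T) (n : nat).
Hypothesis n0 : n%:R != 0 :> k.
Hypothesis sn : forall t, iter n s t = t.
Local Notation emd := (tmod k (option T)).
Local Notation tmod := (tmod k T).
Implicit Types (X Y Z : tmod) (W : emd).

Definition tw X : tmod := TMod (fun t => X (s t)).
Definition tinv X : Prop := tiso X (tw X).
(* The generator [None] acts as a lift of the twist, of order dividing [n] by
   [emod]: these are the modules over the skew group algebra. *)
Definition und W : tmod := TMod (fun t => W (Some t)).
Definition emod W : Prop :=
  (forall t, W (Some t) *m W None = W None *m W (Some (s t))) /\ (W None) ^+ n = 1%:M.
Definition mkE X (f : 'M[k]_(tsz X)) : emd :=
  TMod (fun o => if o is Some t then X t else f).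
Definition iiindec X : Prop := [/\ tinv X, (0 < tsz X)%N &
  ~ exists Y Z, [/\ tinv Y, tinv Z, (0 < tsz Y)%N, (0 < tsz Z)%N & tiso X (tsum Y Z)]].
Definition chi (c : k) W : emd := TMod (fun o => if o is Some t then W (Some t) else c *: W None).

Lemma mulmx_exp N (u : 'M[k]_N) m : u *m u ^+ m = u ^+ m.+1.
Proof. by rewrite exprS. Qed.

Lemma emod_unit W : emod W -> exists2 f, W None *m f = 1%:M & f *m W None = 1%:M.
Proof.
move=> [_ h]; have n_gt0 := closed_n_gt0 n0; exists (W None ^+ n.-1).
  by rewrite mulmx_exp prednK.
by rewrite -[X in _ *m X]expr1 -[_ *m _]exprD addn1 prednK.
Qed.

Lemma emod_pow W i t : emod W -> W (Some t) *m W None ^+ i = W None ^+ i *m W (Some (iter i s t)).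
Proof.
move=> [h _]; elim: i t => [|i IH] t; first by rewrite expr0 mulmx1 mul1mx.
by rewrite exprS -[_ * _]/(_ *m _) mulmxA h -mulmxA IH mulmxA -iterSr.
Qed.

Lemma emod_powV W f i t : emod W -> W None *m f = 1%:M -> f *m W None = 1%:M ->
  W (Some (iter i s t)) *m f ^+ i = f ^+ i *m W (Some t).
Proof.
move=> [h _] af fa.
have hf u : W (Some (s u)) *m f = f *m W (Some u).
  by rewrite -[LHS]mul1mx -fa -!mulmxA (mulmxA (W None)) -h -!mulmxA af mulmx1.
elim: i t => [|i IH] t; first by rewrite expr0 mulmx1 mul1mx.
by rewrite iterS exprS -[_ * _]/(_ *m _) mulmxA hf -!mulmxA IH.
Qed.

Lemma emod_tinv W : emod W -> tinv (und W).
Proof.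
move=> eW; have [f h1 h2] := emod_unit eW; exists (W None), f; split=> // t.
exact: eW.1.
Qed.

Lemma block_expr m1 m2 (a : 'M[k]_m1) (b : 'M[k]_m2) m :
  (block_mx a 0 0 b : 'M_(m1 + m2)) ^+ m = block_mx (a ^+ m) 0 0 (b ^+ m).
Proof.
elim: m => [|m IH]; first by rewrite !expr0 -[RHS]scalar_mx_block.
by rewrite !exprS IH -[LHS]/(_ *m _) mulmx_block !mulmx0 !mul0mx !addr0 add0r.
Qed.

Lemma emod_sum W W' : emod (tsum W W') <-> emod W /\ emod W'.
Proof.
split=> [[h1 h2]|[[h1 h2] [h1' h2']]].
  have e1 t := h1 t; have : forall t, W (Some t) *m W None = W None *m W (Some (s t)) /\
      W' (Some t) *m W' None = W' None *m W' (Some (s t)).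
    move=> t; have := h1 t; rewrite /= !mulmx_block !mulmx0 !mul0mx !addr0 !add0r.
    by case/eq_block_mx.
  move=> h; move: h2; rewrite /= block_expr [1%:M]scalar_mx_block => /eq_block_mx[e2 _ _ e2'].
  by split; split=> // t; case: (h t).
split=> [t|]; first by rewrite /= !mulmx_block !mulmx0 !mul0mx !addr0 !add0r h1 h1'.
by rewrite /= block_expr h2 h2' -scalar_mx_block.
Qed.

(** For an isomorphism [f] to the twist, [f ^+ n] is an automorphism of [X] commuting with [f].
    Multiplying [f] by an inverse [n]-th root of it, which commutes with [f] and with [X], makes the
    [n]-th power 1. *)
Lemma tinv_emod X : tinv X -> exists f : 'M[k]_(tsz X), emod (mkE f).
Proof.
move=> [f0 [g0 [hf0 fg0 gf0]]]; pose f : 'M[k]_(tsz X) := f0; pose g : 'M[k]_(tsz X) := g0.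
have hf t : X t *m f = f *m X (s t) := hf0 t.
have fg : f *m g = 1%:M := fg0; have gf : g *m f = 1%:M := gf0.
have uf : f \in unitmx by case/mulmx1_unit: fg.
have hfm m t : X t *m f ^+ m = f ^+ m *m X (iter m s t).
  elim: m t => [|m IH] t; first by rewrite expr0 mulmx1 mul1mx.
  rewrite !exprS -[f * _]/(f *m _) (mulmxA (X t)) hf -(mulmxA f (X _)) IH (mulmxA f) iterSr //.
pose u := f ^+ n; have uu : u \in unitmx.
  by rewrite /u; elim: (n) => [|m IH]; rewrite ?expr0 ?unitmx1 // exprS unitmx_mul uf.
have [w wu cw] := unitmx_inv_root n0 uu.
have cf : f *m w = w *m f by apply: cw; rewrite -[_ *m _]exprS -[RHS]exprSr.
have cX t : X t *m w = w *m X t by apply: cw; rewrite hfm sn.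
exists (f *m w); split=> [t|] /=.
  by rewrite mulmxA hf -mulmxA cX mulmxA.
rewrite [LHS](@exprMn_comm _ f w n cf) -/u -[_ * _]/(_ *m _).
have [_ uw] := mulmx1_unit wu.
by have := mulmx1C wu.
Qed.

Lemma chi_sum c W W' : chi c (tsum W W') = tsum (chi c W) (chi c W').
Proof.
congr TMod; apply: funext => -[t|] //.
by rewrite /= scale_block_mx !scaler0.
Qed.

(** The isomorphism [f] need not commute with the group. Its isotypic components [P e] do so up to
    the character [z ^ e]. With the components [Q e] of the inverse, the sum of the [P e *m Q e] is
    the unit [n * n], so locality of [W] makes one of them invertible. *)
Lemma emod_iso_chi W W' (z : k) : n.-primitive_root z -> emod W -> emod W' -> tindec W ->
  tiso (und W) (und W') -> exists e, tiso W (chi (z ^+ e) W').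
Proof.
move=> prz eW eW' iW [f [g [hf fg gf]]]; have n_gt0 := closed_n_gt0 n0.
have {}hg := thomV hf fg gf.
pose a := W None; pose b := W' None.
have [ai aai aia] := emod_unit eW; have [bi bbi bib] := emod_unit eW'.
rewrite -/a in aai aia; rewrite -/b in bbi bib.
have an : a ^+ n = 1 := eW.2; have bn : b ^+ n = 1 := eW'.2.
have zn : z ^+ n = 1 := prim_expr_order prz.
have zi : z * z^-1 = 1.
  rewrite mulfV //; apply/eqP=> e; move: zn; rewrite e expr0n eqn0Ngt n_gt0 /= => /esym/eqP.
  by rewrite oner_eq0.
have zin : z^-1 ^+ n = 1 by rewrite exprVn zn invr1.
have inX N (x y : 'M[k]_N) m : x *m y = 1%:M -> x ^+ m *m y ^+ m = 1%:M.
  move=> h; elim: m => [|m IH]; first by rewrite !expr0 mulmx1.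
  by rewrite exprSr exprS -[_ * x]/(_ *m x) -[y * _]/(y *m _) mulmxA -(mulmxA _ x) h mulmx1.
have unX N (x y : 'M[k]_N) : x ^+ n = 1 -> x *m y = 1%:M -> y ^+ n = 1.
  by move=> xn h; have := inX _ _ _ n h; rewrite xn mul1mx.
have ain : ai ^+ n = 1 by apply: unX aai.
have bin : bi ^+ n = 1 by apply: unX bbi.
have shift (V : lmodType k) (F : nat -> V) : F n = F 0%N -> \sum_(i < n) F i.+1 = \sum_(i < n) F i.
  case: (n) n_gt0 => // m _ e; rewrite big_ord_recr /= e [RHS]big_ord_recl addrC; congr (_ + _).
have hf' u : W (Some u) *m f = f *m W' (Some u) := hf u.
have hg' u : W' (Some u) *m g = g *m W (Some u) := hg u.
have hfi i : @thom k T (und W) (und W') (a ^+ i *m f *m bi ^+ i).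
  move=> t; rewrite /= !mulmxA emod_pow // -(mulmxA (a ^+ i) (W _)) hf' -!mulmxA.
  by rewrite (emod_powV i t eW' bbi bib).
have hgi i : @thom k T (und W') (und W) (b ^+ i *m g *m ai ^+ i).
  move=> t; rewrite /= !mulmxA emod_pow // -(mulmxA (b ^+ i) (W' _)) hg' -!mulmxA.
  by rewrite (emod_powV i t eW aai aia).
pose P e := \sum_(i < n) z^-1 ^+ (e * i) *: (a ^+ i *m f *m bi ^+ i).
pose Q e := \sum_(i < n) z ^+ (e * i) *: (b ^+ i *m g *m ai ^+ i).
have hP e : @thom k T (und W) (und W') (P e) by apply: thom_sum => i _; apply: thomZ.
have hQ e : @thom k T (und W') (und W) (Q e) by apply: thom_sum => i _; apply: thomZ.
have aP e : a *m P e = z ^+ e *: P e *m b.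
  have eP : P e = \sum_(i < n) z^-1 ^+ (e * i.+1) *: (a ^+ i.+1 *m f *m bi ^+ i.+1).
    rewrite (shift _ (fun i => z^-1 ^+ (e * i) *: (a ^+ i *m f *m bi ^+ i))) //.
    by rewrite an bin muln0 mulnC exprM zin expr1n !expr0.
  rewrite [in RHS]eP /P mulmx_sumr scaler_sumr mulmx_suml; apply: eq_bigr => i _.
  rewrite -scalemxAr scalerA mulnS exprD mulrA -exprMn zi expr1n mul1r -scalemxAl; congr (_ *: _).
  rewrite !mulmxA exprS exprSr -[bi ^+ i * bi]/(_ *m _) -(mulmxA _ _ b) -(mulmxA (bi ^+ i)) bib.
  by rewrite mulmx1 -[a * _]/(_ *m _).
have bQ e : z ^+ e *: b *m Q e = Q e *m a.
  have {2}-> : Q e = \sum_(i < n) z ^+ (e * i.+1) *: (b ^+ i.+1 *m g *m ai ^+ i.+1).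
    rewrite (shift _ (fun i => z ^+ (e * i) *: (b ^+ i *m g *m ai ^+ i))) //.
    by rewrite bn ain muln0 mulnC exprM zn expr1n !expr0.
  rewrite /Q mulmx_sumr mulmx_suml; apply: eq_bigr => i _.
  rewrite -scalemxAl -scalemxAr scalerA mulnS exprD -scalemxAl; congr (_ *: _).
  rewrite !mulmxA exprS exprSr -[ai ^+ i * ai]/(_ *m _) -(mulmxA _ _ a) -(mulmxA (ai ^+ i)) aia.
  by rewrite mulmx1 -[b * _]/(_ *m _).
have aPi e i : a ^+ i *m P e = z ^+ (e * i) *: P e *m b ^+ i.
  elim: i => [|i IH]; first by rewrite muln0 !expr0 mul1mx scale1r mulmx1.
  rewrite exprS -[a * _]/(_ *m _) -mulmxA IH -scalemxAl -scalemxAr mulmxA aP -!scalemxAl scalerA.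
  by rewrite mulnS exprD mulrC exprS -[b * _]/(_ *m _) !mulmxA.
(* Orthogonality of characters: only the term [i = 0] survives the summation over [e]. *)
have sumP : \sum_(e < n) P e = n%:R *: f.
  rewrite exchange_big /= (bigD1 (Ordinal n_gt0)) //= [X in _ + X]big1 ?addr0 => [|i ni].
    rewrite (eq_bigr (fun=> f)) ?sumr_const ?card_ord ?scaler_nat // => e _.
    by rewrite muln0 !expr0 scale1r mul1mx mulmx1.
  rewrite -scaler_suml; apply/eqP; rewrite scaler_eq0; apply/orP; left.
  have y1 : z^-1 ^+ i != 1.
    rewrite exprVn -invr1 (inj_eq invr_inj) -(prim_order_dvd prz).
    by rewrite gtnNdvd // lt0n.
  have : (1 - z^-1 ^+ i) * \sum_(e < n) z^-1 ^+ (e * i) = 0.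
    rewrite (eq_bigr (fun e : 'I_n => (z^-1 ^+ i) ^+ e)) => [|e _]; last by rewrite -exprM mulnC.
    have -> : (1 - z^-1 ^+ i) * \sum_(e < n) (z^-1 ^+ i) ^+ e = 1 ^+ n - (z^-1 ^+ i) ^+ n.
      rewrite subrXX; congr (_ * _); apply: eq_bigr => e _; by rewrite expr1n mul1r.
    by rewrite expr1n -exprM mulnC exprM zin expr1n subrr.
  by move/eqP; rewrite mulf_eq0 subr_eq0 eq_sym (negPf y1).
have [e _ uE] : exists2 e : 'I_n, true & P e *m Q e \in unitmx.
  apply: (tindec_local_sum iW).
    move=> e _ [t|]; last first.
      by rewrite -/a mulmxA aP -2!scalemxAl -mulmxA scalemxAr scalemxAl bQ mulmxA.
    exact: (thomM (hP e) (hQ e)).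
  have -> : \sum_(e < n) P e *m Q e = (n%:R * n%:R)%:M.
    rewrite (eq_bigr (fun e : 'I_n => \sum_(i < n) a ^+ i *m P e *m g *m ai ^+ i)) => [|e _].
      rewrite exchange_big /=; under eq_bigr => i _ do rewrite -!mulmx_suml -mulmx_sumr sumP.
      rewrite (eq_bigr (fun=> n%:R%:M)) => [|i _].
        by rewrite sumr_const card_ord -raddfMn mulr_natr.
      by rewrite -scalemxAr -!scalemxAl -(mulmxA _ f g) fg mulmx1 (inX _ _ _ _ aai) scalemx1.
    rewrite mulmx_sumr; apply: eq_bigr => i _; rewrite aPi -scalemxAr -!scalemxAl.
    by rewrite !mulmxA.
  by rewrite unitmxE det_scalar unitfE expf_neq0 // mulf_neq0.
have sz : tsz W = tsz W'.
  by have := tiso_sz (ex_intro _ f (ex_intro _ g (And3 hf fg gf))).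
have [h [h1 h2]] := unitmx_iso sz uE; exists (e : nat), (P e), h; split=> // -[t|].
  exact: hP.
by rewrite /= aP -scalemxAr -scalemxAl.
Qed.

(** An invariant decomposition of the underlying module lifts to the skew group algebra, and by the
    previous lemma [W] is isomorphic to the lift up to a character; so [W] would decompose. *)
Lemma emod_iiindec W : emod W -> tindec W -> iiindec (und W).
Proof.
move=> eW iW; split; [exact: emod_tinv|by case: iW|].
move=> [Y [Z [iY iZ Y0 Z0 i]]].
have [f ef] := tinv_emod iY; have [g eg] := tinv_emod iZ.
have [z prz] := closed_prim_root_ex n0.
have e1 : emod (tsum (mkE f) (mkE g)) by apply/emod_sum.
have [e ie] := emod_iso_chi prz eW e1 iW i.
case/tindecP: iW => _; apply; rewrite chi_sum in ie.
by exists (chi (z ^+ e) (mkE f)), (chi (z ^+ e) (mkE g)).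
Qed.

End Clifford.

(** * The Tits form *)

Section Forms.
Variables (V A : finType) (src tgt : A -> V).
Hypothesis noloop : forall a, src a != tgt a.
Local Notation vec := {ffun V -> int}.
Implicit Types (x y z : vec) (S : {set V}) (d : V -> nat).

Definition bf x y : int :=
  2 * (\sum_v x v * y v) - \sum_a (x (src a) * y (tgt a) + x (tgt a) * y (src a)).
Definition ev v : vec := [ffun w => (w == v)%:R].
Definition nz d : vec := [ffun v => (d v)%:Z].
Definition zr v x : vec := x - ev v *~ bf x (ev v).
(** Reflection at all the vertices of [S] at once; for independent [S] it is a product of simple
    reflections ([RS_fold]). *)
Definition RS S x : vec := x - \sum_(v in S) ev v *~ bf x (ev v).
Definition indep S := forall a, ~~ ((src a \in S) && (tgt a \in S)).

Lemma vecMzE x c v : (x *~ c) v = x v * c.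
Proof.
have h (n : nat) : (x *+ n) v = x v * n%:Z by rewrite ffunMnE -mulr_natr natz.
case: c => n; first by rewrite -pmulrn h.
by rewrite NegzE mulrNz ffunE -pmulrn h mulrN.
Qed.

Lemma bfC x y : bf x y = bf y x.
Proof.
congr (2 * _ - _); first by apply: eq_bigr => v _; rewrite mulrC.
by apply: eq_bigr => a _; ring.
Qed.

Lemma bfDl x y z : bf (x + y) z = bf x z + bf y z.
Proof.
rewrite /bf (eq_bigr (fun v => x v * z v + y v * z v)) => [|v _]; last by rewrite ffunE mulrDl.
rewrite big_split /= [X in _ - X](eq_bigr (fun a => (x (src a) * z (tgt a) + x (tgt a) * z (src a)) +
  (y (src a) * z (tgt a) + y (tgt a) * z (src a)))) => [|a _]; last by rewrite !ffunE; ring.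
by rewrite big_split /=; ring.
Qed.

Lemma bfNl x z : bf (- x) z = - bf x z.
Proof.
rewrite /bf (eq_bigr (fun v => - (x v * z v))) => [|v _]; last by rewrite ffunE mulNr.
rewrite sumrN [X in _ - X](eq_bigr (fun a => - (x (src a) * z (tgt a) + x (tgt a) * z (src a)))) => [|a _].
  by rewrite sumrN; ring.
by rewrite !ffunE; ring.
Qed.

Lemma bf0l z : bf 0 z = 0.
Proof. by apply: (addrI (bf 0 z)); rewrite -bfDl !addr0. Qed.
Lemma bfMl x c z : bf (x *~ c) z = bf x z * c.
Proof.
have h (n : nat) : bf (x *+ n) z = bf x z * n%:Z.
  elim: n => [|n IH]; first by rewrite mulr0n bf0l mulr0.
  by rewrite mulrS bfDl IH intS mulrDr mulr1.
case: c => n; first by rewrite -pmulrn h.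
by rewrite NegzE mulrNz bfNl -pmulrn h mulrN.
Qed.
Lemma bf_sum_seq (I : Type) (s : seq I) (P : pred I) (F : I -> vec) z :
  bf (\sum_(i <- s | P i) F i) z = \sum_(i <- s | P i) bf (F i) z.
Proof. exact: (big_morph (bf^~ z) (fun x y => bfDl x y z) (bf0l z)). Qed.
Lemma bf_suml (I : finType) (P : pred I) (F : I -> vec) z :
  bf (\sum_(i | P i) F i) z = \sum_(i | P i) bf (F i) z.
Proof. exact: bf_sum_seq. Qed.
Lemma bfDr x y z : bf z (x + y) = bf z x + bf z y. Proof. by rewrite bfC bfDl !(bfC _ z). Qed.
Lemma bfNr x z : bf z (- x) = - bf z x. Proof. by rewrite bfC bfNl !(bfC _ z). Qed.
Lemma bfMr x c z : bf z (x *~ c) = bf z x * c. Proof. by rewrite bfC bfMl bfC. Qed.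
Lemma bf_sumr (I : finType) (P : pred I) (F : I -> vec) z :
  bf z (\sum_(i | P i) F i) = \sum_(i | P i) bf z (F i).
Proof. by rewrite bfC bf_suml; apply: eq_bigr => i _; rewrite bfC. Qed.

Lemma sum_delta (I : finType) (P : pred I) (F : I -> int) (i : I) :
  \sum_(j | P j) F j * (j == i)%:R = if P i then F i else 0.
Proof.
case: ifPn => Pi.
  rewrite (bigD1 i) //= eqxx mulr1 big1 ?addr0 // => j /andP[_ /negPf ->].
  by rewrite mulr0.
by rewrite big1 // => j Pj; case: eqP => [e|_]; rewrite ?mulr0 //; rewrite e (negPf Pi) in Pj.
Qed.

Lemma bfe x v : bf x (ev v) = 2 * x v -
  (\sum_(a | tgt a == v) x (src a) + \sum_(a | src a == v) x (tgt a)).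
Proof.
rewrite /bf; congr (2 * _ - _).
  by rewrite (eq_bigr (fun w => x w * (w == v)%:R)) ?sum_delta // => w _; rewrite ffunE.
rewrite big_split /=; congr (_ + _).
  rewrite [RHS]big_mkcond; apply: eq_bigr => a _; rewrite ffunE.
  by case: eqP => _; rewrite ?mulr1 ?mulr0.
rewrite [RHS]big_mkcond; apply: eq_bigr => a _; rewrite ffunE.
by case: eqP => _; rewrite ?mulr1 ?mulr0.
Qed.

Lemma vecE x : x = \sum_v ev v *~ x v.
Proof.
apply/ffunP=> w; rewrite sum_ffunE (bigD1 w) //= vecMzE ffunE eqxx mul1r big1 ?addr0 // => v nv.
by rewrite vecMzE ffunE eq_sym (negPf nv) mul0r.
Qed.

Lemma bf_sum_ev x y : bf x y = \sum_v bf x (ev v) * y v.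
Proof. by rewrite {1}(vecE y) bf_sumr; apply: eq_bigr => v _; rewrite bfMr. Qed.

Lemma bf_ev v : bf (ev v) (ev v) = 2.
Proof.
rewrite bfe ffunE eqxx mulr1 !big1 ?addr0 ?subr0 // => a /eqP e.
  by rewrite ffunE -e eq_sym (negPf (noloop a)).
by rewrite ffunE -e (negPf (noloop a)).
Qed.

Lemma bf_zr v x y : bf (zr v x) (zr v y) = bf x y.
Proof. by rewrite /zr !(bfDl, bfDr, bfNl, bfNr, bfMl, bfMr) bf_ev (bfC (ev v) y); ring. Qed.

Lemma zrK v : involutive (zr v).
Proof.
move=> x; rewrite /zr bfDl bfNl bfMl bf_ev -addrA -opprD -mulrzDr.
have -> : bf x (ev v) + (bf x (ev v) - 2 * bf x (ev v)) = 0 by ring.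
by rewrite mulr0z subr0.
Qed.

Lemma zrN v x : zr v (- x) = - zr v x.
Proof. by rewrite /zr bfNl mulrNz opprD opprK. Qed.

Lemma indep_ev S v w : indep S -> v \in S -> w \in S -> v != w -> bf (ev v) (ev w) = 0.
Proof.
move=> iS vS wS nvw; rewrite bfe ffunE eq_sym (negPf nvw) mulr0 !big1 ?addr0 ?subr0 // => a /eqP e; rewrite ffunE.
  by case: eqP => // e'; have := iS a; rewrite e e' vS wS.
by case: eqP => // e'; have := iS a; rewrite e e' vS wS.
Qed.

Lemma RS_fold S x : indep S -> RS S x = foldr zr x (enum S).
Proof.
move=> iS; rewrite /RS -big_enum /=.
have : {subset enum S <= S} by move=> v; rewrite mem_enum.
have : uniq (enum S) := enum_uniq S.
elim: (enum S) => [|v s IH] /=; first by rewrite big_nil subr0.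
case/andP=> vs us sub; rewrite -IH //; last by move=> w ws; apply: sub; rewrite inE ws orbT.
have vS : v \in S by apply: sub; rewrite mem_head.
rewrite /zr bfDl bfNl (_ : bf (\sum_(w <- s) _) _ = 0) ?subr0; last first.
  rewrite bf_sum_seq big1_seq // => w /andP[_ ws]; rewrite bfMl (indep_ev iS) ?mul0r //.
    by apply: sub; rewrite inE ws orbT.
  by apply: contraNneq vs => <-.
by rewrite big_cons opprD addrCA addrC -addrA; congr (_ + _); rewrite addrC.
Qed.

Lemma RSD S x y : RS S (x + y) = RS S x + RS S y.
Proof.
rewrite /RS addrACA -opprD -big_split /=; congr (_ - _).
by apply: eq_bigr => v _; rewrite bfDl mulrzDr.
Qed.

Lemma RS0 S : RS S 0 = 0.
Proof. by rewrite /RS big1 ?subr0 // => v _; rewrite bf0l mulr0z. Qed.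

Lemma RS_sum S (I : finType) (P : pred I) (F : I -> vec) :
  RS S (\sum_(i | P i) F i) = \sum_(i | P i) RS S (F i).
Proof.
elim/big_rec2: _ => [|i y1 y2 _ <-]; [exact: RS0|exact: RSD].
Qed.

Lemma RSE S x v : RS S x v = if v \in S then x v - bf x (ev v) else x v.
Proof.
rewrite ffunE ffunE sum_ffunE; case: ifPn => vS.
  rewrite (bigD1 v) //= vecMzE ffunE eqxx mul1r big1 ?addr0 // => w /andP[_ nw].
  by rewrite vecMzE ffunE eq_sym (negPf nw) mul0r.
rewrite big1 ?subr0 // => w wS; rewrite vecMzE ffunE; case: eqP => [e|_]; last by rewrite mul0r.
by rewrite e wS in vS.
Qed.

Lemma nz_inj d d' : nz d = nz d' -> d = d'.
Proof. by move=> /ffunP e; apply: funext => v; have := e v; rewrite !ffunE => -[]. Qed.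

Lemma nz_simple v : nz (fun w => (w == v) : nat) = ev v.
Proof. by apply/ffunP=> w; rewrite !ffunE; case: eqP. Qed.

Lemma bf_nbr d v : bf (nz d) (ev v) = 2 * (d v)%:Z - (nbr src tgt v d)%:Z.
Proof.
rewrite bfe ffunE /nbr PoszD; congr (_ - (_ + _)).
  by rewrite (big_morph Posz PoszD (erefl (Posz 0))); apply: eq_bigr => a _; rewrite ffunE.
by rewrite (big_morph Posz PoszD (erefl (Posz 0))); apply: eq_bigr => a _; rewrite ffunE.
Qed.

Lemma nz_nrefl v d : (d v <= nbr src tgt v d)%N -> nz (nrefl src tgt v d) = zr v (nz d).
Proof.
move=> le; apply/ffunP=> w; rewrite [RHS]ffunE [X in _ + X]ffunE vecMzE !ffunE bf_nbr /nrefl.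
case: eqP => [->|_]; last by rewrite mul0r subr0.
by rewrite mul1r -subzn //; ring.
Qed.

Definition supp_in d S := forall v, (0 < d v)%N -> v \in S.

Variable k : closedFieldType.
Local Notation Ex := (Ex k src tgt).
Local Notation Un := (Un k src tgt).

(** Taken up to sign, because a simple reflection negates its own simple root; in this form the
    property is stable under all reflections. *)
Definition ExZ x := exists2 d, Ex d & x = nz d \/ x = - nz d.
Definition RealZ x := exists d, [/\ Ex d, Un d & x = nz d \/ x = - nz d].

Lemma ExZ_N x : ExZ x -> ExZ (- x).
Proof. by move=> [d ed [->|->]]; exists d => //; [right|left; rewrite opprK]. Qed.
Lemma RealZ_N x : RealZ x -> RealZ (- x).
Proof. by move=> [d [ed un [->|->]]]; exists d; split=> //; [right|left; rewrite opprK]. Qed.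

Lemma simple_eq d v : {d = fun w => (w == v) : nat} + {d <> fun w => (w == v) : nat}.
Proof. by case: (pselect (d = fun w => (w == v) : nat)); [left|right]. Qed.

Lemma zr_simple v : zr v (ev v) = - ev v.
Proof. by rewrite /zr bf_ev [_ *~ 2]mulr2n opprD addrA subrr add0r. Qed.

Lemma ExZ_zr v x : ExZ x -> ExZ (zr v x).
Proof.
suff h d : Ex d -> ExZ (zr v (nz d)).
  by move=> [d ed [->|->]]; rewrite ?zrN; [|apply: ExZ_N]; apply: h.
move=> ed; have [e|ne] := simple_eq d v.
  by rewrite e nz_simple zr_simple -nz_simple -e; exists d => //; right.
have [le ed'] := Ex_refl noloop ed ne; exists (nrefl src tgt v d) => //.
by left; rewrite nz_nrefl.
Qed.

Lemma RealZ_zr v x : RealZ x -> RealZ (zr v x).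
Proof.
suff h d : Ex d -> Un d -> RealZ (zr v (nz d)).
  by move=> [d [ed un [->|->]]]; rewrite ?zrN; [|apply: RealZ_N]; apply: h.
move=> ed un; have [e|ne] := simple_eq d v.
  by rewrite e nz_simple zr_simple -nz_simple -e; exists d; split=> //; right.
have [le ed'] := Ex_refl noloop ed ne; exists (nrefl src tgt v d); rewrite nz_nrefl //; split=> //; last by left.
apply: (Un_refl noloop (v := v)); last first.
  move=> e; have := congr1 nz e; rewrite nz_simple nz_nrefl // => /(congr1 (zr v)).
  by rewrite zrK zr_simple => /ffunP/(_ v); rewrite !ffunE eqxx.
rewrite (_ : nrefl _ _ _ _ = d) //; apply: nz_inj.
have nb : nbr src tgt v (nrefl src tgt v d) = nbr src tgt v d.
  congr (_ + _)%N; apply: eq_bigr => a /eqP ea; rewrite /nrefl -ea; first by rewrite (negPf (noloop a)).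
  by rewrite eq_sym (negPf (noloop a)).
by rewrite nz_nrefl ?nz_nrefl ?zrK // nb /nrefl eqxx leq_subr.
Qed.

Lemma ExZ_RS S x : indep S -> ExZ x -> ExZ (RS S x).
Proof.
move=> iS ex; rewrite RS_fold //; elim: (enum S) => //= v s; exact: ExZ_zr.
Qed.

Lemma RealZ_RS S x : indep S -> RealZ x -> RealZ (RS S x).
Proof.
move=> iS ex; rewrite RS_fold //; elim: (enum S) => //= v s; exact: RealZ_zr.
Qed.

Lemma RealZ_ev v : RealZ (ev v).
Proof.
by exists (fun w => (w == v) : nat); split; [apply: Ex_simple|apply: Un_simple|left; rewrite nz_simple].
Qed.

Lemma bf_RS S x y : indep S -> bf (RS S x) (RS S y) = bf x y.
Proof.
move=> iS; rewrite !RS_fold //; elim: (enum S) => //= v s IH; by rewrite bf_zr.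
Qed.

Lemma RSK S x : indep S -> RS S (RS S x) = x.
Proof.
move=> iS; apply/ffunP=> v; rewrite !RSE; case: (boolP (v \in S)) => // vS.
rewrite /RS bfDl bfNl bf_suml (bigD1 v) //= bfMl bf_ev big1 ?addr0 => [|w /andP[wS nw]].
  by ring.
by rewrite bfMl (indep_ev iS) ?mul0r.
Qed.

Lemma Ex_gt0 d : Ex d -> exists v, (0 < d v)%N.
Proof. by move=> [X [qX iX <-]]; apply: tindec_qdim_gt0 qX iX. Qed.

(** At a vertex [v] of the support all neighbours have dimension 0, so a reflection would make the
    entry negative; by [Ex_refl] only a simple root can do that. *)
Lemma Ex_indep d S : indep S -> Ex d -> supp_in d S -> exists2 v, v \in S & d = fun w => (w == v) : nat.
Proof.
move=> iS ed sd; have [v dv] := Ex_gt0 ed; have vS := sd v dv; exists v => //.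
have [//|ne] := simple_eq d v; have [le _] := Ex_refl noloop ed ne.
move: le; rewrite leqNgt (_ : nbr _ _ _ _ = 0%N) ?dv // /nbr !big1 // => a /eqP e.
  by apply/eqP; rewrite -leqn0 leqNgt; apply/negP=> /sd h; have := iS a; rewrite h e vS.
by apply/eqP; rewrite -leqn0 leqNgt; apply/negP=> /sd h; have := iS a; rewrite h e vS.
Qed.

Lemma bf_ge0_nz d d' : bf (nz d) (nz d') = \sum_v bf (nz d) (ev v) * (d' v)%:Z.
Proof. by rewrite bf_sum_ev; apply: eq_bigr => w _; rewrite ffunE. Qed.

(** Reflecting at a vertex of the support with positive pairing lowers the total dimension and keeps
    the form, until a simple root with value 2 is reached or no such vertex is left, and then the
    value is at most 0. *)
Lemma Ex_bf_le2 d : Ex d -> bf (nz d) (nz d) <= 2.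
Proof.
have [m] := ubnP (\sum_v d v)%N; elim: m d => // m IH d hm ed.
case: (EM (exists2 v, (0 < d v)%N & 0 < bf (nz d) (ev v))) => [[v dv bv]|h]; last first.
  rewrite bf_ge0_nz; apply: (@le_trans _ _ 0) => //.
  apply: sumr_le0 => v _; case: (posnP (d v)) => [->|dv]; first by rewrite mulr0.
  by apply: mulr_le0_ge0 => //; rewrite leNgt; apply/negP=> bv; apply: h; exists v.
have [e|ne] := simple_eq d v; first by rewrite e nz_simple bf_ev.
have [le ed'] := Ex_refl noloop ed ne; rewrite -(bf_zr v) -nz_nrefl //; apply: IH => //.
apply: leq_trans (_ : \sum_v d v <= m)%N => //.
rewrite (bigD1 v) //= [ltnRHS](bigD1 v) //= {1}/nrefl eqxx (eq_bigr d) => [|w /negPf nw].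
  rewrite ltn_add2r; move: bv; rewrite bf_nbr; lia.
by rewrite /nrefl nw.
Qed.

(** The sum of the vertex idempotents in [U] commutes with the arrows, hence is 0 or 1. *)
Lemma Ex_connected d (U : {set V}) : Ex d ->
  (forall a, (0 < d (src a))%N -> (0 < d (tgt a))%N -> (src a \in U) = (tgt a \in U)) ->
  (forall v, (0 < d v)%N -> v \in U) \/ (forall v, (0 < d v)%N -> v \notin U).
Proof.
move=> [X [qX [_ iX] dX]] h; have [h1 h2 h3] := qX.
have X0 v : d v = 0%N -> X (inl v) = 0.
  by move=> dv; apply/eqP; rewrite -mxrank_eq0 -/(qdim X v) dX dv.
pose e := \sum_(v in U) X (inl v).
have eE v : e *m X (inl v) = if v \in U then X (inl v) else 0.
  rewrite mulmx_suml; case: ifPn => vU.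
    by rewrite (bigD1 v) //= h1 eqxx big1 ?addr0 // => w /andP[_ nw]; rewrite h1 (negPf nw).
  rewrite big1 // => w wU; rewrite h1; case: eqP => // e0; by rewrite -e0 wU in vU.
have Ee v : X (inl v) *m e = if v \in U then X (inl v) else 0.
  rewrite mulmx_sumr; case: ifPn => vU.
    by rewrite (bigD1 v) //= h1 eqxx big1 ?addr0 // => w /andP[_ nw]; rewrite h1 eq_sym (negPf nw).
  rewrite big1 // => w wU; rewrite h1; case: eqP => // e0; by rewrite e0 wU in vU.
have [] := iX e.
- move=> [v|a]; first by rewrite eE Ee.
  have XE : X (inr a) *m e = if tgt a \in U then X (inr a) else 0.
    by rewrite -h3 -mulmxA Ee; case: ifP; rewrite ?mulmx0.
  have EX : e *m X (inr a) = if src a \in U then X (inr a) else 0.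
    by rewrite -h3 !mulmxA eE; case: ifP; rewrite ?mul0mx.
  rewrite XE EX; case: (posnP (d (src a))) => [/X0 s0|sp].
    by rewrite -h3 s0 !mul0mx !if_same.
  case: (posnP (d (tgt a))) => [/X0 t0|tp]; first by rewrite -h3 t0 !mulmx0 !if_same.
  by rewrite h.
- by rewrite {2}/e mulmx_sumr; apply: eq_bigr => v vU; rewrite eE vU.
- move=> e0; right=> v dv; apply/negP=> vU; have := eE v; rewrite e0 vU mul0mx => /esym/eqP.
  by rewrite -mxrank_eq0 -/(qdim X v) dX => /eqP e1; rewrite e1 in dv.
- move=> e1; left=> v dv; apply: contraT => vU; have := eE v; rewrite e1 (negPf vU) mul1mx => /eqP.
  by rewrite -mxrank_eq0 -/(qdim X v) dX => /eqP e2; rewrite e2 in dv.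
Qed.

End Forms.

(** * Generic representations *)

Section PolyFun.
Variables (k : fieldType) (Th : finType).
Local Notation pt := (Th -> k).
Implicit Types (f g : pt -> k) (z : pt) (m : {ffun Th -> nat}).

Definition mono m z : k := \prod_t z t ^+ m t.
(** Polynomial functions of degree at most [D] in each variable separately: the exponents then form
    a cube, whose cardinality is immediate. *)
Definition Pd D f := exists2 l : seq (k * {ffun Th -> nat}),
  (forall cm, cm \in l -> forall t, (cm.2 t <= D)%N) &
  forall z, f z = \sum_(cm <- l) cm.1 * mono cm.2 z.

Lemma Pd_ext D f g : f =1 g -> Pd D f -> Pd D g.
Proof. by move=> fg [l hl h]; exists l => // z; rewrite -fg. Qed.

Lemma Pd_le D D' f : (D <= D')%N -> Pd D f -> Pd D' f.
Proof. by move=> le [l hl h]; exists l => // cm /hl h' t; apply: leq_trans le. Qed.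

Lemma Pd_const D c : Pd D (fun=> c).
Proof.
exists [:: (c, [ffun=> 0%N])] => [cm|z]; first by rewrite inE => /eqP -> t; rewrite ffunE.
by rewrite big_seq1 /mono big1 ?mulr1 // => t _; rewrite ffunE expr0.
Qed.

Lemma Pd_var D t : (0 < D)%N -> Pd D (fun z => z t).
Proof.
move=> D0; exists [:: (1, [ffun u => (u == t) : nat])] => [cm|z].
  by rewrite inE => /eqP -> u; rewrite ffunE; apply: leq_trans (leq_b1 _) D0.
rewrite big_seq1 mul1r /mono (bigD1 t) //= ffunE eqxx expr1 big1 ?mulr1 // => u /negPf nu.
by rewrite ffunE nu expr0.
Qed.

Lemma Pd_add D f g : Pd D f -> Pd D g -> Pd D (fun z => f z + g z).
Proof.
move=> [l hl h] [l' hl' h']; exists (l ++ l') => [cm|z].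
  by rewrite mem_cat => /orP[/hl|/hl'].
by rewrite big_cat h h'.
Qed.

Lemma Pd_mul D D' f g : Pd D f -> Pd D' g -> Pd (D + D') (fun z => f z * g z).
Proof.
move=> [l hl h] [l' hl' h'].
pose cm2 (p : (k * {ffun Th -> nat}) * (k * {ffun Th -> nat})) : k * {ffun Th -> nat} :=
  (p.1.1 * p.2.1, [ffun t => (p.1.2 t + p.2.2 t)%N]).
exists [seq cm2 p | p <- [seq (c, c') | c <- l, c' <- l']].
  move=> cm /mapP[p /allpairsP[[c c'] /= [/hl hc /hl' hc' ->]] ->] t /=.
  by rewrite ffunE leq_add.
move=> z; rewrite h h' big_map big_allpairs_dep /= big_distrlr /=; apply: eq_bigr => c _.
apply: eq_bigr => c' _; rewrite mulrACA; congr (_ * _).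
by rewrite /mono -big_split; apply: eq_bigr => t _; rewrite ffunE exprD.
Qed.

Lemma Pd_opp D f : Pd D f -> Pd D (fun z => - f z).
Proof.
move=> h; apply: (@Pd_ext D (fun z => (- 1) * f z)) => [z|]; first by rewrite mulN1r.
exact: (Pd_mul (Pd_const 0 _) h).
Qed.

Lemma Pd_sum D (I : finType) (P : pred I) (F : I -> pt -> k) : (forall i, Pd D (F i)) ->
  Pd D (fun z => \sum_(i | P i) F i z).
Proof.
move=> h; elim: (index_enum I) => [|i s IH].
  by apply: (Pd_ext _ (Pd_const D 0)) => z; rewrite big_nil.
apply: (@Pd_ext D (fun z => (if P i then F i z else 0) + \sum_(i <- s | P i) F i z)) => [z|].
  by rewrite big_cons; case: ifP => _; rewrite ?add0r.
by apply: (Pd_add (f := fun z => if P i then F i z else 0)) IH; case: (P i); [apply: h|apply: Pd_const].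
Qed.

Lemma Pd_exp D f n : Pd D f -> Pd (n * D) (fun z => f z ^+ n).
Proof.
move=> h; elim: n => [|n IH]; first by apply: (Pd_ext _ (Pd_const _ 1)) => z; rewrite expr0.
by rewrite mulSn; apply: (Pd_ext _ (Pd_mul h IH)) => z; rewrite exprS.
Qed.

Lemma Pd_prod (I : finType) (D : I -> nat) (F : I -> pt -> k) : (forall i, Pd (D i) (F i)) ->
  Pd (\sum_i D i) (fun z => \prod_i F i z).
Proof.
move=> h; elim: (index_enum I) => [|i s IH].
  by apply: (Pd_ext _ (Pd_const _ 1)) => z; rewrite big_nil.
rewrite big_cons; apply: (Pd_ext _ (Pd_mul (h i) IH)) => z; by rewrite big_cons.
Qed.

Lemma Pd_coef D f : Pd D f -> exists c : {ffun Th -> 'I_D.+1} -> k,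
  forall z, f z = \sum_m c m * \prod_t z t ^+ m t.
Proof.
move=> [l hl h].
exists (fun m : {ffun Th -> 'I_D.+1} => \sum_(cm <- l | [forall t, cm.2 t == m t :> nat]) cm.1) => z.
rewrite h; under [RHS]eq_bigr => m _ do rewrite big_distrl /=.
rewrite (exchange_big_dep xpredT) //= big_seq [RHS]big_seq; apply: eq_bigr => cm cml.
have lt t : (cm.2 t < D.+1)%N by rewrite ltnS hl.
rewrite (big_pred1 [ffun t => Ordinal (lt t)]) => [|m].
  by congr (_ * _); apply: eq_bigr => t _; rewrite ffunE.
apply/forallP/eqP => [e|-> t]; last by rewrite ffunE.
by apply/ffunP=> t; apply: val_inj; rewrite ffunE /= -(eqP (e t)).
Qed.

(** There are more functions than monomials, so the rows of the coefficient matrix are dependent. *)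
Lemma Pd_lindep D (I : finType) (F : I -> pt -> k) : (forall i, Pd D (F i)) ->
  (#|{ffun Th -> 'I_D.+1}| < #|I|)%N ->
  exists2 v : I -> k, (exists i, v i != 0) & forall z, \sum_i v i * F i z = 0.
Proof.
move=> hF lt; pose c i := sval (cid (Pd_coef (hF i))).
have cE i z : F i z = \sum_m c i m * \prod_t z t ^+ m t := svalP (cid (Pd_coef (hF i))) z.
pose M := \matrix_(i < #|I|, j < #|{ffun Th -> 'I_D.+1}|) c (enum_val i) (enum_val j).
have : kermx M != 0.
  rewrite kermx_eq0; apply: contraL lt => /eqP rM; rewrite -leqNgt -rM; exact: rank_leq_col.
case/rowV0Pn=> u /sub_kermxP uM u0; exists (fun i => u 0 (enum_rank i)).
  apply: contrapT => h; case/negP: u0; apply/eqP/rowP=> j; rewrite mxE; apply/eqP.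
  by apply: contrapT => /negP uj; apply: h; exists (enum_val j); rewrite enum_valK.
move=> z; under eq_bigr => i _ do rewrite cE big_distrr /=.
rewrite exchange_big big1 //= => m _; under eq_bigr => i _ do rewrite mulrA.
rewrite -big_distrl /= (_ : \sum_i _ = 0) ?mul0r //.
have := congr1 (fun A : 'rV[k]_ _ => A 0 (enum_rank m)) uM; rewrite !mxE => e; rewrite -[RHS]e.
rewrite (reindex (@enum_val I xpredT)) /=; last by apply: onW_bij; apply: enum_val_bij.
by apply: eq_bigr => i _; rewrite enum_valK mxE enum_rankK.
Qed.

End PolyFun.

Lemma digits_inj D (s s' : seq nat) : size s = size s' ->
  all (gtn D) s -> all (gtn D) s' ->
  foldr (fun x acc => x + D * acc)%N 0%N s = foldr (fun x acc => x + D * acc)%N 0%N s' -> s = s'.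
Proof.
elim: s s' => [|x s IH] [|x' s'] //= [sz] /andP[lx ls] /andP[lx' ls'] e.
have D0 : (0 < D)%N by apply: leq_ltn_trans lx.
have ex : x = x'.
  have := congr1 (modn^~ D) e; rewrite /= ![(_ + D * _)%N]addnC ![(D * _)%N]mulnC !modnMDl.
  by rewrite !modn_small.
congr cons => //; apply: IH => //; move/eqP: e; rewrite ex eqn_add2l eqn_pmul2l // => /eqP.
by [].
Qed.

Section Kronecker.
Variables (k : closedFieldType) (Om : finType) (D : nat).

(** Kronecker substitution: the exponents become the digits in base [D] of one integer, so distinct
    monomials stay distinct when variable number [i] is replaced by [z ^ (D ^ i)]. *)
Definition kron (e : {ffun Om -> 'I_D}) : nat := foldr (fun x acc => x + D * acc)%N 0%N [seq (e o : nat) | o <- enum Om].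

Lemma kron_inj : injective kron.
Proof.
move=> e e' h; have := @digits_inj D _ _ _ _ _ h; rewrite !size_map => /(_ erefl).
have al (f : {ffun Om -> 'I_D}) : all (gtn D) [seq (f o : nat) | o <- enum Om].
  by apply/allP=> _ /mapP[o _ ->] /=.
move/(_ (al e) (al e')) => /eq_in_map em; apply/ffunP=> o; apply: val_inj; apply: em.
by rewrite mem_enum.
Qed.

Lemma kron_eval (e : {ffun Om -> 'I_D}) (z : k) :
  \prod_o (z ^+ (D ^ index o (enum Om))) ^+ e o = z ^+ kron e.
Proof.
have h (s : seq Om) (F : Om -> nat) j : uniq s ->
   \prod_(o <- s) (z ^+ (D ^ (j + index o s))) ^+ F o =
   z ^+ (D ^ j * foldr (fun x acc => x + D * acc)%N 0%N [seq F o | o <- s]).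
  elim: s j => [|o s IH] j /=; first by rewrite big_nil muln0 expr0.
  case/andP=> os us; rewrite big_cons /= eqxx addn0 mulnDr exprD -exprM; congr (_ * _).
  rewrite mulnA -expnSr -IH // big_seq [RHS]big_seq; apply: eq_bigr => o' o's.
  by rewrite ifN ?addnS ?addSn //; apply: contraNneq os => ->.
rewrite -[LHS]big_enum /= /kron -[foldr _ _ _]mul1n -(expn0 D) -(h _ _ _ (enum_uniq Om)).
by apply: eq_bigr => o _.
Qed.

Lemma kron_poly_neq0 (v : {ffun Om -> 'I_D} -> k) : (exists e, v e != 0) ->
  \sum_e (v e) *: 'X^(kron e) != 0 :> {poly k}.
Proof.
move=> [e ve]; apply/eqP=> /(congr1 (fun p : {poly k} => p`_(kron e))).
rewrite coef0 coef_sum (bigD1 e) //= coefZ coefXn eqxx mulr1 big1 ?addr0 => [/eqP|e' ne].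
  by rewrite (negPf ve).
by rewrite coefZ coefXn (inj_eq kron_inj) eq_sym (negPf ne) mulr0.
Qed.

End Kronecker.

Section ImageMiss.
Variables (k : closedFieldType) (Om : finType) (J : finType) (Th : J -> finType).
Variable F : forall j, (Th j -> k) -> Om -> k.
Hypothesis F3 : forall j o, Pd 3 (fun z => @F j z o).
Hypothesis lt : forall j, (#|Th j| < #|Om|)%N.

(** A dimension count by linear algebra: the monomials in the target coordinates, pulled back to
    fewer variables, satisfy a linear relation once [D] is large, so each image lies in a
    hypersurface. Kronecker substitution turns the finitely many equations into nonzero polynomials
    in one variable, and a common nonroot gives the point. *)
Lemma image_miss : exists x : Om -> k, forall j z, @F j z <> x.
Proof.
(* The pulled back monomials have partial degree at most [3 * w * D], so they span at most
   [(4 * w * D) ^ (w - 1)] dimensions; this is below their number [D ^ w] because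
   [(4 * w) ^ (w - 1) < D]. *)
pose w := #|Om|; pose D := ((4 * w) ^ w)%N.
have [v hv] : exists v : forall j, {ffun Om -> 'I_D} -> k, forall j, (exists e, v j e != 0) /\
    forall z : Th j -> k, \sum_e v j e * \prod_o @F j z o ^+ e o = 0.
  suff h j : exists v : {ffun Om -> 'I_D} -> k, (exists e, v e != 0) /\
    forall z : Th j -> k, \sum_e v e * \prod_o @F j z o ^+ e o = 0.
    by exists (fun j => sval (cid (h j))) => j; apply: (svalP (cid (h j))).
  have w0 : (0 < w)%N by apply: leq_ltn_trans (lt j).
  have D0 : (0 < D)%N by rewrite expn_gt0 muln_gt0 w0.
  have hP (e : {ffun Om -> 'I_D}) : Pd (w * (D * 3)) (fun z => \prod_o @F j z o ^+ e o).
    apply: (Pd_le _ (Pd_prod (fun o => Pd_exp (e o) (F3 j o)))).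
    rewrite (leq_trans (_ : _ <= \sum_(o : Om) D * 3)%N) //.
      by apply: leq_sum => o _; rewrite leq_mul2r ltnW ?orbT.
    by rewrite sum_nat_const.
  have [|v v0 vz] := Pd_lindep hP; last by exists v.
  rewrite !card_ffun !card_ord -/w.
  have jw : (#|Th j| <= w.-1)%N by rewrite -ltnS prednK // lt.
  apply: (@leq_ltn_trans ((4 * w * D) ^ w.-1)).
    apply: (@leq_trans ((4 * w * D) ^ #|Th j|)); last by rewrite leq_pexp2l // !muln_gt0 w0.
    case: #|Th j| => // t; rewrite leq_exp2r //; nia.
  rewrite expnMn -[in ltnRHS](prednK w0) expnS.
  rewrite ltn_pmul2r; last by rewrite expn_gt0 D0.
  rewrite /D ltn_exp2l ?prednK //; lia.
pose p := \prod_j \sum_e (v j e) *: 'X^(kron e) : {poly k}.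
have p0 : p != 0 by apply/prodf_neq0 => j _; apply: kron_poly_neq0; case: (hv j).
have /closed_nonrootP[z] := p0; rewrite rootE horner_prod => /prodf_neq0 pz.
exists (fun o => z ^+ (D ^ index o (enum Om))) => j y e.
have := pz j isT; rewrite horner_sum (eq_bigr (fun e => v j e * \prod_o @F j y o ^+ e o)) ?(hv j).2 ?eqxx //.
by move=> e' _; rewrite hornerZ hornerXn -kron_eval e.
Qed.

End ImageMiss.

Section Generic.
Variables (k : closedFieldType) (V A : finType) (src tgt : A -> V) (d : V -> nat).
Local Notation N := (stdsz d).
Definition vt (b : 'I_N) : V := tag (enum_val b).

Lemma stdE (k' : fieldType) v (i j : 'I_N) :
  ((stdP k' d v)^T *m stdP k' d v) i j = ((i == j) && (vt i == v))%:R.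
Proof.
rewrite mxE (eq_bigr (fun h => ((enum_val i == Tagged (fun v => 'I_(d v)) h) && (i == j))%:R)); last first.
  move=> h _; rewrite !mxE -natrM mulnb; congr (nat_of_bool _)%:R.
  by case: eqP => //= e; rewrite -e (inj_eq enum_val_inj) eq_sym.
case: (eqVneq i j) => [_|_] /=; last by rewrite big1 // => h _; rewrite andbF.
rewrite /vt; case: (enum_val i) => u b /=; case: eqP => [e|ne].
  subst u; rewrite (bigD1 b) //= eqxx big1 ?addr0 // => h nh; rewrite andbT.
  case: eqP => // /eqP; rewrite eq_Tagged /= eq_sym => h1; by rewrite h1 in nh.
rewrite big1 // => h _; case: eqP => // /(congr1 tag) /= e; by rewrite e in ne.
Qed.

Lemma card_vt v : #|[set i : 'I_N | vt i == v]| = d v.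
Proof.
pose f (h : 'I_(d v)) : 'I_N := enum_rank (Tagged (fun v => 'I_(d v)) h).
have fi : injective f.
  by move=> h h' /enum_rank_inj /eqP; rewrite eq_Tagged => /eqP.
rewrite -[RHS]card_ord -(card_imset _ fi); apply: eq_card => i; rewrite !inE.
apply/eqP/imsetP => [e|[h _ ->]]; last by rewrite /vt enum_rankK.
rewrite /vt in e; case E: (enum_val i) e => [u b] /= e; subst u; exists b => //.
by rewrite -[i]enum_valK E.
Qed.

Definition inOm (o : A * ('I_N * 'I_N)) := (vt o.2.1 == src o.1) && (vt o.2.2 == tgt o.1).
Definition inC (S : {set 'I_N}) (p : 'I_N * 'I_N) := [&& p.1 \in S, p.2 \notin S & vt p.1 == vt p.2].
Definition badS (S : {set 'I_N}) (o : A * ('I_N * 'I_N)) := (o.2.1 \in S) && (o.2.2 \notin S).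
Definition Omega : finType := {o : A * ('I_N * 'I_N) | inOm o}.
Definition Theta S : finType := ({p : 'I_N * 'I_N | inC S p} +
   {o : A * ('I_N * 'I_N) | inOm o && ~~ badS S o})%type.
Definition xmat (xi : Omega -> k) a : 'M[k]_N :=
  \matrix_(i, j) (if insub (a, (i, j)) is Some o then xi o else 0).
Definition cmat S (z : Theta S -> k) : 'M[k]_N :=
  \matrix_(i, j) (if insub (i, j) is Some p then z (inl p) else 0).
Definition ymat S (z : Theta S -> k) a : 'M[k]_N :=
  \matrix_(i, j) (if insub (a, (i, j)) is Some o then z (inr o) else 0).
(* A subrepresentation of [x] spanned by a matrix with pivots in [S] and other
   entries [c] puts [(1 + c) x (1 - c)] in block triangular form [y]; [param]
   recovers [x] from [(c, y)]. *)
Definition param S (z : Theta S -> k) (o : Omega) : k :=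
  ((1%:M - cmat z) *m ymat z (val o).1 *m (1%:M + cmat z)) (val o).2.1 (val o).2.2.

Definition bS (S : {set 'I_N}) v := #|[set i in S | vt i == v]|.
Definition gS (S : {set 'I_N}) v := #|[set i in ~: S | vt i == v]|.

Lemma bgS S v : (bS S v + gS S v = d v)%N.
Proof.
rewrite -card_vt -(cardsID S); congr (_ + _)%N; apply: eq_card => i; rewrite !inE andbC //.
Qed.

Lemma card_inC S : #|{: {p : 'I_N * 'I_N | inC S p}}| = (\sum_v bS S v * gS S v)%N.
Proof.
rewrite card_sig -sum1_card (partition_big (fun p => vt p.1) xpredT) //=.
apply: eq_bigr => v _; rewrite -cardsX -sum1_card; apply: eq_bigl => -[i j].
rewrite !inE /inC /=; case: (i \in S) => //=; case: (j \in S) => //=; rewrite ?andbF //.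
by rewrite andbC; case: eqP => // ->; rewrite eq_sym.
Qed.

Lemma card_bad S : #|[pred o : A * ('I_N * 'I_N) | inOm o && badS S o]| =
  (\sum_a bS S (src a) * gS S (tgt a))%N.
Proof.
rewrite -sum1_card (partition_big (fun o => o.1) xpredT) //=.
apply: eq_bigr => a _; rewrite -cardsX -sum1_card.
rewrite (reindex (fun p : 'I_N * 'I_N => (a, p))) /=; last first.
  by exists (fun o => o.2) => [p|[b p]] //=; rewrite inE => /andP[_ /eqP /= ->].
apply: eq_bigl => -[i j]; rewrite !inE /inOm /badS /= eqxx andbT.
by case: (i \in S); case: (j \in S); rewrite /= ?andbF ?andbT.
Qed.

(** The number of parameters minus the number of coordinates is the Euler form [ef] of the sub and
    quotient dimensions; where it is negative, [image_miss] applies. *)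
Lemma card_Theta S : (#|Theta S| + \sum_a bS S (src a) * gS S (tgt a) =
  \sum_v bS S v * gS S v + #|Omega|)%N.
Proof.
rewrite card_sum card_inC -card_bad -addnA; congr (_ + _)%N.
rewrite /Omega !card_sig -[RHS](cardID (badS S)) addnC; congr (_ + _)%N; by apply: eq_card => o; rewrite !inE /= andbC.
Qed.

Lemma Pd_param S o : Pd 3 (fun z => @param S z o).
Proof.
have hC i j : Pd 1 (fun z : Theta S -> k => cmat z i j).
  case E : (insub (i, j) : option {p | inC S p}) => [p|].
    by apply: (Pd_ext _ (@Pd_var k (Theta S) 1 (inl p) isT)) => z; rewrite mxE E.
  by apply: (Pd_ext _ (@Pd_const k (Theta S) 1 0)) => z; rewrite mxE E.
have hY a i j : Pd 1 (fun z : Theta S -> k => ymat z a i j).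
  case E : (insub (a, (i, j)) : option {o | inOm o && ~~ badS S o}) => [p|].
    by apply: (Pd_ext _ (@Pd_var k (Theta S) 1 (inr p) isT)) => z; rewrite mxE E.
  by apply: (Pd_ext _ (@Pd_const k (Theta S) 1 0)) => z; rewrite mxE E.
have h1 i j : Pd 1 (fun z : Theta S -> k => (1%:M - cmat z) i j).
  apply: (@Pd_ext _ _ _ (fun z => (1%:M : 'M[k]_N) i j + - cmat z i j)) => [z|]; first by rewrite !mxE.
  by apply: Pd_add; [apply: Pd_const|apply: Pd_opp].
have h2 i j : Pd 1 (fun z : Theta S -> k => (1%:M + cmat z) i j).
  apply: (@Pd_ext _ _ _ (fun z => (1%:M : 'M[k]_N) i j + cmat z i j)) => [z|]; first by rewrite [RHS]mxE.
  by apply: Pd_add; [apply: Pd_const|].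
have h3 a i j : Pd 2 (fun z : Theta S -> k => ((1%:M - cmat z) *m ymat z a) i j).
  apply: (@Pd_ext _ _ _ (fun z => \sum_h (1%:M - cmat z) i h * ymat z a h j)) => [z|]; first by rewrite [RHS]mxE.
  by apply: Pd_sum => h; apply: (@Pd_mul _ _ 1 1).
apply: (@Pd_ext _ _ _ (fun z => \sum_h ((1%:M - cmat z) *m ymat z (val o).1) (val o).2.1 h * (1%:M + cmat z) h (val o).2.2)).
  by move=> z; rewrite /param [RHS]mxE.
by apply: Pd_sum => h; apply: (@Pd_mul _ _ 2 1).
Qed.

(** The Euler form of the quiver; its symmetrisation is [bf], see [bf_ef]. *)
Definition ef (b g : V -> nat) : int := (\sum_v b v * g v)%:Z - (\sum_a b (src a) * g (tgt a))%:Z.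

Lemma conj_sandwich n (c x e1 e2 : 'M[k]_n) : c *m e1 = e1 *m c -> c *m e2 = e2 *m c ->
  e1 *m x *m e2 = x ->
  e1 *m ((1%:M + c) *m x *m (1%:M - c)) *m e2 = (1%:M + c) *m x *m (1%:M - c).
Proof.
move=> c1 c2 h.
have -> : e1 *m ((1%:M + c) *m x *m (1%:M - c)) *m e2 =
   (e1 *m (1%:M + c)) *m x *m ((1%:M - c) *m e2) by rewrite !mulmxA.
have -> : e1 *m (1%:M + c) = (1%:M + c) *m e1 by rewrite mulmxDr mulmxDl mulmx1 mul1mx c1.
have -> : (1%:M - c) *m e2 = e2 *m (1%:M - c) by rewrite mulmxBr mulmxBl mulmx1 mul1mx c2.
by rewrite -[in RHS]h !mulmxA.
Qed.

Section SubToParam.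
Variables (xi : Omega -> k) (Y : tmod k (V + A)).
Let x := xmat xi.
Let X : tmod k (V + A) := nf src tgt x.
Local Notation E v := (X (inl v)).
Variable P : 'M[k]_(tsz Y, N).
Hypothesis hP : @thom k _ Y X P.
Hypothesis fP : row_free P.

Lemma nf_xmat a : X (inr a) = x a.
Proof.
apply/matrixP=> i j; rewrite /X /= mxE (bigD1 j) //= stdE eqxx big1 ?addr0 => [|h nh]; last first.
  by rewrite stdE (negPf nh) mulr0.
rewrite mxE (bigD1 i) //= stdE eqxx big1 ?addr0 => [|h nh]; last by rewrite stdE eq_sym (negPf nh) mul0r.
rewrite /x mxE; case: insubP => [o|]; rewrite /inOm /=; first by case/andP=> -> -> _; rewrite mul1r mulr1.
by rewrite mulr0 mul0r.
Qed.

(** After a change of basis [P] is the identity in its pivot columns [S]. Since the vertex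
    idempotents are diagonal, each row then involves only columns of the vertex of its pivot; hence
    [1 + C] respects the vertices, and the pivots count the dimension vector of [Y]. *)
Lemma sub_param : exists S (z : Theta S -> k), bS S = qdim Y /\ @param S z = xi.
Proof.
pose n := tsz Y.
have ff : row_full P^T by rewrite /row_full mxrank_tr.
pose f := fullrankfun ff; have fi : injective f by apply: fullrankfun_inj.
pose G : 'M[k]_n := \matrix_(i, j) P i (f j).
have uG : G \in unitmx.
  rewrite -unitmx_tr (_ : G^T = rowsub f P^T) ?fullrowsub_unit //.
  by apply/matrixP=> i j; rewrite !mxE.
pose P' := invmx G *m P; pose Y' t := invmx G *m Y t *m G.
have P'f i j : P' i (f j) = (i == j)%:R.
  have : (invmx G *m G) i j = (i == j)%:R by rewrite mulVmx // mxE.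
  by rewrite mxE => <-; rewrite mxE; apply: eq_bigr => h _; rewrite !mxE.
have hP' t : P' *m X t = Y' t *m P'.
  by rewrite /P' /Y' -!mulmxA mulKVmx // -hP.
have EE v (i j : 'I_N) : E v i j = ((i == j) && (vt i == v))%:R by apply: stdE.
have PE v i b : (P' *m E v) i b = P' i b * (vt b == v)%:R.
  rewrite mxE (bigD1 b) //= EE eqxx big1 ?addr0 // => h nh; by rewrite EE (negPf nh) mulr0.
have Y'v v i j : Y' (inl v) i j = ((i == j) && (vt (f j) == v))%:R.
  have := congr1 (fun M : 'M_(n, N) => M i (f j)) (hP' (inl v)); rewrite PE P'f mxE (bigD1 j) //=.
  rewrite P'f eqxx mulr1 big1 ?addr0 => [<-|h nh]; first by rewrite -natrM mulnb.
  by rewrite P'f (negPf nh) mulr0.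
have Pg i b : vt b != vt (f i) -> P' i b = 0.
  move=> nb; have := congr1 (fun M : 'M_(n, N) => M i b) (hP' (inl (vt b))); rewrite PE eqxx mulr1 => ->.
  rewrite mxE big1 // => h _; rewrite Y'v; case: eqP => [<-|_]; rewrite ?mul0r //.
  by rewrite eq_sym (negPf nb) mul0r.
pose S := [set f i | i : 'I_n].
have fS i : f i \in S by apply: imset_f.
have bE v : bS S v = qdim Y v.
  have -> : qdim Y v = \rank (Y' (inl v)).
    by apply/esym/rank_sandwich; rewrite mulmxV // mul1mx mulmx1.
  have -> : Y' (inl v) = \sum_(i | vt (f i) == v) delta_mx i i.
    apply/matrixP=> i j; rewrite Y'v summxE; case: (eqVneq i j) => [<-|ne] /=.
      case: (boolP (vt (f i) == v)) => vi.
        rewrite (bigD1 i) //= mxE !eqxx big1 ?addr0 // => h /andP[_ nh].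
        by rewrite mxE eq_sym (negPf nh).
      rewrite big1 // => h vh; rewrite mxE; case: eqP => // e; by rewrite e vh in vi.
    rewrite big1 // => h _; rewrite mxE; case: eqP => //= e; by rewrite -e eq_sym (negPf ne).
  rewrite rank_idem_sum => [|i j]; last by rewrite mul_delta_mx_cond; case: eqP => [->|_]; rewrite ?mulr1n ?mulr0n.
  under eq_bigr => i _ do rewrite mxrank_delta.
  rewrite sum1_card /bS -(card_imset _ fi); apply: eq_card => b; rewrite !inE.
  apply/andP/imsetP => [[/imsetP[i _ ->] vi]|[i vi ->]]; first by exists i.
  by rewrite fS; split=> //; rewrite inE in vi.
have hPx a : P' *m x a = Y' (inr a) *m P' by rewrite -hP' nf_xmat.
clearbody Y' P'.
pose C : 'M[k]_N := \matrix_(i, j) (if j \in S then 0 else \sum_(h | f h == i) P' h j).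
have Cf h j : C (f h) j = if j \in S then 0 else P' h j.
  rewrite mxE; case: ifP => // _; rewrite (bigD1 h) //= big1 ?addr0 // => h' /andP[/eqP/fi ->].
  by rewrite eqxx.
have C0 i j : i \notin S -> C i j = 0.
  move=> iS; rewrite mxE; case: ifP => // _; rewrite big1 // => h /eqP e.
  by rewrite -e fS in iS.
have CS i j : j \in S -> C i j = 0 by move=> jS; rewrite mxE jS.
(* [C] leads from [S] to its complement, so its square vanishes and [1 - C] inverts [1 + C]. *)
have CC : C *m C = 0.
  apply/matrixP=> i j; rewrite !mxE big1 // => h _; case: (boolP (h \in S)) => hS.
    by rewrite CS // mul0r.
  by rewrite (C0 h) // mulr0.
have u1 : (1%:M + C) *m (1%:M - C) = 1%:M by rewrite mulmxDl mul1mx mulmxBr mulmx1 CC subr0 subrK.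
have u2 : (1%:M - C) *m (1%:M + C) = 1%:M by rewrite mulmxBl mul1mx mulmxDr mulmx1 CC addr0 addrK.
pose Pi : 'M[k]_(n, N) := \matrix_(i, b) (f i == b)%:R.
have PiM m (M : 'M[k]_(N, m)) i j : (Pi *m M) i j = M (f i) j.
  rewrite mxE (bigD1 (f i)) //= mxE eqxx mul1r big1 ?addr0 // => h nh.
  by rewrite mxE eq_sym (negPf nh) mul0r.
have PiC : Pi *m (1%:M + C) = P'.
  apply/matrixP=> i b; rewrite PiM mxE Cf mxE; case: ifPn => [/imsetP[j _ ->]|bS].
    by rewrite P'f (inj_eq fi) addr0.
  case: eqP => [e|_]; last by rewrite add0r.
  by rewrite -e fS in bS.
have Cg i j : vt i != vt j -> C i j = 0.
  move=> nij; case: (boolP (i \in S)) => [/imsetP[h _ e]|iS]; last exact: C0.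
  by rewrite e Cf; case: ifP => // _; apply: Pg; rewrite -e eq_sym.
have cE v : C *m E v = E v *m C.
  apply/matrixP=> i j; rewrite !mxE (bigD1 j) //= EE eqxx big1 ?addr0 => [|h nh]; last first.
    by rewrite EE (negPf nh) mulr0.
  rewrite (bigD1 i) //= EE eqxx big1 ?addr0 /= => [|h nh]; last by rewrite EE eq_sym (negPf nh) mul0r.
  by case: (eqVneq (vt i) (vt j)) => [->|/Cg ->]; rewrite ?mulr0 ?mul0r // mulrC.
pose y a := (1%:M + C) *m x a *m (1%:M - C).
(* The rows [Pi *m (1 + C)] span the submodule; its invariance means that the conjugate [y] has no
   entries from [S] to the complement. *)
have yS a i j : i \in S -> j \notin S -> y a i j = 0.
  move=> /imsetP[h _ ->] jS; rewrite -PiM /y !mulmxA PiC hPx -mulmxA.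
  have -> : P' *m (1%:M - C) = Pi by rewrite -PiC -mulmxA u1 mulmx1.
  rewrite mxE big1 // => l _; rewrite mxE; case: eqP => [e|_]; last by rewrite mulr0.
  by rewrite -e fS in jS.
have [h1 h2 h3] := nf_qmod src tgt x.
have yE a : E (src a) *m y a *m E (tgt a) = y a.
  by apply: conj_sandwich => //; have := h3 a; rewrite nf_xmat.
have yO a i j : ~~ inOm (a, (i, j)) -> y a i j = 0.
  rewrite -yE mxE (bigD1 j) //= EE eqxx big1 ?addr0 => [|h nh]; last by rewrite EE (negPf nh) mulr0.
  rewrite mxE (bigD1 i) //= EE eqxx big1 ?addr0 => [|h nh]; last by rewrite EE eq_sym (negPf nh) mul0r.
  by rewrite /inOm /= negb_and => /orP[]/negPf ->; rewrite ?mul0r ?mulr0.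
pose z (t : Theta S) : k := match t with inl p => C (val p).1 (val p).2
  | inr o => y (val o).1 (val o).2.1 (val o).2.2 end.
exists S, z; split; first by apply: funext => v; apply: bE.
have cz : cmat z = C.
  apply/matrixP=> i j; rewrite [LHS]mxE; case: insubP => [p _ e|]; first by rewrite /z e.
  rewrite /inC /= !negb_and negbK => /or3P[/C0 ->|/CS ->|/Cg ->] //.
have yz a : ymat z a = y a.
  apply/matrixP=> i j; rewrite [LHS]mxE; case: insubP => [o _ e|]; first by rewrite /z e.
  rewrite negb_and negbK => /orP[/yO ->|/andP[/= iS jS]] //; by rewrite yS.
apply: funext => o; rewrite /param cz yz /y.
have -> : (1%:M - C) *m ((1%:M + C) *m x (val o).1 *m (1%:M - C)) *m (1%:M + C) =
   ((1%:M - C) *m (1%:M + C)) *m x (val o).1 *m ((1%:M - C) *m (1%:M + C)) by rewrite !mulmxA.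
rewrite u2 mul1mx mulmx1 /x mxE.
case: insubP => [o' _ e|]; first by congr xi; apply: val_inj; rewrite e; case: (val o) => ? [].
by case/negP; case: o => -[a [i j]].
Qed.

End SubToParam.

(** A subrepresentation violating the inequality would put the point in the image of a [param] with
    fewer parameters than coordinates. There is one such image for each pivot set, hence finitely
    many, and they do not cover the space. *)
Theorem generic_subs : exists x : A -> 'M[k]_N, forall (Y : tmod k (V + A)) (P : 'M[k]_(tsz Y, N)),
  @thom k _ Y (nf src tgt x) P -> row_free P ->
  (forall v, (qdim Y v <= d v)%N) /\ 0 <= ef (qdim Y) (fun v => d v - qdim Y v)%N.
Proof.
pose J : finType := {S : {set 'I_N} | (#|Theta S| < #|Omega|)%N}.
have [xi hxi] := @image_miss k Omega J (fun j => Theta (val j)) (fun j z => @param (val j) z)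
   (fun j o => Pd_param (val j) o) (fun j => valP j).
exists (xmat xi) => Y P hP fP.
have [S [z [bE pz]]] := sub_param hP fP.
have gE v : gS S v = (d v - qdim Y v)%N by rewrite -bE -(bgS S v) addKn.
split=> [v|]; first by rewrite -bE -(bgS S v) leq_addr.
rewrite leNgt; apply/negP=> lt.
have lS : (#|Theta S| < #|Omega|)%N.
  have := card_Theta S; rewrite bE (_ : gS S = fun v => d v - qdim Y v)%N; last exact: funext.
  move: lt; rewrite /ef; lia.
exact: (hxi (Sub S lS : J) z).
Qed.

End Generic.

Section GenericBrick.
Variables (k : closedFieldType) (V A : finType) (src tgt : A -> V).

Lemma bf_ef (b g : V -> nat) : bf src tgt (nz b) (nz g) = ef src tgt b g + ef src tgt g b.
Proof.
have h (I : finType) (F G : I -> nat) : (\sum_i F i * G i)%:Z = \sum_i (F i)%:Z * (G i)%:Z.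
  by rewrite (big_morph Posz PoszD (erefl (Posz 0))); apply: eq_bigr => i _; rewrite PoszM.
rewrite /bf /ef !h (eq_bigr (fun v => (b v)%:Z * (g v)%:Z)) => [|v _]; last by rewrite !ffunE.
rewrite [X in _ = _ + (X - _)](eq_bigr (fun v => (b v)%:Z * (g v)%:Z)) => [|v _]; last by rewrite mulrC.
rewrite big_split /= [X in _ - (X + _)](eq_bigr (fun a => (b (src a))%:Z * (g (tgt a))%:Z)) => [|a _]; last by rewrite !ffunE.
rewrite [X in _ - (_ + X)](eq_bigr (fun a => (g (src a))%:Z * (b (tgt a))%:Z)) => [|a _]; last by rewrite !ffunE mulrC.
ring.
Qed.

Lemma row_freeI (m n : nat) (P : 'M[k]_(m, n)) R : P *m R = 1%:M -> row_free P.
Proof. by move=> h; apply/row_freeP; exists R. Qed.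

(** An endomorphism neither 0 nor invertible has its image and kernel as subrepresentations, of
    complementary dimensions [b] and [g]; the generic inequalities for the two add up to a
    nonnegative value of [bf] at [b], [g]. *)
Theorem generic_brick (d : V -> nat) :
  (forall b g : V -> nat, (forall v, b v + g v = d v)%N -> (exists v, 0 < b v)%N -> (exists v, 0 < g v)%N ->
     bf src tgt (nz b) (nz g) < 0) ->
  exists X : tmod k (V + A), [/\ qmod src tgt X, qdim X = d &
    forall h, @thom k _ X X h -> h = 0 \/ h \in unitmx].
Proof.
move=> hd; have [x hx0] := generic_subs k src tgt d.
have hx : forall (Y : tmod k (V + A)) (P : 'M[k]_(tsz Y, tsz (nf src tgt x))),
  @thom k _ Y (nf src tgt x) P -> row_free P ->
  (forall v, (qdim Y v <= d v)%N) /\ 0 <= ef src tgt (qdim Y) (fun v => d v - qdim Y v)%N := hx0.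
have qX := nf_qmod src tgt x; have dX := qdim_nf src tgt x.
move: hx qX dX; move: (nf src tgt x) => X hx qX dX {x hx0}.
exists X; split=> // h hh; have [h0|h0] := eqVneq h 0; first by left.
right; apply: contrapT => /negP uh.
have [q1 q2 q3] := qX.
have [r [P [C [R [L [CP PR LC rE]]]]]] := rank_factor h.
pose Y : tmod k (V + A) := TMod (fun t => L *m X t *m C).
have hP : @thom k _ Y X P.
  move=> t; rewrite /= -mulmxA CP -mulmxA hh -CP !mulmxA LC mul1mx //.
have [bd be] := hx Y P hP (row_freeI PR).
have [s [Kb [Kr [KR Kh inK]]]] : exists s (Kb : 'M[k]_(s, tsz X)) Kr, [/\ Kb *m Kr = 1%:M, Kb *m h = 0 &
    forall m (u : 'M[k]_(m, tsz X)), u *m h = 0 -> u *m Kr *m Kb = u].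
  exists (\rank (kermx h)), (row_base (kermx h)), (pinvmx (row_base (kermx h))); split.
  - by rewrite mulmxVp // row_base_free.
  - by apply/sub_kermxP; rewrite eq_row_base.
  - by move=> m u uh0; rewrite mulmxKpV // eq_row_base; apply/sub_kermxP.
have fK := row_freeI KR.
pose Z : tmod k (V + A) := TMod (fun t => Kb *m X t *m Kr).
have hZ : @thom k _ Z X Kb.
  by move=> t; rewrite /= inK // -mulmxA hh mulmxA Kh mul0mx.
have [gd ge] := hx Z Kb hZ fK.
have dim v : (qdim Y v + qdim Z v = d v)%N.
  rewrite -dX [qdim X v]/qdim -(mxrank_mul_ker (X (inl v)) h); congr (_ + _)%N.
    have EC : X (inl v) *m C = C *m (P *m X (inl v) *m R).
      transitivity (X (inl v) *m h *m R); first by rewrite -CP -!mulmxA PR mulmx1.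
      by rewrite hh -CP !mulmxA.
    have -> : X (inl v) *m h = C *m (L *m X (inl v) *m C) *m P.
      by rewrite -(mulmxA L) EC (mulmxA L) LC mul1mx -EC -mulmxA CP.
    rewrite mxrankMfree ?(row_freeI PR) // -[RHS]mxrank_tr trmx_mul mxrankMfree ?mxrank_tr //.
    by apply: (@row_freeI _ _ _ L^T); rewrite -trmx_mul LC trmx1.
  rewrite /qdim /= -(mxrankMfree _ fK) inK; last by rewrite -mulmxA hh mulmxA Kh mul0mx.
  apply/eqP; rewrite eqn_leq; apply/andP; split; apply: mxrankS.
    rewrite sub_capmx submxMl /=; apply/sub_kermxP; by rewrite -mulmxA hh mulmxA Kh mul0mx.
  apply/rV_subP=> u; rewrite sub_capmx => /andP[/submxP[w e] /sub_kermxP uh0].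
  have uE : u *m X (inl v) = u by rewrite e -mulmxA q1 eqxx.
  have -> : u = u *m Kr *m (Kb *m X (inl v)) by rewrite mulmxA inK.
  exact: submxMl.
have e1 : (fun v => d v - qdim Y v)%N = qdim Z by apply: funext => v; rewrite -dim addKn.
have e2 : (fun v => d v - qdim Z v)%N = qdim Y by apply: funext => v; rewrite -dim addnK.
have ne0 (W : tmod k (V + A)) : ~ (exists v, (0 < qdim W v)%N) -> forall v, W (inl v) = 0.
  move=> nW v; apply/eqP; rewrite -mxrank_eq0 -/(qdim W v) -leqn0 leqNgt; apply/negP=> lt.
  by apply: nW; exists v.
have : bf src tgt (nz (qdim Y)) (nz (qdim Z)) < 0.
  apply: hd => //; apply: contrapT => /ne0 W0.
    case/negP: h0; apply/eqP; rewrite -CP -[C]mulmx1 -LC -[L]mulmx1 -q2 mulmx_sumr mulmx_suml mulmx_sumr.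
    rewrite mulmx_suml big1 // => v _; have := W0 v; rewrite /= => ->.
    by rewrite mulmx0 mul0mx.
  have K0 : Kb = 0.
    rewrite -[Kb]mul1mx -KR -[Kb in X in X *m _]mulmx1 -q2 mulmx_sumr !mulmx_suml big1 // => v _.
    by have := W0 v; rewrite /= => ->; rewrite mul0mx.
  case/negP: uh; rewrite -row_free_unit -kermx_eq0; apply/eqP.
  by rewrite -(inK _ (kermx h) (mulmx_ker _)) K0 mulmx0.
by rewrite e1 in be; rewrite e2 in ge; rewrite bf_ef ltNge addr_ge0.
Qed.

Theorem Ex_generic (d : V -> nat) : (exists v, 0 < d v)%N ->
  (forall b g : V -> nat, (forall v, b v + g v = d v)%N -> (exists v, 0 < b v)%N -> (exists v, 0 < g v)%N ->
     bf src tgt (nz b) (nz g) < 0) -> Ex k src tgt d.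
Proof.
move=> [v dv] /generic_brick[X [qX dX hX]]; exists X; split=> //; split.
  by rewrite (qmod_sz qX) dX (bigD1 v) //= addn_gt0 dv.
move=> e he ee; case: (hX e he) => [->|ue]; [by left|right].
by have := congr1 (mulmx (invmx e)) ee; rewrite mulKmx // mulVmx.
Qed.

End GenericBrick.

(** * Isotropic dimension vectors *)

Section SelfExtension.
Variables (k : closedFieldType) (V A : finType) (src tgt : A -> V).

(** The [xi] for which the self-extension of [X] with off-diagonal block [xi] splits. *)
Definition cobound (X : tmod k (V + A)) (xi : A -> 'M[k]_(tsz X)) := exists2 h : 'M[k]_(tsz X),
  (forall v, X (inl v) *m h = h *m X (inl v)) & forall a, xi a = X (inr a) *m h - h *m X (inr a).

(** As the Euler form vanishes, the commutator map [De] goes between spaces of equal dimension; it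
    kills the identity, so it is not onto. *)
Lemma noncobound_nf d (x : A -> 'M[k]_(stdsz d)) : (exists v, 0 < d v)%N ->
  0 <= ef src tgt d d -> (ef src tgt d d <= 0) ->
  exists2 xi : A -> 'M[k]_(tsz (nf src tgt x)), 
    (forall a, nf src tgt x (inl (src a)) *m xi a *m nf src tgt x (inl (tgt a)) = xi a) &
    ~ cobound xi.
Proof.
move=> [v0 dv0] ef1 ef2; pose N := stdsz d; pose X := nf src tgt x.
have EE v (i j : 'I_N) : X (inl v) i j = ((i == j) && (vt i == v))%:R by apply: stdE.
have EM v (M : 'M[k]_N) i j : (X (inl v) *m M) i j = (vt i == v)%:R * M i j.
  rewrite mxE (bigD1 i) //= EE eqxx big1 ?addr0 // => h nh; by rewrite EE eq_sym (negPf nh) mul0r.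
have ME v (M : 'M[k]_N) i j : (M *m X (inl v)) i j = M i j * (vt j == v)%:R.
  rewrite mxE (bigD1 j) //= EE eqxx big1 ?addr0 // => h nh; by rewrite EE (negPf nh) mulr0.
pose H : finType := {p : 'I_N * 'I_N | vt p.1 == vt p.2}.
pose O : finType := Omega src tgt d.
have cH : #|H| = (\sum_v d v * d v)%N.
  rewrite card_sig -sum1_card (partition_big (fun p => vt p.1) xpredT) //=.
  apply: eq_bigr => v _; rewrite -(card_vt d v) -cardsX -sum1_card; apply: eq_bigl => -[i j].
  by rewrite !inE /= andbC; case: eqP => // ->; rewrite eq_sym.
have cO : #|O| = (\sum_a d (src a) * d (tgt a))%N.
  rewrite card_sig -sum1_card (partition_big (fun o => o.1) xpredT) //=.
  apply: eq_bigr => a _; rewrite -(card_vt d (src a)) -(card_vt d (tgt a)) -cardsX -sum1_card.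
  rewrite (reindex (fun p : 'I_N * 'I_N => (a, p))) /=; last first.
    by exists (fun o => o.2) => [p|[b p]] //=; rewrite inE => /andP[_ /eqP /= ->].
  by apply: eq_bigl => -[i j]; rewrite !inE /inOm /= eqxx andbT.
have cHO : #|H| = #|O| by move: ef1 ef2; rewrite /ef -cH -cO; lia.
pose hmat (u : H -> k) : 'M[k]_N := \matrix_(i, j) (if insub (i, j) is Some p then u p else 0).
pose De (u : H -> k) (o : O) : k :=
  (X (inr (val o).1) *m hmat u - hmat u *m X (inr (val o).1)) (val o).2.1 (val o).2.2.
have hmatD c u w : hmat (fun p => c * u p + w p) = c *: hmat u + hmat w.
  by apply/matrixP=> i j; rewrite !mxE; case: insubP => [p|]; rewrite ?mulr0 ?addr0.
have DeD c u w o : De (fun p => c * u p + w p) o = c * De u o + De w o.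
  rewrite /De hmatD mulmxDr mulmxDl -scalemxAr -scalemxAl.
  rewrite opprD addrACA -scalerBr; by rewrite mxE [X in X + _]mxE.
have hmat_onto (h : 'M[k]_N) : (forall v, X (inl v) *m h = h *m X (inl v)) ->
    exists u, hmat u = h.
  move=> ch; exists (fun p => h (val p).1 (val p).2); apply/matrixP=> i j; rewrite mxE.
  case: insubP => [p _ ->|] //=; move=> ne.
  have := congr1 (fun M : 'M_N => M i j) (ch (vt i)); rewrite EM ME eqxx mul1r => ->.
  by rewrite eq_sym (negPf ne) mulr0.
pose M : 'M[k]_(#|H|, #|O|) := \matrix_(i, j) De (fun p => (p == enum_val i)%:R) (enum_val j).
have De0 o : De (fun=> 0) o = 0.
  have := DeD (-1) (fun=> 0) (fun=> 0) o.
  rewrite (_ : (fun p : H => _) = fun=> 0); last by apply: funext => p; rewrite mulr0 addr0.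
  by rewrite mulN1r addNr.
have De_sum u o : De u o = \sum_i u (enum_val i) * M i (enum_rank o).
  have h (s : seq 'I_#|H|) : De (fun p => \sum_(i <- s) u (enum_val i) * (p == enum_val i)%:R) o =
      \sum_(i <- s) u (enum_val i) * M i (enum_rank o).
    elim: s => [|i s IH]; first by rewrite big_nil -[RHS](De0 o); congr (De _ o); apply: funext => p; rewrite big_nil.
    rewrite big_cons -IH mxE enum_rankK -DeD; congr (De _ o); apply: funext => p; by rewrite big_cons.
  rewrite -h; congr (De _ o); apply: funext => p.
  rewrite (bigD1 (enum_rank p)) //= enum_rankK eqxx mulr1 big1 ?addr0 // => i ni.
  case: eqP => [e|_]; last by rewrite mulr0.
  by rewrite e enum_valK eqxx in ni.
have nf : ~~ row_full M.
  rewrite /row_full; apply/negP=> /eqP rM.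
  have : row_free M by rewrite /row_free rM cHO.
  move/row_free_inj => inj.
  have [u1 hu1] := hmat_onto 1%:M (fun v => etrans (mulmx1 _) (esym (mul1mx _))).
  pose U : 'rV[k]_#|H| := \row_i u1 (enum_val i).
  have U0 : U = 0.
    apply: inj; rewrite mul0mx; apply/rowP=> j; rewrite !mxE.
    under eq_bigr => i _ do rewrite mxE.
    rewrite -[j]enum_valK -De_sum /De hu1 mulmx1 mul1mx subrr mxE //.
  have [i0 _] : exists i0 : 'I_N, vt i0 == v0.
    have := card_vt d v0; case: (pickP (fun i : 'I_N => vt i == v0)) => [i hi _|h0 e]; first by exists i.
    have e0 : #|[set i : 'I_N | vt i == v0]| = 0%N by apply/eqP; rewrite cards_eq0; apply/eqP/setP=> i; rewrite !inE h0.
    by rewrite -e e0 in dv0.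
  have := congr1 (fun M : 'M_N => M i0 i0) hu1; rewrite !mxE eqxx.
  case: insubP => [p _ e|]; last by rewrite /= eqxx.
  have := congr1 (fun W : 'rV_ _ => W 0 (enum_rank p)) U0; rewrite !mxE enum_rankK => -> /eqP.
  by rewrite eq_sym oner_eq0.
have [w hw] : exists w : 'rV[k]_#|O|, ~~ (w <= M)%MS.
  apply: contrapT => h; case/negP: nf; rewrite -sub1mx; apply/row_subP=> i.
  by apply: contrapT => /negP hi; apply: h; exists (row i 1%:M).
exists (fun a => xmat (fun o => w 0 (enum_rank o)) a).
  move=> a; apply/matrixP=> i j; rewrite ME EM mxE; case: insubP => [o|]; rewrite ?mulr0 ?mul0r //.
  by rewrite /inOm /= => /andP[-> ->] _; rewrite mul1r mulr1.
move=> [h ch hx]; have [u hu] := hmat_onto h ch.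
case/negP: hw; apply/submxP; exists (\row_i u (enum_val i)); apply/rowP=> j; rewrite mxE.
under eq_bigr => i _ do rewrite mxE.
rewrite -[j]enum_valK -De_sum; move: (enum_val j) => o0.
have := congr1 (fun M : 'M_N => M (val o0).2.1 (val o0).2.2) (hx (val o0).1).
rewrite mxE; case: insubP => [o _ e|]; last by case/negP; case: o0 => -[a [i i']].
have -> : o = o0 by apply: val_inj; rewrite e; case: (val o0) => ? [].
by move=> ->; rewrite /De hu.
Qed.

End SelfExtension.

Section Uniserial.
Variables (k : closedFieldType) (V A : finType) (src tgt : A -> V).
Variable Y : tmod k (V + A).
Hypothesis qY : qmod src tgt Y.
Hypothesis brick : forall h, @thom k _ Y Y h -> h = 0 \/ h \in unitmx.
Hypothesis Y0 : (0 < tsz Y)%N.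
Variable xi : A -> 'M[k]_(tsz Y).
Hypothesis xiE : forall a, Y (inl (src a)) *m xi a *m Y (inl (tgt a)) = xi a.
Hypothesis nc : ~ cobound xi.
Variable t : nat.
Local Notation N := (tsz Y).
Local Notation B := (stdsz (fun _ : 'I_t => N)).
Local Notation Pm i := (stdP k (fun _ : 'I_t => N) i : 'M[k]_(N, B)).
Local Notation Cm i := ((stdP k (fun _ : 'I_t => N) i)^T : 'M[k]_(B, N)).

Lemma brick_scalar h : @thom k _ Y Y h -> exists c, h = c%:M.
Proof.
move=> hh; have sz : size (char_poly h) != 1%N by rewrite size_char_poly; case: (tsz Y) Y0.
have /closed_rootP[c] := sz; rewrite -eigenvalue_root_char => ec; exists c.
have hc : @thom k _ Y Y (h - c%:M).
  by apply: thomB => //; rewrite -scalemx1; apply/thomZ/thom1.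
case: (brick hc) => [/eqP|u]; first by rewrite subr_eq0 => /eqP.
by move: ec; rewrite /eigenvalue /eigenspace kermx_eq0 row_free_unit u.
Qed.

Definition nxt (i j : 'I_t) : bool := (i.+1 == j)%N.

(* The iterated self-extension of [Y] by [xi]: [Y] on the diagonal, [xi] above it. *)
Definition umod : tmod k (V + A) := TMod (fun s => match s with
  | inl v => \sum_i Cm i *m Y (inl v) *m Pm i
  | inr a => \sum_i Cm i *m Y (inr a) *m Pm i + \sum_i \sum_(j | nxt i j) Cm i *m xi a *m Pm j end).

Lemma PmCm i j : Pm i *m Cm j = (i == j)%:R%:M.
Proof.
have [h1 h2 _] := stdsys k (fun _ : 'I_t => N).
case: eqP => [->|/eqP ne]; first exact: h1.
by rewrite raddf0; apply: h2.
Qed.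

Lemma sumCmPm : \sum_i Cm i *m Pm i = 1%:M.
Proof. by have [_ _ h3] := stdsys k (fun _ : 'I_t => N). Qed.

Lemma blockM i j l m (F G : 'M[k]_N) :
  (Cm i *m F *m Pm j) *m (Cm l *m G *m Pm m) = if j == l then Cm i *m (F *m G) *m Pm m else 0.
Proof.
have -> : (Cm i *m F *m Pm j) *m (Cm l *m G *m Pm m) = Cm i *m F *m (Pm j *m Cm l) *m G *m Pm m by rewrite !mulmxA.
rewrite PmCm; case: eqP => _; last by rewrite raddf0 mulmx0 !mul0mx.
by rewrite mulmx1 !mulmxA.
Qed.

Lemma umodv (v w : V) : umod (inl v) *m umod (inl w) = if v == w then umod (inl v) else 0.
Proof.
have [q1 _ _] := qY; rewrite /= mulmx_suml.
transitivity (\sum_i Cm i *m (Y (inl v) *m Y (inl w)) *m Pm i).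
  apply: eq_bigr => i _; rewrite mulmx_sumr (bigD1 i) //= blockM eqxx big1 ?addr0 // => j nj.
  by rewrite blockM eq_sym (negPf nj).
rewrite q1; case: eqP => // _; by rewrite big1 // => i _; rewrite mulmx0 mul0mx.
Qed.

Lemma PumodV i v : Pm i *m umod (inl v) = Y (inl v) *m Pm i.
Proof.
rewrite /= mulmx_sumr (bigD1 i) //= !mulmxA PmCm eqxx mul1mx big1 ?addr0 // => j nj.
by rewrite !mulmxA PmCm eq_sym (negPf nj) raddf0 !mul0mx.
Qed.

Lemma umodVC j v : umod (inl v) *m Cm j = Cm j *m Y (inl v).
Proof.
rewrite /= mulmx_suml (bigD1 j) //= -!mulmxA PmCm eqxx mulmx1 big1 ?addr0 // => i ni.
by rewrite -!mulmxA PmCm (negPf ni) raddf0 !mulmx0.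
Qed.

Lemma umodVM v i j (F : 'M[k]_N) : umod (inl v) *m (Cm i *m F *m Pm j) = Cm i *m (Y (inl v) *m F) *m Pm j.
Proof. by rewrite 2!(mulmxA (umod _)) umodVC !mulmxA. Qed.

Lemma MumodV v i j (F : 'M[k]_N) : (Cm i *m F *m Pm j) *m umod (inl v) = Cm i *m (F *m Y (inl v)) *m Pm j.
Proof. by rewrite -(mulmxA _ (Pm j)) PumodV !mulmxA. Qed.

Lemma umod_qmod : qmod src tgt umod.
Proof.
have [q1 q2 q3] := qY; split; first exact: umodv.
  rewrite exchange_big /= -sumCmPm; apply: eq_bigr => i _.
  by rewrite -mulmx_suml -mulmx_sumr q2 mulmx1.
move=> a; have h1 := umodVM (src a); have h2 := MumodV (tgt a).
rewrite [umod (inr _)]/=; move: (umod (inl (src a))) (umod (inl (tgt a))) h1 h2 => U1 U2 h1 h2.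
rewrite mulmxDr mulmxDl; congr (_ + _).
  rewrite mulmx_sumr mulmx_suml; apply: eq_bigr => i _.
  by rewrite h1 h2 q3.
rewrite mulmx_sumr mulmx_suml; apply: eq_bigr => i _.
rewrite mulmx_sumr mulmx_suml; apply: eq_bigr => j _.
by rewrite h1 h2 xiE.
Qed.

Lemma umod_qdim v : qdim umod v = (t * qdim Y v)%N.
Proof.
rewrite /qdim /= rank_idem_sum => [|i j]; last first.
  rewrite blockM; case: eqP => [->|_] //; by have [-> _ _] := qY; rewrite eqxx.
rewrite (eq_bigr (fun=> \rank (Y (inl v)))) ?sum_nat_const ?card_ord // => i _.
rewrite -(@rank_sandwich _ _ _ _ (Cm i) (Pm i)) //.
by rewrite !PmCm eqxx mul1mx mulmx1.
Qed.

Section Endo.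
Variable e : 'M[k]_B.
Hypothesis he : @thom k _ umod umod e.
Definition eb (i j : 'I_t) : 'M[k]_N := Pm i *m e *m Cm j.

Lemma PumodA i a : Pm i *m umod (inr a) = Y (inr a) *m Pm i + \sum_(j | nxt i j) xi a *m Pm j.
Proof.
rewrite /= mulmxDr; congr (_ + _).
  rewrite mulmx_sumr (bigD1 i) //= !mulmxA PmCm eqxx mul1mx big1 ?addr0 // => j nj.
  by rewrite !mulmxA PmCm eq_sym (negPf nj) raddf0 !mul0mx.
rewrite mulmx_sumr (bigD1 i) //= [X in _ + X]big1 ?addr0 => [|l nl]; last first.
  by rewrite mulmx_sumr big1 // => j _; rewrite !mulmxA PmCm eq_sym (negPf nl) raddf0 !mul0mx.
by rewrite mulmx_sumr; apply: eq_bigr => j _; rewrite !mulmxA PmCm eqxx mul1mx.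
Qed.

Lemma umodAC j a : umod (inr a) *m Cm j = Cm j *m Y (inr a) + \sum_(i | nxt i j) Cm i *m xi a.
Proof.
rewrite /= mulmxDl; congr (_ + _).
  rewrite mulmx_suml (bigD1 j) //= -!mulmxA PmCm eqxx mulmx1 big1 ?addr0 // => i ni.
  by rewrite -!mulmxA PmCm (negPf ni) raddf0 !mulmx0.
rewrite mulmx_suml [RHS]big_mkcond; apply: eq_bigr => i _.
rewrite mulmx_suml; case: ifPn => ij.
  rewrite (bigD1 j) //= -!mulmxA PmCm eqxx mulmx1 big1 ?addr0 // => l /andP[_ nl].
  by rewrite -!mulmxA PmCm (negPf nl) raddf0 !mulmx0.
rewrite big1 // => l il; rewrite -!mulmxA PmCm; case: eqP => [el|_]; last by rewrite raddf0 !mulmx0.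
by rewrite -el il in ij.
Qed.

Lemma eb_vert i j v : Y (inl v) *m eb i j = eb i j *m Y (inl v).
Proof.
have : Pm i *m (umod (inl v) *m e) *m Cm j = Pm i *m (e *m umod (inl v)) *m Cm j by rewrite he.
have h1 := PumodV i v; have h2 := umodVC j v; move: (umod (inl v)) h1 h2 => U h1 h2.
by rewrite (mulmxA (Pm i) U) h1 -(mulmxA (Pm i)) -(mulmxA e) h2 /eb !mulmxA.
Qed.

Lemma eb_arrow i j a : Y (inr a) *m eb i j - eb i j *m Y (inr a) =
  \sum_(l | nxt l j) eb i l *m xi a - \sum_(l | nxt i l) xi a *m eb l j.
Proof.
have : Pm i *m (umod (inr a) *m e) *m Cm j = Pm i *m (e *m umod (inr a)) *m Cm j by rewrite he.
have h1 := PumodA i a; have h2 := umodAC j a; move: (umod (inr a)) h1 h2 => U h1 h2.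
rewrite (mulmxA (Pm i) U) h1 -(mulmxA (Pm i)) -(mulmxA e) h2 !(mulmxDl, mulmxDr).
rewrite !mulmx_suml !mulmx_sumr => h.
have -> : \sum_(l | nxt l j) eb i l *m xi a = \sum_(l | nxt l j) Pm i *m (e *m (Cm l *m xi a)).
  by apply: eq_bigr => l _; rewrite /eb !mulmxA.
have -> : \sum_(l | nxt i l) xi a *m eb l j = \sum_(l | nxt i l) xi a *m Pm l *m e *m Cm j.
  by apply: eq_bigr => l _; rewrite /eb !mulmxA.
have -> : Y (inr a) *m eb i j = Y (inr a) *m Pm i *m e *m Cm j by rewrite /eb !mulmxA.
have -> : eb i j *m Y (inr a) = Pm i *m (e *m (Cm j *m Y (inr a))) by rewrite /eb !mulmxA.
move: h; move: (_ *m Cm j) (Pm i *m _) (\sum_(_ | _) _) (\sum_(_ | _) _) => a1 a2 b1 b2 h.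
by rewrite -[a1](addrK b2) h addrAC [a2 + b1]addrC addrK.
Qed.

Lemma eb_scalar i j : (forall a, \sum_(l | nxt l j) eb i l *m xi a = \sum_(l | nxt i l) xi a *m eb l j) ->
  exists c, eb i j = c%:M.
Proof.
move=> h; apply: brick_scalar => -[v|a]; first exact: eb_vert.
by apply/eqP; rewrite -subr_eq0 eb_arrow h subrr.
Qed.

Lemma eb_cobound i j c : (forall a, \sum_(l | nxt l j) eb i l *m xi a - \sum_(l | nxt i l) xi a *m eb l j = c *: xi a) ->
  c = 0.
Proof.
move=> h; apply/eqP; apply: contrapT => /negP c0; apply: nc; exists (c^-1 *: eb i j) => [v|a].
  by rewrite -scalemxAr -scalemxAl eb_vert.
by rewrite -scalemxAr -scalemxAl -scalerBr eb_arrow h scalerA mulVf ?scale1r.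
Qed.

Lemma sum_nxt_r (M : zmodType) (i l : 'I_t) (F : 'I_t -> M) : (i.+1 = l)%N -> \sum_(j | nxt i j) F j = F l.
Proof. by move=> il; apply: big_pred1 => j; rewrite /nxt il; apply/eqP/eqP => [/val_inj|->]. Qed.

Lemma sum_nxt_l (M : zmodType) (i l : 'I_t) (F : 'I_t -> M) : (i.+1 = l)%N -> \sum_(j | nxt j l) F j = F i.
Proof. by move=> il; apply: big_pred1 => j; rewrite /nxt -il eqSS; apply/eqP/eqP => [/val_inj|->]. Qed.

Lemma eb_diag s : (forall i j : 'I_t, (i = j + s.+1 :> nat)%N -> eb i j = 0) ->
  forall i j : 'I_t, (i = j + s :> nat)%N -> exists c, eb i j = c%:M.
Proof.
move=> h i j ij; apply: eb_scalar => a; rewrite !big1 // => l /eqP hl.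
  by rewrite h ?mulmx0 // -hl ij addnS.
by rewrite h ?mul0mx // ij -hl addnS addSn.
Qed.

(** From the farthest subdiagonal inwards: the entries on the [s]-th one are scalars, since
    everything below vanishes, and the equation for the position just above such an entry exhibits
    its scalar times [xi], up to sign, as a coboundary. *)
Lemma eb_lower s : (0 < s)%N -> forall i j : 'I_t, (i = j + s :> nat)%N -> eb i j = 0.
Proof.
have [u le] : exists u, (t <= s + u)%N by exists t; rewrite leq_addl.
elim: u s le => [|u IH] s le s0 i j ij.
  by have := ltn_ord i; rewrite ij; lia.
have hd := eb_diag (IH s.+1 ltac:(lia) isT).
(* Along a subdiagonal one proceeds by columns: the preceding entry, absent in the first column and
   otherwise known to vanish, contributes the other term of the equation. *)
elim: {j}(j : nat) {-2}j (erefl (j : nat)) i ij => [|m IHm] j jm i ij; have [c hc] := hd i j ij.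
  have i'P : (i.-1 < t)%N by have := ltn_ord i; lia.
  suff : - c = 0 by move/eqP; rewrite oppr_eq0 hc => /eqP ->; rewrite raddf0.
  apply: (@eb_cobound (Ordinal i'P) j) => a.
  rewrite big1 => [|l /eqP]; last by rewrite jm.
  by rewrite (@sum_nxt_r _ _ i) /= ?hc ?mul_mx_scalar ?sub0r ?scaleNr //; lia.
have i'P : (i.-1 < t)%N by have := ltn_ord i; lia.
suff : - c = 0 by move/eqP; rewrite oppr_eq0 hc => /eqP ->; rewrite raddf0.
apply: (@eb_cobound (Ordinal i'P) j) => a.
rewrite big1 => [|l /eqP hl]; last first.
  have lm : l = m :> nat by move: hl; rewrite jm => -[].
  by rewrite (IHm l lm) ?mul0mx //= lm; lia.
by rewrite (@sum_nxt_r _ _ i) /= ?hc ?mul_mx_scalar ?sub0r ?scaleNr //; lia.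
Qed.

(** The equation just above the diagonal makes the difference of consecutive diagonal scalars, times
    [xi], a coboundary. *)
Lemma eb_const (t0 : (0 < t)%N) : exists c, forall i, eb i i = c%:M.
Proof.
have hd := eb_diag (@eb_lower 1 isT).
have [c hc] := hd (Ordinal t0) (Ordinal t0) (esym (addn0 _)); exists c => i.
elim: {i}(i : nat) {-2}i (erefl (i : nat)) => [|m IHm] i im.
  by have -> : i = Ordinal t0 by apply: val_inj.
have m1 : (m < t)%N by have := ltn_ord i; lia.
have [c' hc'] := hd i i (esym (addn0 _)).
suff /eqP : c - c' = 0 by rewrite subr_eq0 hc' => /eqP ->.
apply: (@eb_cobound (Ordinal m1) i) => a.
rewrite (@sum_nxt_r _ _ i) /= ?im // (@sum_nxt_l _ (Ordinal m1)) /= ?im // IHm // hc'.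
by rewrite mul_mx_scalar mul_scalar_mx scalerBl.
Qed.

End Endo.

Lemma ebM e e' i j : eb (e *m e') i j = \sum_l eb e i l *m eb e' l j.
Proof.
rewrite /eb -[e in LHS]mulmx1 -sumCmPm mulmx_sumr mulmx_suml mulmx_sumr mulmx_suml.
by apply: eq_bigr => l _; rewrite !mulmxA.
Qed.

Lemma eb_eq0 e : (forall i j, eb e i j = 0) -> e = 0.
Proof.
move=> h; rewrite -[e]mul1mx -[1%:M *m e]mulmx1 -sumCmPm mulmx_sumr big1 // => j _.
rewrite mulmx_suml mulmx_suml big1 // => i _.
have -> : Cm i *m Pm i *m e *m (Cm j *m Pm j) = Cm i *m eb e i j *m Pm j by rewrite /eb !mulmxA.
by rewrite h mulmx0 mul0mx.
Qed.

Lemma eb_strict e : e *m e = e -> (forall i j : 'I_t, (j <= i)%N -> eb e i j = 0) -> e = 0.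
Proof.
move=> ee h; apply: eb_eq0 => i j.
have [s] := ubnP (j - i)%N; elim: s i j => // s IH i j lt.
have [le|lt'] := leqP j i; first exact: h.
rewrite -ee ebM big1 // => l _.
have [li|il] := leqP l i; first by rewrite h // mul0mx.
by rewrite [eb e l j]IH ?mulmx0 //; lia.
Qed.

Lemma idem_compl n (e : 'M[k]_n) : e *m e = e -> (1%:M - e) *m (1%:M - e) = 1%:M - e.
Proof. by move=> ee; rewrite mulmxBl mul1mx mulmxBr mulmx1 ee subrr subr0. Qed.

(** Endomorphisms are upper triangular with one scalar on the diagonal; so an idempotent or its
    complement is strictly triangular, and then 0. *)
Theorem umod_tindec (t0 : (0 < t)%N) : tindec umod.
Proof.
have B0 : (0 < B)%N.
  have := rank_leq_col (Pm (Ordinal t0)).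
  have : row_free (Pm (Ordinal t0)) by apply/row_freeP; exists (Cm (Ordinal t0)); rewrite PmCm eqxx.
  by rewrite /row_free => /eqP ->; apply: leq_trans.
split=> // e he ee.
have [c hc] := eb_const he t0.
have lo (i j : 'I_t) : (j < i)%N -> eb e i j = 0 by move=> lt; apply: (@eb_lower _ he (i - j)); lia.
have cc : c * c = c.
  have := ebM e e (Ordinal t0) (Ordinal t0); rewrite ee (bigD1 (Ordinal t0)) //= !hc.
  rewrite big1 ?addr0 => [|l nl]; last by rewrite (lo l) ?mulmx0 //= lt0n; apply: contra nl => /eqP h; apply/eqP/val_inj.
  rewrite -scalar_mxM => /(congr1 (fun M : 'M_N => M (Ordinal Y0) (Ordinal Y0))).
  by rewrite !mxE eqxx.
have [c0|c0] := eqVneq c 0.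
  left; apply: eb_strict => // i j; rewrite leq_eqVlt => /orP[/eqP/val_inj ->|/lo //].
  by rewrite hc c0 raddf0.
have c1 : c = 1 by apply: (mulfI c0); rewrite mulr1.
right; apply/eqP; rewrite eq_sym -subr_eq0; apply/eqP; apply: eb_strict.
  exact: idem_compl.
have e1 i j : eb (1%:M - e) i j = (i == j)%:R%:M - eb e i j by rewrite /eb mulmxBr mulmxBl mulmx1 PmCm.
move=> i j; rewrite leq_eqVlt e1 => /orP[/eqP/val_inj ->|lt]; first by rewrite eqxx hc c1 subrr.
by rewrite lo // subr0; case: eqP => [e2|_]; rewrite ?raddf0 //; move: lt; rewrite e2 ltnn.
Qed.

End Uniserial.

Section Isotropic.
Variables (k : closedFieldType) (V A : finType) (src tgt : A -> V).

Theorem Ex_isotropic (d : V -> nat) (m : nat) : (0 < m)%N -> (exists v, 0 < d v)%N ->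
  bf src tgt (nz d) (nz d) = 0 ->
  (forall b g : V -> nat, (forall v, b v + g v = d v)%N -> (exists v, 0 < b v)%N -> (exists v, 0 < g v)%N ->
     bf src tgt (nz b) (nz g) < 0) ->
  Ex k src tgt (fun v => m * d v)%N.
Proof.
move=> m0 d0 bf0 hd; have [X [qX dX bX]] := generic_brick k hd.
have := qmod_nf qX; rewrite dX => -[x iXx]; have [f [g [hf fg gf]]] := iXx.
have hg : @thom k _ (nf src tgt x) X g by apply: thomV gf.
have bY h : @thom k _ (nf src tgt x) (nf src tgt x) h -> h = 0 \/ h \in unitmx.
  move=> hh; have : @thom k _ X X (f *m h *m g) by apply: thomM hg; apply: thomM hh.
  move=> /bX[h0|u].
    have -> : h = g *m (f *m h *m g) *m f by rewrite !mulmxA gf mul1mx -mulmxA gf mulmx1.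
    by left; rewrite h0 mulmx0 mul0mx.
  right; suff /mulmx1_unit[] : h *m (g *m invmx (f *m h *m g) *m f) = 1%:M by [].
  have := mulmxV u; move: (invmx _) => w hw.
  have -> : h *m (g *m w *m f) = g *m (f *m h *m g *m w) *m f by rewrite !mulmxA gf mul1mx.
  by rewrite hw mulmx1.
have ef0 : ef src tgt d d = 0 by move: bf0; rewrite bf_ef; lia.
have [||xi xiE nc] := @noncobound_nf k V A src tgt d x d0; rewrite ?ef0 //.
have Y0 : (0 < tsz (nf src tgt x))%N.
  have [v dv] := d0; rewrite (qmod_sz (nf_qmod src tgt x)) qdim_nf (bigD1 v) //= addn_gt0 dv //.
exists (umod xi m); split.
- by apply: umod_qmod => //; apply: nf_qmod.
- exact: umod_tindec.
- by apply: funext => v; rewrite (umod_qdim (nf_qmod src tgt x)) qdim_nf.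
Qed.

End Isotropic.

(** * Positivity of symmetric forms and tame components *)

Section SymForm.
Variables (I : finType) (b : I -> I -> int).
Hypothesis bC : forall i j, b i j = b j i.
Hypothesis b0 : forall i j, i != j -> b i j <= 0.

Definition sf (x y : I -> int) : int := \sum_i \sum_j x i * b i j * y j.
(** Connectedness of [S] in the graph of [b], expressed by the absence of a cut, so that no paths
    have to be handled. *)
Definition cutconn (S : pred I) := forall P : pred I,
  (forall i j, S i -> S j -> b i j != 0 -> P i -> P j) -> forall i j, S i -> S j -> P i -> P j.
Local Notation br i j := ((b i j)%:~R : rat).
Definition spread (x t : I -> rat) : rat := \sum_i \sum_j br i j * x i * x j * (t i - t j) ^+ 2.

(* Kac's identity, for the vector with coordinates [x i * t i]. *)
Lemma spread_identity (x t : I -> rat) :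
  \sum_i \sum_j (x i * t i) * br i j * (x j * t j) =
  \sum_i t i ^+ 2 * (x i * \sum_j br i j * x j) - 2%:R^-1 * spread x t.
Proof.
pose U := \sum_i \sum_j br i j * x i * x j * t i ^+ 2.
have UE : U = \sum_i \sum_j br i j * x i * x j * t j ^+ 2.
  rewrite /U exchange_big; apply: eq_bigr => i _; apply: eq_bigr => j _; by rewrite bC; ring.
have -> : \sum_i t i ^+ 2 * (x i * \sum_j br i j * x j) = U.
  by apply: eq_bigr => i _; rewrite !mulr_sumr; apply: eq_bigr => j _; ring.
have -> : spread x t = U + U - 2%:R * \sum_i \sum_j (x i * t i) * br i j * (x j * t j).
  rewrite {2}UE /U /spread mulr_sumr -sumrN -!big_split /=; apply: eq_bigr => i _.
  rewrite mulr_sumr -sumrN -!big_split /=; apply: eq_bigr => j _; ring.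
by field.
Qed.

Lemma spread_le0 x t : (forall i, 0 <= x i) -> spread x t <= 0.
Proof.
move=> x0; apply: sumr_le0 => i _; apply: sumr_le0 => j _.
have [->|ne] := eqVneq i j; first by rewrite subrr expr0n mulr0.
rewrite -!mulrA; apply: mulr_le0_ge0; first by rewrite lerz0 b0.
by rewrite mulr_ge0 // mulr_ge0 // sqr_ge0.
Qed.

Lemma spread_eq0 x t : (forall i, 0 <= x i) -> spread x t = 0 ->
  cutconn (fun i => x i != 0) -> forall i j, x i != 0 -> x j != 0 -> t i = t j.
Proof.
move=> x0 s0 cc i j xi xj.
have h i' j' : br i' j' * x i' * x j' * (t i' - t j') ^+ 2 = 0.
  have t0 i1 j1 : br i1 j1 * x i1 * x j1 * (t i1 - t j1) ^+ 2 <= 0.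
    have [->|ne] := eqVneq i1 j1; first by rewrite subrr expr0n mulr0.
    rewrite -!mulrA; apply: mulr_le0_ge0; first by rewrite lerz0 b0.
    by rewrite mulr_ge0 // mulr_ge0 // sqr_ge0.
  apply/eqP; rewrite eq_le t0 /= -s0 /spread (bigD1 i') //= (bigD1 j') //= -addrA -{2}[br i' j' * _ * _ * _]addr0.
  rewrite lerD2l -[leRHS]addr0; apply: lerD; apply: sumr_le0 => // i1 _; exact: sumr_le0.
apply/eqP; rewrite eq_sym.
apply: (cc (fun j => t j == t i)) xi xj (eqxx _) => i1 j1 x1 x2 bn /eqP <-.
have /eqP := h i1 j1; rewrite !mulf_eq0 intr_eq0 (negPf bn) (negPf x1) (negPf x2) /= orbb subr_eq0 eq_sym.
by [].
Qed.

Lemma sf_ratr x y : (sf x y)%:~R = \sum_i \sum_j (x i)%:~R * br i j * (y j)%:~R.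
Proof.
rewrite /sf rmorph_sum; apply: eq_bigr => i _; rewrite rmorph_sum; apply: eq_bigr => j _.
by rewrite !rmorphM.
Qed.

Variable x : I -> int.
Hypothesis x0 : forall i, 0 <= x i.
Local Notation xr i := ((x i)%:~R : rat).
Let xr0 i : 0 <= xr i. Proof. by rewrite ler0z. Qed.

Lemma ratio (z : I -> int) i : (x i = 0 -> z i = 0) -> xr i * ((z i)%:~R / xr i) = (z i)%:~R.
Proof.
have [->|xi] := eqVneq (x i) 0 => h; first by rewrite h // mul0r.
by rewrite mulrC divfK // intr_eq0.
Qed.

Lemma proportional (z : I -> int) : (forall i, x i = 0 -> z i = 0) ->
  spread (fun i => xr i) (fun i => (z i)%:~R / xr i) = 0 -> cutconn (fun i => x i != 0) ->
  forall i j, z i * x j = z j * x i.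
Proof.
move=> zx s0 cc i j.
have [xi|xi] := eqVneq (x i) 0; first by rewrite xi zx // mulr0 mul0r.
have [xj|xj] := eqVneq (x j) 0; first by rewrite xj (zx j) // mulr0 mul0r.
have cc' : cutconn (fun i => xr i != 0).
  move=> P hP i1 j1; rewrite !intr_eq0; apply: cc => i2 j2 h1 h2.
  by apply: hP; rewrite intr_eq0.
have := spread_eq0 xr0 s0 cc' (i := i) (j := j); rewrite !intr_eq0 => /(_ xi xj) e.
by move/eqP: e; rewrite eqr_div ?intr_eq0 // -!intrM eqr_int => /eqP.
Qed.

(** With [t = z / x] the value is the sum of the [t (1 - t) x (B x)] plus half the spread of [t],
    and all terms are nonpositive. Equality makes [t] constant on the connected support, strictly
    between 0 and 1 by the last two hypotheses, and then forces [B x = 0] there. *)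
Lemma sf_decomp z : (forall i, 0 < x i -> \sum_j b i j * x j <= 0) -> (forall i, 0 <= z i <= x i) ->
  sf z (fun i => x i - z i) <= 0 /\
  (sf z (fun i => x i - z i) = 0 -> cutconn (fun i => x i != 0) -> (exists i, 0 < z i) -> (exists i, z i < x i) ->
   (forall i j, z i * x j = z j * x i) /\ forall i, 0 < x i -> \sum_j b i j * x j = 0).
Proof.
move=> hx hz; pose t i : rat := (z i)%:~R / xr i.
have zx i : x i = 0 -> z i = 0 by move=> xi; have := hz i; rewrite xi; lia.
have zE i : (z i)%:~R = xr i * t i by rewrite ratio //; apply: zx.
pose X i : rat := (\sum_j b i j * x j)%:~R.
have XE i : X i = \sum_j br i j * xr j.
  by rewrite /X rmorph_sum; apply: eq_bigr => j _; rewrite rmorphM.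
have e : (sf z (fun i => x i - z i))%:~R = \sum_i t i * (1 - t i) * (xr i * X i) + 2%:R^-1 * spread (fun i => xr i) t.
  have -> : (sf z (fun i => x i - z i))%:~R = \sum_i t i * (xr i * X i) - \sum_i \sum_j (xr i * t i) * br i j * (xr j * t j).
    rewrite sf_ratr -sumrB; apply: eq_bigr => i _; rewrite XE 2!mulr_sumr -sumrB; apply: eq_bigr => j _.
    by rewrite intrB !zE; move: (t i) (t j) => t1 t2; ring.
  rewrite spread_identity opprD opprK addrA; congr (_ + _); rewrite -sumrB.
  by apply: eq_bigr => i _; rewrite -XE; ring.
have t01 i : 0 < x i -> 0 <= t i <= 1.
  move=> xi; have xi' : 0 < xr i by rewrite ltr0z.
  have /andP[z0 z1] := hz i; rewrite /t divr_ge0 ?ler0z //= ler_pdivrMr // mul1r ler_int //.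
have T0 i : t i * (1 - t i) * (xr i * X i) <= 0.
  have [xi|xi] := eqVneq (x i) 0; first by rewrite xi mul0r mulr0.
  have xp : 0 < x i by rewrite lt_neqAle eq_sym xi x0.
  have /andP[h1 h2] := t01 i xp; apply: mulr_ge0_le0; first by rewrite mulr_ge0 // subr_ge0.
  by apply: mulr_ge0_le0 => //; rewrite lerz0 hx.
have S0 := spread_le0 t xr0.
have T1 : \sum_i t i * (1 - t i) * (xr i * X i) <= 0 by apply: sumr_le0.
split.
  rewrite -(lerz0 rat) e; move: T1 S0; lra.
move=> e0 cc [i1 zi1] [i2 zi2]; move: e; rewrite e0 => e.
have s0 : spread (fun i => xr i) t = 0 by move: e T1 S0; lra.
have pr := proportional zx s0 cc; split=> // i xi.
have s1 : \sum_i t i * (1 - t i) * (xr i * X i) = 0 by move: e; rewrite s0; lra.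
have ti : t i * (1 - t i) * (xr i * X i) = 0.
  apply/eqP; rewrite eq_le T0 /= -s1 (bigD1 i) //= -{2}[t i * _ * _]addr0 lerD2l.
  by apply: sumr_le0.
have xr0' : xr i != 0 by rewrite intr_eq0 gt_eqF.
clearbody t; move/eqP: ti; rewrite !mulf_eq0 (negPf xr0') /= => /orP[/orP[]|].
- move=> /eqP ti; have zi : z i = 0 by apply: (@intr_inj rat); rewrite zE ti mulr0.
  by have := pr i1 i; rewrite zi mul0r => /eqP; rewrite mulf_eq0 (gt_eqF zi1) (gt_eqF xi).
- rewrite subr_eq0 eq_sym => /eqP t1.
  have zi : z i = x i by apply: (@intr_inj rat); rewrite zE t1 mulr1.
  have := pr i2 i; rewrite zi [RHS]mulrC => /(mulIf (negbT (gt_eqF xi))) e2; by rewrite e2 ltxx in zi2.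
- by rewrite intr_eq0 => /eqP.
Qed.

(** When [B x] vanishes on the support, only minus half the spread is left of Kac's identity. *)
Lemma sf_tame z : (forall i, 0 < x i -> \sum_j b i j * x j = 0) -> (forall i, x i = 0 -> z i = 0) ->
  0 <= sf z z /\ (sf z z = 0 -> cutconn (fun i => x i != 0) -> forall i j, z i * x j = z j * x i).
Proof.
move=> hx zx; pose t i : rat := (z i)%:~R / xr i.
have e : (sf z z)%:~R = - (2%:R^-1 * spread (fun i => xr i) t).
  rewrite -[RHS]add0r; transitivity (\sum_i \sum_j (xr i * t i) * br i j * (xr j * t j)).
    rewrite sf_ratr; apply: eq_bigr => i _; apply: eq_bigr => j _; by rewrite !ratio //; apply: zx.
  rewrite spread_identity big1 // => i _.
  have [->|xi] := eqVneq (x i) 0; first by rewrite mul0r mulr0.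
  have := hx i; rewrite lt_neqAle eq_sym xi x0 => /(_ isT) /(congr1 (fun z => z%:~R : rat)).
  rewrite rmorph_sum /= => h; rewrite [X in _ * (_ * X)](_ : _ = 0) ?mulr0 // -[RHS]h.
  by apply: eq_bigr => j _; rewrite rmorphM.
have S0 := spread_le0 t xr0; split.
  by rewrite -(ler0z rat) e; move: S0; lra.
move=> e0; move: e; rewrite e0 => e; apply: proportional => //; move: e; rewrite -/t; lra.
Qed.

End SymForm.

(** [t] is the gcd of the entries. No proper integral part of a primitive vector is proportional to
    it, so proportional decompositions are trivial. *)
Lemma primitive_ex (V : finType) (r : V -> nat) : (exists v, 0 < r v)%N ->
  exists t (d : V -> nat), [/\ (0 < t)%N, (exists v, 0 < d v)%N, r = (fun v => t * d v)%N &
    forall b g : V -> nat, (forall v, b v + g v = d v)%N -> (forall i j, b i * d j = b j * d i)%N ->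
      (forall v, b v = 0%N) \/ (forall v, g v = 0%N)].
Proof.
move=> [v0 rv0]; pose t := \big[gcdn/0%N]_v r v; pose d v := (r v %/ t)%N.
have tr v : (t %| r v)%N by apply: biggcdn_inf.
have t0 : (0 < t)%N by rewrite lt0n; apply: contraTneq (tr v0) => ->; rewrite dvd0n -lt0n.
have rE v : r v = (t * d v)%N by rewrite mulnC divnK.
have d0 v : (0 < r v)%N -> (0 < d v)%N by rewrite rE muln_gt0 => /andP[].
have g1 : \big[gcdn/0%N]_v d v = 1%N.
  apply/eqP; rewrite -(eqn_pmul2l t0) muln1 (big_morph (muln t) (muln_gcdr t) (muln0 t)).
  by apply/eqP; apply: eq_bigr => v _.
exists t, d; split=> //; first by exists v0; apply: d0.
  exact: funext.
move=> b g bg pr; case: (posnP (b v0)) => [b0|b0].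
  left=> v; have := pr v v0; rewrite b0 mul0n => /eqP; rewrite muln_eq0 => /orP[/eqP //|].
  by have := d0 _ rv0; case: (d v0).
right=> v; case: (posnP (d v)) => [dv|dv]; first by have := bg v; lia.
have : (d v %| b v)%N.
  rewrite -[b v]muln1 -g1 (big_morph (muln (b v)) (muln_gcdr _) (muln0 _)).
  by apply/dvdn_biggcdP=> j _; rewrite pr dvdn_mull.
have bv : (0 < b v)%N.
  rewrite lt0n; apply/eqP=> bv; have := pr v v0; rewrite bv mul0n => /esym/eqP; rewrite muln_eq0; lia.
by move=> /(dvdn_leq bv); have := bg v; lia.
Qed.

(** * Indecomposables supported on a tame component *)

Section Tame.
Variables (k : closedFieldType) (V A : finType) (src tgt : A -> V).
Hypothesis noloop : forall a, src a != tgt a.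
Local Notation bf := (bf src tgt).
Local Notation Ex := (Ex k src tgt).
Definition bm (v w : V) : int := bf (ev v) (ev w).

Lemma bmC v w : bm v w = bm w v. Proof. exact: bfC. Qed.

Lemma bm_le0 v w : v != w -> bm v w <= 0.
Proof.
move=> nvw; rewrite /bm bfe ffunE eq_sym (negPf nvw) mulr0 sub0r oppr_le0.
by apply: addr_ge0; apply: sumr_ge0 => a _; rewrite ffunE; case: eqP.
Qed.

Lemma bm_arrow a : bm (src a) (tgt a) != 0.
Proof.
rewrite lt_eqF // /bm bfe ffunE eq_sym (negPf (noloop a)) mulr0 sub0r oppr_lt0.
rewrite (bigD1 a) //= ffunE eqxx -addrA; apply: ltr_wpDr => //.
by apply: addr_ge0; apply: sumr_ge0 => b _; rewrite ffunE; case: eqP.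
Qed.

Lemma bf_bm x w : bf x (ev w) = \sum_v bm w v * x v.
Proof. by rewrite bfC bf_sum_ev. Qed.

Lemma bf_sf (x y : {ffun V -> int}) : bf x y = sf bm x y.
Proof.
rewrite bfC bf_sum_ev; apply: eq_bigr => v _; rewrite bf_bm mulr_suml; apply: eq_bigr => w _; ring.
Qed.

Lemma bf_even x : exists c, bf x x = c *+ 2.
Proof.
exists (\sum_v x v * x v - \sum_a x (src a) * x (tgt a)); rewrite /bf mulr2n.
rewrite big_split /= [X in _ - (_ + X)](eq_bigr (fun a => x (src a) * x (tgt a))) => [|a _]; [ring|exact: mulrC].
Qed.

Section Component.
Variable x : V -> nat.
Hypothesis tx : forall v, (0 < x v)%N -> bf (nz x) (ev v) = 0.
Hypothesis cx : cutconn bm (fun v => x v != 0%N).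

Let cx' : cutconn bm (fun v => nz x v != 0).
Proof. by move=> P hP i j; rewrite !ffunE; apply: cx => i' j' h1 h2; apply: hP; rewrite ffunE. Qed.
Let x0 v : 0 <= nz x v. Proof. by rewrite ffunE. Qed.
Let tx' v : 0 < nz x v -> \sum_w bm v w * nz x w = 0.
Proof. by rewrite ffunE -bf_bm; apply: tx. Qed.

Lemma tame_ge0 (z : {ffun V -> int}) : (forall v, x v = 0%N -> z v = 0) -> 0 <= bf z z.
Proof.
move=> zx; rewrite bf_sf.
by have [|h _] := sf_tame bmC bm_le0 x0 (z := z) tx' => // v; rewrite ffunE => -[]; apply: zx.
Qed.

Lemma tame_null (z : {ffun V -> int}) : (forall v, x v = 0%N -> z v = 0) -> bf z z = 0 ->
  forall i j, z i * (x j)%:Z = z j * (x i)%:Z.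
Proof.
move=> zx z0 i j; have [|_ h] := sf_tame bmC bm_le0 x0 (z := z) tx'.
  by move=> v; rewrite ffunE => -[]; apply: zx.
by rewrite bf_sf in z0; have := h z0 cx' i j; rewrite !ffunE.
Qed.

(** An isotropic vector is proportional to [x], which pairs to 0 with the vertices of its
    support. *)
Lemma tame_radical (z y : {ffun V -> int}) : (forall v, x v = 0%N -> z v = 0) -> bf z z = 0 ->
  (forall v, x v = 0%N -> y v = 0) -> bf z y = 0.
Proof.
move=> zx z0 yx; rewrite bf_sum_ev big1 // => v _.
case: (posnP (x v)) => [/yx ->|xv]; first by rewrite mulr0.
suff -> : bf z (ev v) = 0 by rewrite mul0r.
have e : z *~ (x v)%:Z = nz x *~ z v.
  by apply/ffunP=> w; rewrite !ffunMzE !mulrzz ffunE (tame_null zx z0) mulrC.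
have := congr1 (fun u => bf u (ev v)) e; rewrite /= !bfMl tx // mul0r => /eqP.
by rewrite mulf_eq0 => /orP[/eqP //|]; rewrite eqz_nat; lia.
Qed.

(** Induction by reflections lowering the height. Semidefiniteness at [r - ev v] bounds the pairing
    with [ev v] by 2 and keeps the reflected vector nonnegative unless [r] is simple. *)
Lemma Ex_tame_real r : (forall v, x v = 0%N -> r v = 0%N) -> bf (nz r) (nz r) = 2 -> Ex r.
Proof.
have [m] := ubnP (\sum_v r v)%N; elim: m r => // m IH r hm rx r2.
have [v rv bv] : exists2 v, (0 < r v)%N & 0 < bf (nz r) (ev v).
  apply: contrapT => h; suff : bf (nz r) (nz r) <= 0 by rewrite r2.
  rewrite bf_ge0_nz; apply: sumr_le0 => v _; case: (posnP (r v)) => [->|rv]; first by rewrite mulr0.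
  by apply: mulr_le0_ge0 => //; rewrite leNgt; apply/negP=> bv; apply: h; exists v.
have zx w : x w = 0%N -> (nz r - ev v) w = 0.
  move=> xw; rewrite !ffunE rx //; case: eqP => [e|_]; rewrite ?subr0 //.
  by rewrite -e rx in rv.
have bzz : bf (nz r - ev v) (nz r - ev v) = 4 - 2 * bf (nz r) (ev v).
  by rewrite !(bfDl, bfDr, bfNl, bfNr) r2 bf_ev // (bfC _ _ (ev v)); ring.
have le2 : bf (nz r) (ev v) <= 2 by have := tame_ge0 zx; rewrite bzz; lia.
have [->|ne] := simple_eq r v; first exact: Ex_simple.
have ler : bf (nz r) (ev v) <= (r v)%:Z.
  (* Otherwise [r v = 1] and the pairing is 2, so [r - ev v] is isotropic; being proportional to [x]
     and 0 at [v], it vanishes. *)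
  rewrite leNgt; apply/negP=> lt; have rv1 : r v = 1%N by lia.
  have b2 : bf (nz r) (ev v) = 2 by lia.
  apply: ne; apply: nz_inj; rewrite nz_simple; apply/eqP; rewrite -subr_eq0; apply/eqP/ffunP=> w.
  have xv : x v != 0%N by apply: contraTneq rv => /rx ->.
  have zz : bf (nz r - ev v) (nz r - ev v) = 0 by rewrite bzz b2.
  have := tame_null zx zz w v.
  have -> : (nz r - ev v) v = 0 by rewrite !ffunE eqxx rv1.
  rewrite mul0r => /eqP; rewrite mulf_eq0 eqz_nat (negPf xv) orbF => /eqP ->.
  by rewrite ffunE.
pose c := `|bf (nz r) (ev v)|%N; have cE : bf (nz r) (ev v) = c%:Z by rewrite /c; lia.
pose r' w := if w == v then (r v - c)%N else r w.
have r'E : nz r' = zr src tgt v (nz r).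
  apply/ffunP=> w; rewrite [RHS]ffunE [X in _ + X]ffunE ffunMzE !ffunE ?mulrzz cE /r'.
  case: eqP => [->|_]; last by rewrite mul0r subr0.
  by rewrite mul1r -subzn //; lia.
have : ExZ src tgt k (zr src tgt v (nz r')).
  apply: ExZ_zr => //; exists r'; last by left.
  apply: IH; last by rewrite r'E bf_zr.
    apply: leq_trans (_ : \sum_v r v <= m)%N => //.
    rewrite (bigD1 v) //= [ltnRHS](bigD1 v) //= {1}/r' eqxx (eq_bigr r) => [|w /negPf nw]; last by rewrite /r' nw.
    by rewrite ltn_add2r; lia.
  by move=> w xw; rewrite /r'; case: eqP => [e|_]; rewrite ?rx // -e ?rx.
rewrite r'E zrK // => -[d ed [/nz_inj -> //|/ffunP/(_ v)]].
by rewrite !ffunE; lia.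
Qed.

(** The form is even and semidefinite, so its value is 2 or 0. In the second case [r] is a multiple
    of a primitive isotropic [d]; there [(b, d - b) = - (b, b)], and an isotropic [b] would be
    proportional to [d]. *)
Lemma Ex_tame r : (forall v, x v = 0%N -> r v = 0%N) -> (exists v, 0 < r v)%N -> bf (nz r) (nz r) <= 2 -> Ex r.
Proof.
move=> rx r0 r2.
have nzx (z : V -> nat) : (forall v, x v = 0%N -> z v = 0%N) -> forall v, x v = 0%N -> nz z v = 0.
  by move=> h v xv; rewrite ffunE h.
have [c ec] := bf_even (nz r); have := tame_ge0 (nzx _ rx).
have [/eqP r2' _|ne ge] := boolP (bf (nz r) (nz r) == 2); first exact: Ex_tame_real.
have rr : bf (nz r) (nz r) = 0 by move: ge ne; rewrite ec; lia.
have [t [d [t0 d0 rE hd]]] := primitive_ex r0.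
have dx v : x v = 0%N -> d v = 0%N.
  by move=> /rx; rewrite rE => /eqP; rewrite muln_eq0 => /orP[|/eqP //]; lia.
have nzr : nz r = nz d *~ t%:Z by apply/ffunP=> v; rewrite ffunMzE mulrzz !ffunE rE PoszM mulrC.
have dd : bf (nz d) (nz d) = 0.
  by move: rr; rewrite nzr bfMl bfMr => /eqP; rewrite !mulf_eq0 !eqz_nat => /orP[/orP[/eqP //|]|]; lia.
rewrite rE; apply: Ex_isotropic => // b g bg b0 g0.
have bx v : x v = 0%N -> b v = 0%N by move=> /dx; have := bg v; lia.
have gE : nz g = nz d - nz b by apply/ffunP=> v; rewrite !ffunE -bg; lia.
rewrite gE bfDr bfNr bfC (tame_radical (nzx _ dx) dd (nzx _ bx)) sub0r oppr_lt0.
rewrite lt_neqAle tame_ge0 ?andbT; last exact: nzx.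
apply/eqP=> /esym bb.
have pb := tame_null (nzx _ bx) bb; have pd := tame_null (nzx _ dx) dd.
have pr i j : (b i * d j = b j * d i)%N.
  case: (posnP (x i)) => [xi|xi]; first by rewrite (bx i) // (dx i) // muln0.
  case: (posnP (x j)) => [xj|xj]; first by rewrite (bx j) // (dx j) // muln0.
  have := pb i j; have := pd j i; rewrite !ffunE => h1 h2.
  apply/eqP; rewrite -(eqn_pmul2r xi) -(eqn_pmul2r xj); apply/eqP.
  suff : ((b i)%:Z * (x j)%:Z) * ((d j)%:Z * (x i)%:Z) = ((b j)%:Z * (x i)%:Z) * ((d i)%:Z * (x j)%:Z).
    move=> e; apply/eqP; rewrite -eqz_nat !PoszM; apply/eqP; move: e; lia.
  by rewrite h1 h2.
case: (hd b g bg pr) => h.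
  by case: b0 => v; rewrite h.
by case: g0 => v; rewrite h.
Qed.

End Component.

Lemma nz_sum_seq (J : Type) (s : seq J) (D : J -> V -> nat) :
  nz (fun v => \sum_(e <- s) D e v)%N = \sum_(e <- s) nz (D e).
Proof.
apply/ffunP=> v; rewrite sum_ffunE ffunE (big_morph Posz PoszD (erefl (Posz 0))).
by apply: eq_bigr => e _; rewrite ffunE.
Qed.

(** The members are added one at a time inside the connected component containing the support of
    [D e0]; there the form is semidefinite, and its value at the partial sums is kept at 0 or 2. *)
Theorem tame_chain (J : finType) (D : J -> V -> nat) (e0 : J) (m : nat) :
  (forall v, (0 < \sum_e D e v)%N -> bf (nz (fun v => \sum_e D e v)%N) (ev v) = 0) ->
  (forall e, Ex (D e)) ->
  exists f : seq J, size f = m.+1 /\ Ex (fun v => \sum_(e <- f) D e v)%N.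
Proof.
pose N v := (\sum_e D e v)%N; rewrite -/N => hN hD.
have DN e v : (0 < D e v)%N -> (0 < N v)%N by move=> h; rewrite /N (bigD1 e) //= addn_gt0 h.
have [u0 Du0] := Ex_gt0 (hD e0).
pose adj := [rel u v | [&& (0 < N u)%N, (0 < N v)%N & bm u v != 0]].
have adjC : connect_sym adj by apply: sym_connect_sym => u v; rewrite /= bmC andbCA.
pose C v := connect adj u0 v.
have Cadj u v : adj u v -> C u -> C v by move=> a c; apply: (connect_trans (c : connect adj u0 u)); apply: connect1.
have CN v : C v -> (0 < N v)%N.
  have cl : closed adj (fun v => 0 < N v)%N by move=> u w /= /and3P[]; rewrite /in_mem /= => -> ->.
  by move=> /(closed_connect cl); rewrite /in_mem /= (DN e0).
pose x v := if C v then N v else 0%N.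
have xC v : (0 < x v)%N -> C v by rewrite /x; case: ifP.
have x0C v : x v = 0%N -> ~~ C v by rewrite /x; case: ifP => // /CN; lia.
have tx v : (0 < x v)%N -> bf (nz x) (ev v) = 0.
  move=> xv; have cv := xC v xv; rewrite -(hN v (CN _ cv)) !bf_bm; apply: eq_bigr => w _; rewrite !ffunE /x.
  case: ifPn => // nc; case: (posnP (N w)) => [->//|nw]; rewrite mulr0.
  have [->|bn] := eqVneq (bm v w) 0; first by rewrite mul0r.
  by case/negP: nc; apply: (Cadj v) => //=; rewrite nw bn CN.
have cx : cutconn bm (fun v => x v != 0%N).
  move=> P hP i j; rewrite -!lt0n => xi xj Pi.
  have cij : connect adj i j by apply: (@connect_trans _ _ u0); [rewrite adjC; apply: xC|apply: xC].
  have cl : closed adj (fun v => C v && P v).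
    apply: intro_closed => // u v a; rewrite /in_mem /= => /andP[cu pu]; have cv := Cadj _ _ a cu.
    rewrite cv /=; apply: (hP u) => //; rewrite /x ?cu ?cv -?lt0n ?CN //.
    by case/and3P: a.
  by have := closed_connect cl cij; rewrite /in_mem /= (xC i) // Pi => /esym/andP[].
have Cdich e : (forall v, (0 < D e v)%N -> C v) \/ (forall v, (0 < D e v)%N -> ~~ C v).
  have [|h|h] := Ex_connected (U := [set v | C v]) (hD e).
  - move=> a sa ta; rewrite !inE; have a1 : adj (src a) (tgt a) by rewrite /= !(DN e) //= bm_arrow.
    have a2 : adj (tgt a) (src a) by rewrite /= !(DN e) //= bmC bm_arrow.
    by apply/idP/idP; apply: Cadj.
  - by left=> v /h; rewrite inE.
  - by right=> v /h; rewrite inE.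
have Dx e : (forall v, (0 < D e v)%N -> C v) -> forall v, x v = 0%N -> D e v = 0%N.
  move=> h v /x0C nc; apply/eqP; rewrite -leqn0 leqNgt; apply: contra nc; exact: h.
have e0C : forall v, (0 < D e0 v)%N -> C v.
  by case: (Cdich e0) => // /(_ u0 Du0); rewrite /C connect0.
have nzx (z : V -> nat) : (forall v, x v = 0%N -> z v = 0%N) -> forall v, x v = 0%N -> nz z v = 0.
  by move=> h v xv; rewrite ffunE h.
suff [f [szf fx f2]] : exists f : seq J, [/\ size f = m.+1,
    forall v, x v = 0%N -> (\sum_(e <- f) D e v)%N = 0%N & 
    bf (nz (fun v => \sum_(e <- f) D e v)%N) (nz (fun v => \sum_(e <- f) D e v)%N) <= 2 /\
    exists v, (0 < \sum_(e <- f) D e v)%N].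
  by exists f; split=> //; apply: (Ex_tame tx cx) => //; case: f2.
elim: m => [|m [f [szf fx [f2 f0]]]].
  have h v : (\sum_(e <- [:: e0]) D e v = D e0 v)%N by rewrite big_seq1.
  exists [:: e0]; split=> // [v xv|]; first by rewrite h (Dx e0).
  rewrite (_ : (fun v => _) = D e0); last exact: funext.
  by split; [apply: Ex_bf_le2 (hD e0)|exists u0; rewrite h].
pose r v := (\sum_(e <- f) D e v)%N.
have [e eC be] : exists2 e, (forall v, (0 < D e v)%N -> C v) &
    bf (nz (D e)) (nz (D e)) + 2 * bf (nz r) (nz (D e)) + bf (nz r) (nz r) <= 2.
  have [c ec] := bf_even (nz r); have r0 := tame_ge0 tx (nzx _ fx).
  have [/eqP rr|ne] := boolP (bf (nz r) (nz r) == 0).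
    exists e0 => //; rewrite rr (tame_radical tx cx (nzx _ fx) rr (nzx _ (Dx e0 e0C))) mulr0 !addr0.
    exact: Ex_bf_le2 (hD e0).
  have rr : bf (nz r) (nz r) = 2 by move: r0 f2 ne; rewrite -/r ec; lia.
  (* The sum of all the [D e] is orthogonal to [r], so their pairings with [r] add up to 0; not all
     vanish, as [r] is a sum of some of them and has value 2. Adding one with negative pairing gives
     at most 2 - 2 + 2. *)
  have [e be] : exists e, bf (nz r) (nz (D e)) < 0.
    apply: contrapT => h; have h0 e : 0 <= bf (nz r) (nz (D e)).
      by rewrite leNgt; apply/negP=> lt; apply: h; exists e.
    have s0 : \sum_e bf (nz r) (nz (D e)) = 0.
      rewrite -bf_sumr -nz_sum_seq bfC bf_sum_ev big1 // => v _; rewrite [nz r v]ffunE.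
      case: (posnP (r v)) => [->|rv]; first by rewrite mulr0.
      have -> : bf (nz (fun v0 => \sum_e0 D e0 v0)%N) (ev v) = 0; last by rewrite mul0r.
      apply: hN; have : (0 < x v)%N by rewrite lt0n; apply: contraTneq rv => /fx; rewrite -/(r v) => ->.
      by move=> /xC /CN.
    have hz e : bf (nz r) (nz (D e)) = 0 by apply: (psumr_eq0P _ s0).
    have e1 : bf (nz r) (nz r) = \sum_(e <- f) bf (nz (D e)) (nz r) by rewrite {1}/r nz_sum_seq bf_sum_seq.
    by move: rr; rewrite e1 big1 // => e _; rewrite bfC hz.
  exists e.
    case: (Cdich e) => // nC; move: be; rewrite bf_sf /sf big1 ?ltxx // => u _; rewrite big1 // => v _.
    rewrite !ffunE; case: (posnP (r u)) => [->|ru]; first by rewrite !mul0r.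
    case: (posnP (D e v)) => [->|dv]; first by rewrite mulr0.
    have cu : C u by apply: xC; rewrite lt0n; apply: contraTneq ru => /fx; rewrite -/(r u) => ->.
    have [->|bn] := eqVneq (bm u v) 0; first by rewrite mulr0 mul0r.
    by have := nC v dv; rewrite (Cadj u v) //= bn CN //= (DN e).
  have := Ex_bf_le2 noloop (hD e); rewrite rr; lia.
exists (e :: f); rewrite /= szf; have E : (fun v => \sum_(e' <- e :: f) D e' v)%N = fun v => (D e v + r v)%N.
  by apply: funext => v; rewrite big_cons.
split=> // [v xv|]; first by rewrite big_cons (Dx e) // fx.
rewrite E (_ : nz _ = nz (D e) + nz r); last by apply/ffunP=> v; rewrite !ffunE.
split; first by rewrite !(bfDl, bfDr) (bfC _ _ (nz (D e)) (nz r)); move: be; lia.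
by have [v fv] := f0; exists v; rewrite big_cons addn_gt0 fv orbT.
Qed.

End Tame.

(** * The dual quiver *)

(* From a module [Wt] over the dual quiver to a module over the skew group algebra:
   [ob] and [ch] are the orbit and the character of a vertex, [rp a] represents the
   orbit of [a], which is the [jj a]-th translate of [rp a], and [Zp] acts on the
   [c]-isotypic part by [z ^ c]. *)
Section DualFunctor.
Variables (k : closedFieldType) (V A O : finType) (src tgt : A -> V) (sv : V -> V) (sa : A -> A).
Variables (cl : V -> O) (rp : A -> A) (jj : A -> nat) (n : nat) (z : k) (dd : V -> nat).
Variables (Vt At : finType) (srct tgtt : At -> Vt) (ob : Vt -> O) (ch : Vt -> nat) (ab : At -> A).
Hypothesis src_sa : forall a, src (sa a) = sv (src a).
Hypothesis tgt_sa : forall a, tgt (sa a) = sv (tgt a).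
Hypothesis sv_n : forall v, iter n sv v = v.
Hypothesis cl_sv : forall v, cl (sv v) = cl v.
Hypothesis cl_orbit : forall v w, cl v = cl w -> exists m, w = iter m sv v.
Hypothesis ob_cl : forall u, exists v, cl v = ob u.
Hypothesis rp_sa : forall a, rp (sa a) = rp a.
Hypothesis rp_ab : forall x, rp (ab x) = ab x.
Hypothesis cl_src_rp : forall a, cl (src (rp a)) = cl (src a).
Hypothesis cl_tgt_rp : forall a, cl (tgt (rp a)) = cl (tgt a).
Hypothesis ob_src : forall x, ob (srct x) = cl (src (ab x)).
Hypothesis ob_tgt : forall x, ob (tgtt x) = cl (tgt (ab x)).
Hypothesis At_inj : forall x y, ab x = ab y -> srct x = srct y -> tgtt x = tgtt y -> x = y.
Hypothesis z_n : z ^+ n = 1.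
Hypothesis n_gt0 : (0 < n)%N.
Hypothesis z_arrow : forall a x, ab x = rp a ->
  z ^ (((jj a).+1%:Z - (jj (sa a))%:Z) * (ch (srct x))%:Z) = z ^ (((jj a).+1%:Z - (jj (sa a))%:Z) * (ch (tgtt x))%:Z).
Hypothesis sv_dd : forall v, iter (dd v) sv v = v.
Hypothesis z_dd : forall v u w, ob u = cl v -> ob w = cl v -> z ^ ((dd v)%:Z * (ch u)%:Z) = z ^ ((dd v)%:Z * (ch w)%:Z) -> u = w.
Variable Wt : tmod k (Vt + At).
Hypothesis qWt : qmod srct tgtt Wt.

Local Notation M := (tsz Wt).
Local Notation E u := (Wt (inl u)).
Definition EI (o : O) : 'M[k]_M := \sum_(u | ob u == o) E u.
Definition Zp (m : int) : 'M[k]_M := \sum_u z ^ (m * (ch u)%:Z) *: E u.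
Definition Yb (a : A) : 'M[k]_M := \sum_(x | ab x == a) Wt (inr x).

Let z0 : z != 0.
Proof.
apply: contraTneq isT => z0; have := z_n; rewrite z0 expr0n (gtn_eqF n_gt0) => /esym/eqP.
by rewrite oner_eq0.
Qed.

Let EE u w : E u *m E w = if u == w then E u else 0.
Proof. by case: qWt => ->. Qed.
Let E1 : \sum_u E u = 1%:M. Proof. by case: qWt. Qed.

Lemma EEI u o : E u *m EI o = if ob u == o then E u else 0.
Proof.
rewrite mulmx_sumr; case: ifPn => h.
  by rewrite (bigD1 u) //= EE eqxx big1 ?addr0 // => w /andP[_ nw]; rewrite EE eq_sym (negPf nw).
by rewrite big1 // => w hw; rewrite EE; case: eqP => // e; rewrite e hw in h.
Qed.

Lemma EIE u o : EI o *m E u = if ob u == o then E u else 0.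
Proof.
rewrite mulmx_suml; case: ifPn => h.
  by rewrite (bigD1 u) //= EE eqxx big1 ?addr0 // => w /andP[_ nw]; rewrite EE (negPf nw).
by rewrite big1 // => w hw; rewrite EE; case: eqP => // e; rewrite -e hw in h.
Qed.

Lemma EIEI o p : EI o *m EI p = if o == p then EI o else 0.
Proof.
rewrite {1}/EI mulmx_suml; case: eqP => [<-|/eqP ne]; first by apply: eq_bigr => u hu; rewrite EEI hu.
by rewrite big1 // => u /eqP hu; rewrite EEI hu (negPf ne).
Qed.

Lemma ZpE m u : Zp m *m E u = z ^ (m * (ch u)%:Z) *: E u.
Proof.
rewrite mulmx_suml (bigD1 u) //= -scalemxAl EE eqxx big1 ?addr0 // => w nw.
by rewrite -scalemxAl EE (negPf nw) scaler0.
Qed.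

Lemma EZp m u : E u *m Zp m = z ^ (m * (ch u)%:Z) *: E u.
Proof.
rewrite mulmx_sumr (bigD1 u) //= -scalemxAr EE eqxx big1 ?addr0 // => w nw.
by rewrite -scalemxAr EE eq_sym (negPf nw) scaler0.
Qed.

Lemma ZpD m p : Zp m *m Zp p = Zp (m + p).
Proof.
rewrite {2}/Zp mulmx_sumr; apply: eq_bigr => u _.
by rewrite -scalemxAr ZpE scalerA -expfzDr // mulrDl addrC.
Qed.

Lemma Zp0 : Zp 0 = 1%:M.
Proof. by rewrite -E1; apply: eq_bigr => u _; rewrite mul0r expr0z scale1r. Qed.

Lemma Zpn : Zp n%:Z = 1%:M.
Proof.
have zn : z ^ n%:Z = 1 := z_n.
by rewrite -E1; apply: eq_bigr => u _; rewrite -exprz_exp zn exp1rz scale1r.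
Qed.

Lemma ZpK m : Zp m *m Zp (- m) = 1%:M. Proof. by rewrite ZpD subrr Zp0. Qed.
Lemma ZpNK m : Zp (- m) *m Zp m = 1%:M. Proof. by rewrite ZpD addNr Zp0. Qed.

Lemma ZpEI m o : Zp m *m EI o = EI o *m Zp m.
Proof.
by rewrite mulmx_sumr mulmx_suml; apply: eq_bigr => u _; rewrite ZpE EZp.
Qed.

Lemma Wt_src x : E (srct x) *m Wt (inr x) = Wt (inr x).
Proof. by case: qWt => _ _ <-; rewrite !mulmxA EE eqxx. Qed.
Lemma Wt_tgt x : Wt (inr x) *m E (tgtt x) = Wt (inr x).
Proof. by case: qWt => _ _ <-; rewrite -!mulmxA EE eqxx. Qed.

Lemma EI_Yb a : EI (cl (src a)) *m Yb a = Yb a.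
Proof.
rewrite mulmx_sumr; apply: eq_bigr => x /eqP xa; by rewrite -Wt_src mulmxA EIE ob_src xa eqxx.
Qed.
Lemma Yb_EI a : Yb a *m EI (cl (tgt a)) = Yb a.
Proof.
rewrite mulmx_suml; apply: eq_bigr => x /eqP xa; by rewrite -Wt_tgt -mulmxA EEI ob_tgt xa eqxx.
Qed.

Lemma Zp_Yb a : let m := (jj a).+1%:Z - (jj (sa a))%:Z in Zp m *m Yb (rp a) = Yb (rp a) *m Zp m.
Proof.
move=> m; rewrite mulmx_sumr mulmx_suml; apply: eq_bigr => x /eqP xa.
rewrite -Wt_src mulmxA ZpE -scalemxAl Wt_src z_arrow //.
by rewrite -{2}Wt_tgt -mulmxA EZp -scalemxAr Wt_tgt.
Qed.

Lemma E_Yb_E x : E (srct x) *m Yb (ab x) *m E (tgtt x) = Wt (inr x).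
Proof.
rewrite mulmx_sumr mulmx_suml (bigD1 x) //= Wt_src Wt_tgt big1 ?addr0 // => y /andP[/eqP yx nyx].
rewrite -(Wt_src y) -(Wt_tgt y) !mulmxA EE; case: eqP => [e1|_]; last by rewrite !mul0mx.
rewrite -!mulmxA EE; case: eqP => [e2|_]; last by rewrite !mulmx0.
by case/eqP: nyx; apply: At_inj.
Qed.

(** The action of the arrow [a], carried from the representative of its orbit by [jj a] steps of the
    generator. By [K_twist] one more step leads to [sa a], even where the numbering [jj] jumps; that
    is the role of [z_arrow]. *)
Definition K (a : A) : 'M[k]_M := locked (Zp (- (jj a)%:Z) *m Yb (rp a) *m Zp (jj a)).
Lemma KE a : K a = Zp (- (jj a)%:Z) *m Yb (rp a) *m Zp (jj a).
Proof. by rewrite /K -lock. Qed.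

Lemma ZpS m : Zp m%:Z *m Zp 1 = Zp m.+1%:Z.
Proof. by rewrite ZpD; congr Zp; lia. Qed.

Lemma K_twist a : K a *m Zp 1 = Zp 1 *m K (sa a).
Proof.
have h := Zp_Yb a; rewrite /= in h; set m := _ - _ in h.
rewrite !KE rp_sa; move: (Yb (rp a)) h => Y h.
have -> : Zp 1 *m (Zp (- (jj (sa a))%:Z) *m Y *m Zp (jj (sa a))) =
    (Zp 1 *m Zp (- (jj (sa a))%:Z)) *m Y *m Zp (jj (sa a)) by rewrite !mulmxA.
have -> : Zp (- (jj a)%:Z) *m Y *m Zp (jj a) *m Zp 1 = Zp (- (jj a)%:Z) *m Y *m (Zp (jj a) *m Zp 1).
  by rewrite !mulmxA.
rewrite !ZpD.
have e1 : (jj a)%:Z + 1 = m + jj (sa a) by rewrite /m; lia.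
have e2 : 1 - (jj (sa a))%:Z = - (jj a)%:Z + m by rewrite /m; lia.
by clearbody m; rewrite e1 e2 -!ZpD -!mulmxA (mulmxA (Zp m) Y) h !mulmxA.
Qed.

Lemma EI_K a : EI (cl (src a)) *m K a = K a.
Proof. by rewrite KE !mulmxA -ZpEI -(mulmxA (Zp _)) -cl_src_rp EI_Yb. Qed.
Lemma K_EI a : K a *m EI (cl (tgt a)) = K a.
Proof. by rewrite KE -!mulmxA ZpEI (mulmxA (Yb _)) -cl_tgt_rp Yb_EI. Qed.

Section Splitting.
Variables (N : nat) (U : V -> 'M[k]_(N, M)) (D : V -> 'M[k]_(M, N)).
Hypothesis DU : forall v w, D v *m U w = if v == w then EI (cl v) else 0.
Hypothesis UD1 : \sum_v U v *m D v = 1%:M.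
Hypothesis UEI : forall v, U v *m EI (cl v) = U v.
Hypothesis EID : forall v, EI (cl v) *m D v = D v.

Definition Phi : 'M[k]_N := locked (\sum_v U v *m Zp 1 *m D (sv v)).
Lemma PhiE : Phi = \sum_v U v *m Zp 1 *m D (sv v). Proof. by rewrite /Phi -lock. Qed.

(** The induced module: at each vertex [v] sits a copy of the part of [Wt] over the orbit of [v];
    the generator permutes these copies and acts by [Zp 1]. *)
Definition Wf : tmod k (option (V + A)) := TMod (fun o => match o with
  | None => Phi
  | Some (inl v) => U v *m D v
  | Some (inr a) => U (src a) *m K a *m D (tgt a) end).

Lemma UDUD v w : U v *m D v *m (U w *m D w) = if v == w then U v *m D v else 0.
Proof.
rewrite -!mulmxA (mulmxA (D v)) DU; case: eqP => [<-|_]; last by rewrite mul0mx mulmx0.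
by rewrite EID.
Qed.

Lemma Wf_qmod : qmod src tgt (und Wf).
Proof.
split=> [v w||a] /=; [exact: UDUD|exact: UD1|].
have -> : U (src a) *m D (src a) *m (U (src a) *m K a *m D (tgt a)) *m (U (tgt a) *m D (tgt a)) =
  U (src a) *m ((D (src a) *m U (src a)) *m K a *m (D (tgt a) *m U (tgt a))) *m D (tgt a) by rewrite !mulmxA.
by rewrite !DU !eqxx EI_K K_EI.
Qed.

Lemma Wf_qdim v : qdim (und Wf) v = (\sum_(u | ob u == cl v) qdim Wt u)%N.
Proof.
have -> : qdim (und Wf) v = \rank (EI (cl v)).
  rewrite /qdim /= -[U v in LHS]UEI; apply: rank_sandwich.
  by rewrite DU eqxx !EIEI eqxx EIEI eqxx.
by rewrite /EI rank_idem_sum.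
Qed.

Lemma D_Phi v : D v *m Phi = Zp 1 *m D (sv v).
Proof.
rewrite PhiE mulmx_sumr (bigD1 v) //= !mulmxA DU eqxx big1 ?addr0 => [|w nw].
  by rewrite -ZpEI -mulmxA -(cl_sv v) EID.
by rewrite !mulmxA DU eq_sym (negPf nw) !mul0mx.
Qed.

Lemma Phi_pow m : Phi ^+ m = \sum_v U v *m Zp m *m D (iter m sv v).
Proof.
elim: m => [|m IH].
  by rewrite expr0 -[LHS]UD1; apply: eq_bigr => v _; rewrite Zp0 mulmx1.
rewrite exprSr IH -[_ * _]/(_ *m _) mulmx_suml; apply: eq_bigr => v _.
by rewrite -mulmxA D_Phi mulmxA -(mulmxA (U v)) ZpS -iterS.
Qed.

Definition ss (t : V + A) : V + A := match t with inl v => inl (sv v) | inr a => inr (sa a) end.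

Lemma Phi_U v : Phi *m U (sv v) = U v *m Zp 1.
Proof.
rewrite PhiE mulmx_suml (bigD1 v) //= -!mulmxA DU eqxx big1 ?addr0 => [|w nw].
  by rewrite ZpEI mulmxA cl_sv UEI.
have inj : injective sv.
  by move=> x y e; rewrite -(sv_n x) -(sv_n y); case: (n) n_gt0 => // m _; rewrite !iterSr e.
by rewrite -!mulmxA DU (inj_eq inj) (negPf nw) !mulmx0.
Qed.

Lemma Wf_emod : emod ss n Wf.
Proof.
split; last first.
  by rewrite Phi_pow Zpn -[RHS]UD1; apply: eq_bigr => v _; rewrite mulmx1 sv_n.
move=> [v|a].
  change (U v *m D v *m Phi = Phi *m (U (sv v) *m D (sv v))).
  by rewrite -mulmxA D_Phi !mulmxA Phi_U.
change (U (src a) *m K a *m D (tgt a) *m Phi = Phi *m (U (src (sa a)) *m K (sa a) *m D (tgt (sa a)))).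
by rewrite src_sa tgt_sa -mulmxA D_Phi !mulmxA Phi_U -(mulmxA (U (src a)) (K a)) K_twist !mulmxA.
Qed.

Section Endo.
Variable e : 'M[k]_N.
Hypothesis he : @thom k _ Wf Wf e.
Hypothesis ee : e *m e = e.
Definition ep v : 'M[k]_M := locked (D v *m e *m U v).
Lemma epE v : ep v = D v *m e *m U v. Proof. by rewrite /ep -lock. Qed.

Lemma D_e v : D v *m e = ep v *m D v.
Proof.
have h : U v *m D v *m e = e *m (U v *m D v) := he (Some (inl v)).
have dud : D v *m U v *m D v = D v by rewrite DU eqxx EID.
by rewrite -{1}dud -!mulmxA (mulmxA (U v)) h epE !mulmxA.
Qed.

Lemma ep_EI v : ep v *m EI (cl v) = ep v. Proof. by rewrite epE -mulmxA UEI. Qed.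
Lemma EI_ep v : EI (cl v) *m ep v = ep v. Proof. by rewrite epE !mulmxA EID. Qed.

Lemma ep_sum : e = \sum_v U v *m ep v *m D v.
Proof.
rewrite -[LHS]mul1mx -UD1 mulmx_suml; apply: eq_bigr => v _.
by rewrite -!mulmxA -D_e mulmxA.
Qed.

Lemma ep_idem v : ep v *m ep v = ep v.
Proof.
have -> : ep v *m ep v = (ep v *m D v) *m (e *m U v) by rewrite {2}epE !mulmxA.
by rewrite -D_e epE !mulmxA -(mulmxA (D v) e) ee.
Qed.

Lemma ep_Zp1 v : ep v *m Zp 1 = Zp 1 *m ep (sv v).
Proof.
have h : D v *m (Phi *m e) *m U (sv v) = D v *m (e *m Phi) *m U (sv v) by have := he None => /= ->.
move: h; rewrite !mulmxA D_Phi D_e -(mulmxA (ep v) (D v)) D_Phi -!mulmxA DU eqxx ZpEI (mulmxA (ep v)) cl_sv ep_EI => <-.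
by rewrite epE !mulmxA.
Qed.

Lemma ep_Zp v m : ep v *m Zp m%:Z = Zp m%:Z *m ep (iter m sv v).
Proof.
elim: m => [|m IH] /=; first by rewrite Zp0 mulmx1 mul1mx.
by rewrite -ZpS mulmxA IH -mulmxA ep_Zp1 mulmxA.
Qed.

(** After [dd v] steps the orbit returns to [v], so [ep v] commutes with [Zp (dd v)], whose
    eigenvalues at different vertices over one orbit differ by [z_dd]. *)
Lemma E_ep_E v u w : u != w -> E u *m ep v *m E w = 0.
Proof.
move=> nuw; case: (eqVneq (ob u) (cl v)) => [uv|nu]; last first.
  by rewrite -EI_ep mulmxA EEI (negPf nu) !mul0mx.
case: (eqVneq (ob w) (cl v)) => [wv|nw]; last first.
  by rewrite -ep_EI -!mulmxA EIE (negPf nw) !mulmx0.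
have h := ep_Zp v (dd v); rewrite sv_dd in h.
have h1 : z ^ ((dd v)%:Z * (ch u)%:Z) *: (E u *m ep v *m E w) = z ^ ((dd v)%:Z * (ch w)%:Z) *: (E u *m ep v *m E w).
  by rewrite scalemxAl scalemxAl -EZp -(mulmxA (E u) (Zp _)) -h -!mulmxA ZpE -!scalemxAr.
apply/eqP; move/eqP: h1; rewrite -subr_eq0 -scalerBl scaler_eq0 subr_eq0 => /orP[/eqP/(z_dd uv wv) e1|//].
by rewrite e1 eqxx in nuw.
Qed.

Lemma E_ep v u : E u *m ep v = ep v *m E u.
Proof.
transitivity (E u *m ep v *m E u).
  rewrite -[LHS]mulmx1 -E1 mulmx_sumr (bigD1 u) //= big1 ?addr0 // => w nw.
  by rewrite E_ep_E // eq_sym.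
symmetry; rewrite -[LHS]mul1mx -E1 mulmx_suml (bigD1 u) //= big1 ?addr0 ?mulmxA // => w nw.
by rewrite mulmxA E_ep_E.
Qed.

Lemma Zp_ep m v : Zp m *m ep v = ep v *m Zp m.
Proof.
by rewrite mulmx_suml mulmx_sumr; apply: eq_bigr => u _; rewrite -scalemxAl -scalemxAr E_ep.
Qed.

Lemma ep_orbit v w : cl v = cl w -> ep v = ep w.
Proof.
have h u : ep (sv u) = ep u.
  have := ep_Zp1 u; rewrite -Zp_ep => /(congr1 (mulmx (Zp (- 1)))).
  by rewrite !mulmxA ZpNK !mul1mx.
by move=> /cl_orbit[m ->]; elim: m => //= m IH; rewrite h.
Qed.

Definition vr v := odflt v [pick w | cl w == cl v].
Lemma cl_vr v : cl (vr v) = cl v.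
Proof. by rewrite /vr; case: pickP => [w /eqP|/(_ v)]; rewrite ?eqxx. Qed.
Lemma vr_cl v w : cl v = cl w -> vr v = vr w.
Proof.
move=> e1; rewrite /vr e1; case: pickP => [//|/(_ w)]; by rewrite eqxx.
Qed.

(** The blocks [ep v] are constant along orbits, so one representative per orbit gives the
    endomorphism of [Wt] from which [e] comes. *)
Definition eps : 'M[k]_M := \sum_(v | vr v == v) ep v.

Lemma EI_eps v : EI (cl v) *m eps = ep v.
Proof.
rewrite mulmx_sumr (bigD1 (vr v)) /=; last by rewrite (vr_cl (cl_vr v)).
rewrite -{1}(cl_vr v) EI_ep big1 ?addr0; first by apply: ep_orbit; rewrite cl_vr.
move=> w /andP[/eqP hw nw]; rewrite -EI_ep mulmxA EIEI; case: eqP => [e1|_]; last by rewrite mul0mx.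
by rewrite (vr_cl e1) hw eqxx in nw.
Qed.

Lemma eps_EI v : eps *m EI (cl v) = ep v.
Proof.
rewrite mulmx_suml (bigD1 (vr v)) /=; last by rewrite (vr_cl (cl_vr v)).
rewrite -{1}(cl_vr v) ep_EI big1 ?addr0; first by apply: ep_orbit; rewrite cl_vr.
move=> w /andP[/eqP hw nw]; rewrite -ep_EI -mulmxA EIEI; case: eqP => [e1|_]; last by rewrite mulmx0.
by rewrite -(vr_cl e1) hw eqxx in nw.
Qed.

Lemma eps_E u : eps *m E u = E u *m eps.
Proof. by rewrite mulmx_suml mulmx_sumr; apply: eq_bigr => v _; rewrite E_ep. Qed.

Lemma eps_idem : eps *m eps = eps.
Proof.
by rewrite {1}/eps mulmx_suml; apply: eq_bigr => v _; rewrite -ep_EI -mulmxA EI_eps ep_idem ep_EI.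
Qed.

Lemma ep_K a : ep (src a) *m K a = K a *m ep (tgt a).
Proof.
have : D (src a) *m ((U (src a) *m K a *m D (tgt a)) *m e) *m U (tgt a) =
  D (src a) *m (e *m (U (src a) *m K a *m D (tgt a))) *m U (tgt a) by rewrite (he (Some (inr a))).
have h1 := EI_K a; have h2 := K_EI a; have h3 := D_e (src a).
rewrite !mulmxA h3 DU eqxx h1 -!mulmxA DU eqxx h2 (mulmxA (D (tgt a))).
by rewrite (mulmxA (D (src a)) (U _)) DU eqxx h1 => <-; rewrite epE !mulmxA.
Qed.

Lemma eps_thom : @thom k _ Wt Wt eps.
Proof.
move=> [u|x]; first by rewrite eps_E.
have YK : ep (src (ab x)) *m Yb (ab x) = Yb (ab x) *m ep (tgt (ab x)).
  have YE : Yb (ab x) = Zp (jj (ab x)) *m K (ab x) *m Zp (- (jj (ab x))%:Z).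
    by rewrite KE rp_ab !mulmxA ZpK mul1mx -mulmxA ZpK mulmx1.
  rewrite YE; have := ep_K (ab x); move: (K (ab x)) => F h.
  by rewrite !mulmxA -Zp_ep -(mulmxA (Zp _)) h -!mulmxA -Zp_ep.
have a1 : E (tgtt x) *m eps = ep (tgt (ab x)) *m E (tgtt x).
  rewrite -eps_E; have -> : E (tgtt x) = EI (cl (tgt (ab x))) *m E (tgtt x) by rewrite EIE ob_tgt eqxx.
  by rewrite mulmxA eps_EI mulmxA ep_EI.
have a2 : eps *m E (srct x) = E (srct x) *m ep (src (ab x)).
  rewrite eps_E; have -> : E (srct x) = E (srct x) *m EI (cl (src (ab x))) by rewrite EEI ob_src eqxx.
  by rewrite -mulmxA EI_eps -mulmxA EI_ep.
rewrite -E_Yb_E; move: eps a1 a2 => F a1 a2.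
rewrite -(mulmxA _ (E (tgtt x)) F) a1 2!(mulmxA F) a2 -(mulmxA (E (srct x)) (ep _)) YK.
by rewrite !mulmxA.
Qed.

End Endo.

Lemma Wf_tindec : tindec Wt -> tindec Wf.
Proof.
move=> [M0 hM]; split.
  rewrite /= lt0n; apply/eqP=> N0.
  have EI0 v : EI (cl v) = 0.
    have := DU v v; rewrite eqxx => <-; apply/matrixP=> i j; rewrite !mxE big1 // => l _.
    by have := ltn_ord l; move: N0; lia.
  have : 1%:M = 0 :> 'M[k]_M.
    rewrite -E1 big1 // => u _; have [v uv] := ob_cl u.
    by have := EEI u (ob u); rewrite eqxx -uv EI0 mulmx0.
  move=> /matrixP/(_ (Ordinal M0) (Ordinal M0))/eqP; by rewrite !mxE eqxx oner_eq0.
move=> e he ee; case: (hM (eps e)) => [||e0|e1]; [exact: eps_thom|exact: eps_idem|left|right].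
  rewrite (ep_sum he) big1 // => v _; by rewrite -(EI_eps he) e0 !mulmx0 mul0mx.
rewrite (ep_sum he) -[RHS]UD1; apply: eq_bigr => v _; by rewrite -(EI_eps he) e1 mulmx1 UEI.
Qed.

End Splitting.

Lemma idem_factor m r (P : 'M[k]_(m, r)) (R : 'M_(r, m)) B C :
  B *m P = 1%:M -> R *m C = 1%:M -> P *m R *m (P *m R) = P *m R -> R *m P = 1%:M.
Proof.
move=> hB hC h; have := congr1 (fun M => B *m M *m C) h.
by rewrite /= !mulmxA hB !mul1mx hC -!mulmxA hC mulmx1.
Qed.

Lemma idem_base m (e : 'M[k]_m) : e *m e = e -> row_base e *m col_base e = 1%:M.
Proof.
move=> ee; have [B hB] := row_fullP (col_base_full e); have [C hC] := row_freeP (row_base_free e).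
by apply: (idem_factor hB hC); rewrite mulmx_base.
Qed.

(** Of the Morita equivalence only this is established: idempotent endomorphisms of the induced
    module come from idempotents of [Wt]. *)
Theorem dual_functor : tindec Wt -> exists W : tmod k (option (V + A)),
  [/\ emod ss n W, tindec W, qmod src tgt (und W) &
      forall v, qdim (und W) v = (\sum_(u | ob u == cl v) qdim Wt u)%N].
Proof.
move=> iW; pose rk v := \rank (EI (cl v)).
have [h1 h2 h3] := stdsys k rk.
pose U v : 'M[k]_(stdsz rk, M) := (stdP k rk v)^T *m row_base (EI (cl v)).
pose D v : 'M[k]_(M, stdsz rk) := col_base (EI (cl v)) *m stdP k rk v.
have bb v : row_base (EI (cl v)) *m col_base (EI (cl v)) = 1%:M by apply: idem_base; rewrite EIEI eqxx.
have DU v w : D v *m U w = if v == w then EI (cl v) else 0.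
  have -> : D v *m U w = col_base (EI (cl v)) *m (stdP k rk v *m (stdP k rk w)^T) *m row_base (EI (cl w)).
    by rewrite /D /U !mulmxA.
  case: eqP => [<-|/eqP ne]; first by rewrite h1 mulmx1 mulmx_base.
  by rewrite h2 // mulmx0 mul0mx.
have UD1 : \sum_v U v *m D v = 1%:M.
  rewrite -h3; apply: eq_bigr => v _; rewrite /U /D -mulmxA (mulmxA (row_base _)) bb mul1mx //.
have UEI v : U v *m EI (cl v) = U v.
  by rewrite /U -{2}(mulmx_base (EI (cl v))) -mulmxA (mulmxA (row_base _)) bb mul1mx.
have EID v : EI (cl v) *m D v = D v.
  by rewrite /D -{1}(mulmx_base (EI (cl v))) -mulmxA (mulmxA (row_base _)) bb mul1mx.
clearbody U D; exists (Wf U D); split.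
- exact: Wf_emod.
- exact: Wf_tindec.
- exact: Wf_qmod.
- by move=> v; apply: Wf_qdim.
Qed.

End DualFunctor.

Lemma iter_modn (T : Type) (s : T -> T) x r m : iter r s x = x -> iter m s x = iter (m %% r) s x.
Proof.
move=> h; rewrite {1}(divn_eq m r) addnC iterD; congr (iter _ _ _).
by elim: (m %/ r)%N => [//|q IH]; rewrite mulSn iterD IH.
Qed.

Lemma porbit_dvd (T : finType) (s : {perm T}) x m : iter m s x = x -> (#|porbit s x| %| m)%N.
Proof.
move=> h; set r := #|porbit s x|.
have r0 : (0 < r)%N by rewrite card_gt0; apply/set0Pn; exists x; apply: porbit_id.
have h' : iter (m %% r) s x = x by rewrite -(iter_modn _ (iter_porbit s x)).
rewrite /dvdn; apply: contraT => nz0.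
have lt := ltn_pmod m r0.
have := uniq_traject_porbit s x; rewrite -/r => u.
have := nth_uniq x (s := traject s x r) (i := 0%N) (j := m %% r); rewrite size_traject => /(_ r0 lt u).
by rewrite !nth_traject //= h' eqxx [RHS]eq_sym (negPf nz0).
Qed.

Lemma porbit_congr (T : finType) (s : {perm T}) x p q : iter p s x = iter q s x ->
  (#|porbit s x|%:Z %| p%:Z - q%:Z)%Z.
Proof.
wlog le : p q / (q <= p)%N.
  move=> H; case: (leqP q p) => [le|/ltnW le] h; first exact: H.
  by rewrite -opprB rpredN; apply: H.
move=> h; rewrite subzn //; apply: porbit_dvd.
have inj : injective (iter q s) by elim: q {le h} => [|q IH] x' y' //= /perm_inj /IH.
by apply: inj; rewrite -iterD subnKC.
Qed.

Lemma count_mod q m a : (0 < m)%N -> (\sum_(c < q * m) (c == a %[mod m]) = q)%N.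
Proof.
move=> m0; rewrite -(big_mkord xpredT (fun c => (c == a %[mod m]) : nat)).
elim: q => [|q IH]; first by rewrite mul0n big_geq.
rewrite mulSn addnC (big_cat_nat (n := q * m)) //= ?leq_addr // IH.
rewrite -{1}[(q * m)%N]add0n big_addn addKn big_mkord (bigD1 (Ordinal (ltn_pmod a m0))) //=.
rewrite [X in (X == _ %[mod _])%N]addnC modnMDl modn_mod eqxx big1 ?addn1 // => c nc.
rewrite addnC modnMDl; apply/eqP; rewrite eqb0; apply: contra nc => /eqP e; apply/eqP/val_inj.
by rewrite /= -e modn_small.
Qed.

(** * Orbits of vertices and arrows, and the form of [Gamma] *)

Section OrbitForm.
Variables (V A : finType) (src tgt : A -> V) (g : quiver_aut src tgt).
Local Notation sv := (qa_v g).
Local Notation sa := (qa_a g).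
Local Notation n := (aut_order g).
Local Notation O := (orb g).

Definition ocl (v : V) : O := exist _ (porbit sv v) (imset_f _ (isT : v \in V)).

Lemma val_cl v : val (ocl v) = porbit sv v. Proof. by []. Qed.

Lemma cl_ex (o : O) : exists v, ocl v = o.
Proof. by have /imsetP[v _ e] := valP o; exists v; apply: val_inj; rewrite val_cl e. Qed.

Lemma mem_cl v (o : O) : (v \in val o) = (ocl v == o).
Proof.
have [w <-] := cl_ex o; rewrite val_cl; apply/idP/eqP => [|e]; last by rewrite -val_cl -e porbit_id.
by rewrite -eq_porbit_mem => /eqP e; apply: val_inj.
Qed.

Lemma iter_perm (T : finType) (s : {perm T}) m x : iter m s x = (s ^+ m)%g x.
Proof. by rewrite permX. Qed.

Lemma cl_orbit v w : ocl v = ocl w -> exists m, w = iter m sv v.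
Proof.
move=> e; have : w \in val (ocl v) by rewrite mem_cl e.
by rewrite val_cl => /porbitP[m ->]; exists m; rewrite iter_perm.
Qed.

Lemma cl_sv v : ocl (sv v) = ocl v.
Proof. by apply: val_inj; rewrite !val_cl; have := porbit_perm sv 1 v; rewrite expg1. Qed.

Lemma dorb_gt0 (o : O) : (0 < dorb o)%N.
Proof. by have [v <-] := cl_ex o; rewrite card_gt0; apply/set0Pn; exists v; apply: porbit_id. Qed.

Lemma sv_dorb v : iter (dorb (ocl v)) sv v = v. Proof. exact: iter_porbit. Qed.

Lemma sv_n v : iter n sv v = v.
Proof.
rewrite iter_perm /aut_order; have /dvdnP[q ->] := dvdn_lcml #[sv]%g #[sa]%g.
by rewrite mulnC expgM expg_order expg1n perm1.
Qed.

Lemma sa_n a : iter n sa a = a.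
Proof.
rewrite iter_perm /aut_order; have /dvdnP[q ->] := dvdn_lcmr #[sv]%g #[sa]%g.
by rewrite mulnC expgM expg_order expg1n perm1.
Qed.

Lemma aut_n_gt0 : (0 < n)%N. Proof. by rewrite lcmn_gt0 !order_gt0. Qed.

Lemma dorb_dvd (o : O) : (dorb o %| n)%N.
Proof. by have [v <-] := cl_ex o; apply: porbit_dvd; apply: sv_n. Qed.

Definition ra (a : A) := #|porbit sa a|.

Lemma ra_dvd a : (ra a %| n)%N. Proof. by apply: porbit_dvd; apply: sa_n. Qed.
Lemma src_iter m a : src (iter m sa a) = iter m sv (src a).
Proof. by elim: m => //= m IH; rewrite qa_src IH. Qed.
Lemma tgt_iter m a : tgt (iter m sa a) = iter m sv (tgt a).
Proof. by elim: m => //= m IH; rewrite qa_tgt IH. Qed.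
Lemma dorb_src_dvd a : (dorb (ocl (src a)) %| ra a)%N.
Proof. by apply: porbit_dvd; rewrite -src_iter iter_porbit. Qed.
Lemma dorb_tgt_dvd a : (dorb (ocl (tgt a)) %| ra a)%N.
Proof. by apply: porbit_dvd; rewrite -tgt_iter iter_porbit. Qed.

Lemma cl_iter m v : ocl (iter m sv v) = ocl v.
Proof. by elim: m => //= m IH; rewrite cl_sv. Qed.

Definition rp (a : A) := odflt a [pick b in porbit sa a].
Lemma rp_mem a : rp a \in porbit sa a.
Proof. by rewrite /rp; case: pickP => [b //|h]; rewrite /= porbit_id. Qed.
Lemma rp_eq a b : b \in porbit sa a -> rp b = rp a.
Proof.
rewrite -eq_porbit_mem => /eqP e; rewrite /rp e; case: pickP => //= /(_ a).
by rewrite porbit_id.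
Qed.
Lemma rp_sa a : rp (sa a) = rp a.
Proof. by apply: rp_eq; apply/porbitP; exists 1%N; rewrite expg1. Qed.
Lemma rpK a : rp (rp a) = rp a. Proof. by apply: rp_eq; apply: rp_mem. Qed.
Lemma rp_iter a : exists m, a = iter m sa (rp a).
Proof.
have := rp_mem a; rewrite porbit_sym => /porbitP[m e]; exists m; by rewrite iter_perm.
Qed.
Lemma cl_src_rp a : ocl (src (rp a)) = ocl (src a).
Proof. by have [m {2}->] := rp_iter a; rewrite src_iter cl_iter. Qed.
Lemma cl_tgt_rp a : ocl (tgt (rp a)) = ocl (tgt a).
Proof. by have [m {2}->] := rp_iter a; rewrite tgt_iter cl_iter. Qed.
Lemma card_rp b : rp b = b -> #|[set a | rp a == b]| = ra b.
Proof.
move=> rb; apply: eq_card => a; rewrite !inE; apply/eqP/idP => [<-|].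
  by rewrite porbit_sym rp_mem.
by move=> /rp_eq ->.
Qed.
(** A position of [a] in its orbit counted from [rp a], meaningful only modulo the orbit length;
    hence the congruences of [porbit_congr]. *)
Definition jj a := sval (cid (rp_iter a)).
Lemma jjP a : iter (jj a) sa (rp a) = a. Proof. by rewrite /jj; case: cid => m /= <-. Qed.

Hypothesis adm : admissible g.
Lemma cl_arrow a : ocl (src a) != ocl (tgt a).
Proof. by rewrite eq_sym -mem_cl val_cl; apply: adm. Qed.

Implicit Types x y : {ffun O -> int}.

(** The form in terms of the arrows of [Q]. Admissibility makes the two directions of an edge
    disjoint and keeps them off the diagonal term. *)
Lemma formG_ebase x (o : O) : formG g x (ebase o) = 2 * (dorb o)%:Z * x o -
  (\sum_(a | ocl (tgt a) == o) x (ocl (src a)) + \sum_(a | ocl (src a) == o) x (ocl (tgt a))).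
Proof.
have -> : formG g x (ebase o) = \sum_i x i * bmat i o.
  apply: eq_bigr => i _; rewrite (bigD1 o) //= ffunE eqxx mulr1 big1 ?addr0 // => j nj.
  by rewrite ffunE eq_sym (negPf nj) mulr0.
rewrite (bigD1 o) //= /bmat eqxx PoszM mulrC; congr (_ + _).
rewrite (eq_bigr (fun i => - (\sum_(a | (ocl (src a) == i) && (ocl (tgt a) == o)) x i +
   \sum_(a | (ocl (tgt a) == i) && (ocl (src a) == o)) x i))); last first.
  move=> i ni; rewrite (negPf ni) mulrN; congr (- _).
    rewrite !sumr_const -mulrnDr -mulr_natr natz; congr (_ * Posz _).
  rewrite /nedges.
  have -> : [set a | (src a \in val i) && (tgt a \in val o) || (src a \in val o) && (tgt a \in val i)] =
    [set a | (ocl (src a) == i) && (ocl (tgt a) == o)] :|: [set a | (ocl (tgt a) == i) && (ocl (src a) == o)].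
    apply/setP=> a; rewrite !inE !mem_cl; congr (_ || _); exact: andbC.
  rewrite cardsU [X in (_ - X)%N](_ : _ = 0%N) ?subn0 ?cardsE //.
  apply: eq_card0 => a; apply/negP; rewrite unfold_in => /andP[]; rewrite !inE => /andP[/eqP e1 _] /andP[/eqP e2 _].
  by have := cl_arrow a; rewrite e1 e2 eqxx.
rewrite sumrN big_split /=; congr (- (_ + _)).
  rewrite (partition_big (fun a => ocl (src a)) (fun i => i != o)) /=; last by move=> a /eqP <-; apply: cl_arrow.
  apply: eq_bigr => i ni; rewrite (eq_bigl (fun a => (ocl (tgt a) == o) && (ocl (src a) == i))); last by move=> a; apply: andbC.
  by apply: eq_bigr => a /andP[_ /eqP <-].
rewrite (partition_big (fun a => ocl (tgt a)) (fun i => i != o)) /=; last by move=> a /eqP <-; rewrite eq_sym; apply: cl_arrow.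
apply: eq_bigr => i ni; rewrite (eq_bigl (fun a => (ocl (src a) == o) && (ocl (tgt a) == i))); last by move=> a; apply: andbC.
by apply: eq_bigr => a /andP[_ /eqP <-].
Qed.

Lemma bmatC (i j : O) : bmat i j = bmat j i.
Proof.
rewrite /bmat eq_sym; case: eqP => [-> //|_]; rewrite /nedges; congr (- Posz _).
by apply: eq_card => a; rewrite !inE orbC.
Qed.

Lemma bmat_le0 (i j : O) : i != j -> bmat i j <= 0.
Proof. by move=> ne; rewrite /bmat (negPf ne) oppr_le0. Qed.

Lemma formG_sf x y : formG g x y = sf (@bmat _ _ _ _ g) x y. Proof. by []. Qed.

Lemma formGC x y : formG g x y = formG g y x.
Proof.
rewrite /formG exchange_big; apply: eq_bigr => i _; apply: eq_bigr => j _; rewrite bmatC; ring.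
Qed.

Lemma formG_bmat x (o : O) : formG g x (ebase o) = \sum_j bmat o j * x j.
Proof.
apply: eq_bigr => i _; rewrite (bigD1 o) //= ffunE eqxx mulr1 big1 ?addr0 => [|j nj].
  by rewrite bmatC mulrC.
by rewrite ffunE eq_sym (negPf nj) mulr0.
Qed.

Lemma formG_sum x y : formG g x y = \sum_o formG g x (ebase o) * y o.
Proof.
rewrite formGC; apply: eq_bigr => o _; rewrite formG_bmat mulr_suml.
by apply: eq_bigr => i _; ring.
Qed.

End OrbitForm.

Lemma card_mod N q m a : (0 < m)%N -> (q * m <= N)%N ->
  #|[set c : 'I_N | (c < q * m)%N && (c == a %[mod m])%N]| = q.
Proof.
move=> m0 le; rewrite -[RHS](@count_mod q m a m0) -sum1_card.
rewrite (big_ord_widen _ (fun c => (c == a %[mod m]) : nat) le) [RHS]big_mkcond [LHS]big_mkcond /=.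
by apply: eq_bigr => c _; rewrite inE; case: (ltnP c (q * m)) => //= _; case: (_ == _).
Qed.

Section DualQuiver.
Variables (V A : finType) (src tgt : A -> V) (g : quiver_aut src tgt).
Hypothesis adm : admissible g.
Local Notation sv := (qa_v g).
Local Notation sa := (qa_a g).
Local Notation n := (aut_order g).
Local Notation O := (orb g).
Local Notation cl := (ocl g).
Local Notation mI o := (n %/ dorb o)%N.

(* For the orbit [o] the characters of the stabiliser are numbered by
   [c < n %/ dorb o]; an arrow orbit of length [r] joins [c] to [c'] when they
   have the same restriction, that is, agree modulo [n %/ r]. *)
Definition VtP (p : O * 'I_n) := (p.2 < mI p.1)%N.
Definition Vt : finType := {p : O * 'I_n | VtP p}.
Definition AtP (p : A * ('I_n * 'I_n)) := [&& rp g p.1 == p.1, VtP (cl (src p.1), p.2.1),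
  VtP (cl (tgt p.1), p.2.2) & (p.2.1 == p.2.2 %[mod n %/ ra g p.1])%N].
Definition At : finType := {p : A * ('I_n * 'I_n) | AtP p}.
Definition ob (u : Vt) : O := (val u).1.
Definition ch (u : Vt) : nat := (val u).2.
Definition ab (x : At) : A := (val x).1.

Lemma srctP x : VtP (cl (src (ab x)), (val x).2.1). Proof. by case/and4P: (valP x). Qed.
Lemma tgttP x : VtP (cl (tgt (ab x)), (val x).2.2). Proof. by case/and4P: (valP x). Qed.
Definition srct (x : At) : Vt := exist _ (cl (src (ab x)), (val x).2.1) (srctP x).
Definition tgtt (x : At) : Vt := exist _ (cl (tgt (ab x)), (val x).2.2) (tgttP x).

Lemma n_gt0 : (0 < n)%N. Proof. exact: aut_n_gt0. Qed.
Lemma mI_dorb (o : O) : (mI o * dorb o)%N = n. Proof. by rewrite divnK // dorb_dvd. Qed.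
Lemma mI_gt0 (o : O) : (0 < mI o)%N.
Proof. by rewrite divn_gt0 ?dorb_gt0 // dvdn_leq ?n_gt0 // dorb_dvd. Qed.
Lemma ra_gt0 a : (0 < ra g a)%N.
Proof. by rewrite card_gt0; apply/set0Pn; exists a; apply: porbit_id. Qed.
Lemma mA_gt0 a : (0 < n %/ ra g a)%N.
Proof. by rewrite divn_gt0 ?ra_gt0 // dvdn_leq ?n_gt0 // ra_dvd. Qed.

Lemma mIE a (o : O) : (dorb o %| ra g a)%N -> mI o = (ra g a %/ dorb o * (n %/ ra g a))%N.
Proof.
move=> h; apply/eqP; rewrite -(eqn_pmul2r (dorb_gt0 o)) mI_dorb mulnAC divnK //.
by rewrite mulnC divnK // ra_dvd.
Qed.

Lemma ch_lt u : (ch u < mI (ob u))%N. Proof. exact: (valP u). Qed.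
Lemma Vt_eq u w : ob u = ob w -> ch u = ch w -> u = w.
Proof.
move=> e1 e2; apply: val_inj; rewrite (surjective_pairing (val u)) (surjective_pairing (val w)).
by congr (_, _) => //; apply: val_inj.
Qed.
Definition mkV (o : O) c (h : (c < mI o)%N) : Vt :=
  exist _ (o, Ordinal (leq_trans h (leq_div n (dorb o)))) h.

Lemma At_inj x y : ab x = ab y -> srct x = srct y -> tgtt x = tgtt y -> x = y.
Proof.
move=> e1 /(congr1 val)/= [_ e2] /(congr1 val)/= [_ e3]; apply: val_inj.
rewrite (surjective_pairing (val x)) (surjective_pairing (val y)) (surjective_pairing (val x).2).
by rewrite (surjective_pairing (val y).2) e2 e3; congr (_, _).
Qed.

Lemma noloopt x : srct x != tgtt x.
Proof. by apply/eqP=> /(congr1 ob); apply/eqP/cl_arrow. Qed.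

(** At the source there are [ra / dorb] times [n / ra] characters; those with a prescribed residue
    modulo [n / ra] are [ra / dorb] in number. *)
Lemma card_tgt b u : rp g b = b -> cl (tgt b) = ob u ->
  #|[set x | (tgtt x == u) && (ab x == b)]| = (ra g b %/ dorb (cl (src b)))%N.
Proof.
move=> rb tb.
rewrite -(@card_mod n _ _ (ch u) (mA_gt0 b) (leq_trans (eq_leq (esym (mIE (dorb_src_dvd g b)))) (leq_div _ _))).
rewrite -mIE ?dorb_src_dvd //.
rewrite -(card_in_imset (f := fun x : At => (val x).2.1)); last first.
  move=> x y; rewrite !inE => /andP[/eqP xu /eqP xb] /andP[/eqP yu /eqP yb] e.
  apply: At_inj; rewrite ?xb ?yb ?xu ?yu //.
  by apply: Vt_eq; rewrite /ob /ch /= ?xb ?yb ?e.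
apply: eq_card => c; rewrite inE; apply/imsetP/andP => [[x]|[c1 c2]].
  rewrite inE => /andP[/eqP xu /eqP xb] ->; have /and4P[_ h1 _ h2] := valP x.
  by rewrite -xb; split; [exact: h1|move: h2; rewrite -/(ab x) -xu].
have h : AtP (b, (c, (val u).2)) by apply/and4P; split; rewrite /= ?rb // /VtP /= tb; exact: (valP u).
exists (exist _ (b, (c, (val u).2)) h) => //; rewrite inE; apply/andP; split=> //.
by apply/eqP/Vt_eq.
Qed.

Lemma card_src b u : rp g b = b -> cl (src b) = ob u ->
  #|[set x | (srct x == u) && (ab x == b)]| = (ra g b %/ dorb (cl (tgt b)))%N.
Proof.
move=> rb tb.
rewrite -(@card_mod n _ _ (ch u) (mA_gt0 b) (leq_trans (eq_leq (esym (mIE (dorb_tgt_dvd g b)))) (leq_div _ _))).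
rewrite -mIE ?dorb_tgt_dvd //.
rewrite -(card_in_imset (f := fun x : At => (val x).2.2)); last first.
  move=> x y; rewrite !inE => /andP[/eqP xu /eqP xb] /andP[/eqP yu /eqP yb] e.
  apply: At_inj; rewrite ?xb ?yb ?xu ?yu //.
  by apply: Vt_eq; rewrite /ob /ch /= ?xb ?yb ?e.
apply: eq_card => c; rewrite inE; apply/imsetP/andP => [[x]|[c1 c2]].
  rewrite inE => /andP[/eqP xu /eqP xb] ->; have /and4P[_ _ h1 h2] := valP x.
  by rewrite -xb; split; [exact: h1|move: h2; rewrite -/(ab x) -xu eq_sym].
have h : AtP (b, ((val u).2, c)).
  by apply/and4P; split; rewrite /= ?rb // /VtP /= ?tb; [exact: (valP u)|rewrite eq_sym].
exists (exist _ (b, ((val u).2, c)) h) => //; rewrite inE; apply/andP; split=> //.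
by apply/eqP/Vt_eq.
Qed.

Lemma rp_ab x : rp g (ab x) = ab x. Proof. by case/and4P: (valP x) => /eqP. Qed.

Lemma sum_rp (F : A -> int) (Q : pred A) : (forall a, F (rp g a) = F a) -> (forall a, Q (rp g a) = Q a) ->
  \sum_(a | Q a) F a = \sum_(b | (rp g b == b) && Q b) F b * (ra g b)%:Z.
Proof.
move=> hF hQ; rewrite (partition_big (rp g) (fun b => (rp g b == b) && Q b)) /=; last first.
  by move=> a Qa; rewrite rpK eqxx hQ.
apply: eq_bigr => b /andP[/eqP rb Qb].
rewrite (eq_bigr (fun=> F b)) => [|a /andP[_ /eqP <-]]; last by rewrite hF.
rewrite sumr_const -mulr_natr natz; congr (_ * Posz _); rewrite -(card_rp rb) cardsE.
apply: eq_card => a; rewrite !unfold_in; apply/andP/eqP => [[_ /eqP]//|e].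
by split; [rewrite -hQ e|apply/eqP].
Qed.

(** An orbit of [ra] arrows of [Q] gives [ra / dorb] dual arrows at a fixed end, with [dorb] that of
    the other end; the weight [dorb] restores [ra]. *)
Lemma sum_tgt (be : {ffun O -> int}) u :
  \sum_(x | tgtt x == u) (dorb (ob (srct x)))%:Z * be (ob (srct x)) = \sum_(a | cl (tgt a) == ob u) be (cl (src a)).
Proof.
rewrite [RHS]sum_rp => [|a|a]; [|by rewrite cl_src_rp|by rewrite cl_tgt_rp].
rewrite (partition_big ab (fun b => (rp g b == b) && (cl (tgt b) == ob u))) /=; last first.
  by move=> x /eqP <-; rewrite rp_ab !eqxx.
apply: eq_bigr => b /andP[/eqP rb /eqP tb].
rewrite (eq_bigr (fun=> (dorb (cl (src b)))%:Z * be (cl (src b)))) => [|x /andP[_ /eqP <-]] //.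
rewrite sumr_const -mulr_natr natz -mulrA mulrC -mulrA; congr (_ * _).
rewrite -PoszM; congr Posz; rewrite -[RHS](divnK (dorb_src_dvd g b)); congr (_ * _)%N.
by rewrite -(card_tgt rb tb) cardsE.
Qed.

Lemma sum_src (be : {ffun O -> int}) u :
  \sum_(x | srct x == u) (dorb (ob (tgtt x)))%:Z * be (ob (tgtt x)) = \sum_(a | cl (src a) == ob u) be (cl (tgt a)).
Proof.
rewrite [RHS]sum_rp => [|a|a]; [|by rewrite cl_tgt_rp|by rewrite cl_src_rp].
rewrite (partition_big ab (fun b => (rp g b == b) && (cl (src b) == ob u))) /=; last first.
  by move=> x /eqP <-; rewrite rp_ab !eqxx.
apply: eq_bigr => b /andP[/eqP rb /eqP tb].
rewrite (eq_bigr (fun=> (dorb (cl (tgt b)))%:Z * be (cl (tgt b)))) => [|x /andP[_ /eqP <-]] //.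
rewrite sumr_const -mulr_natr natz -mulrA mulrC -mulrA; congr (_ * _).
rewrite -PoszM; congr Posz; rewrite -[RHS](divnK (dorb_tgt_dvd g b)); congr (_ * _)%N.
by rewrite -(card_src rb tb) cardsE.
Qed.

Local Notation bft := (bf srct tgtt).
Implicit Types (be : {ffun O -> int}) (y : {ffun Vt -> int}).

(* The sum of all the character translates of a lift of [be], see [sum_sh]. *)
Definition Nb be : {ffun Vt -> int} := [ffun u => (dorb (ob u))%:Z * be (ob u)].
Definition pit y : {ffun O -> int} := [ffun o => \sum_(u | ob u == o) y u].

Lemma bf_Nb_ev be u : bft (Nb be) (ev u) = formG g be (ebase (ob u)).
Proof.
rewrite bfe formG_ebase // ffunE mulrA; congr (_ - (_ + _)).
  by rewrite -sum_tgt; apply: eq_bigr => x _; rewrite ffunE.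
by rewrite -sum_src; apply: eq_bigr => x _; rewrite ffunE.
Qed.

(** The averaging identity: it is how the form of [Gamma], and so its fundamental set, controls the
    dual quiver. *)
Lemma bf_Nb be y : bft (Nb be) y = formG g be (pit y).
Proof.
rewrite bf_sum_ev formG_sum // (partition_big ob xpredT) //=; apply: eq_bigr => o _.
rewrite ffunE mulr_sumr; apply: eq_bigr => u /eqP <-; by rewrite bf_Nb_ev.
Qed.

Definition fib (o : O) : {set Vt} := [set u | ob u == o].

Lemma fib_indep o : indep srct tgtt (fib o).
Proof.
move=> x; rewrite !inE; apply/negP=> /andP[/eqP e1 /eqP e2].
by have := cl_arrow adm (ab x); rewrite -[cl (src _)]/(ob (srct x)) e1 -e2 eqxx.
Qed.

Lemma formG_pit y o : formG g (pit y) (ebase o) = (dorb o)%:Z * \sum_(u in fib o) bft y (ev u).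
Proof.
rewrite formGC -bf_Nb (_ : Nb _ = \sum_(u in fib o) ev u *~ (dorb o)%:Z).
  by rewrite bf_suml mulr_sumr; apply: eq_bigr => u _; rewrite bfMl bfC mulrC.
apply/ffunP=> u; rewrite sum_ffunE !ffunE; case: eqP => [e|/eqP ne].
  rewrite (bigD1 u) ?inE ?e //= ffunMzE ffunE eqxx mulr1 -mulrzr intz mul1r big1 ?addr0 // => w /andP[_ nw].
  by rewrite ffunMzE ffunE eq_sym (negPf nw) mul0rz.
rewrite mulr0 big1 // => w; rewrite inE ffunMzE ffunE => /eqP e; case: eqP => [e2|_]; last by rewrite mul0rz.
by rewrite -e -e2 eqxx in ne.
Qed.

(** The division by [dorb o] in [refl] cancels the factor in [formG_pit]; so words in the
    reflections of [Gamma] lift to the dual quiver. *)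
Lemma pit_RS o y : pit (RS srct tgtt (fib o) y) = refl o (pit y).
Proof.
apply/ffunP=> p; rewrite !ffunE formG_pit mulKz ?lt0r_neq0 ?ltz_nat ?dorb_gt0 //.
rewrite (eq_bigr (fun u => y u - if o == p then bft y (ev u) else 0)).
  rewrite big_split /= sumrN; congr (_ - _); case: eqP => [<-|_]; last by rewrite mulr0 big1.
  by rewrite mulr1; apply: eq_bigl => u; rewrite inE.
move=> u /eqP up; rewrite RSE inE up eq_sym; case: ifP => //; by rewrite subr0.
Qed.

End DualQuiver.

Section QuiverSymmetry.
Variables (k : closedFieldType) (V A : finType) (src tgt : A -> V) (p : V -> V) (q : A -> A).
Hypotheses (pI : injective p) (qI : injective q).
Hypothesis src_q : forall a, src (q a) = p (src a).
Hypothesis tgt_q : forall a, tgt (q a) = p (tgt a).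

Lemma bf_sym (x y : {ffun V -> int}) : bf src tgt [ffun v => x (p v)] [ffun v => y (p v)] = bf src tgt x y.
Proof.
rewrite /bf [in RHS](reindex_inj pI) [X in _ = _ - X](reindex_inj qI) /=; congr (2 * _ - _).
  by apply: eq_bigr => v _; rewrite !ffunE.
by apply: eq_bigr => a _; rewrite !ffunE src_q tgt_q.
Qed.

Lemma Ex_sym d : Ex k src tgt d -> Ex k src tgt (fun v => d (p v)).
Proof.
move=> [X [[q1 q2 q3] [X0 iX] <-]].
exists (TMod (fun t => match t with inl v => X (inl (p v)) | inr a => X (inr (q a)) end)); split=> //.
  split=> [v w||a] /=; first by rewrite q1 (inj_eq pI).
    by rewrite -q2 [in RHS](reindex_inj pI).
  by rewrite -src_q -tgt_q q3.
split=> // e he ee; apply: iX => // -[v|a].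
  by have := he (inl (invF pI v)); rewrite /= f_invF.
by have := he (inr (invF qI a)); rewrite /= f_invF.
Qed.

End QuiverSymmetry.

(** * Lifting imaginary roots to the dual quiver *)

Section Lifting.
Variables (V A : finType) (src tgt : A -> V) (g : quiver_aut src tgt) (k : closedFieldType).
Hypothesis adm : admissible g.
Local Notation n := (aut_order g).
Local Notation O := (orb g).
Local Notation cl := (ocl g).
Local Notation mI o := (n %/ dorb o)%N.
Local Notation Vt := (Vt g).
Local Notation At := (At g).
Local Notation srct := (@srct _ _ _ _ g).
Local Notation tgtt := (@tgtt _ _ _ _ g).
Local Notation bft := (bf srct tgtt).
Implicit Types (u w : Vt) (y : {ffun Vt -> int}).

(* Tensoring with the generating character. *)
Definition p1 u : Vt := mkV (ltn_pmod (ch u).+1 (mI_gt0 (ob u))).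

Lemma ob_p1 u : ob (p1 u) = ob u. Proof. by []. Qed.
Lemma ch_p1 u : ch (p1 u) = ((ch u).+1 %% mI (ob u))%N. Proof. by []. Qed.

Lemma p1_inj : injective p1.
Proof.
move=> u w e; have eo : ob u = ob w by rewrite -ob_p1 e.
apply: Vt_eq => //; have := congr1 (fun x => ch x) e; rewrite !ch_p1 -eo => /eqP.
rewrite -[(ch u).+1]addn1 -[(ch w).+1]addn1 eqn_modDr => /eqP.
by rewrite !modn_small ?eo ?ch_lt // -eo ch_lt.
Qed.

Lemma q1P (x : At) : AtP (ab x, ((val (p1 (srct x))).2, (val (p1 (tgtt x))).2)).
Proof.
have /and4P[h1 _ _ h2] := valP x; apply/and4P; split=> //.
- exact: (valP (p1 (srct x))).
- exact: (valP (p1 (tgtt x))).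
change (((ch (srct x)).+1 %% mI (ob (srct x)))%N == ((ch (tgtt x)).+1 %% mI (ob (tgtt x))) %[mod n %/ ra g (ab x)])%N.
rewrite !modn_dvdm.
- by rewrite -[(ch (srct x)).+1]addn1 -[(ch (tgtt x)).+1]addn1 eqn_modDr.
- by rewrite (mIE (dorb_tgt_dvd g (ab x))) dvdn_mull.
- by rewrite (mIE (dorb_src_dvd g (ab x))) dvdn_mull.
Qed.

Definition q1 (x : At) : At := exist _ (ab x, ((val (p1 (srct x))).2, (val (p1 (tgtt x))).2)) (q1P x).

Lemma srct_q1 x : srct (q1 x) = p1 (srct x). Proof. by apply: Vt_eq. Qed.
Lemma tgtt_q1 x : tgtt (q1 x) = p1 (tgtt x). Proof. by apply: Vt_eq. Qed.

Lemma q1_inj : injective q1.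
Proof.
move=> x y e; apply: At_inj; first exact: (congr1 (fun x => ab x) e).
  by apply: p1_inj; rewrite -!srct_q1 e.
by apply: p1_inj; rewrite -!tgtt_q1 e.
Qed.

Definition sh e y : {ffun Vt -> int} := [ffun u => y (iter e p1 u)].

Lemma shS e y : sh e.+1 y = [ffun u => sh e y (p1 u)].
Proof. by apply/ffunP=> u; rewrite !ffunE iterSr. Qed.

Lemma bf_sh e y y' : bft (sh e y) (sh e y') = bft y y'.
Proof.
elim: e => [|e IH]; first by congr bf; apply/ffunP=> u; rewrite ffunE.
by rewrite !shS (bf_sym p1_inj q1_inj srct_q1 tgtt_q1).
Qed.

Lemma Ex_sh e d : Ex k srct tgtt d -> Ex k srct tgtt (fun u => d (iter e p1 u)).
Proof.
elim: e d => // e IH d ed; rewrite (_ : (fun u => _) = fun u => d (iter e p1 (p1 u))); last first.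
  by apply: funext => u; rewrite iterSr.
exact: (Ex_sym p1_inj q1_inj srct_q1 tgtt_q1 (d := fun u => d (iter e p1 u)) (IH d ed)).
Qed.

Lemma ob_iter e u : ob (iter e p1 u) = ob u. Proof. by elim: e. Qed.
Lemma ch_iter e u : ch (iter e p1 u) = ((ch u + e) %% mI (ob u))%N.
Proof.
elim: e => [|e IH]; first by rewrite addn0 modn_small // ch_lt.
by rewrite /= ch_p1 IH ob_iter -addn1 modnDml addn1 addnS.
Qed.

Lemma pit_sh e y : pit (sh e y) = pit y.
Proof.
apply/ffunP=> o; rewrite !ffunE.
have inj : injective (iter e p1) by elim: e => [|e IH] u w //= /p1_inj /IH.
rewrite [RHS](reindex_inj inj) /=; apply: eq_big => u; first by rewrite ob_iter.
by rewrite ffunE.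
Qed.

(** [e] runs below [n = dorb * mI] while the fibre is cyclic of length [mI], so it is traversed
    [dorb] times. *)
Lemma card_iter u w : ob w = ob u -> #|[set e : 'I_n | iter e p1 u == w]| = dorb (ob u).
Proof.
move=> wu; have m0 := mI_gt0 (ob u); set m := mI (ob u) in m0.
have nE : (dorb (ob u) * m)%N = n by rewrite mulnC /m mI_dorb.
rewrite -(@card_mod n (dorb (ob u)) m (ch w + (m - ch u)) m0 (eq_leq nE)); apply: eq_card => e.
rewrite !inE nE ltn_ord /= -(eqn_modDl (ch u)) addnCA subnKC; last by rewrite ltnW // ch_lt.
rewrite modnDr [(ch w %% m)%N]modn_small; last by rewrite /m -wu ch_lt.
by apply/eqP/eqP => [<-|h]; [rewrite ch_iter|apply: Vt_eq; rewrite ?ob_iter ?ch_iter].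
Qed.

Lemma sum_sh y : \sum_(e < n) sh e y = Nb (pit y).
Proof.
apply/ffunP=> u; rewrite sum_ffunE !ffunE mulr_sumr.
rewrite (partition_big (fun e : 'I_n => iter e p1 u) (fun w => ob w == ob u)) /=; last by move=> e _; rewrite ob_iter.
apply: eq_bigr => w /eqP wu; rewrite (eq_bigr (fun=> y w)) => [|e /eqP <-]; last by rewrite ffunE.
by rewrite sumr_const -mulr_natr natz mulrC -(card_iter wu) cardsE.
Qed.

Definition pn (d : Vt -> nat) (o : O) : nat := (\sum_(u | ob u == o) d u)%N.

Lemma pit_nz d : pit (nz d) = nz (pn d).
Proof.
apply/ffunP=> o; rewrite !ffunE /pn (big_morph Posz PoszD (erefl (Posz 0))).
by apply: eq_bigr => u _; rewrite ffunE.
Qed.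

Lemma pn_gt0 d : (exists u, 0 < d u)%N -> exists o, (0 < pn d o)%N.
Proof. by move=> [u du]; exists (ob u); rewrite /pn (bigD1 u) //= addn_gt0 du. Qed.

(** The entries of a lift are bounded by the total of [x], so there are finitely many lifts; [d0],
    which puts everything on the character 0, is one. *)
Lemma lift_min (x : O -> nat) : exists d : Vt -> nat, pn d = x /\
  forall d', pn d' = x -> bft (nz d) (nz d) <= bft (nz d') (nz d').
Proof.
pose N := (\sum_o x o)%N.
pose d0 u := if ch u == 0%N then x (ob u) else 0%N.
have pd0 : pn d0 = x.
  apply: funext => o; rewrite /pn (bigD1 (mkV (mI_gt0 o))) //= {1}/d0 /= big1 ?addn0 // => u /andP[/eqP uo nu].
  rewrite /d0; case: eqP => // c0; case/eqP: nu; exact: Vt_eq.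
have bd d u : pn d = x -> (d u < N.+1)%N.
  move=> dx; rewrite ltnS /N (bigD1 (ob u)) //= -dx {1}/pn (bigD1 u) //= -!addnA leq_addr //.
pose F (f : {ffun Vt -> 'I_N.+1}) := bft (nz (fun u => f u : nat)) (nz (fun u => f u : nat)).
pose P (f : {ffun Vt -> 'I_N.+1}) := `[< pn (fun u => f u : nat) = x >].
pose tof d : {ffun Vt -> 'I_N.+1} := [ffun u => inord (d u)].
have tofK d : pn d = x -> (fun u => tof d u : nat) = d.
  by move=> dx; apply: funext => u; rewrite ffunE inordK // bd.
have P0 : P (tof d0) by apply/asboolP; rewrite tofK.
case: (arg_minP F P0) => f /asboolP Pf hf; exists (fun u => f u : nat); split=> // d' dx.
have := hf (tof d'); rewrite /F tofK // => -> //; by apply/asboolP; rewrite tofK.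
Qed.

Definition negdec (x : O -> nat) := forall b c : O -> nat, (forall o, b o + c o = x o)%N ->
  (exists o, 0 < b o)%N -> (exists o, 0 < c o)%N -> formG g (nz b) (nz c) < 0.

(** Replacing [b] by a translate gives another lift of [x] and keeps [(b, b)] and [(c, c)], so
    minimality bounds [(b, c)] by each [(sh e b, c)]; these add up to the form of [Gamma] at the
    projections. *)
Lemma Ex_lift x : (exists o, 0 < x o)%N -> negdec x -> exists2 d, Ex k srct tgtt d & pn d = x.
Proof.
move=> [o xo] nx; have [d [dx hd]] := lift_min x; exists d => //; apply: Ex_generic.
  apply: contrapT => h; move: xo; rewrite -dx /pn big1 // => u _.
  by apply/eqP; rewrite -leqn0 leqNgt; apply/negP=> du; apply: h; exists u.
move=> b c bc b0 c0.
have le e : bft (nz b) (nz c) <= bft (sh e (nz b)) (nz c).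
  have dE : nz d = nz b + nz c by apply/ffunP=> u; rewrite !ffunE -bc.
  have d'E : nz (fun u => b (iter e p1 u) + c u)%N = sh e (nz b) + nz c.
    by apply/ffunP=> u; rewrite !ffunE.
  have := hd (fun u => b (iter e p1 u) + c u)%N; rewrite dE d'E !(bfDl, bfDr) bf_sh.
  rewrite !(bfC _ _ (nz c)) => H.
  have : pn (fun u => b (iter e p1 u) + c u)%N = x.
    apply: (nz_inj); rewrite -pit_nz d'E -dx -pit_nz dE.
    have pitD y y' : pit (y + y') = pit y + pit y'.
      apply/ffunP=> o'; rewrite !ffunE -big_split /=; by apply: eq_bigr => u _; rewrite ffunE.
    by rewrite !pitD pit_sh.
  by move=> /H; move: (bft (nz b) (nz b)) (bft (nz b) (nz c)) => *; lia.
have lt : \sum_(e < n) bft (sh e (nz b)) (nz c) < 0.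
  rewrite -bf_suml sum_sh bf_Nb // !pit_nz; apply: nx; [move=> o'|exact: pn_gt0|exact: pn_gt0].
  by rewrite -dx /pn -big_split /=; apply: eq_bigr => u _; rewrite bc.
rewrite ltNge; apply/negP=> ge; move: lt; rewrite ltNge; case/negP.
by apply: sumr_ge0 => e _; apply: le_trans (le e).
Qed.

Lemma fundamental_cut x : fundamental g x -> cutconn (@bmat _ _ _ _ g) (fun o => x o != 0).
Proof.
move=> [_ [_ [_ cx]]] P hP i j xi xj Pi.
have /connectP[p pp ->] : connect [rel u v | [&& u \in supp x, v \in supp x & gadj u v]] i j.
  by apply: cx; rewrite inE.
elim: p i xi Pi pp => //= o p IH i xi Pi /andP[/and3P[_]]; rewrite inE => xo /andP[_ bn] pp.
by apply: IH => //; apply: (hP i).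
Qed.

Theorem fundamental_lift x : fundamental g x -> exists2 d, Ex k srct tgtt d & pit (nz d) = x.
Proof.
move=> fx; have cx := fundamental_cut fx; have [x0 [xn0 [xe _]]] := fx.
pose xn o := `|x o|%N; have xE : x = nz xn by apply/ffunP=> o; rewrite ffunE /xn; have := x0 o; lia.
have xp : exists o, (0 < xn o)%N.
  apply: contrapT => h; case/eqP: xn0; apply/ffunP=> o; rewrite ffunE xE ffunE.
  by case: (posnP (xn o)) => [-> //|h']; case: h; exists o.
suff [d ed dx] : exists2 d, Ex k srct tgtt d & pn d = xn by exists d => //; rewrite pit_nz dx -xE.
have sub (z b c : O -> nat) : (forall o, b o + c o = z o)%N ->
    formG g (nz b) (nz c) = sf (@bmat _ _ _ _ g) (nz b) (fun o => nz z o - nz b o).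
  move=> bc; rewrite formG_sf; congr sf; apply: funext => o; rewrite !ffunE -bc; lia.
have rng (z b c : O -> nat) : (forall o, b o + c o = z o)%N -> forall o, 0 <= nz b o <= nz z o.
  by move=> bc o; rewrite !ffunE -bc; lia.
have [nd|nnd] := EM (negdec xn); first exact: Ex_lift.
(* The equality case of [sf_decomp]: a decomposition of nonnegative pairing puts [x] in the radical
   on its support. *)
have tame o : 0 < x o -> \sum_j bmat o j * x j = 0.
  have [b [c [bc b0 c0 ge]]] : exists b c : O -> nat, [/\ forall o, (b o + c o = xn o)%N,
      exists o, (0 < b o)%N, exists o, (0 < c o)%N & 0 <= formG g (nz b) (nz c)].
    apply: contrapT => h; apply: nnd => b c bc b0 c0; rewrite ltNge; apply/negP=> ge.
    by apply: h; exists b, c.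
  have [le eq] := sf_decomp (@bmatC _ _ _ _ g) (@bmat_le0 _ _ _ _ g) (x := x) x0 (z := nz b)
    (fun o _ => eq_ind _ (fun z => z <= 0) (xe o) _ (formG_bmat x o)) (ltac:(rewrite xE; exact: rng bc)).
  have e0 : sf (@bmat _ _ _ _ g) (nz b) (fun o => x o - nz b o) = 0.
    by apply/eqP; rewrite eq_le le /=; move: ge; rewrite (sub _ _ _ bc) -xE.
  have [] := eq e0 cx; last by move=> _; apply.
    by have [o' h] := b0; exists o'; rewrite ffunE.
  by have [o' h] := c0; exists o'; rewrite xE !ffunE -bc; lia.
have [t [de [t0 d0 xnE prim]]] := primitive_ex xp.
have xde o : x o = nz de o * t%:Z by rewrite xE !ffunE xnE PoszM mulrC.
have dpos o : 0 < nz de o -> 0 < x o by rewrite xde !ffunE; nia.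
have tamed o : 0 < nz de o -> \sum_j bmat o j * nz de j = 0.
  move=> /dpos/tame; rewrite (eq_bigr (fun j => bmat o j * nz de j * t%:Z)) => [|j _]; last by rewrite xde mulrA.
  by rewrite -mulr_suml => /eqP; rewrite mulf_eq0 eqz_nat => /orP[/eqP //|]; lia.
have cd : cutconn (@bmat _ _ _ _ g) (fun o => nz de o != 0).
  have eqs o : (x o != 0) = (nz de o != 0) by rewrite xde mulf_eq0 eqz_nat; lia.
  move=> P hP i j; rewrite -!eqs; apply: cx => i' j'; rewrite !eqs; exact: hP.
(* Equality would again force proportionality, which the primitive part [de] excludes although [x]
   does not. *)
have ndd : negdec de.
  move=> b c bc b0 c0.
  have le0 o : 0 < nz de o -> \sum_j bmat o j * nz de j <= 0 by move=> /tamed ->.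
  have de0 o : 0 <= nz de o by rewrite ffunE.
  have [le eq] := sf_decomp (@bmatC _ _ _ _ g) (@bmat_le0 _ _ _ _ g) de0 le0 (rng _ _ _ bc).
  rewrite (sub _ _ _ bc) lt_neqAle le andbT; apply/eqP=> e0.
  have [] := eq e0 cd.
  - by have [o' h] := b0; exists o'; rewrite ffunE.
  - by have [o' h] := c0; exists o'; rewrite !ffunE -bc; lia.
  move=> pr _; case: (prim b c bc) => [i j|h|h].
  - by have := pr i j; rewrite !ffunE -!PoszM => -[].
  - by have [o] := b0; rewrite h.
  - by have [o] := c0; rewrite h.
have [d ed dd] := Ex_lift d0 ndd.
pose D (e : 'I_n) u := d (iter e p1 u).
have ND : nz (fun u => \sum_e D e u)%N = Nb (nz de).
  rewrite nz_sum_seq -dd -pit_nz -sum_sh; apply: eq_bigr => e _; by apply/ffunP=> u; rewrite !ffunE.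
(* A chain of [t] translates of one lift of [de], with [t.-1] since the chain has one more member
   than its index. Each translate projects to [de], so the sum projects to [x]. *)
have [|f [sf ef]] := @tame_chain k _ _ srct tgtt (noloopt adm) _ D (Ordinal (n_gt0 g)) t.-1 _ (fun e => Ex_sh e ed).
  move=> u Nu; rewrite ND bf_Nb_ev // formG_bmat tamed //.
  have : 0 < nz (fun u => \sum_e D e u)%N u by rewrite ffunE.
  by rewrite ND !ffunE; nia.
exists (fun u => \sum_(e <- f) D e u)%N => //; apply: funext => o.
rewrite /pn exchange_big /= (eq_bigr (fun=> de o)) => [|e _]; last first.
  have := pit_sh e (nz d); rewrite [pit (nz d)]pit_nz dd => /ffunP/(_ o); rewrite !ffunE => h.
  apply/eqP; rewrite -eqz_nat (big_morph Posz PoszD (erefl (Posz 0))) -h; apply/eqP.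
  by apply: eq_bigr => u _; rewrite !ffunE.
by rewrite big_const_seq count_predT iter_addn_0 sf prednK // xnE mulnC.
Qed.

(** The word lifts to reflections at fibres. The result is a dimension vector up to sign, and the
    negative sign is excluded because [be] is nonnegative and nonzero. *)
Theorem imag_lift be : imag_root g be -> nonneg_vec g be -> be != 0 ->
  exists2 d, Ex k srct tgtt d & pit (nz d) = be.
Proof.
move=> [s [x [fx hs]]] be0 bn.
have pitN y : pit (- y) = - pit y.
  by apply/ffunP=> o; rewrite !ffunE -sumrN; apply: eq_bigr => u _; rewrite ffunE.
have [y ey py] : exists2 y, ExZ srct tgtt k y & pit y = weyl_word s x.
  elim: s {hs} => [|o s [y ey py]] /=.
    by have [d ed dx] := fundamental_lift fx; exists (nz d) => //; exists d => //; left.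
  exists (RS srct tgtt (fib o) y); last by rewrite pit_RS // py.
  by apply: ExZ_RS => //; [apply: noloopt|apply: fib_indep].
have [y' ey' py'] : exists2 y, ExZ srct tgtt k y & pit y = be.
  by case: hs => ->; [exists y|exists (- y); [apply: ExZ_N|rewrite pitN py]].
case: ey' => d ed [yE|yE]; first by exists d; rewrite -?yE.
case/eqP: bn; apply/ffunP=> o; rewrite ffunE; apply/eqP; rewrite eq_le be0 andbT.
by rewrite -py' yE pitN pit_nz !ffunE oppr_le0.
Qed.

Theorem imag_iiindec be : n%:R != 0 :> k -> imag_root g be -> nonneg_vec g be -> be != 0 ->
  exists X : tmod k (V + A), [/\ qmod src tgt X, iiindec (ss (qa_v g) (qa_a g)) X &
    forall v, (qdim X v)%:Z = be (cl v)].
Proof.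
move=> n0 ib be0 bn; have [d [Wt [qWt iWt dWt]] pd] := imag_lift ib be0 bn.
have [z pz] := closed_prim_root_ex n0.
have zmod (i j : int) : (n%:Z %| i - j)%Z -> z ^ i = z ^ j.
  move=> /dvdzP[c e]; have z0 : z != 0.
    by apply: contraTneq isT => z0; have := prim_expr_order pz; rewrite z0 expr0n (gtn_eqF (n_gt0 g)) => /esym/eqP; rewrite oner_eq0.
  have -> : i = j + n%:Z * c by rewrite -[i](subrK j) e; ring.
  have zn : z ^ n%:Z = 1 := prim_expr_order pz.
  by rewrite expfzDr // -exprz_exp zn exp1rz mulr1.
(* The first factor is divisible by the length of the arrow orbit, the difference of the characters
   by [n] over that length; so the exponents agree modulo [n]. *)
have z_arrow a (x : At) : ab x = rp g a ->
    z ^ (((jj g a).+1%:Z - (jj g (qa_a g a))%:Z) * (ch (srct x))%:Z) =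
    z ^ (((jj g a).+1%:Z - (jj g (qa_a g a))%:Z) * (ch (tgtt x))%:Z).
  move=> xa; apply: zmod; rewrite -mulrBr.
  have /dvdzP[c1 e1] : ((ra g (ab x))%:Z %| (jj g a).+1%:Z - (jj g (qa_a g a))%:Z)%Z.
    by apply: porbit_congr; rewrite xa iterS jjP -[in RHS](rp_sa g a) jjP.
  have /dvdzP[c2 e2] : ((n %/ ra g (ab x))%N%:Z %| (ch (srct x))%:Z - (ch (tgtt x))%:Z)%Z.
    by have /and4P[_ _ _ h] := valP x; rewrite -eqz_mod_dvd !modz_nat eqz_nat.
  have nE : n%:Z = (n %/ ra g (ab x))%N%:Z * (ra g (ab x))%:Z by rewrite -PoszM divnK // ra_dvd.
  by apply/dvdzP; exists (c1 * c2); rewrite e1 e2 nE; ring.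
(* The exponents stay below [n], so the primitive root separates them. *)
have z_dd v u w : ob u = cl v -> ob w = cl v ->
    z ^ ((dorb (cl v))%:Z * (ch u)%:Z) = z ^ ((dorb (cl v))%:Z * (ch w)%:Z) -> u = w.
  move=> uv wv; rewrite -!PoszM => h.
  have : z ^+ (dorb (cl v) * ch u) == z ^+ (dorb (cl v) * ch w) by apply/eqP.
  have small u' : ob u' = cl v -> (dorb (cl v) * ch u' < n)%N.
    by move=> uv'; rewrite -(mI_dorb (cl v)) mulnC ltn_pmul2r ?dorb_gt0 // -uv' ch_lt.
  rewrite (eq_prim_root_expr pz) !modn_small ?small // eqn_pmul2l ?dorb_gt0 // => /eqP e.
  by apply: Vt_eq; rewrite ?uv.
have [W [eW iW qW dW]] := @dual_functor k V A O src tgt (qa_v g) (qa_a g) cl (rp g) (jj g) n z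
   (fun v => dorb (cl v)) Vt At srct tgtt (@ob _ _ _ _ g) (@ch _ _ _ _ g) (@ab _ _ _ _ g)
   (qa_src g) (qa_tgt g) (sv_n g) (cl_sv g) (@cl_orbit _ _ _ _ g) (fun u => cl_ex (ob u)) (rp_sa g) (@rp_ab _ _ _ _ g)
   (cl_src_rp g) (cl_tgt_rp g) (fun x => erefl) (fun x => erefl) (@At_inj _ _ _ _ g) (prim_expr_order pz) (n_gt0 g)
   z_arrow (sv_dorb g) z_dd Wt qWt iWt.
exists (und W); split=> //.
  apply: (emod_iiindec n0 _ eW iW) => -[v|a].
    have -> m : iter m (ss (qa_v g) (qa_a g)) (inl v) = inl (iter m (qa_v g) v) by elim: m => //= m ->.
    by rewrite sv_n.
  have -> m : iter m (ss (qa_v g) (qa_a g)) (inr a) = inr (iter m (qa_a g) a) by elim: m => //= m ->.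
  by rewrite sa_n.
by move=> v; rewrite dW -pd pit_nz ffunE dWt.
Qed.

End Lifting.

Lemma uniq_sub_perm (T : eqType) (t l : seq T) : uniq t -> {subset t <= l} ->
  exists u, perm_eq l (t ++ u).
Proof.
elim: t l => [|x t IH] l; first by exists l.
case/andP=> xt ut sub; have xl : x \in l by apply: sub; rewrite mem_head.
have [|u hu] := IH (rem x l) ut.
  move=> y yt; have := sub y; rewrite inE yt orbT => /(_ isT) yl.
  have := perm_mem (perm_to_rem xl) y; rewrite yl inE => /esym/orP[/eqP e|//].
  by rewrite -e yt in xt.
by exists u; apply: (perm_trans (perm_to_rem xl)); rewrite /= perm_cons.
Qed.

Lemma big_traject (R : Type) (idx : R) (op : Monoid.law idx) (T : Type) (f : T -> T) x r (F : T -> R) :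
  \big[op/idx]_(y <- traject f x r) F y = \big[op/idx]_(j < r) F (iter j f x).
Proof.
elim: r => [|r IH]; first by rewrite big_nil big_ord0.
by rewrite trajectSr -cats1 big_cat big_seq1 IH big_ord_recr.
Qed.

(** * Orbits of indecomposables *)

Section TwistOrbit.
Variables (k : closedFieldType) (T : Type) (s : T -> T) (n : nat).
Hypothesis n0 : (0 < n)%N.
Hypothesis sn : forall t, iter n s t = t.
Local Notation tmod := (tmod k T).
Local Notation ctmod := (ctmod k T).
Local Notation tw := (@tw k T s).
Implicit Types (X Y Z : tmod) (c : ctmod).

Lemma tw_iso X Y : tiso X Y -> tiso (tw X) (tw Y).
Proof. by move=> [f [h [hf fg gf]]]; exists f, h; split=> // t; apply: hf. Qed.

Lemma tw_tbig (l : seq tmod) : tw (tbig l) = tbig (map tw l).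
Proof. by elim: l => //= X l <-. Qed.

Lemma tw_tindec X : tindec X -> tindec (tw X).
Proof.
move=> [X0 iX]; split=> // e he ee; apply: iX => // t.
have := he (iter n.-1 s t); rewrite /= -iterS prednK // sn; exact.
Qed.

Definition ta c : ctmod := can (tw c).

Lemma ta_cindec c : cindec c -> cindec (ta c).
Proof.
move=> [ic _]; split; last exact: canK.
exact: tindec_iso (can_iso _) (tw_tindec ic).
Qed.

Lemma all_tindec_map (l : seq ctmod) : all_cindec l -> all_tindec (map tw l).
Proof.
elim: l => //= c l IH h; split; first by apply: tw_tindec; case: (h c (mem_head _ _)).
by apply: IH => c' cl; apply: h; rewrite inE cl orbT.
Qed.

Lemma dec_tw X : perm_eq (dec (tw X)) (map ta (dec X)).
Proof.
have h : tiso (tw X) (tbig (map tw (dec X))) by rewrite -tw_tbig; apply/tw_iso/dec_iso.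
apply: (perm_trans (y := dec (tbig (map tw (dec X))))); first exact/dec_isoP.
apply: (perm_trans (dec_tbig (all_tindec_map (@dec_indec _ _ X)))).
by rewrite -map_comp.
Qed.

Lemma tinv_dec X : tinv s X <-> perm_eq (dec X) (map ta (dec X)).
Proof.
split=> [/dec_isoP h|h]; first exact: perm_trans h (dec_tw X).
by apply/dec_isoP; apply: (perm_trans h); rewrite perm_sym; apply: dec_tw.
Qed.

Lemma iter_ta c m : can c = c -> iter m ta c = can (TMod (fun t => (c : tmod) (iter m s t)) : tmod).
Proof.
move=> cc; elim: m => [|m IH]; first by rewrite /= -{1}cc; congr can; case: (c : tmod).
rewrite iterS IH /ta; apply/canP.
have -> : (TMod (fun t => (c : tmod) (iter m.+1 s t)) : tmod) = tw (TMod (fun t => (c : tmod) (iter m s t))).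
  by rewrite /tw /=; congr TMod; apply: funext => t; rewrite -iterSr.
by apply: tw_iso; apply: tiso_sym; apply: can_iso.
Qed.

Lemma iter_ta_n c q : can c = c -> iter (q * n) ta c = c.
Proof.
move=> cc; elim: q => // q IH; rewrite mulSn addnC iterD; rewrite [iter n ta c](_ : _ = c) //.
rewrite iter_ta // -[RHS]cc; congr can.
have -> : (fun t => (c : tmod) (iter n s t)) = (c : tmod) by apply: funext => t; rewrite sn.
by case: (c : tmod).
Qed.

Definition isorb c r := [/\ cindec c, (0 < r)%N, uniq (traject ta c r) & iter r ta c = c].

Lemma isorb_ex c : cindec c -> exists r, isorb c r.
Proof.
move=> ic; have cc := ic.2.
have ex : exists r, (0 < r)%N && (iter r ta c == c) by exists n; rewrite n0 /= -[n]mul1n iter_ta_n.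
case: (ex_minnP ex) => r /andP[r0 /eqP rc] min; exists r; split=> //.
apply/(uniqP c) => i j; rewrite !inE size_traject => ir jr; rewrite !nth_traject //.
wlog lt : i j ir jr / (i < j)%N.
  move=> H; case: (ltngtP i j) => [lt|lt|//] e; first exact: H.
  by apply/esym; apply: H.
move=> e; have := congr1 (iter (i * n - i) ta) e; rewrite -!iterD subnK ?leq_pmulr // iter_ta_n //.
have -> : (i * n - i + j)%N = ((j - i) + i * n)%N by have := leq_pmulr i n0; lia.
rewrite iterD iter_ta_n // => /esym/eqP h.
by have := min (j - i)%N; rewrite subn_gt0 lt h => /(_ isT); lia.
Qed.

Lemma isorb_perm c r : isorb c r -> perm_eq (map ta (traject ta c r)) (traject ta c r).
Proof.
move=> [_ _ _ rc]; have -> : map ta (traject ta c r) = traject ta (ta c) r.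
  by elim: r c {rc} => //= r IH c; rewrite IH.
rewrite -(perm_cons c) -[c :: traject ta (ta c) r]/(traject ta c r.+1) trajectSr rc.
by rewrite perm_rcons.
Qed.

Lemma isorb_cindec c r : isorb c r -> all_cindec (traject ta c r).
Proof.
move=> [ic _ _ _] c' /trajectP[i _ ->]; elim: i => //= i; exact: ta_cindec.
Qed.

Lemma dec_nil X : (0 < tsz X)%N -> exists c, c \in dec X.
Proof.
move=> X0; case e : (dec X) => [|c l]; last by exists c; rewrite mem_head.
by have := tiso_sz (dec_iso X); rewrite e /= => h; rewrite h in X0.
Qed.

Lemma tbig_gt0 (l : seq ctmod) c : c \in l -> all_cindec l -> (0 < tsz (tbig l))%N.
Proof.
elim: l => // c' l _ _ h; have [[c0 _] _] := h c' (mem_head _ _).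
by rewrite /= addn_gt0 c0.
Qed.

Lemma dec_tbig_cindec (l : seq ctmod) : all_cindec l -> perm_eq (dec (tbig l)) l.
Proof. by move=> h; apply: dec_unique => //; apply: tiso_refl. Qed.

Lemma iter_mem_dec X c m : tinv s X -> c \in dec X -> iter m ta c \in dec X.
Proof.
move=> /tinv_dec h cX; elim: m => //= m IH; rewrite (perm_mem h); exact: map_f.
Qed.

(** The twist orbit of one summand occurs entirely in [X]; its sum is invariant, and so is the
    remainder, which must then be empty. *)
Lemma iiindec_orbit X : iiindec s X -> exists c r, isorb c r /\ perm_eq (dec X) (traject ta c r).
Proof.
move=> [iX X0 nX]; have [c cX] := dec_nil X0.
have [r ir] := isorb_ex (dec_indec cX); exists c, r; split=> //.
have [_ r0 ut _] := ir.
have [|u hu] := uniq_sub_perm ut (l := dec X).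
  by move=> c' /trajectP[i _ ->]; apply: iter_mem_dec.
case: u hu => [|c1 u] hu; first by rewrite cats0 in hu.
have it := isorb_cindec ir.
have iu : all_cindec (c1 :: u).
  by move=> c' cu; apply: (@dec_indec _ _ X); rewrite (perm_mem hu) mem_cat cu orbT.
case: nX; exists (tbig (traject ta c r)), (tbig (c1 :: u)); split.
- apply/tinv_dec; have p := dec_tbig_cindec it.
  rewrite (permPl p) (permPr (perm_map ta p)) perm_sym; exact: isorb_perm.
- apply/tinv_dec; have p := dec_tbig_cindec iu.
  rewrite (permPl p) (permPr (perm_map ta p)) -(perm_cat2l (traject ta c r)) -(permPl hu).
  move/tinv_dec: iX => h; rewrite (permPl h) (permPl (perm_map ta hu)) map_cat perm_cat2r.
  exact: isorb_perm.
- by apply: (tbig_gt0 (c := c)) => //; case: (r) r0 => // m _; rewrite mem_head.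
- by apply: (tbig_gt0 (c := c1)) => //; rewrite mem_head.
- apply: (tiso_trans (dec_iso X)); apply: (tiso_trans (tbig_perm hu)); exact: tbig_cat.
Qed.

(** An invariant summand containing one member of the orbit contains all; two complementary ones
    would share members, against distinctness. *)
Lemma orbit_iiindec X c r : isorb c r -> perm_eq (dec X) (traject ta c r) -> iiindec s X.
Proof.
move=> ir hX; have [ic r0 ut rc] := ir.
have mem c1 c2 : c1 \in traject ta c r -> c2 \in traject ta c r -> exists m, c2 = iter m ta c1.
  move=> /trajectP[i lt ->] /trajectP[j _ ->]; exists (j + (r - i))%N.
  by rewrite iterD -(iterD (r - i)) subnK ?rc // ltnW.
split.
- by apply/tinv_dec; rewrite (permPl hX) (permPr (perm_map ta hX)) perm_sym; apply: isorb_perm.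
- rewrite (tiso_sz (dec_iso X)); apply: (tbig_gt0 (c := c)); last exact: dec_indec.
  by rewrite (perm_mem hX); case: (r) r0 => // m _; rewrite mem_head.
move=> [Y [Z [iY iZ Y0 Z0 /dec_isoP iX]]].
have [c1 c1Y] := dec_nil Y0; have [c2 c2Z] := dec_nil Z0.
have hYZ : perm_eq (traject ta c r) (dec Y ++ dec Z).
  by rewrite -(permPl hX) (permPl iX); apply: dec_sum.
have [m e] : exists m, c2 = iter m ta c1 by apply: mem; rewrite (perm_mem hYZ) mem_cat ?c1Y ?c2Z ?orbT.
move: ut; rewrite (perm_uniq hYZ) cat_uniq => /and3P[_ /seq.hasP[]].
by exists c2 => //; rewrite e; apply: iter_mem_dec.
Qed.

End TwistOrbit.

(** * Folding the root system *)

Section Folding.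
Variables (V A : finType) (src tgt : A -> V) (g : quiver_aut src tgt).
Hypothesis adm : admissible g.
Local Notation sv := (qa_v g).
Local Notation sa := (qa_a g).
Local Notation O := (orb g).
Local Notation cl := (ocl g).
Local Notation bf := (bf src tgt).
Implicit Types (x y : {ffun V -> int}) (be ga : {ffun O -> int}).

Lemma adm_noloop a : src a != tgt a.
Proof. by apply: contraTneq (cl_arrow adm a) => ->; rewrite negbK. Qed.

Definition fS (o : O) : {set V} := [set v | cl v == o].
(** The inverse of the bijection [fmap], see [pull_fmap] and [fmap_pull]. *)
Definition pull be : {ffun V -> int} := [ffun v => be (cl v)].
Definition sg x : {ffun V -> int} := [ffun v => x (sv v)].
Definition RSw (s : seq O) x := foldr (fun o => RS src tgt (fS o)) x s.
(** Applied to the dimension vector of one summand it gives that of the sum over an orbit of length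
    [r] ([nz_qdim_orbit]). *)
Definition osum r x := \sum_(j < r) iter j sg x.

Lemma fS_indep o : indep src tgt (fS o).
Proof.
move=> a; rewrite !inE; apply/negP=> /andP[/eqP e1 /eqP e2].
by have := cl_arrow adm a; rewrite e1 e2 eqxx.
Qed.

Lemma card_fS o : #|fS o| = dorb o.
Proof. by apply: eq_card => v; rewrite inE mem_cl. Qed.

Lemma bf_sg x y : bf (sg x) (sg y) = bf x y.
Proof. exact: (bf_sym (@perm_inj _ sv) (@perm_inj _ sa) (qa_src g) (qa_tgt g)). Qed.

Lemma bf_sg_ev x v : bf (sg x) (ev v) = bf x (ev (sv v)).
Proof.
rewrite -[RHS]bf_sg; congr (bf _ _); apply/ffunP=> w.
by rewrite !ffunE (inj_eq perm_inj).
Qed.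

Lemma RS_sg o x : RS src tgt (fS o) (sg x) = sg (RS src tgt (fS o) x).
Proof.
apply/ffunP=> v; rewrite [RHS]ffunE !RSE !inE cl_sv bf_sg_ev; by rewrite !ffunE.
Qed.

Lemma RSw_iter_sg s j x : RSw s (iter j sg x) = iter j sg (RSw s x).
Proof.
elim: s => //= o s ->; elim: j => //= j IH; by rewrite RS_sg IH.
Qed.

Lemma RSw_sum s (I : finType) (F : I -> {ffun V -> int}) : RSw s (\sum_i F i) = \sum_i RSw s (F i).
Proof. by elim: s => //= o s ->; rewrite RS_sum. Qed.

Lemma RSw_osum s r x : RSw s (osum r x) = osum r (RSw s x).
Proof. by rewrite RSw_sum; apply: eq_bigr => j _; rewrite RSw_iter_sg. Qed.

Lemma RSw_rev s x : RSw (rev s) (RSw s x) = x.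
Proof.
elim: s x => //= o s IH x; rewrite rev_cons -cats1 /RSw foldr_cat /=.
by rewrite (RSK adm_noloop _ (fS_indep o)); apply: IH.
Qed.

Lemma RSwK s x : RSw s (RSw (rev s) x) = x.
Proof. by rewrite -{1}[s]revK RSw_rev. Qed.

Lemma RSw_inj s : injective (RSw s).
Proof. by move=> x y e; rewrite -(RSw_rev s x) e RSw_rev. Qed.

Lemma iter_sgE j x v : iter j sg x v = x (iter j sv v).
Proof. by elim: j v => // j IH v; rewrite iterS ffunE IH -iterSr. Qed.

Lemma bf_pull_orbit be v w : cl v = cl w -> bf (pull be) (ev v) = bf (pull be) (ev w).
Proof.
have sgp : sg (pull be) = pull be by apply/ffunP=> u; rewrite !ffunE cl_sv.
by move=> /cl_orbit[m ->]; elim: m => //= m ->; rewrite -bf_sg_ev sgp.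
Qed.

Lemma formG_fS be o : formG g be (ebase o) = \sum_(v in fS o) bf (pull be) (ev v).
Proof.
rewrite formG_ebase // (eq_bigr (fun v => 2 * be o - (\sum_(a | tgt a == v) be (cl (src a)) + \sum_(a | src a == v) be (cl (tgt a))))).
  rewrite [RHS]big_split /= sumrN [X in _ = X - _]sumr_const card_fS; congr (_ - _).
    by rewrite -mulr_natr natz; ring.
  rewrite big_split /=; congr (_ + _).
    rewrite (partition_big tgt (mem (fS o))) /=; last by move=> a; rewrite inE.
    by apply: eq_bigr => v; rewrite inE => /eqP vo; apply: eq_bigl => a; apply/andP/eqP => [[_ /eqP]//|->]; rewrite vo !eqxx.
  rewrite (partition_big src (mem (fS o))) /=; last by move=> a; rewrite inE.
  by apply: eq_bigr => v; rewrite inE => /eqP vo; apply: eq_bigl => a; apply/andP/eqP => [[_ /eqP]//|->]; rewrite vo !eqxx.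
move=> v; rewrite inE => /eqP vo; rewrite bfe ffunE vo; congr (_ - (_ + _)).
  by apply: eq_bigr => a _; rewrite ffunE.
by apply: eq_bigr => a _; rewrite ffunE.
Qed.

Lemma formG_cl be v : formG g be (ebase (cl v)) = (dorb (cl v))%:Z * bf (pull be) (ev v).
Proof.
rewrite formG_fS (eq_bigr (fun=> bf (pull be) (ev v))) => [|w]; last by rewrite inE => /eqP/bf_pull_orbit.
by rewrite sumr_const card_fS -mulr_natr natz mulrC.
Qed.

Lemma RS_pull o be : RS src tgt (fS o) (pull be) = pull (refl o be).
Proof.
apply/ffunP=> v; rewrite RSE inE [RHS]ffunE [RHS]ffunE [pull be v]ffunE [ebase o (cl v)]ffunE eq_sym.
case: eqP => [->|_]; last by rewrite mulr0 subr0.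
by rewrite formG_cl mulKz ?mulr1 // lt0r_neq0 // ltz_nat dorb_gt0.
Qed.

Lemma RSw_pull s be : RSw s (pull be) = pull (weyl_word s be).
Proof. by elim: s => //= o s ->; rewrite RS_pull. Qed.

Lemma pull_inj : injective pull.
Proof.
move=> be ga /ffunP e; apply/ffunP=> o; have [v <-] := cl_ex o; by have := e v; rewrite !ffunE.
Qed.

Lemma bf_pull be ga : bf (pull be) (pull ga) = formG g be ga.
Proof.
rewrite bf_sum_ev formG_sum // (partition_big cl xpredT) //=; apply: eq_bigr => o _.
rewrite formG_fS mulr_suml; apply: eq_big => v; first by rewrite inE.
by move=> /eqP <-; rewrite [pull ga v]ffunE.
Qed.

Lemma formG_weyl s be : formG g (weyl_word s be) (weyl_word s be) = formG g be be.
Proof.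
rewrite -!bf_pull -RSw_pull; elim: s => //= o s <-.
by rewrite bf_RS //; [apply: adm_noloop|apply: fS_indep].
Qed.

Lemma formG_simple o : formG g (ebase o) (ebase o) = (2 * dorb o)%:Z.
Proof.
rewrite formG_bmat // (bigD1 o) //= ffunE eqxx mulr1 /bmat eqxx big1 ?addr0 // => p np.
by rewrite ffunE eq_sym (negPf np) mulr0.
Qed.

Lemma osum_inv r x : iter r sg x = x -> forall v, osum r x (sv v) = osum r x v.
Proof.
move=> e v; rewrite -[LHS](ffunE (fun v => osum r x (sv v))) -/(sg _).
congr (fun_of_fin _ v) => /=.
have -> : sg (osum r x) = \sum_(j < r) iter j.+1 sg x.
  apply/ffunP=> w; rewrite ffunE !sum_ffunE; apply: eq_bigr => j _; by rewrite iterS [RHS]ffunE.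
apply: (addrI x); rewrite -[LHS](big_ord_recl r (fun j => iter j sg x)).
by rewrite big_ord_recr /= e addrC.
Qed.

Lemma osum_ev i : osum (dorb (cl i)) (ev i) = pull (ebase (cl i)).
Proof.
apply/ffunP=> v; rewrite sum_ffunE !ffunE.
under eq_bigr => j _ do rewrite iter_sgE ffunE.
have u := uniq_traject_porbit sv v; case: eqP => [iv|niv]; last first.
  rewrite big1 // => j _; case: eqP => // e; case: niv; by rewrite -e cl_iter.
have : i \in porbit sv v by rewrite -val_cl mem_cl iv.
have dE : dorb (cl i) = #|porbit sv v| by rewrite iv.
rewrite porbit_traject => /trajectP[j0 lt e0]; rewrite dE.
rewrite (bigD1 (Ordinal lt)) //= -e0 eqxx big1 ?addr0 // => j nj; case: eqP => // e; case/eqP: nj.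
apply: val_inj; apply/eqP; rewrite /= -(nth_uniq v _ _ u) ?size_traject ?ltn_ord // !nth_traject ?ltn_ord //.
by rewrite e e0.
Qed.

Lemma pull_fmap x : aut_invariant g x -> pull (fmap g x) = x.
Proof.
move=> ix; apply/ffunP=> v; rewrite !ffunE.
case: pickP => [w|/(_ v)] /=; last by rewrite -val_cl val_cl porbit_id.
rewrite -val_cl mem_cl => /eqP/esym/cl_orbit[m ->]; by elim: m => //= m; rewrite ix.
Qed.

Lemma pull_inv be : aut_invariant g (pull be).
Proof. by move=> v; rewrite !ffunE cl_sv. Qed.

Lemma fmap_pull be : fmap g (pull be) = be.
Proof. by apply: pull_inj; rewrite pull_fmap //; apply: pull_inv. Qed.

Variable k : closedFieldType.
Local Notation Ex := (Ex k src tgt).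
Local Notation Un := (Un k src tgt).
Local Notation tmod := (tmod k (V + A)).
Local Notation ctmod := (ctmod k (V + A)).
Local Notation st := (ss sv sa).
Local Notation ta := (@ta k _ st).
Local Notation qmod := (qmod src tgt).

Lemma st_n t : iter (aut_order g) st t = t.
Proof.
case: t => [v|a].
  have -> m : iter m st (inl v) = inl (iter m sv v) by elim: m => //= m ->.
  by rewrite sv_n.
have -> m : iter m st (inr a) = inr (iter m sa a) by elim: m => //= m ->.
by rewrite sa_n.
Qed.

Lemma RealZ_Un d : RealZ src tgt k (nz d) -> Un d.
Proof.
move=> [d' [ed un [/nz_inj -> //|e]]]; have [v dv] := Ex_gt0 ed.
by move/ffunP/(_ v): e; rewrite !ffunE; lia.
Qed.

Lemma RealZ_RSw s i : RealZ src tgt k (RSw s (ev i)).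
Proof.
elim: s => [|o s IH] /=; first exact: (RealZ_ev adm_noloop).
exact: (RealZ_RS adm_noloop (fS_indep o)).
Qed.

Lemma ExZ_RSw s x : ExZ src tgt k x -> ExZ src tgt k (RSw s x).
Proof.
by move=> ex; elim: s => //= o s; apply: ExZ_RS; [apply: adm_noloop|apply: fS_indep].
Qed.

Lemma qmod_tw (X : tmod) : qmod X -> qmod (tw st X).
Proof.
move=> [q1 q2 q3]; split=> [v w||a] /=; first by rewrite q1 (inj_eq perm_inj).
  by rewrite -q2 [in RHS](reindex_inj (@perm_inj _ sv)).
by rewrite -qa_src -qa_tgt q3.
Qed.

Lemma qmod_ta (c : ctmod) j : qmod c -> qmod (iter j ta c).
Proof.
move=> qc; elim: j => //= j IH; apply: (qmod_iso (can_iso _)); exact: qmod_tw.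
Qed.

Lemma qdim_ta (c : ctmod) j v : qdim (iter j ta c : tmod) v = qdim (c : tmod) (iter j sv v).
Proof.
elim: j v => // j IH v; rewrite iterS -(qdim_iso (can_iso _)) -[LHS]/(qdim (iter j ta c : tmod) (sv v)).
by rewrite IH -iterSr.
Qed.

Lemma nz_qdim_ta (c : ctmod) j : nz (qdim (iter j ta c : tmod)) = iter j sg (nz (qdim (c : tmod))).
Proof. by apply/ffunP=> v; rewrite iter_sgE !ffunE qdim_ta. Qed.

Lemma nz_qdim_orbit (X : tmod) c r : perm_eq (dec X) (traject ta c r) ->
  nz (qdim X) = osum r (nz (qdim (c : tmod))).
Proof.
move=> hX; apply/ffunP=> v; rewrite ffunE sum_ffunE qdim_dec (perm_big _ hX) /= big_traject.
by rewrite (big_morph Posz PoszD (erefl (Posz 0))); apply: eq_bigr => j _; rewrite iter_sgE ffunE qdim_ta.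
Qed.

Lemma isorb_sg c r : isorb st c r -> iter r sg (nz (qdim (c : tmod))) = nz (qdim (c : tmod)).
Proof. by move=> [_ _ _ rc]; rewrite -nz_qdim_ta rc. Qed.

(** Reflections at orbits are invertible and commute with the twist, so [r] steps fix the vertex [i]
    and [dorb] divides [r]. Conversely [dorb] steps fix the dimension vector of [c]; by uniqueness
    for real roots they fix the class [c], so [r] is at most [dorb]. *)
Lemma real_order s i c r : isorb st c r -> qmod c -> nz (qdim (c : tmod)) = RSw s (ev i) -> r = dorb (cl i).
Proof.
move=> ic qc dc; have [cc r0 ut rc] := ic.
have h1 : iter r sg (ev i) = ev i.
  by apply: (@RSw_inj s); rewrite RSw_iter_sg -dc; apply: isorb_sg.
have dr : (dorb (cl i) %| r)%N.
  apply: porbit_dvd; move/ffunP/(_ i): h1; rewrite iter_sgE !ffunE eqxx; by case: eqP.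
have un : Un (qdim (c : tmod)) by apply: RealZ_Un; rewrite dc; apply: RealZ_RSw.
have h2 : iter (dorb (cl i)) ta c = c.
  have ci : cindec (iter (dorb (cl i)) ta c).
    by elim: (dorb _) => //= j; apply: (ta_cindec (aut_n_gt0 g) st_n).
  rewrite -[LHS]ci.2 -[RHS]cc.2; apply/canP; apply: un => //; try exact: qmod_ta.
  - exact: ci.1.
  - apply: nz_inj; rewrite nz_qdim_ta dc -RSw_iter_sg; congr RSw; apply/ffunP=> v.
    rewrite iter_sgE !ffunE; congr (_%:R); congr (nat_of_bool _).
    apply/eqP/eqP => [e|->]; last exact: sv_dorb.
    have cv : cl v = cl i by rewrite -e cl_iter.
    by rewrite -e -cv sv_dorb.
  - exact: cc.1.
apply/eqP; rewrite eqn_leq (dvdn_leq r0 dr) andbT leqNgt; apply/negP=> lt.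
have := nth_uniq c (s := traject ta c r) (i := 0%N) (j := dorb (cl i)); rewrite size_traject => /(_ r0 lt ut).
rewrite !nth_traject //= h2 eqxx => /esym/eqP e; by have := dorb_gt0 (cl i); rewrite -e.
Qed.

(** Reflecting at an orbit with positive sum of pairings lowers the height. If the result is the
    negative of a dimension vector, [d] is supported on that orbit, hence simple. *)
Lemma reduce d : Ex d -> exists s, (exists i, nz d = RSw s (ev i)) \/
  (exists d', [/\ Ex d', nz d = RSw s (nz d') & forall o, \sum_(v in fS o) bf (nz d') (ev v) <= 0]).
Proof.
have [m] := ubnP (\sum_v d v)%N; elim: m d => // m IH d hm ed.
have [h|h] := EM (forall o, \sum_(v in fS o) bf (nz d) (ev v) <= 0).
  by exists [::]; right; exists d.
have [o lt] : exists o, 0 < \sum_(v in fS o) bf (nz d) (ev v).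
  by apply: contrapT => h'; apply: h => o; rewrite leNgt; apply/negP=> lt; apply: h'; exists o.
have RSE' v := RSE src tgt (fS o) (nz d) v.
have : ExZ src tgt k (RS src tgt (fS o) (nz d)).
  by apply: ExZ_RS; [apply: adm_noloop|apply: fS_indep|exists d => //; left].
case=> d' ed' [e|e].
  have dE : nz d = RS src tgt (fS o) (nz d').
    by rewrite -e RSK //; [apply: adm_noloop|apply: fS_indep].
  have [|s hs] := IH d' _ ed'.
    apply: leq_trans (_ : \sum_v d v <= m)%N => //.
    rewrite -ltz_nat !(big_morph Posz PoszD (erefl (Posz 0))).
    have -> : \sum_v (d' v)%:Z = \sum_v (d v)%:Z - \sum_(v in fS o) bf (nz d) (ev v).
      rewrite [X in _ - X]big_mkcond -sumrB; apply: eq_bigr => v _.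
      have := RSE' v; rewrite e !ffunE => ->; by case: ifP => _; rewrite ?subr0.
    by rewrite ltrBlDr ltrDl.
  exists (o :: s); case: hs => [[i hi]|[d2 [e2 hd2 h2]]]; [left; exists i|right; exists d2; split=> //].
    by rewrite /= -hi.
  by rewrite /= -hd2.
have sd : supp_in d (fS o).
  move=> v dv; apply: contraTT dv => vo; have := RSE' v; rewrite (negPf vo) e !ffunE -leqNgt; lia.
have [i _ dE] := Ex_indep adm_noloop (fS_indep o) ed sd.
by exists [::]; left; exists i; rewrite dE nz_simple.
Qed.

(** Not [X] but a summand is reduced, as summing over twists commutes with reflections. If the
    reduced vector is not simple, its orbit sum [al] descends to the fundamental set: the pairings
    are sums of nonpositive ones, and connectedness comes from [Ex_connected]. *)
Theorem ii_root (X : tmod) : qmod X -> iiindec st X ->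
  exists be, is_root g be /\ nz (qdim X) = pull be.
Proof.
move=> qX iX; have [c [r [ic hX]]] := iiindec_orbit (aut_n_gt0 g) st_n iX.
have [cc r0 ut rc] := ic.
have cX : c \in dec X by rewrite (perm_mem hX); case: (r) r0 => // m _; rewrite mem_head.
have [_ qc] := dec_qmod qX cX.
have ed : Ex (qdim (c : tmod)) by exists c; split=> //; case: cc.
rewrite (nz_qdim_orbit hX).
have [s [[i hi]|[d' [ed' hd' hb]]]] := reduce ed.
  exists (weyl_word s (ebase (cl i))); split; first by left; exists s, (cl i).
  by rewrite (real_order ic qc hi) hi -RSw_osum osum_ev RSw_pull.
have inv : iter r sg (nz d') = nz d'.
  by apply: (@RSw_inj s); rewrite RSw_iter_sg -hd'; apply: isorb_sg.
pose al := osum r (nz d'); have ial : aut_invariant g al by move=> v; apply: osum_inv.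
have alE v : al v = \sum_(j < r) (d' (iter j sv v))%:Z.
  by rewrite /al sum_ffunE; apply: eq_bigr => j _; rewrite iter_sgE ffunE.
have al0 v : 0 <= al v by rewrite alE; apply: sumr_ge0.
have ald v : (0 < d' v)%N -> 0 < al v.
  move=> dv; rewrite alE (bigD1 (Ordinal r0)) //=; apply: ltr_wpDr; last by rewrite ltz_nat.
  by apply: sumr_ge0.
pose be := fmap g al; have pbe : pull be = al by apply: pull_fmap.
have bE v : be (cl v) = al v by have /ffunP/(_ v) := pbe; rewrite ffunE.
exists (weyl_word s be); split; last by rewrite hd' -RSw_osum -/al -pbe RSw_pull.
right; exists s, be; split; last by left.
have [v0 dv0] := Ex_gt0 ed'.
split; first by move=> o; have [v <-] := cl_ex o; rewrite bE.
split.
  by apply/eqP=> b0; have := ald v0 dv0; rewrite -bE b0 ffunE ltxx.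
split.
  move=> o; rewrite formG_fS pbe /al.
  have -> : \sum_(v in fS o) bf (osum r (nz d')) (ev v) = \sum_(j < r) \sum_(v in fS o) bf (nz d') (ev v).
    rewrite (eq_bigr (fun v => \sum_(j < r) bf (iter j sg (nz d')) (ev v))) => [|v _]; last by rewrite bf_suml.
    rewrite exchange_big /=; apply: eq_bigr => j _.
    have h x v : bf (iter j sg x) (ev v) = bf x (ev (iter j sv v)).
      by elim: (nat_of_ord j) v => // j' IHj v; rewrite iterS bf_sg_ev IHj -iterSr.
    have inj : injective (iter j sv) by elim: (nat_of_ord j) => [|j' IHj] u w //= /perm_inj /IHj.
    rewrite [RHS](reindex_inj inj) /=; apply: eq_big => v; first by rewrite !inE cl_iter.
    by rewrite h.
  by apply: sumr_le0.
have supE i : i \in supp be -> exists2 v, (0 < d' v)%N & cl v = i.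
  rewrite inE; have [v <-] := cl_ex i; rewrite bE alE => h.
  apply: contrapT => h'; case/eqP: h; rewrite big1 // => j _.
  case: (posnP (d' (iter j sv v))) => [-> //|dv]; case: h'; exists (iter j sv v) => //; exact: cl_iter.
move=> i j /supE[v dv <-] /supE[w dw <-].
set R := [rel u v | _].
have RC : connect_sym R.
  apply: sym_connect_sym => p q /=; rewrite /gadj [p == q]eq_sym bmatC.
  by case: (p \in _); case: (q \in _).
have arrow a : (0 < d' (src a))%N -> (0 < d' (tgt a))%N -> R (cl (src a)) (cl (tgt a)).
  move=> sd td; rewrite /R /= !inE !bE !gt_eqF ?ald //= /gadj cl_arrow //= /bmat (negPf (cl_arrow adm a)).
  rewrite oppr_eq0 eqz_nat -lt0n card_gt0; apply/set0Pn; exists a; by rewrite inE !mem_cl !eqxx.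
have [|h|h] := Ex_connected (U := [set u | connect R (cl v) (cl u)]) ed'.
- move=> a sd td; rewrite !inE; have Ra := arrow a sd td.
  apply/idP/idP => h; first by apply: (connect_trans h); apply: connect1.
  by apply: (connect_trans h); rewrite RC; apply: connect1.
- by have := h w dw; rewrite inE.
- by have := h v dv; rewrite inE connect0.
Qed.

Lemma qmod_tbig (l : seq tmod) : (forall X, List.In X l -> qmod X) -> qmod (tbig l).
Proof.
elim: l => [|X l IH] h /=.
  by split=> [v w||a]; apply/matrixP=> -[].
by apply/qmod_sum; split; [apply: h; left|apply: IH => Y hY; apply: h; right].
Qed.

Lemma osum_opp_nz r d be : (exists v, 0 < d v)%N -> nonneg_vec g be -> (0 < r)%N -> osum r (- nz d) = pull be -> False.
Proof.
move=> [v dv] b0 r0 /ffunP/(_ v); rewrite sum_ffunE ffunE => h; have := b0 (cl v); rewrite -h leNgt; case/negP.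
rewrite (bigD1 (Ordinal r0)) //=; apply: (@le_lt_trans _ _ ((- nz d) v)); last by rewrite !ffunE oppr_lt0 ltz_nat.
rewrite gerDl; apply: sumr_le0 => j _; by rewrite iter_sgE !ffunE oppr_le0.
Qed.

Theorem real_exists s o : nonneg_vec g (weyl_word s (ebase o)) ->
  exists X : tmod, [/\ qmod X, iiindec st X & nz (qdim X) = pull (weyl_word s (ebase o))].
Proof.
move=> b0; have [i io] := cl_ex o; have os : osum (dorb (cl i)) (RSw s (ev i)) = pull (weyl_word s (ebase o)).
  by rewrite -RSw_osum osum_ev RSw_pull io.
have [d [[X0 [qX0 iX0 dX0]] un dE]] := RealZ_RSw s i.
have ed : Ex d by exists X0.
have {}dE : RSw s (ev i) = nz d.
  case: dE => // e; rewrite e in os; by case: (osum_opp_nz (Ex_gt0 ed) b0 (dorb_gt0 _) os).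
pose c : ctmod := can X0; have ic : cindec c by split; [exact: tindec_iso (can_iso _) iX0|exact: canK].
have qc : qmod c by apply: qmod_iso (can_iso _) qX0.
have dc : nz (qdim (c : tmod)) = RSw s (ev i).
  by rewrite dE -dX0; apply/ffunP=> v; rewrite !ffunE -(qdim_iso (can_iso X0)).
have [r ir] := isorb_ex (aut_n_gt0 g) st_n ic.
have hX := dec_tbig_cindec (isorb_cindec (aut_n_gt0 g) st_n ir).
exists (tbig (traject ta c r)); split.
- apply: qmod_tbig => Y; have : forall l : seq ctmod, List.In Y l -> (Y : ctmod) \in l.
    by elim=> //= Z l IH [->|/IH h]; rewrite inE ?eqxx ?h ?orbT.
  by move=> h /h /trajectP[j _ ->]; apply: qmod_ta.
- exact: (orbit_iiindec (aut_n_gt0 g) st_n ir).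
- by rewrite (nz_qdim_orbit hX) dc (real_order ir qc dc).
Qed.

(** The inverse word turns the orbit sum into a simple root of [Gamma], so it carries the summand to
    a vector supported on one orbit, where [Ex_indep] leaves only simple roots. *)
Lemma real_orbit s o (X : tmod) : qmod X -> iiindec st X -> nz (qdim X) = pull (weyl_word s (ebase o)) ->
  exists c i, [/\ isorb st c (dorb o), perm_eq (dec X) (traject ta c (dorb o)), cl i = o, qmod c &
    nz (qdim (c : tmod)) = RSw s (ev i)].
Proof.
move=> qX iX dX; have [c [r [ic hX]]] := iiindec_orbit (aut_n_gt0 g) st_n iX.
have [cc r0 _ _] := ic.
have cX : c \in dec X by rewrite (perm_mem hX); case: (r) r0 => // m _; rewrite mem_head.
have [_ qc] := dec_qmod qX cX.
have : ExZ src tgt k (RSw (rev s) (nz (qdim (c : tmod)))).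
  apply: ExZ_RSw; exists (qdim (c : tmod)); last by left.
  by exists c; split=> //; case: cc.
have os : osum r (RSw (rev s) (nz (qdim (c : tmod)))) = pull (ebase o).
  by rewrite -RSw_osum -(nz_qdim_orbit hX) dX -RSw_pull RSw_rev.
case=> d ed [e|e]; rewrite e in os; last first.
  by case: (osum_opp_nz (Ex_gt0 ed) _ r0 os) => p; rewrite ffunE; case: eqP.
have sd : supp_in d (fS o).
  move=> v dv; rewrite inE; move/ffunP/(_ v): os; rewrite sum_ffunE !ffunE (bigD1 (Ordinal r0)) //= ffunE.
  rewrite eq_sym; case: eqP => // _ h; have : 0 < (d v)%:Z by rewrite ltz_nat.
  rewrite ltNge -h lerDl; case/negP; apply: sumr_ge0 => j _; by rewrite iter_sgE ffunE.
have [i iS dE] := Ex_indep adm_noloop (fS_indep o) ed sd.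
have io : cl i = o by move: iS; rewrite inE => /eqP.
have dc : nz (qdim (c : tmod)) = RSw s (ev i).
  by rewrite -(RSwK s (nz _)) e dE nz_simple.
have rE : r = dorb o by rewrite (real_order ic qc dc) io.
by exists c, i; rewrite -rE.
Qed.

(** The vertices found for [X] and [Y] lie in one orbit, so a translate of a summand of [X] has the
    dimension vector of one of [Y]. Uniqueness on [Q] identifies these summands, and with them the
    orbits. *)
Theorem real_unique s o (X Y : tmod) : qmod X -> iiindec st X -> qmod Y -> iiindec st Y ->
  nz (qdim X) = pull (weyl_word s (ebase o)) -> nz (qdim Y) = pull (weyl_word s (ebase o)) -> tiso X Y.
Proof.
move=> qX iX qY iY dX dY.
have [c [i [ic hX io qc dc]]] := real_orbit qX iX dX.
have [c' [i' [ic' hY io' qc' dc']]] := real_orbit qY iY dY.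
have [m im] : exists m, i = iter m sv i' by apply: cl_orbit; rewrite io.
have [cc r0 _ _] := ic; have [cc' _ ut' _] := ic'.
have cX j : iter j ta c \in dec X.
  apply: (iter_mem_dec (aut_n_gt0 g) st_n); first by case: iX.
  by rewrite (perm_mem hX); case: (dorb o) r0 => // q _; rewrite mem_head.
have e : iter m ta c = c'.
  have ci : cindec (iter m ta c) by apply: (@dec_indec _ _ X).
  rewrite -[LHS]ci.2 -[RHS]cc'.2; apply/canP.
  have un : Un (qdim (c' : tmod)) by apply: RealZ_Un; rewrite dc'; apply: RealZ_RSw.
  apply: un => //; [exact: qmod_ta|exact: ci.1| |exact: cc'.1].
  apply: nz_inj; rewrite nz_qdim_ta dc dc' -RSw_iter_sg; congr RSw; apply/ffunP=> v.
  have inj : injective (iter m sv) by elim: (m) => [|j IHj] u w //= /perm_inj /IHj.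
  by rewrite iter_sgE !ffunE im (inj_eq inj).
have [|u hu] := uniq_sub_perm ut' (l := dec X).
  by move=> c2 /trajectP[j _ ->]; rewrite -e -iterD; apply: cX.
have u0 : u = [::].
  apply: size0nil; have := perm_size hu; rewrite (perm_size hX) size_cat !size_traject; lia.
apply/dec_isoP; rewrite (permPr hY); by rewrite u0 cats0 in hu.
Qed.

Theorem real_size s o (X : tmod) : qmod X -> iiindec st X -> nz (qdim X) = pull (weyl_word s (ebase o)) ->
  size (dec X) = dorb o.
Proof.
by move=> qX iX dX; have [c [i [_ hX _ _ _]]] := real_orbit qX iX dX; rewrite (perm_size hX) size_traject.
Qed.

End Folding.

(** * The theorem *)

Section Representations.
Variables (V A : finType) (src tgt : A -> V) (g : quiver_aut src tgt) (k : closedFieldType).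
Local Notation sv := (qa_v g).
Local Notation sa := (qa_a g).
Local Notation tmod := (tmod k (V + A)).
Local Notation rep := (rep src tgt k).
Local Notation st := (ss sv sa).
Local Notation qmod := (qmod src tgt).
Implicit Types (R : rep) (X Y Z : tmod).

(** The casts in [twist] disappear between the maps of a splitting system. *)
Lemma cast_sandwich N (d : V -> nat) (C : forall v, 'M[k]_(N, d v)) (P : forall v, 'M[k]_(d v, N))
  v v' w w' (e1 : v = v') (e2 : w = w') (M : 'M[k]_(d v, d w)) :
  C v' *m castmx (congr1 d e1, congr1 d e2) M *m P w' = C v *m M *m P w.
Proof. by case: v' / e1; case: w' / e2; rewrite castmx_id. Qed.

Lemma twist_linked R X : linked R X ->
  linked (twist g R) (TMod (fun t => match t with
    inl v => X (inl (sv^-1 v)%g) | inr a => X (inr (sa^-1 a)%g) end) : tmod).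
Proof.
move=> [P [C [[PC PC0 s] XV XA]]].
exists (fun v => P (sv^-1 v)%g), (fun v => C (sv^-1 v)%g); split=> [|v|a] /=; last first.
- by rewrite XA cast_sandwich.
- exact: XV.
split=> [v|v w nvw|]; [exact: PC|by apply: PC0; rewrite (inj_eq perm_inj)|].
by rewrite -[RHS]s [RHS](reindex_inj (@perm_inj _ sv^-1%g)).
Qed.

(** The same matrices serve on both sides after renaming generators: [twist] moves by the inverse
    permutations, [tw] by the permutations themselves. *)
Lemma linked_ii R X : linked R X -> (ii_rep g R <-> tinv st X).
Proof.
move=> lR; rewrite /ii_rep (linked_iso (twist_linked lR) lR); split=> -[f [h [hf fh hf']]].
  exists f, h; split=> // -[v|a]; first by have := hf (inl (sv v)); rewrite /= permK.
  by have := hf (inr (sa a)); rewrite /= permK.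
exists f, h; split=> // -[v|a] /=; first by have := hf (inl (sv^-1 v)%g); rewrite /= permKV.
by have := hf (inr (sa^-1 a)%g); rewrite /= permKV.
Qed.

Lemma linked_ii_indec R X : linked R X -> (ii_indec g R <-> iiindec st X).
Proof.
move=> lR; have qX := linked_qmod lR; split.
  move=> [iR [R0 nR]]; split; [exact/(linked_ii lR)|exact/(linked_nonzero lR)|].
  move=> [Y [Z [iY iZ Y0 Z0 iX]]]; apply: nR.
  have /qmod_sum[qY qZ] := qmod_iso iX qX.
  have [RY [lY _]] := qmod_linked qY; have [RZ [lZ _]] := qmod_linked qZ.
  exists RY, RZ; split; [exact/(linked_ii lY)|split; [exact/(linked_ii lZ)|]].
  split; [exact/(linked_nonzero lY)|split; [exact/(linked_nonzero lZ)|]].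
  exact/(linked_iso lR (linked_sum lY lZ)).
move=> [iX X0 nX]; split; [exact/(linked_ii lR)|split; [exact/(linked_nonzero lR)|]].
move=> [Y [Z [iY [iZ [Y0 [Z0 iR]]]]]]; apply: nX.
have [XY lY] := linked_ex Y; have [XZ lZ] := linked_ex Z.
exists XY, XZ; split; [exact/(linked_ii lY)|exact/(linked_ii lZ)| | |].
- exact/(linked_nonzero lY).
- exact/(linked_nonzero lZ).
- exact/(linked_iso lR (linked_sum lY lZ)).
Qed.

Lemma linked0 : linked (rep0 src tgt k) (tzero k (V + A)).
Proof.
exists (fun=> 0), (fun=> 0); split=> [|v|a]; try by apply/matrixP=> -[].
by split=> [v|v w _|]; apply/matrixP=> -[].
Qed.

Lemma link_list (Ys : seq rep) : all_indec Ys ->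
  exists Xs : seq tmod, [/\ size Xs = size Ys, all_tindec Xs & linked (rep_bigsum Ys) (tbig Xs)].
Proof.
elim: Ys => [_|Y Ys IH /= [iY /IH[Xs [sX iX lX]]]]; first by exists [::]; split=> //; apply: linked0.
have [X lY] := linked_ex Y; exists (X :: Xs); split; rewrite /= ?sX //.
  by split=> //; apply/(linked_indec lY).
exact: linked_sum.
Qed.

Lemma unlink_list (Xs : seq tmod) : (forall X, List.In X Xs -> tindec X /\ qmod X) ->
  exists Ys : seq rep, all_indec Ys /\ linked (rep_bigsum Ys) (tbig Xs).
Proof.
elim: Xs => [_|X Xs IH h]; first by exists [::]; split=> //; apply: linked0.
have [|Ys [iY lY]] := IH; first by move=> Z hZ; apply: h; right.
have [iX qX] := h X (or_introl erefl); have [R [lR _]] := qmod_linked qX.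
exists (R :: Ys); split; last exact: linked_sum.
by split=> //; apply/(linked_indec lR).
Qed.

Lemma linked_decomposition R X : linked R X ->
  (exists Ys, indec_decomposition R Ys) /\ forall Ys, indec_decomposition R Ys -> size Ys = size (dec X).
Proof.
move=> lR; split=> [|Ys [iY hY]].
  have [|Ys [iY lY]] := @unlink_list (dec X).
    move=> Y hY; have YX : (Y : ctmod k (V + A)) \in dec X.
      elim: (dec X) hY => //= Z l IH [->|/IH h]; by rewrite inE ?eqxx ?h ?orbT.
    by have [[iY _] qY] := dec_qmod (linked_qmod lR) YX.
  by exists Ys; split=> //; apply/(linked_iso lR lY); apply: dec_iso.
have [Xs [sX iX lX]] := link_list iY.
have /dec_isoP p : tiso X (tbig Xs) by apply/(linked_iso lR lX).
by rewrite (perm_size p) (perm_size (dec_tbig iX)) size_map sX.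
Qed.

Lemma linked_dimvec R X : linked R X -> dimvec R = nz (qdim X).
Proof. by move=> lR; apply/ffunP=> v; rewrite !ffunE (linked_dim lR). Qed.

End Representations.

Theorem theorem1 (V A : finType) (src tgt : A -> V)
    (g : quiver_aut src tgt) (k : closedFieldType) :
  no_loops src tgt -> admissible g ->
  (aut_order g)%:R != (0 : k) ->
  (forall beta : {ffun orb g -> int},
     (exists X : rep src tgt k, ii_indec g X /\ beta = fmap g (dimvec X))
     <-> pos_root g beta)
  /\
  (forall alpha : {ffun V -> int},
     aut_invariant g alpha -> real_root g (fmap g alpha) ->
     nonneg_vec g (fmap g alpha) -> fmap g alpha != 0 ->
     (exists X : rep src tgt k, ii_indec g X /\ dimvec X = alpha) /\
     (forall X Y : rep src tgt k,
        ii_indec g X -> dimvec X = alpha -> ii_indec g Y -> dimvec Y = alpha ->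
        rep_iso X Y) /\
     (forall X : rep src tgt k, ii_indec g X -> dimvec X = alpha ->
        (exists Ys, indec_decomposition X Ys) /\
        (forall Ys, indec_decomposition X Ys ->
           (2 * size Ys)%:Z = formG g (fmap g alpha) (fmap g alpha)))).
Proof.
move=> _ adm n0; have real be : real_root g be -> nonneg_vec g be ->
    exists R : rep src tgt k, ii_indec g R /\ dimvec R = pull be.
  move=> [s [o ->]] b0; have [X [qX iX dX]] := real_exists adm k b0.
  have [R [lR _]] := qmod_linked qX; exists R; split; first exact/(linked_ii_indec _ lR).
  by rewrite (linked_dimvec lR).
split=> [be|al ial [s [o ho]] al0 aln].
  split=> [[R [iR ->]]|[[re|im] [b0 bn]]].
  - have [X lR] := linked_ex R; have qX := linked_qmod lR.
    have iX : iiindec (ss (qa_v g) (qa_a g)) X by apply/(linked_ii_indec g lR).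
    have [ga [rb db]] := ii_root adm qX iX.
    have bE v : ga (ocl g v) = (rdim R v)%:Z.
      by move/ffunP/(_ v): db; rewrite !ffunE (linked_dim lR).
    rewrite (linked_dimvec lR) db fmap_pull //; split=> //; split.
      by move=> o; have [v <-] := cl_ex o; rewrite bE.
    case: iR => _ [[v Rv] _]; apply/eqP=> b0; have := bE v; rewrite b0 ffunE => -[e].
    by rewrite -e in Rv.
  - by have [R [iR dR]] := real be re b0; exists R; rewrite dR fmap_pull.
  have [X [qX iX dX]] := imag_iiindec adm n0 im b0 bn.
  have [R [lR _]] := qmod_linked qX; exists R; split; first exact/(linked_ii_indec _ lR).
  rewrite (linked_dimvec lR) (_ : nz _ = pull be) ?fmap_pull //.
  by apply/ffunP=> v; rewrite !ffunE dX.
have alE : al = pull (weyl_word s (ebase o)) by rewrite -ho pull_fmap.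
have lift (X : rep src tgt k) : ii_indec g X -> dimvec X = al -> exists2 Y, linked X Y &
    [/\ qmod src tgt Y, iiindec (ss (qa_v g) (qa_a g)) Y & nz (qdim Y) = pull (weyl_word s (ebase o))].
  move=> iX dX; have [Y lX] := linked_ex X; exists Y => //; split; first exact: linked_qmod lX.
    exact/(linked_ii_indec g lX).
  by rewrite -(linked_dimvec lX) dX.
split; last split.
- have [R [iR dR]] := real (fmap g al) ltac:(by exists s, o) al0.
  by exists R; rewrite dR pull_fmap.
- move=> X Y iX dX iY dY; have [X' lX [qX' iX' dX']] := lift X iX dX.
  have [Y' lY [qY' iY' dY']] := lift Y iY dY.
  exact/(linked_iso lX lY)/(real_unique adm (s := s) (o := o)).
move=> X iX dX; have [X' lX [qX' iX' dX']] := lift X iX dX.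
have [h1 h2] := linked_decomposition lX; split=> // Ys /h2 ->.
(* The number of summands is [dorb o], and the form, invariant under the Weyl group, has the value
   [2 * dorb o] at the simple root. *)
by rewrite (real_size adm qX' iX' dX') ho formG_weyl // formG_simple.
Qed.
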